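(* Let $\mathcal W$ be the class of $C^*$-algebras $D$ such that $W(D)$ is almost unperforated. Let $A$ be a $\sigma$-unital simple $C^*$-algebra which is essentially tracially in $\mathcal W$. Then $A$ has strict comparison.
   Context: **Cuntz semigroup.** For a $C^*$-algebra $A$ let $M_\infty(A)_+=\bigcup_nM_n(A)_+$, identifying $x\in M_n(A)$ with $\mathrm{diag}(x,0)\in M_{n+m}(A)$. For $a,b\in M_n(A)_+$, $a\lesssim b$ means there are $x_i\in M_n(A)$ with $\|a-x_i^*bx_i\|\to0$ (same notation in $A\otimes\mathcal K$); $a\sim b$ means $a\lesssim b$ and $b\lesssim a$. $W(A)=M_\infty(A)_+/\sim$, with classes $\langle a\rangle$, addition induced by $\mathrm{diag}(a,b)$, and order $\langle a\rangle\le\langle b\rangle$ iff $a\lesssim b$. $W(A)$ is almost unperforated if for all $\langle a\rangle,\langle b\rangle\in W(A)$ and $k\in\mathbb N$, $(k+1)\langle a\rangle\le k\langle b\rangle$ implies $\langle a\rangle\le\langle b\rangle$. **Essential tracial approximation.** $A_+^1$ is the set of positive elements of norm $\le1$; $a\in_\varepsilon S$ means $\|a-x\|<\varepsilon$ for some $x\in S$. Let $\mathcal P$ be a class of $C^*$-algebras. A simple $C^*$-algebra $A$ is *essentially tracially in* $\mathcal P$ if for any finite $\mathcal F\subset A$, $\varepsilon>0$ and $s\in A_+\setminus\{0\}$ there are $e\in A_+^1$ and a nonzero $C^*$-subalgebra $B\subset A$ with $B\in\mathcal P$ such that (1) $\|ex-xe\|<\varepsilon$ for all $x\in\mathcal F$;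 (2) $(1-e)x\in_\varepsilon B$ and $\|(1-e)x\|\ge\|x\|-\varepsilon$ for all $x\in\mathcal F$; (3) $e\lesssim s$. (Here $1$ is the unit of $A$, or of the unitization if $A$ is non-unital.) **Strict comparison.** $QT(\cdot)$ denotes the 2-quasitraces of norm one. For $A$ $\sigma$-unital and simple choose $b$ in the Pedersen ideal $\mathrm{Ped}(A)_+$ with $\|b\|=1$ and put $B_0=\overline{bAb}$, so $A\otimes\mathcal K\cong B_0\otimes\mathcal K$ and each $\tau\in QT(B_0)$ extends to a lower semicontinuous quasitrace on $A\otimes\mathcal K$; put $d_\tau(x)=\lim_n\tau(f_{1/n}(x))$ for $x\in(A\otimes\mathcal K)_+$, where $f_\varepsilon(t)=0$ for $0\le t\le\varepsilon/2$, $=1$ for $t\ge\varepsilon$, linear between. $A$ has strict comparison (for positive elements) if for any $x,y\in(A\otimes\mathcal K)_+$, $d_\tau(x)<d_\tau(y)$ for all $\tau\in QT(B_0)$ implies $x\lesssim y$.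
   Formalization: In the definition of strict comparison, y is required to be nonzero; read literally, when QT(B_0) is empty (e.g. A = O_2) the condition would force x ≲ 0 for every x, which is false, and otherwise y ≠ 0 follows from d_τ(x) < d_τ(y). *)

(* Defs.v *)
From HB Require Import structures.
From mathcomp Require Import all_boot all_order all_algebra.
From mathcomp Require Import all_classical all_reals all_analysis.
From mathcomp Require Import complex.
Set Implicit Arguments.
Unset Strict Implicit.
Unset Printing Implicit Defensive.
Import Order.TTheory GRing.Theory Num.Theory.
Import numFieldNormedType.Exports.
Local Open Scope classical_set_scope.
Local Open Scope complex_scope.
Local Open Scope ring_scope.

(* C*-algebras need not be unital, so the product cannot come from a MathComp
   ring structure.  The norm of a normedModType over R[i] takes its values in
   R[i]; these are nonnegative elements of R[i], i.e. nonnegative reals, and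
   the order of R[i] restricts to the usual one on the reals. *)
HB.mixin Record CompleteNormedModule_isCStarAlgebra (R : realType) A
    & CompleteNormedModule R[i] A := {
  cmul : A -> A -> A ;
  star : A -> A ;
  cmulA : associative cmul ;
  cmulDl : left_distributive cmul +%R ;
  cmulDr : right_distributive cmul +%R ;
  cscalerAl : forall (k : R[i]) (x y : A), k *: cmul x y = cmul (k *: x) y ;
  cscalerAr : forall (k : R[i]) (x y : A), k *: cmul x y = cmul x (k *: y) ;
  starK : involutive star ;
  starD : {morph star : x y / x + y} ;
  starZ : forall (k : R[i]) (x : A), star (k *: x) = Num.conj k *: star x ;
  starM : forall x y : A, star (cmul x y) = cmul (star y) (star x) ;
  cnormM_le : forall x y : A, `|cmul x y| <= `|x| * `|y| ;
  cnorm_star_mul : forall x : A, `|cmul (star x) x| = `|x| ^+ 2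
}.

#[short(type="cstarAlgType")]
HB.structure Definition CStarAlgebra (R : realType) :=
  { A of CompleteNormedModule_isCStarAlgebra R A
      & CompleteNormedModule R[i] A }.

Reserved Notation "x ** y" (at level 40, left associativity).
Notation "x ** y" := (cmul x y) : ring_scope.

Section BasicNotions.
Variables (R : realType) (A : cstarAlgType R).
Implicit Types (x y a b : A) (B I : set A).

Definition positive : set A := [set star y ** y | y in setT].

Definition positive_unit_ball : set A := [set a | positive a /\ `|a| <= 1].

Definition self_adjoint : set A := [set a | star a = a].

Definition cuntz_sub a b : Prop :=
  exists x : nat -> A, (star (x k) ** b ** x k) @[k --> \oo] --> a.

Definition two_sided_ideal I : Prop :=
  [/\ I 0, forall (k : R[i]) x y, I x -> I y -> I (k *: x + y)
    & forall a x, I x -> I (a ** x) /\ I (x ** a)].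

Definition simple_cstar : Prop :=
  (exists x, x != 0) /\
  forall I, two_sided_ideal I -> closed I -> I = [set 0] \/ I = setT.

Definition sigma_unital : Prop :=
  exists2 u : nat -> A, (forall n, positive_unit_ball (u n)) &
    forall x, (u n ** x) @[n --> \oo] --> x /\ (x ** u n) @[n --> \oo] --> x.

(* The Pedersen ideal is the smallest dense two-sided (not necessarily closed)
   ideal. *)
Definition pedersen_ideal : set A :=
  [set x | forall I, two_sided_ideal I -> closure I = setT -> I x].

Definition hereditary_of b : set A := closure [set b ** x ** b | x in setT].

Definition cstar_subalgebra B : Prop :=
  [/\ B 0, forall (k : R[i]) x y, B x -> B y -> B (k *: x + y),
      forall x y, B x -> B y -> B (x ** y),
      forall x, B x -> B (star x)
    & closed B].

Definition in_eps (a : A) (eps : R) B : Prop :=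
  exists2 x, B x & `|a - x| < eps%:C.

(* The polynomial p - p(0) evaluated at x: no unit is needed. *)
Definition poly_eval0 (p : {poly R}) x : A :=
  \sum_(k < size p) (p`_k.+1)%:C *: iter k (cmul x) x.

(* Continuous functional calculus for x >= 0 and f continuous on [0, |x|] with
   f 0 = 0: y = f(x) iff y is the norm limit of the p(x), for polynomials p
   with p(0) = 0 converging to f uniformly on [0, |x|]. *)
Definition is_cfc (f : R -> R) x y : Prop :=
  forall eps : R, 0 < eps -> exists p : {poly R},
    [/\ p.[0] = 0,
        forall t : R, 0 <= t -> t%:C <= `|x| -> `|p.[t] - f t| <= eps
      & `|y - poly_eval0 p x| <= eps%:C].

Definition cfc (f : R -> R) x : A := xget 0 [set y | is_cfc f x y].

End BasicNotions.

Definition f_cut (R : realType) (eps t : R) : R :=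
  if t <= eps / 2 then 0 else if eps <= t then 1 else 2 * t / eps - 1.

(* A C*-subalgebra B of A, viewed as a C*-algebra in its own right, is given by
   a C*-algebra D and an isometric *-homomorphism iota : D -> A of range B. *)
Definition star_iso_onto (R : realType) (D A : cstarAlgType R) (B : set A)
    (iota : D -> A) : Prop :=
  [/\ forall (k : R[i]) x y, iota (k *: x + y) = k *: iota x + iota y,
      forall x y, iota (x ** y) = iota x ** iota y,
      forall x, iota (star x) = star (iota x),
      forall x, `|iota x| = `|x|
    & range iota = B].

Definition subalgebra_in (R : realType) (P : cstarAlgType R -> Prop)
    (A : cstarAlgType R) (B : set A) : Prop :=
  exists (D : cstarAlgType R) (iota : D -> A), star_iso_onto B iota /\ P D.

(* For e, x in A, the element (1 - e) x of A is x - e x, also when 1 is the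
   unit of the unitization. *)
Definition essentially_tracially_in (R : realType)
    (P : cstarAlgType R -> Prop) (A : cstarAlgType R) : Prop :=
  forall (F : set A) (eps : R) (s : A),
    finite_set F -> 0 < eps -> positive s -> s != 0 ->
  exists (e : A) (B : set A),
    [/\ positive_unit_ball e,
        cstar_subalgebra B /\ (exists2 x, B x & x != 0),
        subalgebra_in P B,
        forall x, F x ->
          [/\ `|e ** x - x ** e| < eps%:C,
              in_eps (x - e ** x) eps B
            & `|x| - eps%:C <= `|x - e ** x| ]
      & cuntz_sub e s].

(* [amplification I A] is the type of copies of A (x) K(l^2(I)): a C*-algebra
   containing the *-algebra of finitely supported I x I matrices over A as a
   dense *-subalgebra, [emb i j a] being the matrix with the single entry a in
   position (i, j).  The C*-norm on finite matrices being unique, such a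
   C*-algebra is unique up to a unique isomorphism compatible with [emb].
   It is M_n(A) for I = 'I_n, and A (x) K for I = nat. *)
Record amplification (R : realType) (I : eqType) (A : cstarAlgType R) := {
  amp :> cstarAlgType R ;
  emb : I -> I -> A -> amp ;
  emb_linear : forall i j (k : R[i]) (a b : A),
    emb i j (k *: a + b) = k *: emb i j a + emb i j b ;
  emb_mul : forall i j k l (a b : A),
    emb i j a ** emb k l b = if j == k then emb i l (a ** b) else 0 ;
  emb_star : forall i j (a : A), star (emb i j a) = emb j i (star a) ;
  emb_inj : forall i j, injective (emb i j) ;
  emb_dense : closure
    [set x | exists s : seq (I * I * A),
       x = \sum_(p <- s) emb p.1.1 p.1.2 p.2] = setT
}.

Notation stabilization A := (amplification nat A).

Section CuntzSemigroup.
Variables (R : realType) (A : cstarAlgType R) (AK : stabilization A).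

(* Inside A (x) K, the matrix x in M_n(A) and diag(x, 0) in M_(n+m)(A) are the
   same element, and M_oo(A) is the union of the M_n(A). *)
Definition mx_in (n : nat) (a : 'M[A]_n) : AK :=
  \sum_(i < n) \sum_(j < n) emb AK i j (a i j).

Definition mx_positive (n : nat) (a : 'M[A]_n) : Prop :=
  exists y : 'M[A]_n, mx_in a = star (mx_in y) ** mx_in y.

(* <a> <= <b> in W(A): a <~ b within some M_N(A) containing both a and b. *)
Definition W_le (n m : nat) (a : 'M[A]_n) (b : 'M[A]_m) : Prop :=
  exists2 N : nat, (maxn n m <= N)%N &
  exists x : nat -> 'M[A]_N,
    (star (mx_in (x k)) ** mx_in b ** mx_in (x k)) @[k --> \oo] --> mx_in a.

(* k <a> is the class of diag(a, ..., a), with k blocks. *)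
Definition W_mul (k n : nat) (a : 'M[A]_n) : 'M[A]_(\sum_(i < k) n) :=
  \mxdiag_(i < k) a.

End CuntzSemigroup.

(* This does not depend on the choice of the copy AK of A (x) K. *)
Definition W_almost_unperforated (R : realType) (A : cstarAlgType R) : Prop :=
  exists AK : stabilization A,
  forall (n m : nat) (a : 'M[A]_n) (b : 'M[A]_m) (k : nat),
    mx_positive AK a -> mx_positive AK b ->
    W_le AK (W_mul k.+1 a) (W_mul k b) -> W_le AK a b.

Section Quasitraces.
Variables (R : realType).

Definition quasitrace (A : cstarAlgType R) (tau : A -> R[i]) : Prop :=
  [/\ forall x : A, tau (star x ** x) = tau (x ** star x)
                    /\ 0 <= tau (star x ** x),
      forall B : set A, cstar_subalgebra B ->
        (forall x y, B x -> B y -> x ** y = y ** x) ->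
        forall (k : R[i]) x y, B x -> B y ->
          tau (k *: x + y) = k * tau x + tau y
    & forall a b : A, self_adjoint a -> self_adjoint b ->
        tau (a + 'i *: b) = tau a + 'i * tau b].

Definition quasitrace2 (A : cstarAlgType R) (tau : A -> R[i]) : Prop :=
  quasitrace tau /\
  exists (M2 : amplification 'I_2 A) (tau2 : M2 -> R[i]),
    quasitrace tau2 /\ forall a : A, tau2 (emb M2 ord0 ord0 a) = tau a.

Definition QT (A : cstarAlgType R) : set (A -> R[i]) :=
  [set tau | quasitrace2 tau /\
     ereal_sup [set (complex.Re (tau a))%:E | a in @positive_unit_ball R A]
       = 1%:E].

(* Lower semicontinuous [0, oo]-valued quasitraces; only the values of T on
   positive elements are relevant. *)
Definition lsc_quasitrace (S : cstarAlgType R) (T : S -> \bar R) : Prop :=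
  [/\ forall x, positive x -> (0 <= T x)%E,
      forall x, T (star x ** x) = T (x ** star x),
      forall (k : R) x, 0 <= k -> positive x -> T (k%:C *: x) = (k%:E * T x)%E,
      forall x y, positive x -> positive y -> x ** y = y ** x ->
        T (x + y) = (T x + T y)%E
    & lower_semicontinuous (T : subspace (@positive R S) -> \bar R)].

Definition dim_fun (S : cstarAlgType R) (T : S -> \bar R) (x : S) : \bar R :=
  limn (fun n : nat => T (cfc (f_cut (n.+1%:R)^-1) x)).

End Quasitraces.

(* For b in Ped(A)_+ of norm one, D together with iota is the hereditary
   C*-subalgebra B_0 = closure (b A b) as a C*-algebra.  Each tau in QT(B_0)
   has a unique lower semicontinuous extension T to (A (x) K)_+, where B_0 sits
   in A (x) K as the corner B_0 (x) e_00.  The condition does not depend on b.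
   If QT(B_0) is nonempty then the hypothesis on d_tau forces y != 0; if
   QT(B_0) is empty (e.g. for A purely infinite) the requirement y != 0 only
   excludes the absurd instance in which x <~ 0 for every x. *)
Definition strict_comparison (R : realType) (A : cstarAlgType R) : Prop :=
  forall (AK : stabilization A) (b : A) (D : cstarAlgType R) (iota : D -> A),
    positive b -> pedersen_ideal b -> `|b| = 1 ->
    star_iso_onto (hereditary_of b) iota ->
  forall x y : AK, positive x -> positive y -> y != 0 ->
    (forall (tau : D -> R[i]) (T : AK -> \bar R),
       QT tau -> lsc_quasitrace T ->
       (forall d : D, positive d ->
          T (emb AK 0%N 0%N (iota d)) = (complex.Re (tau d))%:E) ->
       (dim_fun T x < dim_fun T y)%E) ->
    cuntz_sub x y.

(* Main.v *)
(* If x is not Cuntz below y, then the cut (x - 2e)_+ is not either.  The Cuntz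
   semigroup of A (x) K is almost unperforated up to such cuts, so a = (x - e)_+
   satisfies (k + 1)<a> <= k<y> for no k.  By Goodearl and Handelman there is an
   additive monotone f with f(y) <= 1 <= f(a).  The integral over t > 0 of
   f((z - t)_+) is a lower semicontinuous 2-quasitrace T(z).  It is bounded on the
   hereditary subalgebra of b because b lies in the Pedersen ideal, and nonzero
   there because A is simple; once it is normalized, d_T(y) <= d_T(x) contradicts
   the hypothesis on x and y.

   For almost unperforation, let (k + 1)<a> <= k<b> with a, b matrices over A.
   Compressing a, b and an element implementing the comparison by 1 - e, where e is
   Cuntz small and almost commutes with everything in sight, yields matrices over a
   subalgebra B with W(B) almost unperforated; hence <a> <= <b> + m<e> up to a cut.
   To absorb m<e>, b is first replaced by some b1 with <b1> + <c> <= <b>, c <> 0, and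
   k<b> <= (k + 1)<b1>.  Such b1 and c exist unless A (x) K contains a minimal
   projection, and then Cuntz comparison is decided by rank. *)

Require Import Defs.
From HB Require Import structures.
From mathcomp Require Import all_boot all_order all_algebra.
From mathcomp Require Import all_classical all_reals all_analysis.
From mathcomp Require Import complex ring lra zify.
From Stdlib Require Ncring Ncring_tac.
Set Implicit Arguments.
Unset Strict Implicit.
Unset Printing Implicit Defensive.
Import Order.TTheory GRing.Theory Num.Theory.
Import numFieldNormedType.Exports.
Local Open Scope classical_set_scope.
Local Open Scope ring_scope.

(** All computations take place in the unitization of [A (x) K], where [1 - e] makes sense; the
    elements of [A (x) K] itself are those satisfying [ideal], and witnesses found outside are
    pushed back by local approximate units. The hypothesis concerns finite matrices over a
    subalgebra [B], compared inside [B (x) K], while the conclusion concerns [A (x) K]. Such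
    matrices therefore live in two algebras, and norms, functional calculus and comparison are
    carried from one to the other. General elements of [A (x) K] are reached from finite matrices at
    the price of a cut. The demand [k<b> <= (k + 1)<b1>] comes from doubling:
    [(2k + 2)<a> <= 2k<b> <= (2k + 1)<b1>] has the shape of the original inequality, with [b1] in
    place of [b]. Additivity of [T] on commuting elements rests on the law
    [d(x + y) + d(x y) = d(x) + d(y)], the rule of a measure for unions and intersections of open
    supports. It controls the Riemann sums while slices of one element are added to the other. The
    2-quasitrace property holds because [M_2] over the corner also sits inside [A (x) K]. *)

#[export] Instance pzRing_ops (U : pzRingType) :
  @Ncring.Ring_ops U 0 1 (@GRing.add U) (@GRing.mul U) (fun x y => x - y)
    (@GRing.opp U) eq := {}.

#[export] Instance pzRing_Ring (U : pzRingType) : Ncring.Ring (T := U).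
Proof.
split.
- exact: RelationClasses.eq_equivalence.
- by move=> x y /= -> z t ->.
- by move=> x y /= -> z t ->.
- by move=> x y /= -> z t ->.
- by move=> x y /= ->.
- exact: add0r.
- exact: addrC.
- exact: addrA.
- exact: mul1r.
- exact: mulr1.
- exact: mulrA.
- exact: mulrDl.
- by move=> x y z; apply: mulrDr.
- by [].
- exact: subrr.
Qed.

Ltac ncring := Ncring_tac.non_commutative_ring.

Lemma le_eps (R : realType) (a b : R) : (forall e : R, 0 < e -> a <= b + e) -> a <= b.
Proof. by move=> H; apply/ler_addgt0Pr => e /H. Qed.

Reserved Notation "N[ x ]" (at level 0, x at level 99, format "N[ x ]").

(* A unital C*-algebra is presented as an algebra over R with a real-valued norm;
   [ui] is the scalar i, and completeness is sequential. *)
HB.mixin Record isUCStar (R : realType) U & GRing.Algebra R U := {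
  unorm : U -> R ;
  ustar : U -> U ;
  ui : U ;
  unormD : forall x y : U, unorm (x + y) <= unorm x + unorm y ;
  unormZ : forall (k : R) (x : U), unorm (k *: x) = `|k| * unorm x ;
  unorm0_eq0 : forall x : U, unorm x = 0 -> x = 0 ;
  ustarK : involutive ustar ;
  ustarD : {morph ustar : x y / x + y} ;
  ustarZ : forall (k : R) x, ustar (k *: x) = k *: ustar x ;
  ustarM : forall x y : U, ustar (x * y) = ustar y * ustar x ;
  ustar_ui : ustar ui = - ui ;
  uiM : ui * ui = -1 ;
  uiC : forall x, ui * x = x * ui ;
  unormM : forall x y : U, unorm (x * y) <= unorm x * unorm y ;
  unorm_ustar_mul : forall x : U, unorm (ustar x * x) = unorm x ^+ 2 ;
  ucomplete : forall u : nat -> U,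
    (forall e : R, 0 < e -> exists N, forall m n, (N <= m)%N -> (N <= n)%N ->
       unorm (u m - u n) < e) ->
    exists l, forall e : R, 0 < e -> exists N, forall n, (N <= n)%N ->
       unorm (u n - l) < e
}.

#[short(type="ucstarType")]
HB.structure Definition UCStar (R : realType) :=
  { U of isUCStar R U & GRing.Algebra R U }.

Notation "x ^*u" := (ustar x) (at level 2, format "x ^*u") : ring_scope.
Notation "N[ x ]" := (unorm x) : ring_scope.

(** * Spectral calculus of polynomials *)

Section Basics.
Variables (R : realType) (U : ucstarType R).
Implicit Types (x y z a b : U).

Lemma unorm0 : N[0 : U] = 0.
Proof. by rewrite -(scale0r 0) unormZ normr0 mul0r. Qed.

Lemma unormN x : N[- x] = N[x].
Proof. by rewrite -scaleN1r unormZ normrN1 mul1r. Qed.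

Lemma udistC x y : N[x - y] = N[y - x].
Proof. by rewrite -unormN opprB. Qed.

Lemma unormB x y : N[x - y] <= N[x] + N[y].
Proof. by rewrite -(unormN y); apply: unormD. Qed.

Lemma unorm_ge0 x : 0 <= N[x].
Proof. by have := unormB x x; rewrite subrr unorm0; lra. Qed.
Hint Resolve unorm_ge0 : core.

Lemma udistD z x y : N[x - y] <= N[x - z] + N[z - y].
Proof. by rewrite -{1}(subrK z x) -addrA; apply: unormD. Qed.

Lemma unorm_eq0 x : (N[x] == 0) = (x == 0).
Proof. by apply/eqP/eqP => [/unorm0_eq0//|->]; rewrite unorm0. Qed.

Lemma unorm_gt0 x : (0 < N[x]) = (x != 0).
Proof. by rewrite lt_def unorm_ge0 andbT unorm_eq0. Qed.

Lemma unorm_le0 x : (N[x] <= 0) = (x == 0).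
Proof. by rewrite -unorm_eq0 eq_le unorm_ge0 andbT. Qed.

Lemma unorm_sum I (r : seq I) (P : pred I) (F : I -> U) :
  N[\sum_(i <- r | P i) F i] <= \sum_(i <- r | P i) N[F i].
Proof.
elim/big_rec2: _ => [|i y x _ H]; first by rewrite unorm0.
by apply: le_trans (unormD _ _) _; rewrite lerD2l.
Qed.

Definition sa x := x^*u = x.

Lemma ustar0 : (0 : U)^*u = 0.
Proof. by apply: (addrI (0 : U)^*u); rewrite -ustarD !addr0. Qed.

Lemma ustarN x : (- x)^*u = - x^*u.
Proof. by apply/eqP; rewrite -addr_eq0 -ustarD addNr ustar0. Qed.

Lemma ustarB x y : (x - y)^*u = x^*u - y^*u.
Proof. by rewrite ustarD ustarN. Qed.

Lemma ustar1 : (1 : U)^*u = 1.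
Proof. by have H := ustarK (1 : U); rewrite -[LHS]mul1r -{1}H -ustarM mul1r H. Qed.

Lemma ustar_sum I (r : seq I) (P : pred I) (F : I -> U) :
  (\sum_(i <- r | P i) F i)^*u = \sum_(i <- r | P i) (F i)^*u.
Proof. by apply: (big_morph _ ustarD ustar0). Qed.

Lemma norm_ustar x : N[x^*u] = N[x].
Proof.
suff H y : N[y] <= N[y^*u].
  by apply/eqP; rewrite eq_le H -{2}[x]ustarK H.
have [->|y0] := eqVneq y 0; first by rewrite ustar0.
have y0' : 0 < N[y] by rewrite unorm_gt0.
rewrite -(ler_pM2r y0') -expr2 -unorm_ustar_mul.
exact: unormM.
Qed.

Lemma unorm_mul_ustar x : N[x * x^*u] = N[x] ^+ 2.
Proof. by rewrite -{1}[x]ustarK unorm_ustar_mul norm_ustar. Qed.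

Lemma unorm1 : N[1 : U] = 1.
Proof.
have := unorm_ustar_mul (1 : U); rewrite ustar1 mul1r expr2 => /eqP.
rewrite -subr_eq0 -{1}[N[1]]mulr1 -mulrBr mulf_eq0 unorm_eq0 oner_eq0 /=.
by rewrite subr_eq0 => /eqP.
Qed.

Lemma sa_norm_sqr x : sa x -> N[x * x] = N[x] ^+ 2.
Proof. by move=> sx; rewrite -{1}sx unorm_ustar_mul. Qed.

Lemma saD x y : sa x -> sa y -> sa (x + y).
Proof. by rewrite /sa ustarD => -> ->. Qed.
Lemma saN x : sa x -> sa (- x).
Proof. by rewrite /sa ustarN => ->. Qed.
Lemma saB x y : sa x -> sa y -> sa (x - y).
Proof. by move=> sx sy; apply: saD => //; apply: saN. Qed.
Lemma saZ (k : R) x : sa x -> sa (k *: x).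
Proof. by rewrite /sa ustarZ => ->. Qed.
Lemma sa0 : sa (0 : U). Proof. exact: ustar0. Qed.
Lemma sa1 : sa (1 : U). Proof. exact: ustar1. Qed.
Lemma saA (k : R) : sa (k%:A : U).
Proof. exact/saZ/sa1. Qed.
Lemma saM x y : sa x -> sa y -> x * y = y * x -> sa (x * y).
Proof. by rewrite /sa ustarM => -> -> ->. Qed.
Lemma sa_ustarM x : sa (x^*u * x).
Proof. by rewrite /sa ustarM ustarK. Qed.
Lemma sa_Mustar x : sa (x * x^*u).
Proof. by rewrite /sa ustarM ustarK. Qed.
Lemma sa_conj x y : sa x -> sa (y^*u * x * y).
Proof. by move=> sx; rewrite /sa !ustarM ustarK sx mulrA. Qed.
Lemma sa_sum I (r : seq I) (P : pred I) (F : I -> U) :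
  (forall i, P i -> sa (F i)) -> sa (\sum_(i <- r | P i) F i).
Proof. by move=> H; rewrite /sa ustar_sum; apply: eq_bigr => i /H. Qed.

(* [u = x + i y] is a unitary whose real part is [x]. *)
Lemma sq_sum1_norm_le1 x y : sa x -> sa y -> x * y = y * x ->
  x * x + y * y = 1 -> N[x] <= 1.
Proof.
move=> sx sy xy H.
pose u := x + ui * y.
have su : u^*u = x - ui * y.
  by rewrite ustarD ustarM ustar_ui sx sy mulrN -uiC.
have uu : u^*u * u = 1.
  rewrite su /u -H; transitivity (x * x + x * ui * y - ui * (y * x) - ui * (y * ui) * y).
    by ncring.
  rewrite -!uiC -xy; transitivity (x * x - ui * ui * (y * y)); first by ncring.
  by rewrite uiM mulN1r opprK.
have nu : N[u] = 1.
  by apply/eqP; rewrite -sqrp_eq1// -unorm_ustar_mul uu unorm1.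
have -> : x = 2^-1 *: (u + u^*u).
  rewrite su /u addrACA subrr addr0 scalerDr -scalerDl.
  by rewrite (_ : 2^-1 + 2^-1 = 1) ?scale1r//; lra.
rewrite unormZ ger0_norm ?invr_ge0//.
have := unormD u u^*u; rewrite norm_ustar nu; lra.
Qed.

Definition ulim (u : nat -> U) l := forall e : R, 0 < e ->
  exists N, forall n, (N <= n)%N -> N[u n - l] < e.

Lemma ulim_unique (u : nat -> U) l l' : ulim u l -> ulim u l' -> l = l'.
Proof.
move=> ul ul'; apply/eqP; rewrite -subr_eq0 -unorm_le0; apply: le_eps => e e0.
have [N HN] := ul (e/2) ltac:(lra); have [N' HN'] := ul' (e/2) ltac:(lra).
have := HN (maxn N N') (leq_maxl _ _); have := HN' (maxn N N') (leq_maxr _ _).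
have := udistD (u (maxn N N')) l l'; rewrite (udistC l (u _)) add0r; lra.
Qed.

Lemma norm_mulB_le a b a' b' :
  N[a * b - a' * b'] <= N[a - a'] * N[b] + N[a'] * N[b - b'].
Proof.
have -> : a * b - a' * b' = (a - a') * b + a' * (b - b').
  by rewrite mulrBl mulrBr addrA subrK.
by apply: le_trans (unormD _ _) _; apply: lerD; apply: unormM.
Qed.

Definition pev (p : {poly R}) x : U := horner_alg x p.

Lemma pevD p q x : pev (p + q) x = pev p x + pev q x.
Proof. exact: rmorphD. Qed.

Lemma pevB p q x : pev (p - q) x = pev p x - pev q x.
Proof. exact: rmorphB. Qed.
Lemma pevM p q x : pev (p * q) x = pev p x * pev q x.
Proof. exact: rmorphM. Qed.
Lemma pevXn p n x : pev (p ^+ n) x = pev p x ^+ n.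
Proof. exact: rmorphXn. Qed.
Lemma pevX x : pev 'X x = x.
Proof. exact: horner_algX. Qed.
Lemma pevC k x : pev k%:P x = k%:A.
Proof. exact: horner_algC. Qed.
Lemma pevZ k p x : pev (k *: p) x = k *: pev p x.
Proof. by rewrite -mul_polyC pevM pevC mulr_algl. Qed.
Lemma pev0 x : pev 0 x = 0.
Proof. exact: rmorph0. Qed.
Lemma pev1 x : pev 1 x = 1.
Proof. exact: rmorph1. Qed.

Lemma sa_pev p x : sa x -> sa (pev p x).
Proof.
move=> sx; elim/poly_ind: p => [|p c IH]; first by rewrite pev0; apply: sa0.
rewrite pevD pevM pevX pevC; apply: saD; last exact: saA.
by apply: saM => //; have := pevM p 'X x; rewrite mulrC pevM pevX.
Qed.

Lemma pev_comm p x z : z * x = x * z -> z * pev p x = pev p x * z.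
Proof.
move=> zx; elim/poly_ind: p => [|p c IH]; first by rewrite pev0 mul0r mulr0.
rewrite pevD pevM pevX pevC mulrDr mulrDl mulr_algl mulr_algr; congr (_ + _).
by rewrite mulrA IH -!mulrA zx.
Qed.

(** The norm-closed real unital algebra generated by [x]. For self-adjoint [x] all its elements are
    self-adjoint and commute, so square roots found in it can be multiplied freely. *)
Definition inC x y := forall e : R, 0 < e -> exists p, N[y - pev p x] < e.

Lemma inC_pev p x : inC x (pev p x).
Proof. by move=> e e0; exists p; rewrite subrr unorm0. Qed.

Lemma inC_closed x y :
  (forall e : R, 0 < e -> exists2 z, inC x z & N[y - z] < e) -> inC x y.
Proof.
move=> H e e0; have [z zx yz] := H (e/2) ltac:(lra).
have [p Hp] := zx (e/2) ltac:(lra); exists p.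
by have := udistD z y (pev p x); lra.
Qed.

Lemma inC_lim x (u : nat -> U) y : (forall n, inC x (u n)) -> ulim u y -> inC x y.
Proof.
move=> H ul; apply: inC_closed => e e0; have [N /(_ N (leqnn _)) HN] := ul e e0.
by exists (u N) => //; rewrite udistC.
Qed.

Lemma inC_sa x y : sa x -> inC x y -> sa y.
Proof.
move=> sx H; rewrite /sa; apply/eqP; rewrite -subr_eq0 -unorm_le0.
apply: le_eps => e e0; have [p Hp] := H (e/2) ltac:(lra).
have := udistD (pev p x) y^*u y; rewrite add0r (udistC (pev p x) y).
have -> : N[y^*u - pev p x] = N[y - pev p x].
  by rewrite -norm_ustar ustarB ustarK sa_pev.
lra.
Qed.

Lemma inC_comm x y z : inC x y -> z * x = x * z -> z * y = y * z.
Proof.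
move=> H zx; apply/eqP; rewrite -subr_eq0 -unorm_le0; apply: le_eps => e e0.
have nz : 0 < N[z] + 1 by have := unorm_ge0 z; lra.
have [p Hp] := H (e / (2 * (N[z] + 1))) ltac:(rewrite divr_gt0//; lra).
have -> : z * y - y * z = z * (y - pev p x) - (y - pev p x) * z.
  transitivity (z * (y - pev p x) - (y - pev p x) * z + (z * pev p x - pev p x * z)).
    by ncring.
  by rewrite (pev_comm p zx) subrr addr0.
rewrite add0r.
apply: le_trans (unormB _ _) _.
apply: le_trans (lerD (unormM _ _) (unormM _ _)) _.
move: Hp; rewrite ltr_pdivlMr; last lra.
have := unorm_ge0 (y - pev p x); have := unorm_ge0 z; nra.
Qed.

Lemma inCC x y z : inC x y -> inC x z -> y * z = z * y.
Proof. by move=> Hy Hz; apply: (inC_comm Hz); apply/esym/(inC_comm Hy). Qed.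

Lemma inCD x y z : inC x y -> inC x z -> inC x (y + z).
Proof.
move=> Hy Hz e e0; have [p Hp] := Hy (e/2) ltac:(lra).
have [q Hq] := Hz (e/2) ltac:(lra); exists (p + q).
rewrite pevD opprD addrACA.
by have := unormD (y - pev p x) (z - pev q x); lra.
Qed.

Lemma inCM x y z : inC x y -> inC x z -> inC x (y * z).
Proof.
move=> Hy Hz e e0.
have nz := unorm_ge0 z; have ny := unorm_ge0 y.
have d0 : 0 < 2 * (N[z] + 1) by lra.
have [p Hp] := Hy (Num.min 1 (e / (2 * (N[z] + 1))))
  ltac:(by rewrite lt_min ltr01 divr_gt0).
have d1 : 0 < 2 * (N[y] + 1) by lra.
have [q Hq] := Hz (e / (2 * (N[y] + 1))) ltac:(by rewrite divr_gt0).
exists (p * q); rewrite pevM; apply: le_lt_trans (norm_mulB_le _ _ _ _) _.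
move: Hp; rewrite lt_min ltr_pdivlMr// => /andP[Hp1 Hp].
move: Hq; rewrite ltr_pdivlMr// => Hq.
have np : N[pev p x] <= N[y] + 1.
  by have := udistD y (pev p x) 0; rewrite !subr0 (udistC _ y); lra.
have := unorm_ge0 (y - pev p x); have := unorm_ge0 (z - pev q x).
have := unorm_ge0 (pev p x); nra.
Qed.

Lemma inCX x : inC x x.
Proof. by rewrite -{2}[x]pevX; apply: inC_pev. Qed.
Lemma inCA x (k : R) : inC x k%:A.
Proof. by rewrite -(pevC k x); apply: inC_pev. Qed.
Lemma inC1 x : inC x 1.
Proof. by rewrite -(pev1 x); apply: inC_pev. Qed.
Lemma inCZ x y (k : R) : inC x y -> inC x (k *: y).
Proof. by move=> H; rewrite -mulr_algl; apply: inCM => //; apply: inCA. Qed.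
Lemma inCN x y : inC x y -> inC x (- y).
Proof. by move=> H; rewrite -scaleN1r; apply: inCZ. Qed.
Lemma inCB x y z : inC x y -> inC x z -> inC x (y - z).
Proof. by move=> Hy Hz; apply: inCD => //; apply: inCN. Qed.

Lemma inC_pevr x y p : inC x y -> inC x (pev p y).
Proof.
move=> H; elim/poly_ind: p => [|p c IH]; first by rewrite pev0 -(pev0 x); apply: inC_pev.
by rewrite pevD pevM pevX pevC; apply: inCD; [exact: inCM | exact: inCA].
Qed.

Lemma inC_trans x y z : inC x y -> inC y z -> inC x z.
Proof.
move=> H H'; apply: inC_closed => e e0; have [p Hp] := H' e e0.
by exists (pev p y) => //; apply: inC_pevr.
Qed.

End Basics.

#[local] Hint Resolve unorm_ge0 : core.

(** * Continuous functional calculus *)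

Section Calculus.
Variables (R : realType) (U : ucstarType R).
Implicit Types (x y z a b h : U) (p q : {poly R}).

Lemma half_gt0 (e : R) : 0 < e -> 0 < e / 2.
Proof. by move=> e0; rewrite divr_gt0. Qed.

Lemma sqrtM_id (k : R) : 0 <= k -> Num.sqrt k * Num.sqrt k = k.
Proof. by move=> k0; rewrite -expr2 sqr_sqrtr. Qed.

Lemma exp_small (q e : R) : 0 <= q < 1 -> 0 < e -> exists N, forall n, (N <= n)%N -> q ^+ n < e.
Proof.
move=> /andP[q0 q1] e0.
have /cvgrPdist_lt /(_ e e0) [N _ HN] : (fun n => q ^+ n) @ \oo --> (0 : R).
  by apply: cvg_expr; rewrite ger0_norm.
exists N => n /HN; rewrite sub0r normrN ger0_norm//; exact: exprn_ge0.
Qed.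

Lemma ugeom_lim (u : nat -> U) (C q : R) : 0 <= C -> 0 <= q < 1 ->
  (forall n, N[u n.+1 - u n] <= C * q ^+ n) -> exists l, ulim u l.
Proof.
move=> C0 q01 H; have /andP[q0 q1] := q01.
have D n k : N[u (n + k)%N - u n] <= C * q ^+ n / (1 - q).
  suff E : (1 - q) * N[u (n + k)%N - u n] <= C * q ^+ n * (1 - q ^+ k).
    rewrite ler_pdivlMr; last lra.
    rewrite mulrC; apply: le_trans E _.
    have := exprn_ge0 k q0; have : 0 <= C * q ^+ n by rewrite mulr_ge0// exprn_ge0.
    nra.
  elim: k => [|k IH]; first by rewrite addn0 subrr unorm0 expr0 subrr !mulr0.
  have := udistD (u (n + k)%N) (u (n + k.+1)%N) (u n).
  have := H (n + k)%N; rewrite addnS exprD exprS => Hk.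
  set A := N[_ - u n]; set B := N[_ - u n] in IH *.
  set D := N[_ - _] in Hk *; move=> T.
  have : (1 - q) * A <= (1 - q) * (C * (q ^+ n * q ^+ k)) + (1 - q) * B.
    by rewrite -mulrDr ler_wpM2l//; lra.
  lra.
apply: ucomplete => e e0.
have e1 : 0 < e * (1 - q) / (2 * (C + 1)).
  by rewrite divr_gt0// ?mulr_gt0//; lra.
have [N HN] := exp_small q01 e1.
have HN' : C * q ^+ N / (1 - q) < e / 2.
  have := HN N (leqnn _); rewrite ltr_pdivlMr ?ltr_pdivrMr; [|lra|lra].
  have := exprn_ge0 N q0; nra.
exists N => m n Nm Nn; have := udistD (u N) (u m) (u n).
rewrite (udistC (u N)) -(subnKC Nm) -(subnKC Nn).
by have := D N (m - N)%N; have := D N (n - N)%N; lra.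
Qed.

(** A fixed point [l] satisfies [2 l = z + l^2], that is, [(1 - l)^2 = 1 - z]. *)
Fixpoint sqrt_iter z n : U :=
  if n is n'.+1 then 2^-1 *: (z + sqrt_iter z n' * sqrt_iter z n') else 0.

Lemma sqrt_1B z : N[z] < 1 -> exists2 h, inC z h & h * h = 1 - z.
Proof.
set q := N[z] => q1; have q0 : 0 <= q by exact: unorm_ge0.
pose y := sqrt_iter z.
have yS n : y n.+1 = 2^-1 *: (z + y n * y n) by [].
have yC n : inC z (y n).
  elim: n => [|n IH]; first by rewrite /y /= -(pev0 z); apply: inC_pev.
  by rewrite yS; apply/inCZ/inCD; [exact: inCX|exact: inCM].
have yq n : N[y n] <= q.
  elim: n => [|n IH]; first by rewrite unorm0.
  rewrite yS unormZ ger0_norm ?invr_ge0//.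
  have := unormD z (y n * y n); have := unormM (y n) (y n).
  have := unorm_ge0 (y n); rewrite -/q; nra.
(* The iterates commute, so the next difference is half the product of the current one with
   [y n.+1 + y n], whose norm is at most [2 q]. *)
have yd n : N[y n.+1 - y n] <= 1 * q ^+ n.
  elim: n => [|n IH]; first by rewrite subr0 expr0; have := yq 1%N; lra.
  rewrite [X in X - _]yS [X in _ - X]yS -scalerBr unormZ ger0_norm ?invr_ge0//.
  have -> : z + y n.+1 * y n.+1 - (z + y n * y n) = (y n.+1 - y n) * (y n.+1 + y n).
    transitivity ((y n.+1 - y n) * (y n.+1 + y n) + (y n * y n.+1 - y n.+1 * y n)).
      by ncring.
    by rewrite (inCC (yC n) (yC n.+1)) subrr addr0.
  have := unormM (y n.+1 - y n) (y n.+1 + y n).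
  have := unormD (y n.+1) (y n); have := yq n; have := yq n.+1.
  have := unorm_ge0 (y n.+1 - y n); rewrite exprS; nra.
have q01 : 0 <= q < 1 by rewrite q0.
have [l Hl] := ugeom_lim ler01 q01 yd.
have lC : inC z l by apply: inC_lim Hl.
have lE : l + l = z + l * l.
  apply/eqP; rewrite -subr_eq0 -unorm_le0; apply: le_eps => e e0; rewrite add0r.
  have [N HN] := Hl (e / (4 + 4 * q + 4 * N[l]))
    ltac:(rewrite divr_gt0//; have := unorm_ge0 l; lra).
  have h1 := HN N (leqnn _); have h2 := HN N.+1 (leqnSn _).
  have -> : l + l - (z + l * l) = (l - y N.+1) + (l - y N.+1) + (y N * y N - l * l).
    have E2 : y N.+1 + y N.+1 = z + y N * y N.
      by rewrite yS -scalerDl (_ : 2^-1 + 2^-1 = 1) ?scale1r//; lra.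
    transitivity ((l - y N.+1) + (l - y N.+1) + ((y N.+1 + y N.+1) - z - l * l)).
      by ncring.
    by rewrite E2; ncring.
  rewrite ltr_pdivlMr in h1; last by have := unorm_ge0 l; lra.
  rewrite ltr_pdivlMr in h2; last by have := unorm_ge0 l; lra.
  have := unormD ((l - y N.+1) + (l - y N.+1)) (y N * y N - l * l).
  have := unormD (l - y N.+1) (l - y N.+1); rewrite !(udistC l).
  have := norm_mulB_le (y N) (y N) l l; have := yq N; have := unorm_ge0 l.
  have g0 := unorm_ge0 (y N - l); have g1 := unorm_ge0 (y N.+1 - l).
  move=> l0 yqN; have := ler_wpM2l g0 yqN; nra.
exists (1 - l); first by apply: inCB => //; apply: inC1.
transitivity (1 - (l + l) + l * l); first by ncring.
by rewrite lE; ncring.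
Qed.

Lemma sqrt_ABz (x z : U) (c : R) : sa x -> inC x z -> N[z] < c ->
  exists h, [/\ inC x h, sa h & h * h = c%:A - z].
Proof.
move=> sx zx zc; have c0 : 0 < c by have := unorm_ge0 z; lra.
have [|h hz hh] := @sqrt_1B (c^-1 *: z).
  by rewrite unormZ gtr0_norm ?invr_gt0// mulrC ltr_pdivrMr ?mul1r.
have hx : inC x h by apply: inC_trans hz; apply: inCZ.
exists (Num.sqrt c *: h); split; first exact: inCZ.
  by apply: saZ; apply: inC_sa hx.
rewrite -scalerAl -scalerAr scalerA hh -expr2 sqr_sqrtr ?ltW//.
by rewrite scalerBr scalerA mulfV ?scale1r//; apply: lt0r_neq0.
Qed.

(** Scale [w = x - a] by [s] so that [N[s w] < 1] and take [h^2 = 1 - (s w)^2]. Since [h + i s w] is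
    unitary, [N[h] <= 1], so [(1 + c) - h^2 = (s w)^2 + c] again has a square root; [c = s^2 b^2]
    yields the quadratic after division by [s^2]. *)
Lemma sqrt_quadratic x (a b : R) : sa x -> b != 0 ->
  exists h, [/\ inC x h, sa h & h * h = (x - a%:A) * (x - a%:A) + (b ^+ 2)%:A].
Proof.
move=> sx b0; set w := x - a%:A.
have wx : inC x w by apply: inCB; [exact: inCX|exact: inCA].
have sw : sa w := inC_sa sx wx.
pose s := (N[w] + 1)^-1.
have s0 : 0 < s by rewrite invr_gt0; have := unorm_ge0 w; lra.
have nw : N[s *: w] < 1.
  rewrite unormZ gtr0_norm// mulrC ltr_pdivrMr ?mul1r; last by have := unorm_ge0 w; lra.
  lra.
have wC : inC x ((s *: w) * (s *: w)) by apply: inCM; apply: inCZ.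
have [|h [hx sh hh]] := @sqrt_ABz x _ 1 sx wC.
  apply: le_lt_trans (unormM _ _) _; have := unorm_ge0 (s *: w); nra.
rewrite scale1r in hh.
have h1 : N[h] <= 1.
  apply: (@sq_sum1_norm_le1 _ _ h (s *: w)) => //.
  - exact: saZ.
  - by apply: inCC hx _; apply: inCZ.
  - by rewrite hh subrK.
pose c := s ^+ 2 * b ^+ 2.
have c0 : 0 < c by rewrite mulr_gt0// exprn_even_gt0//= ?lt0r_neq0.
have [||k [kx sk kk]] := @sqrt_ABz x (h * h) (1 + c) sx.
- exact: inCM.
- by apply: le_lt_trans (unormM _ _) _; have := unorm_ge0 h; nra.
exists (s^-1 *: k); split; [exact: inCZ|exact: saZ|].
rewrite -scalerAl -scalerAr scalerA kk hh -scalerAl -scalerAr scalerA.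
rewrite opprB addrC scalerDl scale1r addrA subrK.
rewrite scalerDr scalerA -invfM mulVf ?scale1r ?mulf_neq0 ?lt0r_neq0//.
rewrite scalerA /c expr2 mulrA mulVf ?mul1r ?mulf_neq0 ?lt0r_neq0//.
Qed.

(** A root [a + i b] in [R[i]] is either real, or a root of the real quadratic [(X - a)^2 + b^2]. In
    the second case the remainder of [p] modulo this quadratic has degree at most 1 and vanishes at
    [a + i b], hence is zero. *)
Lemma real_poly_root_cases p : (1 < size p)%N ->
  (exists (a : R) q, p = q * ('X - a%:P)) \/
  (exists (a b : R) q, b != 0 /\ p = q * (('X - a%:P) ^+ 2 + (b ^+ 2)%:P)).
Proof.
move=> sp; have /closed_rootP [z] : size (map_poly (real_complex R) p) != 1%N.
  by rewrite size_map_poly; case: (size p) sp => [|[]].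
case: z => a b rz.
have [b0|b0] := eqVneq b 0; [left|right].
  have : root p a.
    move: rz; rewrite b0 (_ : (a +i* 0)%C = real_complex R a)// /root horner_map.
    by move=> /eqP[/eqP].
  by case/factor_theorem => q ->; exists a, q.
pose d := ('X - a%:P) ^+ 2 + (b ^+ 2)%:P.
have sd : size d = 3%N.
  rewrite /d size_polyDl; rewrite size_exp_XsubC// size_polyC.
  by case: eqP.
have d0 : d != 0 by rewrite -size_poly_eq0 sd.
have := divp_eq p d; set r := p %% d => pE.
have sr : (size r <= 2)%N by rewrite -ltnS -sd ltn_modp.
exists a, b, (p %/ d); split=> //.
suff r0 : r = 0 by rewrite -/d {1}pE r0 addr0.
have dz : (map_poly (real_complex R) d).[(a +i* b)%C] = 0.
  rewrite /d rmorphD rmorphXn rmorphB /= map_polyX !map_polyC /= !hornerE.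
  by apply/eqP; rewrite eq_complex /=; apply/andP; split; apply/eqP; ring.
have : (map_poly (real_complex R) r).[(a +i* b)%C] = 0.
  by move: rz; rewrite /root {1}pE rmorphD rmorphM hornerD hornerM dz mulr0 add0r => /eqP.
have rE : r = r`_1 *: 'X + (r`_0)%:P.
  apply/polyP => -[|[|i]]; rewrite !coefE /= ?mulr0 ?mulr1 ?add0r ?addr0//.
  by rewrite nth_default//; apply: leq_trans sr _.
rewrite rE rmorphD /= map_polyZ map_polyX map_polyC /= !hornerE => /eqP.
rewrite eq_complex /= => /andP[/eqP h1 /eqP h2].
have r1 : r`_1 = 0.
  by apply/eqP; move/eqP: h2; rewrite ?mul0r ?addr0 mulf_eq0 (negbTE b0) orbF.
have r0 : r`_0 = 0 by rewrite r1 in h1; lra.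
by move: rE; rewrite r1 r0 scale0r add0r polyC0.
Qed.

(** Linear factors of [p] have their root outside [[-M, M]] and, with the right sign, are positive
    there; quadratic factors are positive everywhere. Each has a square root in the commutative
    algebra generated by [x], hence so does the product. This is how positivity on an interval
    containing the spectrum becomes algebraic. *)
Lemma pev_pos_sqrt p x (M : R) : sa x -> N[x] <= M ->
  (forall t : R, `|t| <= M -> 0 < p.[t]) ->
  exists h, [/\ inC x h, sa h & h * h = pev p x].
Proof.
move=> sx xM; have M0 : 0 <= M := le_trans (unorm_ge0 x) xM.
have mul_sqrt y z : (exists h, [/\ inC x h, sa h & h * h = y]) ->
    (exists h, [/\ inC x h, sa h & h * h = z]) ->
    exists h, [/\ inC x h, sa h & h * h = y * z].
  move=> [h [hx sh <-]] [k [kx sk <-]]; exists (h * k); split.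
  - exact: inCM.
  - by apply: saM => //; apply: inCC hx kx.
  - by rewrite -!mulrA (mulrA k) (inCC kx hx) -!mulrA.
have [n] := ubnP (size p); elim: n p => // n IH p; rewrite ltnS => pn pp.
have [sp|sp] := leqP (size p) 1.
  have pE := size1_polyC sp; have := pp 0; rewrite normr0 pE hornerC => /(_ M0) c0.
  exists (Num.sqrt p`_0)%:A; split; [exact: inCA|exact: saA|].
  by rewrite pevC -scalerAl mul1r scalerA -expr2 sqr_sqrtr// ltW.
case: (real_poly_root_cases sp) => [[a [q pE]] | [a [b [q [b0 pE]]]] ].
  have q0 : q != 0.
    by apply/eqP => q0; move: sp; rewrite pE q0 mul0r size_poly0.
  have sq : (size q < n)%N.
    by apply: leq_trans pn; rewrite pE size_Mmonic// ?monicXsubC// size_XsubC addn2.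
  have aM : M < `|a|.
    rewrite ltNge; apply/negP => /pp; rewrite pE !hornerE subrr mulr0; lra.
  have [a0|a0] := ltrP 0 a.
    rewrite pE -[q * _]opprK -mulrN -mulNr opprB; rewrite pevM; apply: mul_sqrt.
      apply: IH; first by rewrite size_polyN.
      move=> t tM; have := pp t tM; rewrite pE !hornerE.
      have : t <= M by apply: le_trans tM; apply: ler_norm.
      by rewrite (gtr0_norm a0) in aM; nra.
    rewrite pevB pevC pevX; apply: sqrt_ABz => //; first exact: inCX.
    by rewrite (gtr0_norm a0) in aM; lra.
  rewrite pE pevM; apply: mul_sqrt.
    apply: IH => // t tM; have := pp t tM; rewrite pE !hornerE.
    have : - t <= M by apply: le_trans tM; rewrite -normrN; apply: ler_norm.
    by rewrite (ler0_norm a0) in aM; nra.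
  have [||h [hx sh hh]] := @sqrt_ABz x (- x) (- a) sx.
  - by apply: inCN; apply: inCX.
  - by rewrite unormN; rewrite (ler0_norm a0) in aM; lra.
  - exists h; split => //; rewrite hh pevB pevC pevX opprK addrC; congr (_ + _).
    by rewrite scaleNr.
have q0 : q != 0.
  by apply/eqP => q0; move: sp; rewrite pE q0 mul0r size_poly0.
have sd : size (('X - a%:P) ^+ 2 + (b ^+ 2)%:P) = 3%N.
  rewrite size_polyDl; rewrite size_exp_XsubC// size_polyC.
  by case: eqP.
rewrite pE pevM; apply: mul_sqrt.
  apply: IH => [|t tM]; last first.
    have := pp t tM; rewrite pE !hornerE.
    have : 0 < b ^+ 2 by rewrite exprn_even_gt0.
    by have := sqr_ge0 (t - a); nra.
  have d0 : ('X - a%:P) ^+ 2 + (b ^+ 2)%:P != 0 by rewrite -size_poly_eq0 sd.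
  by apply: leq_trans pn; rewrite pE size_mul// sd addn3.
have [h [hx sh hh]] := sqrt_quadratic a sx b0.
exists h; split=> //; rewrite hh pevD pevXn pevB pevX !pevC.
by rewrite expr2.
Qed.

(** For [L > K] the polynomial [L^2 - p^2] is positive on the interval, so its value at [x] is some
    [h^2], and [(p(x) + i h) / L] is unitary. *)
Lemma pev_norm p x (K : R) : sa x ->
  (forall t : R, `|t| <= N[x] -> `|p.[t]| <= K) -> N[pev p x] <= K.
Proof.
move=> sx H; apply: le_eps => e e0.
have K0 : 0 <= K by apply: le_trans (normr_ge0 _) (H 0 _); rewrite normr0 unorm_ge0.
pose L := K + e; have L0 : 0 < L by rewrite /L; lra.
have [|h [hx sh hh]] := @pev_pos_sqrt ((L ^+ 2)%:P - p ^+ 2) x _ sx (lexx _).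
  move=> t /H pt; rewrite !hornerE -(real_normK (num_real p.[t])).
  by have := normr_ge0 p.[t]; rewrite /L; nra.
have px := @inC_pev _ _ p x.
have : N[L^-1 *: pev p x] <= 1.
  apply: (@sq_sum1_norm_le1 _ _ _ (L^-1 *: h)).
  - exact/saZ/sa_pev.
  - exact: saZ.
  - by apply: (@inCC _ _ x); apply: inCZ.
  - rewrite -!scalerAl -!scalerAr -!scalerDr hh pevB pevC pevXn -expr2 addrC subrK.
    rewrite !scalerA (_ : _ * _ * _ = 1) ?scale1r//; field; exact: lt0r_neq0.
by rewrite unormZ gtr0_norm ?invr_gt0// mulrC ler_pdivrMr// mul1r.
Qed.

(* By the Weierstrass theorem these are exactly the continuous functions. *)
Definition papp (f : R -> R) := forall M e : R, 0 < e ->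
  exists p, forall t, `|t| <= M -> `|f t - p.[t]| <= e.

Lemma papp_poly p : papp (horner p).
Proof. by move=> M e e0; exists p => t _; rewrite subrr normr0 ltW. Qed.

Lemma papp_ext (f g : R -> R) : (forall t, f t = g t) -> papp f -> papp g.
Proof. by move=> fg Hf M e e0; have [p Hp] := Hf M e e0; exists p => t; rewrite -fg; apply: Hp. Qed.

Lemma papp_id : papp id.
Proof. by apply: papp_ext (papp_poly 'X) => t; rewrite hornerX. Qed.

Lemma papp_cst c : papp (fun=> c).
Proof. by apply: papp_ext (papp_poly c%:P) => t; rewrite hornerC. Qed.

Lemma papp_lim (f : R -> R) :
  (forall M e, 0 < e -> exists2 g, papp g & forall t, `|t| <= M -> `|f t - g t| <= e) -> papp f.
Proof.
move=> H M e e0; have [g gp fg] := H M (e / 2) ltac:(lra).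
have [p Hp] := gp M (e / 2) ltac:(lra); exists p => t tM.
by have := ler_distD (g t) (f t) p.[t]; have := fg t tM; have := Hp t tM; lra.
Qed.

Lemma papp_bounded (f : R -> R) M : papp f -> exists K, forall t, `|t| <= M -> `|f t| <= K.
Proof.
move=> /(_ M 1 ltr01) [p Hp].
suff [K HK] : exists K, forall t, `|t| <= M -> `|p.[t]| <= K.
  exists (K + 1) => t tM; have := ler_distD p.[t] (f t) 0; rewrite !subr0.
  by have := Hp t tM; have := HK t tM; lra.
elim/poly_ind: p {Hp} => [|p c [K HK]]; first by exists 0 => t _; rewrite horner0 normr0.
exists (K * M + `|c|) => t tM; rewrite !hornerE.
apply: le_trans (ler_normD _ _) _; rewrite lerD2r normrM ler_pM//; exact: HK.
Qed.

Lemma pappD (f g : R -> R) : papp f -> papp g -> papp (fun t => f t + g t).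
Proof.
move=> Hf Hg M e e0; have [p Hp] := Hf M (e / 2) ltac:(lra).
have [q Hq] := Hg M (e / 2) ltac:(lra); exists (p + q) => t tM.
rewrite hornerD opprD addrACA; apply: le_trans (ler_normD _ _) _.
by have := Hp t tM; have := Hq t tM; lra.
Qed.

Lemma pappM (f g : R -> R) : papp f -> papp g -> papp (fun t => f t * g t).
Proof.
move=> Hf Hg M e e0.
have [K HK] := papp_bounded M Hf; have [L HL] := papp_bounded M Hg.
have K1 : 0 < `|K| + 1 by have := normr_ge0 K; lra.
have L1 : 0 < `|L| + 1 by have := normr_ge0 L; lra.
have d0 : 0 < e / (2 * (`|L| + 1)) by rewrite divr_gt0//; lra.
have e1 : 0 < Num.min 1 (e / (2 * (`|L| + 1))) by rewrite lt_min ltr01.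
have [p Hp] := Hf M _ e1.
have e2 : 0 < e / (2 * (`|K| + 1)) by rewrite divr_gt0//; lra.
have [q Hq] := Hg M _ e2.
exists (p * q) => t tM; rewrite hornerM.
have := Hp t tM; rewrite le_min ler_pdivlMr; last lra.
move=> /andP[p1 p2]; have := Hq t tM; rewrite ler_pdivlMr; last lra.
move=> q2.
have -> : f t * g t - p.[t] * q.[t] = (f t - p.[t]) * g t + p.[t] * (g t - q.[t]) by ring.
apply: le_trans (ler_normD _ _) _; rewrite !normrM.
have pt : `|p.[t]| <= `|K| + 1.
  have := ler_distD (f t) p.[t] 0; rewrite !subr0 (distrC _ (f t)).
  by have := HK t tM; have := ler_norm K; lra.
have gt : `|g t| <= `|L| + 1 by have := HL t tM; have := ler_norm L; lra.
have := normr_ge0 (f t - p.[t]); have := normr_ge0 (g t - q.[t]).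
have := normr_ge0 (g t); have := normr_ge0 p.[t]; nra.
Qed.

Lemma papp_pol_comp p (f : R -> R) : papp f -> papp (fun t => p.[f t]).
Proof.
move=> Hf; elim/poly_ind: p => [|p c IH].
  by apply: papp_ext (papp_cst 0) => t; rewrite horner0.
by apply: papp_ext (pappD (pappM IH Hf) (papp_cst c)) => t; rewrite !hornerE.
Qed.

Lemma papp_comp (g f : R -> R) : papp g -> papp f -> papp (fun t => g (f t)).
Proof.
move=> Hg Hf; apply: papp_lim => M e e0; have [K HK] := papp_bounded M Hf.
have [p Hp] := Hg K e e0; exists (fun t => p.[f t]); first exact: papp_pol_comp.
by move=> t tM; apply: Hp; apply: HK.
Qed.

Lemma pappZ c (f : R -> R) : papp f -> papp (fun t => c * f t).
Proof. by move=> Hf; apply: pappM => //; apply: papp_cst. Qed.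

Lemma pappN (f : R -> R) : papp f -> papp (fun t => - f t).
Proof. by move=> Hf; apply: papp_ext (pappZ (-1) Hf) => t; rewrite mulN1r. Qed.

Lemma pappB (f g : R -> R) : papp f -> papp g -> papp (fun t => f t - g t).
Proof. by move=> Hf Hg; apply: pappD => //; apply: pappN. Qed.

Fixpoint sqrt_poly n : {poly R} :=
  if n is n'.+1 then 2^-1 *: ('X + sqrt_poly n' ^+ 2) else 0.

(* On [0, 1], [1 - sqrt_poly n] decreases to [sqrt (1 - t)]. *)
Lemma sqrt_poly_approx n (t : R) : 0 <= t <= 1 -> 0 <= (sqrt_poly n).[t] /\
  0 <= 1 - (sqrt_poly n).[t] - Num.sqrt (1 - t) <= 2 / n.+1%:R.
Proof.
move=> /andP[t0 t1]; set s := Num.sqrt (1 - t).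
have s0 : 0 <= s by apply: sqrtr_ge0.
have ss : s ^+ 2 = 1 - t by rewrite sqr_sqrtr//; lra.
have s1 : s <= 1 by rewrite -(@ler_sqr _ s 1) ?nnegrE//; nra.
elim: n => [|n [IH0 /andP[IH1 IH2]]] /=; first by rewrite horner0; split; lra.
rewrite !hornerE; set y := (sqrt_poly n).[t] in IH0 IH1 IH2 *.
split; first by have := sqr_ge0 y; nra.
set d := 1 - y - s in IH1 IH2.
have -> : 1 - 2^-1 * (t + y ^+ 2) - s = d - d * s - d ^+ 2 / 2.
  have tE : t = 1 - s ^+ 2 by rewrite ss; ring.
  by rewrite [X in _ * (X + _)]tE /d; field.
have n0 : (0 : R) < n.+1%:R by rewrite ltr0n.
have n2 : (0 : R) < n.+2%:R by rewrite ltr0n.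
have nE : (n.+2%:R : R) = n.+1%:R + 1 by rewrite -natr1.
move: IH2; rewrite ler_pdivlMr// => IH2.
have d1 : d <= 1 - s by rewrite /d; lra.
apply/andP; split; first nra.
rewrite ler_pdivlMr// nE.
(* Expanded, this reads [(d - d^2 / 2) n.+2 <= 2 - d^2 / 2], and the new error is at most
   [d - d^2 / 2]. *)
have h : 0 <= (2 - d * n.+1%:R) * (1 - d / 2) by apply: mulr_ge0; lra.
have := mulr_ge0 IH1 s0; nra.
Qed.

Lemma inv_small (C e : R) : 0 < e -> exists n, C / n.+1%:R <= e.
Proof.
move=> e0; exists (Num.truncn (`|C| / e)).
have n0 : (0 : R) < (Num.truncn (`|C| / e)).+1%:R by rewrite ltr0n.
rewrite ler_pdivrMr//; have := truncnS_gt (`|C| / e).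
rewrite ltr_pdivrMr//; have := ler_norm C; nra.
Qed.

Lemma papp_abs (f : R -> R) : papp f -> papp (fun t => `|f t|).
Proof.
move=> Hf; apply: (@papp_comp (fun t => `|t|)) => // M e e0.
pose L := `|M| + 1; have L0 : 0 < L by rewrite /L; have := normr_ge0 M; lra.
have [n Hn] := inv_small (L * 2) e0.
exists (L *: (1 - (sqrt_poly n \Po (1 - (L ^- 2) *: 'X^2)))) => t tM.
rewrite hornerZ hornerD hornerN hornerC horner_comp hornerD hornerN hornerZ hornerXn hornerC.
have tL : `|t| <= L by rewrite /L; have := ler_norm M; lra.
have uE : 1 - (1 - L ^- 2 * t ^+ 2) = (`|t| / L) ^+ 2.
  by rewrite expr_div_n real_normK ?num_real//; ring.
have u0 : 0 <= `|t| / L <= 1.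
  by apply/andP; split; [rewrite divr_ge0// (ltW L0)|rewrite ler_pdivrMr ?mul1r].
have [_] := @sqrt_poly_approx n (1 - L ^- 2 * t ^+ 2)
  ltac:(by have : 1 - (1 - L ^- 2 * t ^+ 2) = (`|t| / L) ^+ 2 := uE; nra).
rewrite uE sqrtr_sqr ger0_norm; last by case/andP: u0.
set P := _.[_]; move=> /andP[h1 h2].
have tE : `|t| = L * (`|t| / L) by rewrite mulrC divfK// lt0r_neq0.
have -> : `|t| - L * (1 - P) = - (L * (1 - P - `|t| / L)).
  by rewrite {1}tE; ring.
rewrite normrN normrM gtr0_norm// ger0_norm//.
by apply: le_trans Hn; rewrite -mulrA ler_pM2l.
Qed.

Lemma papp_max (f g : R -> R) : papp f -> papp g -> papp (fun t => Num.max (f t) (g t)).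
Proof.
move=> Hf Hg.
apply: papp_ext (pappZ 2^-1 (pappD (pappD Hf Hg) (papp_abs (pappB Hf Hg)))) => t.
by rewrite maxr_absE mulrC.
Qed.

Lemma papp_min (f g : R -> R) : papp f -> papp g -> papp (fun t => Num.min (f t) (g t)).
Proof.
move=> Hf Hg; apply: papp_ext (pappN (papp_max (pappN Hf) (pappN Hg))) => t.
by rewrite oppr_max !opprK.
Qed.

Lemma papp_sqrt (f : R -> R) : papp f -> papp (fun t => Num.sqrt (f t)).
Proof.
move=> Hf; apply: (@papp_comp Num.sqrt) => //; apply: papp_lim => M e e0.
pose L := `|M| + 1; have L0 : 0 < L by rewrite /L; have := normr_ge0 M; lra.
have [n Hn] := inv_small (Num.sqrt L * 2) e0.
pose g t : R := Num.sqrt L * (1 - (sqrt_poly n).[1 - L^-1 * Num.max 0 t]).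
exists g.
  apply: pappZ; apply: pappB; first exact: papp_cst.
  apply: papp_pol_comp; apply: pappB; first exact: papp_cst.
  by apply: pappZ; apply: papp_max; [exact: papp_cst|exact: papp_id].
move=> t tM; rewrite /g; set u := Num.max 0 t.
have tL : `|t| <= L by rewrite /L; have := ler_norm M; lra.
have u0 : 0 <= u by rewrite /u le_max lexx.
have uL : u <= L by rewrite /u ge_max ltW//=; apply: le_trans tL; apply: ler_norm.
have -> : Num.sqrt t = Num.sqrt u.
  rewrite /u; case: (leP 0 t) => t0 //.
  by rewrite sqrtr0 ler0_sqrtr// ltW.
have v0 : 0 <= L^-1 * u <= 1.
  apply/andP; split; first by rewrite mulr_ge0// invr_ge0 (ltW L0).
  by rewrite mulrC ler_pdivrMr ?mul1r.
have [_] := @sqrt_poly_approx n (1 - L^-1 * u) ltac:(lra).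
rewrite subKr; set P := _.[_] => /andP[h1 h2].
have -> : Num.sqrt u = Num.sqrt L * Num.sqrt (L^-1 * u).
  by rewrite -sqrtrM ?ltW// mulrA mulfV ?mul1r// lt0r_neq0.
have -> : Num.sqrt L * Num.sqrt (L^-1 * u) - Num.sqrt L * (1 - P) =
   - (Num.sqrt L * (1 - P - Num.sqrt (L^-1 * u))) by ring.
rewrite normrN normrM ger0_norm ?sqrtr_ge0// ger0_norm//.
by apply: le_trans Hn; rewrite -mulrA ler_wpM2l ?sqrtr_ge0.
Qed.

(** Geometric series: with [r = 1 - f / L], which lies in [[0, 1 - d / L]], the partial sum of
    [L^-1 r^k] over [k < n] differs from [1 / f] by [r^n / f]. *)
Lemma papp_inv (d : R) (f : R -> R) : 0 < d -> papp f -> (forall t, d <= f t) ->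
  papp (fun t => (f t)^-1).
Proof.
move=> d0 Hf df; apply: papp_lim => M e e0; have [K HK] := papp_bounded M Hf.
pose L := `|K| + d + 1; have L0 : d < L by rewrite /L; have := normr_ge0 K; lra.
have L0' : 0 < L by lra.
have r01 : 0 <= 1 - d / L < 1.
  rewrite subr_ge0 ler_pdivrMr ?mul1r// ltW//= ltrBlDr ltrDl divr_gt0//.
have [n Hn] := exp_small r01 (mulr_gt0 e0 d0).
exists (fun t => L^-1 * (\sum_(k < n) 'X^k : {poly R}).[1 - L^-1 * f t]).
  apply: pappZ; apply: papp_pol_comp; apply: pappB; first exact: papp_cst.
  exact: pappZ.
move=> t tM; have ft := df t.
have fL : f t <= L by rewrite /L; have := HK t tM; have := ler_norm (f t); have := ler_norm K; lra.
have f0 : 0 < f t by lra.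
set r := 1 - L^-1 * f t.
have rE : f t = L * (1 - r) by rewrite /r; field; exact: lt0r_neq0.
have r0 : 0 <= r by rewrite /r subr_ge0 mulrC ler_pdivrMr ?mul1r.
have r1 : r <= 1 - d / L by rewrite /r lerD2l lerN2 mulrC ler_wpM2l// invr_ge0 ltW.
have sE : (1 - r) * (\sum_(k < n) 'X^k : {poly R}).[r] = 1 - r ^+ n.
  rewrite horner_sum; under eq_bigr do rewrite hornerXn.
  by rewrite -[RHS]opprB subrX1; ring.
set S := _.[r] in sE *.
have -> : (f t)^-1 - L^-1 * S = (f t)^-1 * r ^+ n.
  have nr : 1 - r != 0 by apply/eqP => E; move: f0; rewrite rE E mulr0 ltxx.
  rewrite rE; have -> : r ^+ n = 1 - (1 - r) * S by rewrite sE; ring.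
  by field; rewrite nr lt0r_neq0.
have rn : r ^+ n <= (1 - d / L) ^+ n by apply: lerXn2r => //; rewrite nnegrE//; case/andP: r01.
rewrite ger0_norm; last by rewrite mulr_ge0 ?exprn_ge0// invr_ge0 (ltW f0).
rewrite mulrC ler_pdivrMr//; have := Hn n (leqnn _); nra.
Qed.

(** Controlling the distance to every polynomial at once determines [y] without the choice of an
    approximating sequence. The interval [[- N[x], N[x]]] stands for the spectrum of [x]. *)
Definition is_fc (f : R -> R) x y := forall p (K : R),
  (forall t, `|t| <= N[x] -> `|f t - p.[t]| <= K) -> N[y - pev p x] <= K.

Definition fc f x : U := xget 0 [set y | is_fc f x y].

Lemma is_fc_ex f x : papp f -> sa x -> exists y, is_fc f x y.
Proof.
move=> Hf sx.
have /choice [P HP] : forall n : nat, exists p, forall t, `|t| <= N[x] -> `|f t - p.[t]| <= n.+1%:R^-1.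
  by move=> n; apply: Hf; rewrite invr_gt0 ltr0n.
have PP n q (K : R) : (forall t, `|t| <= N[x] -> `|f t - q.[t]| <= K) ->
    N[pev (P n) x - pev q x] <= n.+1%:R^-1 + K.
  move=> Hq; rewrite -pevB; apply: pev_norm => // t tx; rewrite hornerD hornerN.
  have := ler_distD (f t) (P n).[t] q.[t]; rewrite [`|(P n).[t] - f t|]distrC.
  by move: (HP n t tx) (Hq t tx); set c := _^-1; lra.
have [|y Hy] := @ucomplete R U (fun n => pev (P n) x).
  move=> e e0; have [N HN] := @inv_small 1 (e / 4) ltac:(lra); exists N => m n Nm Nn.
  have L k : (N <= k)%N -> (k.+1%:R : R)^-1 <= e / 4.
    move=> Nk; apply: le_trans HN; rewrite mul1r lef_pV2 ?posrE ?ltr0n//.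
    by rewrite ler_nat.
  move: (L m Nm) (L n Nn) (PP m (P n) _ (HP n)).
  by set a := m.+1%:R^-1; set b := n.+1%:R^-1; lra.
exists y => q K Hq; apply: le_eps => e e0.
have [N HN] := Hy (e / 2) ltac:(lra); have [N' HN'] := @inv_small 1 (e / 2) ltac:(lra).
pose k := maxn N N'.
have := HN k (leq_maxl _ _); have := PP k q K Hq.
have : (k.+1%:R : R)^-1 <= e / 2.
  apply: le_trans HN'; rewrite mul1r lef_pV2 ?posrE ?ltr0n// ler_nat ltnS leq_maxr//.
by set a := _^-1; have := udistD (pev (P k) x) y (pev q x); rewrite [N[y - pev (P k) x]]udistC; lra.
Qed.

Lemma fcP f x : papp f -> sa x -> is_fc f x (fc f x).
Proof. by move=> Hf sx; have [y Hy] := is_fc_ex Hf sx; rewrite /fc; case: xgetP => [z _ //|/(_ y)]. Qed.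

Lemma fc_approx f x : papp f -> sa x -> forall e : R, 0 < e ->
  exists p, (forall t, `|t| <= N[x] -> `|f t - p.[t]| <= e) /\ N[fc f x - pev p x] <= e.
Proof.
move=> Hf sx e e0; have [p Hp] := Hf N[x] e e0; exists p; split => //.
exact: fcP.
Qed.

Lemma fc_eq f x y : papp f -> sa x -> (forall e : R, 0 < e ->
  exists p, (forall t, `|t| <= N[x] -> `|f t - p.[t]| <= e) /\ N[y - pev p x] <= e) ->
  fc f x = y.
Proof.
move=> Hf sx H; apply/eqP; rewrite -subr_eq0 -unorm_le0; apply: le_eps => e e0.
have [p [p1 p2]] := H (e / 2) ltac:(lra); have := fcP Hf sx p1.
by have := udistD (pev p x) (fc f x) y; rewrite [N[pev p x - y]]udistC; lra.
Qed.

Lemma fc_inC f x : papp f -> sa x -> inC x (fc f x).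
Proof.
move=> Hf sx e e0; have [p [_ Hp]] := fc_approx Hf sx (half_gt0 e0).
by exists p; lra.
Qed.

Lemma fc_sa f x : papp f -> sa x -> sa (fc f x).
Proof. by move=> Hf sx; apply: inC_sa sx (fc_inC Hf sx). Qed.

Lemma fc_comm f x z : papp f -> sa x -> z * x = x * z -> z * fc f x = fc f x * z.
Proof. by move=> Hf sx; apply: inC_comm; apply: fc_inC. Qed.

Lemma fc_commV f g x : papp f -> papp g -> sa x -> fc f x * fc g x = fc g x * fc f x.
Proof. by move=> Hf Hg sx; apply: (@inCC _ _ x); apply: fc_inC. Qed.

Lemma fc_norm f x (K : R) : papp f -> sa x ->
  (forall t, `|t| <= N[x] -> `|f t| <= K) -> N[fc f x] <= K.
Proof.
move=> Hf sx H; have := @fcP f x Hf sx 0 K; rewrite pev0 subr0; apply => t tx.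
by rewrite horner0 subr0; apply: H.
Qed.

Lemma fc_pev p x : sa x -> fc (horner p) x = pev p x.
Proof.
move=> sx; apply: fc_eq => // [|e e0]; first exact: papp_poly.
by exists p; rewrite subrr unorm0 ltW//; split => // t _; rewrite subrr normr0 ltW.
Qed.

Lemma fc_ext f g x : papp f -> papp g -> sa x ->
  (forall t, `|t| <= N[x] -> f t = g t) -> fc f x = fc g x.
Proof.
move=> Hf Hg sx fg; apply: fc_eq => // e e0.
have [p [h1 h2]] := fc_approx Hg sx e0; exists p; split => // t tx.
by rewrite fg//; apply: h1.
Qed.

Lemma fc_id x : sa x -> fc id x = x.
Proof.
move=> sx; rewrite -[RHS]pevX -fc_pev//; apply: fc_ext => //; [exact: papp_id|exact: papp_poly|].
by move=> t _; rewrite hornerX.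
Qed.

Lemma fc_cst c x : sa x -> fc (fun=> c) x = c%:A.
Proof.
move=> sx; rewrite -(pevC c x) -fc_pev//; apply: fc_ext => //; [exact: papp_cst|exact: papp_poly|].
by move=> t _; rewrite hornerC.
Qed.

Lemma fcD f g x : papp f -> papp g -> sa x ->
  fc (fun t => f t + g t) x = fc f x + fc g x.
Proof.
move=> Hf Hg sx; apply: fc_eq => // [|e e0]; first exact: pappD.
have [p [p1 p2]] := fc_approx Hf sx (half_gt0 e0).
have [q [q1 q2]] := fc_approx Hg sx (half_gt0 e0).
exists (p + q); split=> [t tx|].
  rewrite hornerD opprD addrACA; apply: le_trans (ler_normD _ _) _.
  by have := p1 t tx; have := q1 t tx; lra.
rewrite pevD opprD addrACA; apply: le_trans (unormD _ _) _; lra.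
Qed.

Lemma fcM f g x : papp f -> papp g -> sa x ->
  fc (fun t => f t * g t) x = fc f x * fc g x.
Proof.
move=> Hf Hg sx; apply/eqP; rewrite -subr_eq0 -unorm_le0; apply: le_eps => e e0.
have [K HK] := papp_bounded N[x] Hf; have [L HL] := papp_bounded N[x] Hg.
have Kn : 0 <= K by apply: le_trans (normr_ge0 _) (HK 0 _); rewrite normr0 unorm_ge0.
have Ln : 0 <= L by apply: le_trans (normr_ge0 _) (HL 0 _); rewrite normr0 unorm_ge0.
have d0 : 0 < Num.min 1 (e / (2 * (K + L + 2))).
  by rewrite lt_min ltr01 divr_gt0//; lra.
have [p [p1 p2]] := fc_approx Hf sx d0; have [q [q1 q2]] := fc_approx Hg sx d0.
set d := Num.min _ _ in d0 p1 p2 q1 q2.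
have dd : d * (2 * (K + L + 2)) <= e.
  by rewrite -ler_pdivlMr ?ge_min ?lexx ?orbT//; lra.
have d1 : d <= 1 by rewrite ge_min lexx.
have pq t : `|t| <= N[x] -> `|f t * g t - (p * q).[t]| <= d * L + (K + 1) * d.
  move=> tx; rewrite hornerM.
  have -> : f t * g t - p.[t] * q.[t] = (f t - p.[t]) * g t + p.[t] * (g t - q.[t]) by ring.
  apply: le_trans (ler_normD _ _) _; rewrite !normrM; apply: lerD.
    by apply: ler_pM => //; [apply: p1|apply: HL].
  apply: ler_pM => //; last exact: q1.
  have := ler_distD (f t) p.[t] 0; rewrite !subr0 (distrC _ (f t)).
  by have := HK t tx; have := p1 t tx; lra.
have h1 := @fcP _ x (pappM Hf Hg) sx _ _ pq.
have nf : N[fc f x] <= K by apply: fc_norm.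
have ng : N[fc g x] <= L by apply: fc_norm.
have h2 := norm_mulB_le (fc f x) (fc g x) (pev p x) (pev q x).
have np : N[pev p x] <= K + 1.
  by have := udistD (fc f x) (pev p x) 0; rewrite !subr0 (udistC _ (fc f x)); lra.
have := udistD (pev p x * pev q x) (fc (fun t => f t * g t) x) (fc f x * fc g x).
rewrite pevM in h1; rewrite (udistC (pev p x * _)) add0r.
have := unorm_ge0 (fc g x); have := unorm_ge0 (pev p x).
have := ler_pM (unorm_ge0 _) (unorm_ge0 _) p2 ng.
have := ler_pM (unorm_ge0 _) (unorm_ge0 _) np q2.
nra.
Qed.

Lemma fcZ c f x : papp f -> sa x -> fc (fun t => c * f t) x = c *: fc f x.
Proof.
by move=> Hf sx; rewrite fcM ?fc_cst ?mulr_algl//; apply: papp_cst.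
Qed.

Lemma fcN f x : papp f -> sa x -> fc (fun t => - f t) x = - fc f x.
Proof.
move=> Hf sx; rewrite -scaleN1r -fcZ//; apply: fc_ext => //; [exact: pappN|exact: pappZ|].
by move=> t _; rewrite mulN1r.
Qed.

Lemma fcB f g x : papp f -> papp g -> sa x ->
  fc (fun t => f t - g t) x = fc f x - fc g x.
Proof. by move=> Hf Hg sx; rewrite fcD ?fcN//; apply: pappN. Qed.

Lemma fc_pol_comp p f x : papp f -> sa x -> fc (fun t => p.[f t]) x = pev p (fc f x).
Proof.
move=> Hf sx; elim/poly_ind: p => [|p c IH].
  have := fc_cst 0 sx; rewrite scale0r pev0 => <-; apply: fc_ext => //; last by move=> t _; rewrite horner0.
    by apply: papp_pol_comp.
  exact: papp_cst.
have h1 := papp_pol_comp p Hf; rewrite pevD pevM pevX pevC -IH -fcM//; first rewrite -(fc_cst c sx) -fcD//.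
- apply: fc_ext => //; [exact: papp_pol_comp| |by move=> t _; rewrite !hornerE].
  by apply: pappD; [exact: pappM|exact: papp_cst].
- exact: pappM.
- exact: papp_cst.
Qed.

Lemma fc_comp g f x : papp g -> papp f -> sa x -> fc (fun t => g (f t)) x = fc g (fc f x).
Proof.
move=> Hg Hf sx; apply/eqP; rewrite -subr_eq0 -unorm_le0; apply: le_eps => e e0.
have [K HK] := papp_bounded N[x] Hf.
have [p Hp] := Hg (Num.max K N[fc f x]) (e / 2) ltac:(lra).
have h1 : N[fc (fun t => g (f t)) x - pev p (fc f x)] <= e / 2.
  rewrite -fc_pol_comp// -fcB//; [|exact: papp_comp|exact: papp_pol_comp].
  apply: fc_norm => // [|t tx].
    by apply: pappB; [exact: papp_comp|exact: papp_pol_comp].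
  by apply: Hp; rewrite le_max HK.
have h2 : N[fc g (fc f x) - pev p (fc f x)] <= e / 2.
  by apply: fcP => // [|t tx]; [exact: fc_sa|apply: Hp; rewrite le_max tx orbT].
have := udistD (pev p (fc f x)) (fc (fun t => g (f t)) x) (fc g (fc f x)).
by rewrite (udistC (pev p _)); lra.
Qed.

End Calculus.

#[export] Hint Resolve papp_id papp_cst papp_poly : papp.

Ltac tpapp := first [ assumption | solve [auto with papp nocore] | lazymatch goal with
  | |- papp (fun t => @GRing.add _ (@?f t) (@?g t)) => refine (@pappD _ f g _ _); tpapp
  | |- papp (fun t => @GRing.opp _ (@?f t)) => refine (@pappN _ f _); tpapp
  | |- papp (fun t => @GRing.mul _ (@?f t) (@?g t)) => refine (@pappM _ f g _ _); tpapp
  | |- papp (fun t => Num.max (@?f t) (@?g t)) => refine (@papp_max _ f g _ _); tpapp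
  | |- papp (fun t => Num.min (@?f t) (@?g t)) => refine (@papp_min _ f g _ _); tpapp
  | |- papp (fun t => Num.sqrt (@?f t)) => refine (@papp_sqrt _ f _); tpapp
  | |- papp (fun t => `|@?f t|) => refine (@papp_abs _ f _); tpapp
  | |- papp (fun t => ?h (@?f t)) => refine (@papp_comp _ h f _ _); tpapp
  end ].

(** * Positive elements *)

Section Positivity.
Variables (R : realType) (U : ucstarType R).
Implicit Types (x y z a b h : U) (p q : {poly R}) (f g : R -> R).

(** Polynomials satisfy the relation and limits preserve it. With [x = w w^*], [y = w^* w] and
    [z = w] it moves functional calculus across [w], in the role of a polar decomposition. *)
Lemma fc_intertwine f x y z : papp f -> sa x -> sa y -> x * z = z * y ->
  fc f x * z = z * fc f y.
Proof.
move=> Hf sx sy xz.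
have P p : pev p x * z = z * pev p y.
  elim/poly_ind: p => [|p c IH]; first by rewrite !pev0 mul0r mulr0.
  by rewrite !pevD !pevM !pevX !pevC mulrDl mulrDr mulr_algl mulr_algr -mulrA xz mulrA IH mulrA.
apply/eqP; rewrite -subr_eq0 -unorm_le0; apply: le_eps => e e0; rewrite add0r.
have nz : 0 < N[z] + 1 by have := unorm_ge0 z; lra.
have d0 : 0 < e / (2 * (N[z] + 1)) by rewrite divr_gt0//; lra.
have [p Hp] := Hf (Num.max N[x] N[y]) _ d0.
have px : N[fc f x - pev p x] <= e / (2 * (N[z] + 1)).
  by apply: fcP => // t tx; apply: Hp; rewrite le_max tx.
have py : N[fc f y - pev p y] <= e / (2 * (N[z] + 1)).
  by apply: fcP => // t tx; apply: Hp; rewrite le_max tx orbT.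
have -> : fc f x * z - z * fc f y = (fc f x - pev p x) * z - z * (fc f y - pev p y).
  transitivity ((fc f x - pev p x) * z - z * (fc f y - pev p y) + (pev p x * z - z * pev p y)).
    by ncring.
  by rewrite P subrr addr0.
apply: le_trans (unormB _ _) _; apply: le_trans (lerD (unormM _ _) (unormM _ _)) _.
move: px py; rewrite !ler_pdivlMr; try lra.
have := unorm_ge0 z; have := unorm_ge0 (fc f x - pev p x).
have := unorm_ge0 (fc f y - pev p y); nra.
Qed.

Definition pneg (t : R) := Num.max (- t) 0.
Definition ppos (t : R) := Num.max t 0.

Lemma papp_pneg : papp pneg. Proof. by rewrite /pneg; tpapp. Qed.
Lemma papp_ppos : papp ppos. Proof. by rewrite /ppos; tpapp. Qed.
#[local] Hint Resolve papp_pneg papp_ppos : papp.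

Definition spos x := sa x /\ fc pneg x = 0.

(** Unlike the vanishing of the negative part, this norm criterion is visibly stable under addition,
    which gives [sposD]. *)
Lemma spos_norm x (M : R) : sa x -> N[x] <= M -> spos x <-> N[M%:A - x] <= M.
Proof.
move=> sx xM; split=> [[_ x0]|H].
  have -> : M%:A - x = fc (fun t => M - ppos t) x.
    rewrite fcB ?fc_cst//; try tpapp; congr (_ - _).
    rewrite -[LHS]addr0 -x0 -[X in X + _](fc_id sx) -fcD//; try tpapp.
    apply: fc_ext => //; try tpapp; move=> t _; rewrite /ppos /pneg.
    by case: (leP (- t) 0) => ?; case: (leP t 0) => ?; lra.
  apply: fc_norm => //; first by tpapp.
  move=> t tx; have := ler_norm t; have := normr_ge0 t; rewrite /ppos ler_norml.
  by case: (leP t 0) => ?; lra.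
split=> //; have sy : sa (M%:A - x) by apply: saB => //; apply: saA.
have xE : x = fc (fun t => M - t) (M%:A - x).
  by rewrite fcB ?fc_cst ?fc_id//; try tpapp; rewrite opprB addrC subrK.
rewrite xE -fc_comp//; try tpapp.
have <- : fc (fun=> 0) (M%:A - x) = 0 by rewrite fc_cst// scale0r.
apply: fc_ext => //; try tpapp; move=> t tx; rewrite /pneg.
have := ler_norm t; case: (leP (- (M - t)) 0) => ?; lra.
Qed.

Lemma sposD x y : spos x -> spos y -> spos (x + y).
Proof.
move=> px py; have [sx _] := px; have [sy _] := py.
apply/(@spos_norm _ (N[x] + N[y])); [exact: saD|exact: unormD|].
have hx := (spos_norm sx (lexx _)).1 px; have hy := (spos_norm sy (lexx _)).1 py.
have -> : (N[x] + N[y])%:A - (x + y) = (N[x]%:A - x) + (N[y]%:A - y).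
  by rewrite scalerDl opprD addrACA.
by apply: le_trans (unormD _ _) _; apply: lerD.
Qed.

Lemma spos_sqr h : sa h -> spos (h * h).
Proof.
move=> sh; split; first by apply: saM.
have -> : h * h = fc (fun t => t * t) h by rewrite fcM ?fc_id//; tpapp.
rewrite -fc_comp//; try tpapp.
have <- : fc (fun=> 0) h = 0 by rewrite fc_cst// scale0r.
apply: fc_ext => //; try tpapp; move=> t _; rewrite /pneg.
by case: (leP (- (t * t)) 0) => //; nra.
Qed.

Lemma spos_sqrt x : spos x -> exists h, [/\ inC x h, sa h & x = h * h].
Proof.
move=> [sx x0]; exists (fc (fun t => Num.sqrt (ppos t)) x).
split; [by apply: fc_inC => //; tpapp|by apply: fc_sa => //; tpapp|].
rewrite -fcM//; try tpapp.
rewrite -[LHS]addr0 -x0 -[X in X + _](fc_id sx) -fcD//; try tpapp.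
apply: fc_ext => //; try tpapp; move=> t _.
rewrite -expr2 sqr_sqrtr ?le_max ?lexx ?orbT// /ppos /pneg.
by case: (leP (- t) 0) => ?; case: (leP t 0) => ?; lra.
Qed.

Lemma sa_sqr_eq0 a : sa a -> a * a = 0 -> a = 0.
Proof.
move=> sa aa; apply/unorm0_eq0/eqP; rewrite -sqrf_eq0 -sa_norm_sqr//.
by rewrite aa unorm0.
Qed.

(** Kaplansky's argument. Let [a] be the negative part of [z^* z] and [w = z a], so that
    [w^* w = - a^3]. The sum [w w^* + w^* w] is a combination of squares of self-adjoint elements,
    hence [w w^*] is positive. Moving [ppos] across [w] gives [w w^* w = 0], so [w^* w = 0] and
    [a = 0]. *)
Lemma spos_ustarM z : spos (z^*u * z).
Proof.
set x := z^*u * z; have sx : sa x by apply: sa_ustarM.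
split=> //; set a := fc pneg x.
have sa_a : sa a by apply: fc_sa => //; tpapp.
have xa : x * a = - (a * a).
  rewrite /a -{1}(fc_id sx) -!fcM -?fcN//; try tpapp.
  apply: fc_ext => //; try tpapp; move=> t _; rewrite /pneg.
  by case: (leP (- t) 0) => ?; lra.
pose w := z * a.
pose b := fc (fun t => pneg t * Num.sqrt (pneg t)) x.
have sb : sa b by apply: fc_sa => //; tpapp.
have bb : b * b = a * a * a.
  rewrite /a /b -!fcM//; try tpapp; apply: fc_ext => //; try tpapp; move=> t _.
  rewrite mulrACA -expr2 -expr2 sqr_sqrtr; last by rewrite le_max lexx orbT.
  by ring.
have ww : w^*u * w = - (b * b).
  transitivity (a * (x * a)); first by rewrite /w ustarM [a^*u]sa_a /x; ncring.
  by rewrite xa bb; ncring.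
have pww : spos (w * w^*u).
  have -> : w * w^*u = 2^-1 *: ((w + w^*u) * (w + w^*u) +
      (ui * (w - w^*u)) * (ui * (w - w^*u))) + b * b.
    have E : (ui * (w - w^*u)) * (ui * (w - w^*u)) = - ((w - w^*u) * (w - w^*u)).
      by rewrite -(mulrA ui) (mulrA _ ui) -uiC !mulrA uiM; ncring.
    rewrite E; have -> : b * b = - (w^*u * w) by rewrite ww opprK.
    apply/eqP; rewrite -subr_eq; apply/eqP; rewrite opprK.
    have -> : (w + w^*u) * (w + w^*u) - (w - w^*u) * (w - w^*u) =
       (w * w^*u + w^*u * w) + (w * w^*u + w^*u * w) by ncring.
    by rewrite scalerDr -scalerDl (_ : 2^-1 + 2^-1 = 1) ?scale1r//; lra.
  apply: sposD; last exact: spos_sqr.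
  have Z (u : U) : 2^-1 *: (u * u) = (Num.sqrt 2^-1 *: u) * (Num.sqrt 2^-1 *: u).
    by rewrite -scalerAl -scalerAr scalerA sqrtM_id// invr_ge0.
  rewrite scalerDr !Z; apply: sposD; apply: spos_sqr; apply: saZ.
    by rewrite /sa ustarD ustarK addrC.
  by rewrite /sa ustarM ustarB ustarK ustar_ui uiC; ncring.
have E := @fc_intertwine ppos (w * w^*u) (w^*u * w) w papp_ppos
   pww.1 (sa_ustarM _) (esym (mulrA _ _ _)).
have p0 : fc ppos (w^*u * w) = 0.
  have [sbb bb0] := spos_sqr sb.
  rewrite ww -bb0; have -> : - (b * b) = fc (fun t => - t) (b * b) by rewrite fcN ?fc_id//; tpapp.
  by rewrite -fc_comp//; tpapp.
have pE : fc ppos (w * w^*u) = w * w^*u.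
  have [s1 s2] := pww; rewrite -[RHS]subr0 -[X in _ - X]oppr0 -s2 opprK.
  rewrite -[X in _ = X + _](fc_id s1) -fcD//; try tpapp.
  apply: fc_ext => //; try tpapp; move=> t _; rewrite /ppos /pneg.
  by case: (leP (- t) 0) => ?; case: (leP t 0) => ?; lra.
rewrite p0 mulr0 pE in E.
have c0 : w^*u * w = 0.
  by apply: sa_sqr_eq0; [exact: sa_ustarM|rewrite -mulrA (mulrA w) E mulr0].
have a3 : a * a * a = 0 by rewrite -bb -[LHS]opprK -ww c0 oppr0.
apply: sa_sqr_eq0 => //; apply: sa_sqr_eq0; first exact: saM.
by rewrite mulrA a3 mul0r.
Qed.

Definition upos x := exists y, x = y^*u * y.

Lemma uposP x : upos x <-> spos x.
Proof.
split=> [[y ->]|/spos_sqrt [h [_ sh ->]]]; first exact: spos_ustarM.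
by exists h; rewrite sh.
Qed.

Lemma upos_sa x : upos x -> sa x.
Proof. by case/uposP. Qed.

Lemma uposD x y : upos x -> upos y -> upos (x + y).
Proof. by move=> /uposP px /uposP py; apply/uposP/sposD. Qed.

Lemma upos_sqr h : sa h -> upos (h * h).
Proof. by move=> sh; exists h; rewrite sh. Qed.

Lemma upos_conj x z : upos x -> upos (z^*u * x * z).
Proof. by move=> [y ->]; exists (y * z); rewrite ustarM !mulrA. Qed.

Lemma uposZ (k : R) x : 0 <= k -> upos x -> upos (k *: x).
Proof.
move=> k0 [y ->]; exists (Num.sqrt k *: y).
by rewrite ustarZ -scalerAl -scalerAr scalerA -expr2 sqr_sqrtr.
Qed.

Lemma upos0 : upos (0 : U). Proof. by exists 0; rewrite mulr0. Qed.
Lemma upos1 : upos (1 : U). Proof. by exists 1; rewrite ustar1 mulr1. Qed.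
Lemma uposA (k : R) : 0 <= k -> upos (k%:A : U).
Proof. by move=> k0; apply: uposZ => //; apply: upos1. Qed.

Lemma upos_sum I (r : seq I) (P : pred I) (F : I -> U) :
  (forall i, P i -> upos (F i)) -> upos (\sum_(i <- r | P i) F i).
Proof.
move=> H; elim/big_ind: _ => //; first exact: upos0.
exact: uposD.
Qed.

Lemma fc_upos f x : papp f -> sa x -> (forall t, `|t| <= N[x] -> 0 <= f t) -> upos (fc f x).
Proof.
move=> Hf sx f0; exists (fc (fun t => Num.sqrt (f t)) x).
rewrite (_ : _^*u = fc (fun t => Num.sqrt (f t)) x); last by apply: fc_sa => //; tpapp.
rewrite -fcM//; try tpapp; apply: fc_ext => //; try tpapp; move=> t tx.
by rewrite -expr2 sqr_sqrtr// f0.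
Qed.

Lemma upos_ppos x : upos x -> fc ppos x = x.
Proof.
move=> /uposP [sx x0]; rewrite -[RHS]addr0 -x0 -[X in _ = X + _](fc_id sx) -fcD//; try tpapp.
apply: fc_ext => //; try tpapp; move=> t _; rewrite /ppos /pneg.
by case: (leP (- t) 0) => ?; case: (leP t 0) => ?; lra.
Qed.

Lemma fc_eq_pos f g x : papp f -> papp g -> upos x ->
  (forall t, 0 <= t <= N[x] -> f t = g t) -> fc f x = fc g x.
Proof.
move=> Hf Hg px H; have sx := upos_sa px.
rewrite -(upos_ppos px) -!fc_comp//; try tpapp; apply: fc_ext => //.
- by apply: papp_comp => //; tpapp.
- by apply: papp_comp => //; tpapp.
move=> t tx; apply: H; rewrite /ppos le_max lexx orbT ge_max unorm_ge0 andbT.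
exact: le_trans (ler_norm _) tx.
Qed.

Lemma fc_norm_pos f x (K : R) : papp f -> upos x ->
  (forall t, 0 <= t <= N[x] -> `|f t| <= K) -> N[fc f x] <= K.
Proof.
move=> Hf px H; have sx := upos_sa px.
rewrite -(upos_ppos px) -fc_comp//; try tpapp; apply: fc_norm => //.
  by apply: papp_comp => //; tpapp.
move=> t tx; apply: H; rewrite /ppos le_max lexx orbT ge_max unorm_ge0 andbT.
exact: le_trans (ler_norm _) tx.
Qed.

Lemma fc_upos_pos f x : papp f -> upos x ->
  (forall t, 0 <= t <= N[x] -> 0 <= f t) -> upos (fc f x).
Proof.
move=> Hf px H; have sx := upos_sa px.
rewrite -(upos_ppos px) -fc_comp//; try tpapp; apply: fc_upos => //.
  by apply: papp_comp => //; tpapp.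
move=> t tx; apply: H; rewrite /ppos le_max lexx orbT ge_max unorm_ge0 andbT.
exact: le_trans (ler_norm _) tx.
Qed.

Definition ule x y := upos (y - x).

Lemma ule_refl x : ule x x. Proof. by rewrite /ule subrr; apply: upos0. Qed.

Lemma ule_trans y x z : ule x y -> ule y z -> ule x z.
Proof. by rewrite /ule => h k; rewrite -(subrK y z) -addrA; apply: uposD. Qed.

Lemma uleD x y x' y' : ule x y -> ule x' y' -> ule (x + x') (y + y').
Proof. by rewrite /ule opprD addrACA; apply: uposD. Qed.

Lemma ule_conj x y z : ule x y -> ule (z^*u * x * z) (z^*u * y * z).
Proof. by rewrite /ule -mulrBl -mulrBr; apply: upos_conj. Qed.

Lemma uleZ (k : R) x y : 0 <= k -> ule x y -> ule (k *: x) (k *: y).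
Proof. by move=> k0; rewrite /ule -scalerBr; apply: uposZ. Qed.

Lemma ule_pos x : upos x <-> ule 0 x.
Proof. by rewrite /ule subr0. Qed.

Lemma ule_addr x y : upos y -> ule x (x + y).
Proof. by rewrite /ule [x + y]addrC addrK. Qed.

Lemma fc_ule f g x : papp f -> papp g -> sa x ->
  (forall t, `|t| <= N[x] -> f t <= g t) -> ule (fc f x) (fc g x).
Proof.
move=> Hf Hg sx fg; rewrite /ule -fcB//; apply: fc_upos => //; first exact: pappB.
by move=> t /fg; lra.
Qed.

Lemma fc_ule_pos f g x : papp f -> papp g -> upos x ->
  (forall t, 0 <= t <= N[x] -> f t <= g t) -> ule (fc f x) (fc g x).
Proof.
move=> Hf Hg px fg; rewrite /ule -fcB//; last exact: upos_sa.
by apply: fc_upos_pos => //; [exact: pappB|move=> t /fg; lra].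
Qed.

Lemma ule_norm x : sa x -> ule x N[x]%:A.
Proof.
move=> sx; rewrite -(fc_cst _ sx) -{1}(fc_id sx); apply: fc_ule => //; try tpapp.
by move=> t tx; apply: le_trans tx; apply: ler_norm.
Qed.

Lemma ule_normA x (M : R) : sa x -> N[x] <= M -> ule x M%:A.
Proof.
move=> sx xM; apply: ule_trans (ule_norm sx) _.
by rewrite /ule -scalerBl; apply: uposA; lra.
Qed.

(** If [x = h^2] and [L - x = k^2] with commuting [h], [k], then [h^2 + k^2 = L] and
    [sq_sum1_norm_le1] bounds [h]; [L] is taken slightly larger than [M]. *)
Lemma upos_norm_le x (M : R) : 0 <= M -> upos x -> ule x M%:A -> N[x] <= M.
Proof.
move=> M0 px xM; apply: le_eps => e e0; pose L := M + e.
have L0 : 0 < L by rewrite /L; lra.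
have {}xM : spos (L%:A - x).
  apply/uposP; rewrite (_ : _ - _ = (M%:A - x) + e%:A); last by rewrite scalerDl addrAC.
  by apply: uposD => //; apply: uposA; lra.
have sx := upos_sa px.
have [h [hx sh xE]] := spos_sqrt ((uposP _).1 px).
have [k [kx sk kE]] := spos_sqrt xM.
have {}kx : inC x k by apply: inC_trans kx; apply: inCB; [exact: inCA|exact: inCX].
pose s := Num.sqrt L; have s0 : 0 < s by rewrite sqrtr_gt0.
have sL : s * s = L by rewrite -expr2 sqr_sqrtr// ltW.
have : N[s^-1 *: h] <= 1.
  apply: (@sq_sum1_norm_le1 _ _ _ (s^-1 *: k)); try exact: saZ.
    by apply: (@inCC _ _ x); apply: inCZ.
  rewrite -!scalerAl -!scalerAr -xE -kE !scalerA -scalerDr [x + _]addrC subrK scalerA.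
  by rewrite -invfM sL mulVf ?scale1r// lt0r_neq0.
rewrite unormZ gtr0_norm ?invr_gt0// mulrC ler_pdivrMr// mul1r => hs.
rewrite xE sa_norm_sqr// -/L -sL; have := unorm_ge0 h; nra.
Qed.

Lemma upos_norm_mono x y : upos x -> ule x y -> N[x] <= N[y].
Proof.
move=> px xy; have py : upos y by apply/(ule_pos y).2/(ule_trans _ xy)/(ule_pos x).1.
apply: upos_norm_le => //; apply: ule_trans xy (ule_norm (upos_sa py)).
Qed.

End Positivity.
#[export] Hint Resolve papp_pneg papp_ppos : papp.

(** * Cuntz comparison *)

Section Cuntz.
Variables (R : realType) (U : ucstarType R).
Implicit Types (x y z a b h : U) (f g : R -> R).

Definition cut (e t : R) := Num.max (t - e) 0.
Definition ucut (e : R) a := fc (cut e) a.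

Lemma papp_cut e : papp (cut e). Proof. by rewrite /cut; tpapp. Qed.
#[local] Hint Resolve papp_cut : papp.

Lemma cut_ge0 e t : 0 <= cut e t.
Proof. by rewrite /cut le_max lexx orbT. Qed.

Lemma ucut_upos e a : sa a -> upos (ucut e a).
Proof. by move=> sx; apply: fc_upos => // [|t _]; [tpapp|apply: cut_ge0]. Qed.

Lemma ucut_dist e a : 0 <= e -> upos a -> N[a - ucut e a] <= e.
Proof.
move=> e0 pa; have sx := upos_sa pa.
rewrite -{1}(fc_id sx) -fcB//; try tpapp; apply: fc_norm_pos => //; first by tpapp.
move=> t /andP[t0 _]; rewrite /cut; case: (leP (t - e) 0) => ?; rewrite ler_norml; lra.
Qed.

Lemma ucut_ucut e e' a : 0 <= e' -> sa a -> ucut e' (ucut e a) = ucut (e + e') a.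
Proof.
move=> e0 sx; rewrite /ucut -fc_comp//; try tpapp; apply: fc_ext => //; try tpapp.
move=> t _; rewrite /cut; case: (leP (t - e) 0) => ?.
  by case: (leP (0 - e') 0) => ?; case: (leP (t - (e + e')) 0) => ?; lra.
by case: (leP (t - e - e') 0) => ?; case: (leP (t - (e + e')) 0) => ?; lra.
Qed.

Lemma ucut0 a : upos a -> ucut 0 a = a.
Proof.
move=> pa; rewrite -[RHS](upos_ppos pa); apply: fc_ext; try tpapp; first exact: upos_sa.
by move=> t _; rewrite /cut /ppos subr0.
Qed.

Lemma ucut_eq0 e a : sa a -> ule a e%:A -> ucut e a = 0.
Proof.
move=> sx ae; rewrite /ule in ae; have /uposP[s0 ap] := ae.
rewrite -ap.
have -> : e%:A - a = fc (fun t => e - t) a.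
  by rewrite fcB ?fc_id ?fc_cst//; tpapp.
rewrite -fc_comp//; try tpapp; apply: fc_ext => //; try tpapp.
by move=> t _; rewrite /cut /pneg opprB.
Qed.

Lemma ucut_eq0_norm e a : 0 <= e -> upos a -> ucut e a = 0 -> N[a] <= e.
Proof.
by move=> e0 pa E; have := ucut_dist e0 pa; rewrite E subr0.
Qed.

Definition csub a b := forall e : R, 0 < e -> exists x, N[x^*u * b * x - a] < e.

Lemma csub_refl a : csub a a.
Proof. by move=> e e0; exists 1; rewrite ustar1 mul1r mulr1 subrr unorm0. Qed.

Lemma csub_conj b x : csub (x^*u * b * x) b.
Proof. by move=> e e0; exists x; rewrite subrr unorm0. Qed.

Lemma csub_lim a b : (forall e : R, 0 < e -> exists2 a', N[a - a'] < e & csub a' b) -> csub a b.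
Proof.
move=> H e e0; have [a' aa' h] := H (e / 2) (half_gt0 e0).
have [x Hx] := h (e / 2) (half_gt0 e0); exists x.
by have := udistD a' (x^*u * b * x) a; rewrite [N[a' - a]]udistC; lra.
Qed.

Lemma norm_conj_le b x : N[x^*u * b * x] <= N[x] ^+ 2 * N[b].
Proof.
apply: le_trans (unormM _ _) _; rewrite expr2 mulrAC.
apply: ler_wpM2r; first exact: unorm_ge0.
by apply: le_trans (unormM _ _) _; rewrite norm_ustar.
Qed.

Lemma csub_trans b a c : csub a b -> csub b c -> csub a c.
Proof.
move=> ab bc; apply: csub_lim => e e0; have [x Hx] := ab (e / 2) (half_gt0 e0).
exists (x^*u * b * x); first by rewrite udistC; lra.
move=> d d0.
have nx : 0 < N[x] ^+ 2 + 1 by have := sqr_ge0 N[x]; lra.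
have [y Hy] := bc (d / (N[x] ^+ 2 + 1)) ltac:(by rewrite divr_gt0).
exists (y * x).
have -> : (y * x)^*u * c * (y * x) - x^*u * b * x = x^*u * (y^*u * c * y - b) * x.
  by rewrite ustarM; ncring.
apply: le_lt_trans (norm_conj_le _ _) _.
move: Hy; rewrite ltr_pdivlMr//.
have := unorm_ge0 (y^*u * c * y - b); have := sqr_ge0 N[x]; nra.
Qed.

Lemma csub0 b : csub 0 b.
Proof. by move=> e e0; exists 0; rewrite mulr0 subrr unorm0. Qed.

Lemma csubZ (k : R) a : 0 <= k -> csub (k *: a) a.
Proof.
move=> k0; have := csub_conj a (Num.sqrt k)%:A.
by rewrite [_%:A^*u]saA mulr_algl mulr_algr scalerA sqrtM_id.
Qed.

Lemma fc_at0 f : papp f -> fc f (0 : U) = (f 0)%:A.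
Proof.
move=> Hf; rewrite -(fc_cst _ (sa0 U)); apply: fc_ext => //; try tpapp; first exact: sa0.
by move=> t; rewrite unorm0 normr_le0 => /eqP ->.
Qed.

Lemma fc_mul0r f a z : papp f -> f 0 = 0 -> sa a -> z * a = 0 -> z * fc f a = 0.
Proof.
move=> Hf f0 sx za; rewrite -(@fc_intertwine _ _ f 0) ?fc_at0 ?f0 ?scale0r ?mul0r//.
exact: sa0.
Qed.

Lemma fc_mul0l f a z : papp f -> f 0 = 0 -> sa a -> a * z = 0 -> fc f a * z = 0.
Proof.
move=> Hf f0 sx za; rewrite (@fc_intertwine _ _ f a 0) ?fc_at0 ?f0 ?scale0r ?mulr0//.
exact: sa0.
Qed.

(* With [k = (b + d)^(-1/2)] and [w = k a^(1/2)] one has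
   [a - w^* b w = d a^(1/2) k^2 a^(1/2)], whose norm is at most [d]
   since [k a k <= k b k <= 1]. *)
Lemma ule_csub a b : upos a -> ule a b -> csub a b.
Proof.
move=> pa ab; have pb : upos b by apply/(ule_pos b).2/(ule_trans _ ab)/(ule_pos a).1.
have sb := upos_sa pb.
have [h [_ sh aE]] := spos_sqrt ((uposP _).1 pa).
move=> e e0; pose d := e / 2; have d0 : 0 < d by rewrite half_gt0.
pose k t : R := (Num.sqrt (ppos t + d))^-1.
have pk : papp k.
  apply: (@papp_inv _ (Num.sqrt d)); first by rewrite sqrtr_gt0.
    by tpapp.
  by move=> t; apply: ler_wsqrtr; rewrite lerDr /ppos le_max lexx orbT.
have kk t : 0 <= t -> k t * k t = (t + d)^-1.
  move=> t0; rewrite /k /ppos (max_idPl t0) -invfM sqrtM_id//; lra.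
have sk : sa (fc k b) by apply: fc_sa.
exists (fc k b * h).
have -> : (fc k b * h)^*u * b * (fc k b * h) - a =
    - (h * fc (fun t => d * (k t * k t)) b * h).
  rewrite ustarM [h^*u]sh [(fc k b)^*u]sk aE.
  transitivity (h * (fc k b * b * fc k b - 1) * h); first by ncring.
  rewrite -mulNr -mulrN; congr (_ * _ * _).
  rewrite -{2}(fc_id sb) -[X in _ - X]scale1r -(fc_cst 1 sb) -!fcM// -?fcB -?fcN//; try tpapp.
  apply: fc_eq_pos => //; try tpapp; move=> t /andP[t0 _].
  rewrite [k t * t * _]mulrAC !kk//; field; apply/lt0r_neq0; lra.
rewrite unormN fcZ//; try tpapp.
rewrite fcM// -scalerAr -scalerAl unormZ gtr0_norm//.
have -> : h * (fc k b * fc k b) * h = (fc k b * h)^*u * (fc k b * h).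
  by rewrite ustarM [h^*u]sh [(fc k b)^*u]sk; ncring.
rewrite unorm_ustar_mul -unorm_mul_ustar ustarM [h^*u]sh [(fc k b)^*u]sk.
have -> : fc k b * h * (h * fc k b) = (fc k b)^*u * a * fc k b.
  by rewrite [(fc k b)^*u]sk aE; ncring.
have : N[(fc k b)^*u * a * fc k b] <= 1.
  apply: upos_norm_le => //; first exact: upos_conj.
  apply: ule_trans (ule_conj _ ab) _.
  rewrite [(fc k b)^*u]sk -{2}(fc_id sb) -(fc_cst 1 sb) -!fcM//; try tpapp.
  apply: fc_ule_pos => //; try tpapp; move=> t /andP[t0 _].
  rewrite [k t * t * _]mulrAC kk// mulrC ler_pdivrMr ?mul1r; lra.
rewrite /d; nra.
Qed.

(** Conjugate [a - e <= b] by [g(a)], where [g] vanishes up to [e] and is 1 from [e + d / 2] on. The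
    left-hand side becomes positive and is within [d / 2] of [(a - e)_+]. *)
Lemma ule_cut_csub e a b : sa a -> upos b -> ule a (b + e%:A) -> csub (ucut e a) b.
Proof.
move=> sx pb ab; apply: csub_lim => d d0.
pose g t : R := Num.min 1 (Num.max 0 ((2 / d) * (t - e))).
have pg : papp g by rewrite /g; tpapp.
pose G t := g t * (t - e) * g t.
have pG : papp G by rewrite /G; tpapp.
have dd : 0 < 2 / d by rewrite divr_gt0.
have Gt t : 0 <= G t /\ `|cut e t - G t| <= d / 2.
  rewrite /G /g /cut; case: (leP (t - e) 0) => te.
    have -> : Num.max 0 (2 / d * (t - e)) = 0 :> R.
      by apply: max_idPl; rewrite pmulr_rle0.
    by rewrite (min_idPr ler01) mulr0 subr0 normr0; split => //; lra.
  have m0 : 0 < 2 / d * (t - e) by rewrite mulr_gt0.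
  rewrite (max_idPr (ltW m0)); case: (leP 1 (2 / d * (t - e))) => h.
    by rewrite mul1r mulr1 subrr normr0; split; lra.
  have [m1 te1] := (ltW m0, ltW te); split; first by rewrite mulr_ge0// mulr_ge0.
  have te' : t - e < d / 2.
    by move: h; rewrite mulrAC ltr_pdivrMr//; lra.
  set m := 2 / d * (t - e) in m0 h *.
  have -> : t - e - m * (t - e) * m = (t - e) * (1 - m * m) by ring.
  rewrite normrM gtr0_norm// ger0_norm; [|nra].
  by have : 1 - m * m <= 1 by [nra]; have : 0 <= 1 - m * m by [nra]; nra.
exists (fc G a).
  rewrite -fcB//; try tpapp; apply: (@le_lt_trans _ _ (d / 2)); last lra.
  by apply: fc_norm => //; [tpapp|move=> t _; case: (Gt t)].
apply: csub_trans (csub_conj b (fc g a)).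
apply: ule_csub; first by apply: fc_upos => // t _; case: (Gt t).
have -> : fc G a = (fc g a)^*u * (a - e%:A) * fc g a.
  rewrite [(fc g a)^*u]fc_sa//.
  have -> : a - e%:A = fc (fun t => t - e) a by rewrite fcB ?fc_id ?fc_cst//; tpapp.
  by rewrite -!fcM//; tpapp.
apply: ule_conj; move: ab; rewrite /ule opprB addrA.
by rewrite addrAC.
Qed.

Lemma csub_cut_le e a : 0 <= e -> upos a -> csub (ucut e a) a.
Proof.
move=> e0 pa; apply: ule_cut_csub => //; first exact: upos_sa.
by apply: ule_addr; apply: uposA.
Qed.

Lemma dist_cut_csub e a b : sa a -> upos b -> N[a - b] <= e -> csub (ucut e a) b.
Proof.
move=> sx pb ab; apply: ule_cut_csub => //.
have sab : sa (a - b) by apply: saB => //; apply: upos_sa.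
have := ule_normA sab ab; rewrite /ule.
by rewrite opprB addrCA addrA.
Qed.

Lemma csub_cutP a b : upos a -> (forall e : R, 0 < e -> csub (ucut e a) b) -> csub a b.
Proof.
move=> pa H; apply: csub_lim => e e0; exists (ucut (e / 2) a).
  by have := ucut_dist (ltW (half_gt0 e0)) pa; lra.
exact/H/half_gt0.
Qed.

Lemma csub_cut_mono e e' a : e <= e' -> sa a -> csub (ucut e' a) (ucut e a).
Proof.
move=> ee sx; apply: ule_csub; first exact: ucut_upos.
apply: fc_ule => //; try tpapp; move=> t _; rewrite /cut.
by case: (leP (t - e') 0) => ?; case: (leP (t - e) 0) => ?; lra.
Qed.

Lemma csub_cut_cut e a b : 0 < e -> upos a -> upos b -> csub a b ->
  exists2 d : R, 0 < d & csub (ucut e a) (ucut d b).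
Proof.
move=> e0 pa pb ab; have [x Hx] := ab (e / 2) (half_gt0 e0).
have nx : 0 < N[x] ^+ 2 + 1 by have := sqr_ge0 N[x]; lra.
(* Replacing [b] by its cut at [d] changes [x^* b x] by at most [e / 2]. *)
pose d := e / 2 / (N[x] ^+ 2 + 1).
have d0 : 0 < d by rewrite divr_gt0// half_gt0.
exists d => //; apply: csub_trans (csub_conj _ x).
apply: dist_cut_csub; first exact: upos_sa.
  by apply: upos_conj; apply: ucut_upos; apply: upos_sa.
have := udistD (x^*u * b * x) a (x^*u * ucut d b * x).
rewrite [N[a - x^*u * b * x]]udistC -mulrBl -mulrBr.
have := norm_conj_le (b - ucut d b) x; have := ucut_dist (ltW d0) pb.
have dE : d * (N[x] ^+ 2 + 1) = e / 2 by rewrite divfK// lt0r_neq0.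
have := sqr_ge0 N[x]; nra.
Qed.

(* The function [g] equals [t^(-1/2)] on [[e, oo)], the support of [cut e]. *)
Lemma csub_cut_star e x : 0 < e -> csub (ucut e (x^*u * x)) (ucut e (x * x^*u)).
Proof.
move=> e0; pose g t : R := (Num.sqrt (Num.max t e))^-1.
have pg : papp g.
  apply: (@papp_inv _ (Num.sqrt e)); first by rewrite sqrtr_gt0.
    by tpapp.
  by move=> t; apply: ler_wsqrtr; rewrite le_max lexx orbT.
have s1 := sa_ustarM x; have s2 := sa_Mustar x.
have -> : ucut e (x^*u * x) =
    (x * fc g (x^*u * x))^*u * ucut e (x * x^*u) * (x * fc g (x^*u * x)).
  rewrite ustarM [(fc g _)^*u]fc_sa//; set y := x^*u * x.
  have E : ucut e (x * x^*u) * x = x * ucut e y.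
    by apply: fc_intertwine => //; [tpapp|rewrite /y mulrA].
  have -> : fc g y * x^*u * ucut e (x * x^*u) * (x * fc g y) =
    fc g y * x^*u * (ucut e (x * x^*u) * x) * fc g y by ncring.
  have -> : fc g y * x^*u * (ucut e (x * x^*u) * x) * fc g y = fc g y * y * ucut e y * fc g y.
    by rewrite E /y; ncring.
  rewrite -[X in _ = fc g y * X * _ * _](fc_id s1) /ucut -!fcM//; try tpapp.
  apply: fc_ext => //; try tpapp; move=> t _; rewrite /cut.
  case: (leP (t - e) 0) => te; first by rewrite mulr0 mul0r.
  have tm : Num.max t e = t by apply: max_idPl; lra.
  rewrite /g tm mulrAC [_ * t]mulrC -mulrA mulrACA mulrAC.
  have t0 : 0 < t by lra.
  rewrite [X in _ = X](_ : _ = t * ((Num.sqrt t)^-1 * (Num.sqrt t)^-1) * (t - e)); last by ring.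
  by rewrite -invfM sqrtM_id ?ltW// mulfV ?mul1r// lt0r_neq0.
exact: csub_conj.
Qed.

Lemma csub_star x : csub (x^*u * x) (x * x^*u).
Proof.
apply: csub_cutP => [|e e0]; first by exists x.
apply: csub_trans (csub_cut_star x e0) _.
by apply: csub_cut_le; [exact: ltW|exists x^*u; rewrite ustarK].
Qed.

Lemma csub_sqr a : upos a -> csub (a * a) a.
Proof.
move=> pa; have sx := upos_sa pa.
have [h [_ sh aE]] := spos_sqrt ((uposP _).1 pa).
have -> : a * a = h^*u * a * h by rewrite [h^*u]sh aE; ncring.
exact: csub_conj.
Qed.

End Cuntz.
#[export] Hint Resolve papp_cut : papp.

(** * Cuntz comparison of diagonal matrices *)

Section Families.
Variables (R : realType) (U : ucstarType R).

(* A finite family stands for the diagonal matrix with these entries; this avoids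
   forming matrix algebras over [U]. *)
Definition fsub (I J : finType) (a : I -> U) (b : J -> U) :=
  forall e : R, 0 < e -> exists X : J -> I -> U, forall i i',
    N[\sum_j (X j i)^*u * b j * X j i' - (if i == i' then a i else 0)] < e.

Lemma fsub_trans (I J K : finType) (b : J -> U) (a : I -> U) (c : K -> U) :
  fsub a b -> fsub b c -> fsub a c.
Proof.
move=> ab bc e e0; have [X HX] := ab (e / 2) (half_gt0 e0).
pose C := \sum_i \sum_j N[X j i].
have CX i0 : \sum_j N[X j i0] <= C.
  rewrite /C (bigD1 i0)//= lerDl; do 2!apply: sumr_ge0 => ? _; exact: unorm_ge0.
have C0 : 0 <= C by do 2!apply: sumr_ge0 => ? _; exact: unorm_ge0.
have C2 : 0 < 2 * (C ^+ 2 + 1) by have := sqr_ge0 C; lra.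
have [Y HY] := bc (e / (2 * (C ^+ 2 + 1))) ltac:(by rewrite divr_gt0).
set d := e / _ in HY; have d0 : 0 <= d := ltW (divr_gt0 e0 C2).
exists (fun k i => \sum_j Y k j * X j i) => i i'.
pose E j j' := \sum_k (Y k j)^*u * c k * Y k j'.
have -> : \sum_k (\sum_j Y k j * X j i)^*u * c k * (\sum_j Y k j * X j i') =
    \sum_j \sum_j' (X j i)^*u * (E j j' - (if j == j' then b j else 0)) * X j' i' +
    \sum_j (X j i)^*u * b j * X j i'.
  rewrite -big_split /=.
  transitivity (\sum_j \sum_j' (X j i)^*u * E j j' * X j' i').
    have S k : (\sum_j Y k j * X j i)^*u * c k * (\sum_j Y k j * X j i') =
        \sum_j \sum_j' (X j i)^*u * ((Y k j)^*u * c k * Y k j') * X j' i'.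
      rewrite ustar_sum !mulr_suml; apply: eq_bigr => j _.
      rewrite mulr_sumr; apply: eq_bigr => j' _.
      by rewrite ustarM !mulrA.
    rewrite (eq_bigr _ (fun k _ => S k)) exchange_big /=; apply: eq_bigr => j _.
    rewrite exchange_big /=; apply: eq_bigr => j' _.
    by rewrite /E mulr_sumr mulr_suml.
  apply: eq_bigr => j _; have -> : (X j i)^*u * b j * X j i' =
      \sum_j' (X j i)^*u * (if j == j' then b j else 0) * X j' i'.
    rewrite (bigD1 j)//= eqxx big1 ?addr0// => j' /negPf jj'.
    by rewrite eq_sym jj' mulr0 mul0r.
  rewrite -big_split /=; apply: eq_bigr => j' _.
  by rewrite mulrBr mulrBl subrK.
rewrite -addrA; apply: le_lt_trans (unormD _ _) _.
suff : N[\sum_j \sum_j' (X j i)^*u * (E j j' - (if j == j' then b j else 0)) * X j' i'] <= C ^+ 2 * d.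
  have dE : d * (2 * (C ^+ 2 + 1)) = e by rewrite divfK// lt0r_neq0.
  by have := HX i i'; lra.
apply: le_trans (unorm_sum _ _ _) _.
apply: (@le_trans _ _ (\sum_j N[X j i] * (d * C))).
  apply: ler_sum => j _; apply: le_trans (unorm_sum _ _ _) _.
  rewrite mulrCA.
  apply: (@le_trans _ _ (\sum_j' N[X j i] * d * N[X j' i'])).
    apply: ler_sum => j' _; apply: le_trans (unormM _ _) _; apply: ler_wpM2r; first exact: unorm_ge0.
    apply: le_trans (unormM _ _) _; rewrite norm_ustar; apply: ler_wpM2l; first exact: unorm_ge0.
    by apply: ltW; apply: HY.
  rewrite -mulr_sumr mulrCA mulrA ler_wpM2l//.
  by apply: mulr_ge0 => //; exact: unorm_ge0.
rewrite -mulr_suml expr2 -mulrA [C * d]mulrC; apply: ler_wpM2r; last exact: CX.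
exact: mulr_ge0.
Qed.

Lemma fsub_inj (I J : finType) (h : I -> J) (a : I -> U) (b : J -> U) :
  injective h -> (forall i, a i = b (h i)) -> fsub a b.
Proof.
move=> hi ab e e0; exists (fun j i => if j == h i then 1 else 0) => i i'.
rewrite (bigD1 (h i))//= eqxx ustar1 mul1r big1 ?addr0; last first.
  by move=> j /negPf ->; rewrite ustar0 !mul0r.
rewrite (inj_eq hi) ab; case: eqP => _; rewrite ?mulr1 ?mulr0 subrr unorm0//.
Qed.

Definition fcat (I J : finType) (a : I -> U) (b : J -> U) (s : I + J) :=
  match s with inl i => a i | inr j => b j end.

Lemma fsub_cat (I J I' J' : finType) (a : I -> U) (b : J -> U) (a' : I' -> U) (b' : J' -> U) :
  fsub a b -> fsub a' b' -> fsub (fcat a a') (fcat b b').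
Proof.
move=> ab ab' e e0; have [X HX] := ab e e0; have [X' HX'] := ab' e e0.
exists (fun s t => match s, t with inl j, inl i => X j i | inr j, inr i => X' j i | _, _ => 0 end).
move=> [i|i] [i'|i']; rewrite big_sumType /=.
- rewrite [X in _ + X - _]big1 ?addr0; first exact: HX.
  by move=> j _; rewrite mulr0.
- rewrite !big1 ?addr0 ?subrr ?unorm0// => j _; rewrite ?mulr0//.
  by rewrite ustar0 !mul0r.
- rewrite !big1 ?addr0 ?subrr ?unorm0// => j _; rewrite ?mulr0//.
  by rewrite ustar0 !mul0r.
- rewrite [X in X + _ - _]big1 ?add0r; first exact: HX'.
  by move=> j _; rewrite mulr0.
Qed.

Lemma fsub1 (a b : U) : csub a b <-> fsub (fun _ : unit => a) (fun _ : unit => b).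
Proof.
split=> H e e0; have [x Hx] := H e e0.
  by exists (fun _ _ => x) => -[] []; rewrite big_const card_unit /= addr0.
exists (x tt tt); have := Hx tt tt; by rewrite (bigD1 tt)//= big1 ?addr0// => -[].
Qed.

Lemma fsub_conj (I : finType) (v b : I -> U) :
  fsub (fun _ : unit => \sum_i (v i)^*u * b i * v i) b.
Proof. by move=> e e0; exists (fun i _ => v i) => -[] [] /=; rewrite subrr unorm0. Qed.

Lemma fsub_sum (I : finType) (b : I -> U) : fsub (fun _ : unit => \sum_i b i) b.
Proof.
rewrite (_ : \sum_i b i = \sum_i 1^*u * b i * 1); first exact: fsub_conj.
by apply: eq_bigr => i _; rewrite ustar1 mul1r mulr1.
Qed.

(** The row with entries [g(a_i)] conjugates the sum to the diagonal matrix: orthogonality kills all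
    other terms, and [t g(t)^2] is within [e / 2] of [t]. *)
Lemma fsub_orth (I : finType) (a : I -> U) : (forall i, upos (a i)) ->
  (forall i j, i != j -> a i * a j = 0) -> fsub a (fun _ : unit => \sum_i a i).
Proof.
move=> pa ao e e0.
pose g t : R := Num.min 1 (Num.max 0 (2 / e * t)).
have pg : papp g by rewrite /g; tpapp.
have g0 : g 0 = 0 by rewrite /g mulr0 maxxx (min_idPr ler01).
exists (fun _ i => fc g (a i)) => i i'.
rewrite big_const card_unit /= addr0.
have sx := upos_sa (pa i); have sx' := upos_sa (pa i').
rewrite [_^*u]fc_sa// mulr_sumr mulr_suml (bigD1 i)//= big1 ?addr0; last first.
  move=> j ji; rewrite fc_mul0l ?mul0r//; apply: ao; by rewrite eq_sym.
case: eqP => [<-|/eqP ii]; last first.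
  by rewrite -mulrA fc_mul0r ?mulr0 ?subrr ?unorm0//; apply: ao.
rewrite -{2 4}(fc_id sx) -!fcM -?fcB//; try tpapp.
apply: (@le_lt_trans _ _ (e / 2)); last lra.
apply: fc_norm_pos => //; first by tpapp.
move=> t /andP[t0 _]; have d0 : 0 < 2 / e by rewrite divr_gt0.
have m0 : 0 <= 2 / e * t by rewrite mulr_ge0// ltW.
rewrite /g (max_idPr m0); case: (leP 1 (2 / e * t)) => h.
  by rewrite mul1r mulr1 subrr normr0; lra.
have te : t < e / 2 by move: h; rewrite mulrAC ltr_pdivrMr//; lra.
set m := 2 / e * t in m0 h *.
have m1 : m * t * m <= t by rewrite mulrAC; have : m * m <= 1 by [nra]; nra.
have m2 : 0 <= m * t * m by rewrite mulr_ge0// mulr_ge0.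
by rewrite ler_norml; lra.
Qed.

Lemma fsub_orth2 (a b : U) : upos a -> upos b -> a * b = 0 ->
  fsub (fcat (fun _ : unit => a) (fun _ : unit => b)) (fun _ : unit => a + b).
Proof.
move=> pa pb ab; have ba : b * a = 0.
  by rewrite -[a](upos_sa pa) -[b](upos_sa pb) -ustarM ab ustar0.
have := @fsub_orth _ (fcat (fun _ : unit => a) (fun _ : unit => b)).
rewrite big_sumType /= !big_const !card_unit /= !addr0; apply.
  by case.
by move=> [[]|[]] [[]|[]].
Qed.

Lemma fsub_sum2 (a b : U) :
  fsub (fun _ : unit => a + b) (fcat (fun _ : unit => a) (fun _ : unit => b)).
Proof.
have := fsub_sum (fcat (fun _ : unit => a) (fun _ : unit => b)).
by rewrite big_sumType /= !big_const !card_unit /= !addr0.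
Qed.

End Families.

(** * States of preordered monoids *)

Section States.
Variables (R : realType) (M : nmodType) (le : M -> M -> Prop) (u : M).
Hypothesis ple_refl : forall x, le x x.
Hypothesis ple_trans : forall y x z, le x y -> le y z -> le x z.
Hypothesis ple_add : forall x x' y y', le x x' -> le y y' -> le (x + y) (x' + y').
Hypothesis ple_zero : forall x, le 0 x.

(** [u] is not assumed to be an order unit, so functionals are controlled only on the elements
    dominated by a multiple of [u]; their values elsewhere are arbitrary. *)
Definition bd x := exists m, le x (u *+ m).

Lemma le_addr x y : le x (x + y).
Proof. by rewrite -{1}[x]addr0; apply: ple_add. Qed.

Lemma le_muln x y n : le x y -> le (x *+ n) (y *+ n).
Proof. by move=> xy; elim: n => [|n IH]; rewrite ?mulr0n// !mulrS; apply: ple_add. Qed.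

Lemma bdD x y : bd x -> bd y -> bd (x + y).
Proof. by move=> [m xm] [n yn]; exists (m + n)%N; rewrite mulrnDr; apply: ple_add. Qed.

Lemma bdM x n : bd x -> bd (x *+ n).
Proof. by move=> [m xm]; exists (m * n)%N; rewrite mulrnA; apply: le_muln. Qed.

Lemma bd_le x y : le x y -> bd y -> bd x.
Proof. by move=> xy [m ym]; exists m; apply: ple_trans ym. Qed.

Record subl (q : M -> R) : Prop := {
  subl_mono : forall x y, bd y -> le x y -> q x <= q y ;
  subl_add : forall x y, bd x -> bd y -> q (x + y) <= q x + q y ;
  subl_muln : forall x n, bd x -> q (x *+ n) = n%:R * q x }.

Lemma bd0 : bd 0. Proof. by exists 0%N. Qed.

Lemma subl0 q : subl q -> q 0 = 0.
Proof. by move=> H; rewrite -(mulr0n 0) (subl_muln H) ?mul0r//; exact: bd0. Qed.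

Lemma subl_ge0 q x : subl q -> bd x -> 0 <= q x.
Proof. by move=> H bx; rewrite -(subl0 H); apply: (subl_mono H). Qed.

(* The quotient of [q] making [z] additive. *)
Definition qz_set (q : M -> R) z w : set R := [set q (w + z *+ n) - n%:R * q z | n in [set: nat]].
Definition qz (q : M -> R) z w := inf (qz_set q z w).

Lemma qz_ge0 q z w n : subl q -> bd z -> bd w -> 0 <= q (w + z *+ n) - n%:R * q z.
Proof.
move=> H bz bw; rewrite subr_ge0 -(subl_muln H)//; apply: (subl_mono H).
  exact/bdD/bdM.
by rewrite addrC; apply: le_addr.
Qed.

Lemma qz_lb q z w : subl q -> bd z -> bd w -> has_lbound (qz_set q z w).
Proof. by move=> H bz bw; exists 0 => _ [n _ <-]; apply: qz_ge0. Qed.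

Lemma qz_le q z w n : subl q -> bd z -> bd w -> qz q z w <= q (w + z *+ n) - n%:R * q z.
Proof. by move=> H bz bw; apply: ge_inf; [exact: qz_lb|exists n]. Qed.

Lemma qz_glb q z w c : (forall n, c <= q (w + z *+ n) - n%:R * q z) -> c <= qz q z w.
Proof.
move=> H; apply: lb_le_inf; first by exists (q (w + z *+ 0) - 0%:R * q z), 0%N.
by move=> _ [n _ <-].
Qed.

(** By subadditivity the terms whose infimum is [qz] decrease with the index, so the infimum is a
    limit and may be taken along the multiples of any positive integer. Homogeneity of [qz] depends
    on this. *)
Lemma qz_decr q z w n k : subl q -> bd z -> bd w ->
  q (w + z *+ (n + k)) - (n + k)%:R * q z <= q (w + z *+ n) - n%:R * q z.
Proof.
move=> H bz bw; elim: k => [|k IH]; first by rewrite addn0.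
apply: le_trans IH; rewrite addnS mulrSr addrA.
have := subl_add H (bdD bw (bdM (n + k) bz)) bz.
rewrite -natr1; lra.
Qed.

Lemma qz_subl q z : subl q -> bd z -> subl (qz q z).
Proof.
move=> H bz; split.
- move=> x y by_ xy; apply: qz_glb => n; apply: le_trans (qz_le n H bz _) _.
    exact: bd_le xy by_.
  by rewrite lerD2r; apply: (subl_mono H); [exact/bdD/bdM|apply: ple_add].
- move=> x y bx by_; rewrite -lerBlDr; apply: qz_glb => n; rewrite lerBlDr -lerBlDl.
  apply: qz_glb => m; rewrite lerBlDr; apply: le_trans (qz_le (n + m) H bz (bdD bx by_)) _.
  have := subl_add H (bdD bx (bdM n bz)) (bdD by_ (bdM m bz)).
  by rewrite addrACA -mulrnDr natrD; lra.
- move=> x [|n] bx.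
    rewrite mulr0n mul0r; apply/eqP; rewrite eq_le; apply/andP; split.
      by have := qz_le 0 H bz bd0; rewrite mul0r mulr0n addr0 (subl0 H) subr0.
    by apply: qz_glb => m; apply: qz_ge0 => //; exact: bd0.
  have E m : q (x *+ n.+1 + z *+ (m * n.+1)) - (m * n.+1)%:R * q z =
      n.+1%:R * (q (x + z *+ m) - m%:R * q z).
    by rewrite mulrnA -mulrnDl (subl_muln H) ?natrM; [ring|exact/bdD/bdM].
  apply/eqP; rewrite eq_le; apply/andP; split.
    rewrite -ler_pdivrMl ?ltr0n//; apply: qz_glb => m; rewrite ler_pdivrMl ?ltr0n//.
    by rewrite -E; apply: qz_le => //; apply: bdM.
  apply: qz_glb => m.
  apply: le_trans (_ : _ <= n.+1%:R * (q (x + z *+ m) - m%:R * q z)) _.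
    by rewrite ler_pM2l ?ltr0n//; apply: qz_le.
  by rewrite -E mulnS addnC mulnC addnC; apply: qz_decr => //; apply: bdM.
Qed.

Lemma qz_le_q q z w : subl q -> bd z -> bd w -> qz q z w <= q w.
Proof. by move=> H bz bw; have := qz_le 0 H bz bw; rewrite mul0r mulr0n addr0 subr0. Qed.

Lemma qz_addz q z w : subl q -> bd z -> bd w -> qz q z (w + z) = qz q z w + q z.
Proof.
move=> H bz bw; apply/eqP; rewrite eq_le; apply/andP; split.
  rewrite -lerBlDr; apply: qz_glb => n; rewrite lerBlDr.
  apply: le_trans (qz_le n H bz (bdD bw bz)) _.
  have := qz_decr n 1 H bz bw; rewrite addn1 mulrS addrA -natr1; lra.
apply: qz_glb => n; have := qz_le n.+1 H bz bw.
by rewrite mulrS addrA -natr1; lra.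
Qed.

Lemma qz_adda q z a c : subl q -> bd z -> (forall w, bd w -> q (w + a) = q w + c) ->
  forall w, bd w -> qz q z (w + a) = qz q z w + c.
Proof.
move=> H bz qa w bw.
have E n : q (w + a + z *+ n) = q (w + z *+ n) + c.
  by rewrite addrAC qa//; exact/bdD/bdM.
have lb1 : has_lbound (qz_set q z (w + a)).
  by exists c => _ [n _ <-]; rewrite E; have := qz_ge0 n H bz bw; lra.
apply/eqP; rewrite eq_le; apply/andP; split.
  rewrite -lerBlDr; apply: qz_glb => n; rewrite lerBlDr.
  apply: (@le_trans _ _ (q (w + a + z *+ n) - n%:R * q z)).
    by apply: ge_inf => //; exists n.
  by rewrite E; lra.
by apply: qz_glb => n; rewrite E; have := qz_le n H bz bw; lra.
Qed.

(** Its infimum is the Minkowski functional of the order interval of [u], the largest among the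
    sublinear monotone functionals with value at most 1 at [u]. *)
Definition gauge_set x : set R :=
  [set r | exists k m : nat, [/\ (0 < m)%N, le (x *+ m) (u *+ k) & r = k%:R / m%:R]].
Definition gauge x := inf (gauge_set x).

Lemma gauge_lb x : has_lbound (gauge_set x).
Proof. by exists 0 => _ [k [m [_ _ ->]]]; rewrite divr_ge0. Qed.

Lemma gauge_le x k m : (0 < m)%N -> le (x *+ m) (u *+ k) -> gauge x <= k%:R / m%:R.
Proof. by move=> m0 h; apply: ge_inf; [exact: gauge_lb|exists k, m]. Qed.

Lemma gauge_glb x c : bd x ->
  (forall k m, (0 < m)%N -> le (x *+ m) (u *+ k) -> c <= k%:R / m%:R) -> c <= gauge x.
Proof.
move=> [k xk] H; apply: lb_le_inf.
  by exists (k%:R / 1%:R), k, 1%N; split => //; rewrite mulr1n.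
by move=> _ [k' [m [m0 h ->]]]; apply: H.
Qed.

Lemma gauge_subl : subl gauge.
Proof.
have nz m : (0 < m)%N -> (m%:R : R) != 0 by case: m => // m _; rewrite pnatr_eq0.
split.
- move=> x y by_ xy; apply: gauge_glb => // k m m0 h; apply: gauge_le => //.
  exact: ple_trans (le_muln m xy) h.
- move=> x y bx by_; rewrite -lerBlDr; apply: gauge_glb => // k m m0 h.
  rewrite lerBlDr -lerBlDl; apply: gauge_glb => // k' m' m0' h'; rewrite lerBlDr.
  have -> : k'%:R / m'%:R + k%:R / m%:R = (k' * m + k * m')%:R / (m * m')%:R :> R.
    by rewrite natrD !natrM; field; rewrite !nz.
  apply: gauge_le; first by rewrite muln_gt0 m0.
  rewrite mulrnDl mulrnDr addrC; apply: ple_add.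
    by rewrite [(m * m')%N]mulnC !mulrnA; apply: le_muln.
  by rewrite !mulrnA; apply: le_muln.
- move=> x [|n] bx.
    rewrite mulr0n mul0r; apply/eqP; rewrite eq_le; apply/andP; split.
      have := @gauge_le 0 0 1; rewrite mul0r; apply => //; rewrite mulr1n mulr0n//.
    by apply: gauge_glb => [|k m _ _]; [exact: bd0|rewrite divr_ge0].
  apply/eqP; rewrite eq_le; apply/andP; split.
    rewrite -ler_pdivrMl ?ltr0n//; apply: gauge_glb => // k m m0 h.
    rewrite ler_pdivrMl ?ltr0n// mulrA -natrM; apply: gauge_le => //.
    by rewrite -mulrnA mulnC mulrnA [(n.+1 * k)%N]mulnC mulrnA; apply: le_muln.
  apply: gauge_glb => [|k m m0 h]; first exact: bdM.
  rewrite -ler_pdivlMl ?ltr0n//.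
  have -> : n.+1%:R^-1 * (k%:R / m%:R) = k%:R / (n.+1 * m)%:R :> R.
    by rewrite natrM invfM mulrCA.
  by apply: gauge_le; rewrite ?muln_gt0// mulrnA.
Qed.

(* Goodearl and Handelman: Zorn's lemma yields a minimal sublinear functional
   keeping the value at [a], and minimality forces additivity. *)
Lemma state_ex a : bd a -> (forall k, ~ le (a *+ k.+1) (u *+ k)) ->
  exists f : M -> R, [/\ forall x y, bd x -> bd y -> f (x + y) = f x + f y,
    forall x y, bd y -> le x y -> f x <= f y, f u <= 1 & 1 <= f a].
Proof.
move=> ba Ha; have Gs := gauge_subl; pose c := gauge a.
have bu : bd u by exists 1%N.
have c1 : 1 <= c.
  apply: gauge_glb => // k m m0 h; rewrite ler_pdivlMr ?ltr0n// mul1r ler_nat leqNgt.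
  apply/negP => km; apply: (Ha k); apply: ple_trans h.
  by rewrite -(subnKC km) mulrnDr; apply: le_addr.
(* The clause on [a] freezes the value [c] at [a] while the functional decreases elsewhere. *)
pose P (q : M -> R) := subl q /\ (forall w, bd w -> q (w + a) = q w + c) /\
  (forall x, bd x -> q x <= gauge x).
have P0 : P (qz gauge a).
  by split; [exact: qz_subl|split => [w bw|x bx]; [exact: qz_addz|exact: qz_le_q]].
pose T := {q | P q}.
pose ge (s t : T) := `[< forall x, bd x -> sval t x <= sval s x >].
have [|||[q [qs [qa qg]]] qm] := @ZL_preorder T (exist _ _ P0) ge.
- by move=> s; apply/asboolP => x _.
- move=> r s t /asboolP rs /asboolP st; apply/asboolP => x bx.
  exact: le_trans (st x bx) (rs x bx).
- move=> A Atot; have [[t0 At0]|A0] := pselect (A !=set0); last first.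
    exists (exist _ _ P0) => s As; exfalso; apply: A0; by exists s.
  pose V x : set R := [set sval s x | s in A].
  have Vlb x : bd x -> has_lbound (V x).
    by move=> bx; exists 0 => _ [s _ <-]; apply: subl_ge0 => //; case: (svalP s).
  have Vle x s : bd x -> A s -> inf (V x) <= sval s x.
    by move=> bx As; apply: ge_inf; [exact: Vlb|exists s].
  have Vglb x e : (forall s, A s -> e <= sval s x) -> e <= inf (V x).
    move=> H; apply: lb_le_inf; first by exists (sval t0 x), t0.
    by move=> _ [s As <-]; apply: H.
  have Pi : P (fun x => inf (V x)).
    split; [split|split].
    + move=> x y by_ xy; apply: (Vglb _ _) => s As.
      apply: le_trans (Vle x s (bd_le xy by_) As) _.
      by apply: (subl_mono (svalP s).1).
    + move=> x y bx by_; rewrite -lerBlDr; apply: (Vglb _ _) => s As; rewrite lerBlDr -lerBlDl.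
      apply: (Vglb _ _) => t At; rewrite lerBlDr.
      (* In a chain one of the two functionals lies below the other, so a single one bounds both
         terms. *)
      have [/asboolP h|/asboolP h] := Atot _ _ As At.
        apply: le_trans (Vle _ t (bdD bx by_) At) _.
        apply: le_trans (subl_add (svalP t).1 bx by_) _.
        by have := h x bx; lra.
      apply: le_trans (Vle _ s (bdD bx by_) As) _.
      apply: le_trans (subl_add (svalP s).1 bx by_) _.
      by have := h y by_; lra.
    + move=> x n bx; have [->|n0] := eqVneq n 0%N.
        rewrite mulr0n mul0r; apply/eqP; rewrite eq_le; apply/andP; split.
          by have := Vle 0 t0 bd0 At0; rewrite (subl0 (svalP t0).1).
        by apply: (Vglb _ _) => s As; rewrite (subl0 (svalP s).1).
      have n0' : (0 : R) < n%:R by rewrite ltr0n lt0n.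
      apply/eqP; rewrite eq_le; apply/andP; split.
        rewrite -ler_pdivrMl//; apply: (Vglb _ _) => s As; rewrite ler_pdivrMl//.
        by rewrite -(subl_muln (svalP s).1)//; apply: Vle => //; apply: bdM.
      apply: (Vglb _ _) => s As; rewrite (subl_muln (svalP s).1)// ler_pM2l//.
      exact: Vle.
    + move=> w bw; apply/eqP; rewrite eq_le; apply/andP; split.
        rewrite -lerBlDr; apply: (Vglb _ _) => s As; rewrite lerBlDr.
        by rewrite -(svalP s).2.1//; apply: Vle => //; apply: bdD.
      apply: (Vglb _ _) => s As; rewrite (svalP s).2.1// lerD2r; exact: Vle.
    + move=> x bx; apply: le_trans (Vle x t0 bx At0) _.
      exact: (svalP t0).2.2.
  by exists (exist _ _ Pi) => s As; apply/asboolP => x bx; apply: Vle.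
exists q; split.
- move=> w z bw bz.
  (* Minimality gives [q = qz q z] on bounded elements, and [qz_addz] splits off [z] from the
     right-hand side. *)
  have Pz : P (qz q z).
    split; [exact: qz_subl|split; first exact: qz_adda].
    by move=> x bx; apply: le_trans (qz_le_q qs bz bx) (qg x bx).
  have le1 : ge (exist _ _ (conj qs (conj qa qg))) (exist _ _ Pz).
    by apply/asboolP => x bx; apply: qz_le_q.
  have /asboolP /= le2 := qm _ le1.
  have E x : bd x -> q x = qz q z x.
    by move=> bx; apply/eqP; rewrite eq_le le2//= qz_le_q.
  by rewrite (E (w + z)) ?qz_addz -?E//; apply: bdD.
- exact: (subl_mono qs).
- apply: le_trans (qg u bu) _.
  by have := @gauge_le u 1 1; rewrite divr1; apply.
- by have := qa 0 bd0; rewrite add0r (subl0 qs) add0r => ->.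
Qed.

End States.

(** * Quasitraces from dimension functions *)

Section Commuting.
Variables (R : realType) (U : ucstarType R).
Implicit Types (x y z a b c : U).

Lemma commL x y : y * x = x * y -> forall z, z * y * x = z * x * y.
Proof. by move=> yx z; rewrite -!mulrA yx. Qed.

Lemma upos_commP x : upos x -> exists h, [/\ inC x h, sa h & x = h * h].
Proof. by move=> /uposP /spos_sqrt. Qed.

Lemma ule_sand x y z : sa z -> ule x y -> ule (z * x * z) (z * y * z).
Proof. by move=> sz xy; rewrite -{1 3}[z]sz; apply: ule_conj. Qed.

Lemma upos_sand x z : sa z -> upos x -> upos (z * x * z).
Proof. by move=> sz px; rewrite -{1}[z]sz; apply: upos_conj. Qed.

Lemma ule_mulC a b c : ule a b -> upos c -> c * a = a * c -> c * b = b * c ->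
  ule (c * a) (c * b).
Proof.
move=> ab /upos_commP [h [hc sh cE]] ca cb.
have ha : a * h = h * a by apply: (inC_comm hc).
have hb : b * h = h * b by apply: (inC_comm hc).
rewrite cE.
have -> : h * h * a = h^*u * a * h by rewrite [h^*u]sh -!mulrA ha.
have -> : h * h * b = h^*u * b * h by rewrite [h^*u]sh -!mulrA hb.
exact: ule_conj.
Qed.

Lemma upos_mulC a b : upos a -> upos b -> a * b = b * a -> upos (a * b).
Proof.
move=> pa pb ab; apply/(ule_pos _).2; rewrite -(mulr0 a).
by apply: ule_mulC; rewrite ?mulr0 ?mul0r//; apply/(ule_pos _).1.
Qed.

Lemma csub_mulC a e : upos e -> a * e = e * a -> csub (a * e) a.
Proof.
move=> /upos_commP [h [hc sh eE]] ae.
have ha : a * h = h * a by apply: (inC_comm hc).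
rewrite eE.
have -> : a * (h * h) = h^*u * a * h by rewrite [h^*u]sh mulrA ha.
exact: csub_conj.
Qed.

Lemma csub_uleZ (C : R) a b : 0 <= C -> upos a -> ule a (C *: b) -> csub a b.
Proof. by move=> C0 pa ab; apply: csub_trans (csubZ _ C0); apply: ule_csub. Qed.

Lemma csub_fc (C : R) f g a : papp f -> papp g -> upos a -> 0 <= C ->
  (forall t, 0 <= t <= N[a] -> 0 <= f t <= C * g t) -> csub (fc f a) (fc g a).
Proof.
move=> Hf Hg pa C0 H; apply: (csub_uleZ C0).
  by apply: fc_upos_pos => // t /H /andP[].
rewrite -fcZ//; last exact: upos_sa.
by apply: fc_ule_pos => //; [tpapp|move=> t /H /andP[]].
Qed.

Lemma csub_cube a : upos a -> csub a (a * a * a).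
Proof.
move=> pa; apply: csub_cutP => // e e0; have sx := upos_sa pa.
have -> : a * a * a = fc (fun t => t * t * t) a by rewrite !fcM ?fc_id//; tpapp.
apply: (csub_fc (C := (e * e)^-1)) => //; try tpapp.
  by rewrite invr_ge0 mulr_ge0// ltW.
move=> t /andP[t0 _]; rewrite cut_ge0 /cut /=; case: (leP (t - e) 0) => te.
  by rewrite mulr_ge0 ?invr_ge0 ?mulr_ge0 ?(ltW e0).
rewrite mulrC ler_pdivlMr ?mulr_gt0//.
have et : e <= t by lra.
have : e * e <= t * t by nra.
nra.
Qed.

Lemma csub_square a : upos a -> csub a (a * a).
Proof.
move=> pa; apply: csub_trans (csub_cube pa) _.
apply: csub_mulC => //; by rewrite mulrA.
Qed.

Definition two x y : unit + unit -> U := fcat (fun _ => x) (fun _ => y).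

Lemma fsub_two x y x' y' : csub x x' -> csub y y' -> fsub (two x y) (two x' y').
Proof. by move=> /fsub1 h /fsub1 k; apply: fsub_cat. Qed.

Lemma fsub_two_exact x y z w p q r s : sa z -> sa w ->
  p^*u * z * p + q^*u * w * q = x -> r^*u * z * r + s^*u * w * s = y ->
  p^*u * z * r + q^*u * w * s = 0 ->
  fsub (two x y) (two z w).
Proof.
move=> sz sw E1 E2 E3 e e0.
have E4 : r^*u * z * p + s^*u * w * q = 0.
  rewrite -[LHS]ustarK ustarD !ustarM !ustarK [z^*u]sz [w^*u]sw !mulrA E3; exact: ustar0.
exists (fun k i => match k, i with inl _, inl _ => p | inr _, inl _ => q
                   | inl _, inr _ => r | inr _, inr _ => s end).
by move=> [[]|[]] [[]|[]]; rewrite big_sumType /= !big_const !card_unit /= !addr0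
   ?E1 ?E2 ?E3 ?E4 ?subrr ?subr0 unorm0.
Qed.

(* With the columns [(1, 1)] and [(y, - x)] the matrix [diag(x, y)] becomes
   [diag(x + y, x y (x + y))]. *)
Lemma fsub_modular1 x y : upos x -> upos y -> x * y = y * x ->
  fsub (two (x + y) (x * y)) (two x y).
Proof.
move=> px py xy; have [sx sy] := (upos_sa px, upos_sa py).
have s1 : 1^*u = 1 :> U := ustar1 U.
have pxy := upos_mulC px py xy.
have cs : (x + y) * (x * y) = (x * y) * (x + y).
  rewrite mulrDl mulrDr !mulrA; congr (_ + _); last by rewrite xy.
  by rewrite -!mulrA xy.
apply: (@fsub_trans _ _ _ _ _ (two (x + y) (x * y * (x + y)))).
  apply: fsub_two; first exact: csub_refl.
  apply: csub_trans (csub_square pxy) _.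
  apply: (@csub_uleZ N[y]) => //; first by apply: upos_mulC.
  rewrite scalerAr; apply: ule_mulC => //.
  - apply: (@ule_trans _ _ (N[y] *: x)).
      have -> : x * y = y * x by [].
      have := @ule_mulC y N[y]%:A x (ule_norm sy) px; rewrite mulr_algr mulr_algl xy; exact.
    rewrite scalerDr; apply: ule_addr; exact: uposZ.
  - by rewrite -scalerAl -scalerAr cs.
apply: (@fsub_two_exact _ _ _ _ 1 1 y (- x)) => //.
- by rewrite s1 !mul1r !mulr1.
- rewrite ustarN [x^*u]sx [y^*u]sy.
  transitivity (y * x * y + x * y * x); first by ncring.
  by rewrite -xy mulrDr addrC; congr (_ + _); rewrite -!mulrA xy.
- by rewrite s1 !mul1r mulrN xy subrr.
Qed.

(** The columns [(x, 1)] and [(y, - 1)] turn [diag(s, x y s)], with [s = x + y], into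
    [diag(x s^2, y s^2)], and [x <~ x^3 <= x s^2], likewise for [y]. *)
Lemma fsub_modular2 x y : upos x -> upos y -> x * y = y * x ->
  fsub (two x y) (two (x + y) (x * y)).
Proof.
move=> px py xy; have [sx sy] := (upos_sa px, upos_sa py).
have s1 : 1^*u = 1 :> U := ustar1 U.
have pxy := upos_mulC px py xy; pose s := x + y; have ps : upos s := uposD px py.
have xs : x * s = s * x by rewrite /s mulrDl mulrDr xy.
have ys : y * s = s * y by rewrite /s mulrDl mulrDr xy.
have cs : s * (x * y) = (x * y) * s by rewrite mulrA -xs -mulrA -ys mulrA.
have H z : upos z -> ule z s -> z * s = s * z -> csub z (z * (s * s)).
  move=> pz zs zC; apply: csub_trans (csub_cube pz) _; apply: ule_csub.
    rewrite -mulrA; apply: upos_mulC => //; last by rewrite mulrA.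
    by apply: upos_sqr; apply: upos_sa.
  rewrite -mulrA; apply: ule_mulC => //; rewrite ?mulrA//.
    apply: (@ule_trans _ _ (z * s)); first by apply: ule_mulC.
    by rewrite zC; apply: ule_mulC.
  by rewrite zC -!mulrA zC.
apply: (@fsub_trans _ _ _ _ _ (two (x * (s * s)) (y * (s * s)))).
  apply: fsub_two; apply: H => //; first exact: ule_addr.
  by rewrite /s addrC; apply: ule_addr.
apply: (@fsub_trans _ _ _ _ _ (two s (x * y * s))); last first.
  by apply: fsub_two; [exact: csub_refl|apply: csub_mulC].
have sm : sa (x * y * s) by apply: saM; [exact: upos_sa|exact: upos_sa|].
apply: (@fsub_two_exact _ _ _ _ x 1 y (- 1)) => //; first exact: upos_sa.
- rewrite [x^*u]sx s1 mul1r mulr1.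
  transitivity (x * (s * x) + x * (y * s)); first by ncring.
  by rewrite -xs -mulrDr -mulrDl.
- rewrite [y^*u]sy ustarN s1 mulrN1 mulN1r opprK.
  transitivity (y * (s * y) + (x * y) * s); first by ncring.
  by rewrite -ys xy -mulrA -mulrDr -mulrDl [y + x]addrC.
- rewrite [x^*u]sx s1 mul1r mulrN1 -mulrA -ys mulrA; exact: subrr.
Qed.

End Commuting.

Lemma sum_nat_split (R : zmodType) (F : nat -> R) m n :
  \sum_(0 <= k < m + n) F k = \sum_(0 <= k < m) F k + \sum_(0 <= k < n) F (k + m)%N.
Proof.
rewrite (big_cat_nat (n := m)) ?leq_addr//=; congr (_ + _).
by rewrite -{1}[m]add0n big_addn addKn.
Qed.

(* [Pd] plays the role of the positive part of the Pedersen ideal: the cuts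
   [ucut t a], [0 < t], of the elements of [Kd] belong to it. *)
Section FromDimension.
Variables (R : realType) (U : ucstarType R) (Pd : U -> Prop) (d : U -> R).
Hypothesis Pd_upos : forall a, Pd a -> upos a.
Hypothesis Pd_csub : forall a b, Pd b -> upos a -> csub a b -> Pd a.
Hypothesis PdD : forall a b, Pd a -> Pd b -> Pd (a + b).
Hypothesis Pd0 : Pd 0.
Hypothesis d0 : d 0 = 0.
Hypothesis d_two : forall x y z w, upos x -> upos y -> Pd z -> Pd w ->
  fsub (two x y) (two z w) -> d x + d y <= d z + d w.
Implicit Types (x y z a b c q : U).

Lemma d_mono a b : upos a -> Pd b -> csub a b -> d a <= d b.
Proof.
move=> pa pb ab; have := @d_two a 0 b 0 pa (upos0 U) pb Pd0.
by rewrite d0 !addr0; apply; apply: fsub_two => //; apply: csub_refl.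
Qed.

Lemma d_ge0 a : Pd a -> 0 <= d a.
Proof. by move=> pa; rewrite -d0; apply: d_mono => //; [exact: upos0|exact: csub0]. Qed.

(** For commuting positive elements [d] behaves as a measure of open supports: a sum is supported on
    the union, a product on the intersection. All estimates below on Riemann sums have this
    reading. *)
Lemma d_modular x y : Pd x -> Pd y -> x * y = y * x -> d (x + y) + d (x * y) = d x + d y.
Proof.
move=> Px Py xy; have [px py] := (Pd_upos Px, Pd_upos Py).
have pxy := upos_mulC px py xy; have pD := uposD px py.
have Pxy : Pd (x * y) by apply: Pd_csub Px pxy _; apply: csub_mulC.
apply/eqP; rewrite eq_le; apply/andP; split.
  by apply: d_two => //; apply: fsub_modular1.
by apply: d_two => //; [exact: PdD|apply: fsub_modular2].
Qed.

Lemma d_sub x y : Pd x -> Pd y -> d (x + y) <= d x + d y.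
Proof.
move=> Px Py; have [px py] := (Pd_upos Px, Pd_upos Py).
have := @d_two (x + y) 0 x y (uposD px py) (upos0 U) Px Py.
rewrite d0 addr0; apply.
apply: fsub_trans (fsub_sum2 x y) => e e0.
exists (fun k i => match i with inl _ => 1 | inr _ => 0 end).
have s1 : 1^*u = 1 :> U := ustar1 U.
by move=> [[]|[]] [[]|[]]; rewrite big_const card_unit /= ?ustar0 ?s1 ?addr0 ?mul1r ?mulr1 ?mul0r ?mulr0 ?subrr unorm0.
Qed.

Definition Kd a := upos a /\ forall t : R, 0 < t -> Pd (ucut t a).

Lemma Kd_Pd a : Pd a -> Kd a.
Proof.
move=> Pa; have pa := Pd_upos Pa; split => // t t0.
apply: Pd_csub Pa (ucut_upos _ (upos_sa pa)) _; apply: csub_cut_le => //; exact: ltW.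
Qed.

Lemma ule_cutA t a : upos a -> ule a (ucut t a + t%:A).
Proof.
move=> pa; have sx := upos_sa pa.
rewrite -{1}(fc_id sx) -(fc_cst t sx) /ucut -fcD//; try tpapp.
apply: fc_ule => //; try tpapp; move=> s _; rewrite /cut.
by case: (leP (s - t) 0) => ?; lra.
Qed.

Lemma ule_ucut s t a b : upos a -> upos b -> 0 <= s -> ule a (b + s%:A) ->
  csub (ucut (t + s) a) (ucut t b).
Proof.
move=> pa pb s0 ab; apply: ule_cut_csub; first exact: upos_sa.
  by apply: ucut_upos; apply: upos_sa.
apply: ule_trans ab _; rewrite scalerDl addrA; apply: uleD; last exact: ule_refl.
exact: ule_cutA.
Qed.

Lemma KdD a b : Kd a -> Kd b -> Kd (a + b).
Proof.
move=> [pa Ka] [pb Kb]; split=> [|t t0]; first exact: uposD.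
have t2 := half_gt0 t0.
apply: Pd_csub (PdD (Ka _ t2) (Kb _ t2)) _ _.
  by apply: ucut_upos; apply: upos_sa; apply: uposD.
apply: ule_cut_csub; first by apply: upos_sa; apply: uposD.
  by apply: uposD; apply: ucut_upos; apply: upos_sa.
have -> : (t%:A : U) = (t / 2)%:A + (t / 2)%:A by rewrite -scalerDl; congr (_ *: _); field.
by rewrite addrACA; apply: uleD; apply: ule_cutA.
Qed.

Lemma Kd_le a b : upos a -> ule a b -> Kd b -> Kd a.
Proof.
move=> pa ab [pb Kb]; split=> // t t0.
apply: Pd_csub (Kb t t0) _ _; first by apply: ucut_upos; apply: upos_sa.
by have := @ule_ucut 0 t a b pa pb (lexx _); rewrite scale0r !addr0; apply.
Qed.

(* [Sn h a n] is a lower Riemann sum of the integral of [d (ucut t a)] over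
   [0 < t], and [Td a] is the value of that integral. *)
Definition Sn (h : R) a n : R := h * \sum_(0 <= k < n) d (ucut (k.+1%:R * h) a).

Definition Td a : \bar R :=
  ereal_sup [set r | exists h n, 0 < h /\ r = (Sn h a n)%:E].

Lemma Kd_grid h a k : 0 < h -> Kd a -> Pd (ucut (k.+1%:R * h) a).
Proof. by move=> h0 [_]; apply; rewrite mulr_gt0. Qed.

Lemma Sn_ge0 h a n : 0 < h -> Kd a -> 0 <= Sn h a n.
Proof.
move=> h0 Ka; rewrite /Sn mulr_ge0 ?(ltW h0)//; apply: sumr_ge0 => k _.
exact/d_ge0/Kd_grid.
Qed.

Lemma Sn_le_Td h a n : 0 < h -> ((Sn h a n)%:E <= Td a)%E.
Proof. by move=> h0; apply: ereal_sup_ubound; exists h, n. Qed.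

Lemma Td_le a (c : \bar R) : (forall h n, 0 < h -> ((Sn h a n)%:E <= c)%E) -> (Td a <= c)%E.
Proof. by move=> H; apply: ge_ereal_sup => _ [h [n [h0 ->]]]; apply: H. Qed.

Lemma Td_gt a (c : \bar R) : (c < Td a)%E -> exists h n, 0 < h /\ (c < (Sn h a n)%:E)%E.
Proof. by move=> /ereal_sup_gt [_ [h [n [h0 ->]]] H]; exists h, n. Qed.

Lemma Td_ge0 a : (0 <= Td a)%E.
Proof. by have := @Sn_le_Td 1 a 0 ltr01; rewrite /Sn big_geq// mulr0. Qed.

Lemma Sn_mono_n h a m n : 0 < h -> Kd a -> (m <= n)%N -> Sn h a m <= Sn h a n.
Proof.
move=> h0 Ka mn; rewrite /Sn ler_pM2l// [leRHS](big_cat_nat (n := m))//= lerDl.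
apply: sumr_ge0 => k _; exact/d_ge0/Kd_grid.
Qed.

Lemma Sn_sub h a b n : 0 < h -> Kd a -> Kd b ->
  (forall t, 0 < t -> csub (ucut t a) (ucut t b)) -> Sn h a n <= Sn h b n.
Proof.
move=> h0 Ka Kb H; rewrite /Sn ler_pM2l//; apply: ler_sum => k _; apply: d_mono.
- by apply: ucut_upos; apply: upos_sa; case: Ka.
- exact: Kd_grid.
- by apply: H; rewrite mulr_gt0.
Qed.

Lemma Td_sub a b : Kd a -> Kd b ->
  (forall t, 0 < t -> csub (ucut t a) (ucut t b)) -> (Td a <= Td b)%E.
Proof.
move=> Ka Kb H; apply: Td_le => h n h0; apply: le_trans (Sn_le_Td b n h0).
by rewrite lee_fin; apply: Sn_sub.
Qed.

Lemma Td_mono a b : upos a -> Kd b -> ule a b -> (Td a <= Td b)%E.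
Proof.
move=> pa Kb ab; apply: Td_sub => // [|t t0]; first exact: Kd_le ab Kb.
have := @ule_ucut 0 t a b pa Kb.1 (lexx _); rewrite scale0r !addr0; exact.
Qed.

(** Each interval of length [h1] receives [L = floor(h1 / h)] points of the finer grid, at which the
    decreasing integrand is at least its value at the right end point. What is lost is less than one
    mesh [h] out of [h1]. *)
Lemma Sn_refine h h1 a n1 : 0 < h -> h <= h1 -> Kd a ->
  exists n, (1 - h / h1) * Sn h1 a n1 <= Sn h a n.
Proof.
move=> h0 hh Ka; have h10 : 0 < h1 by lra.
pose L := Num.truncn (h1 / h).
have /andP[L1 L2] : L%:R <= h1 / h < L.+1%:R.
  by apply: truncn_itv; rewrite divr_ge0// ltW.
rewrite ler_pdivlMr// in L1; rewrite ltr_pdivrMr// in L2.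
exists (n1 * L)%N.
have E : L%:R * \sum_(0 <= k < n1) d (ucut (k.+1%:R * h1) a) <=
    \sum_(0 <= k < n1 * L) d (ucut (k.+1%:R * h) a).
  elim: n1 => [|n IH]; first by rewrite mul0n !big_geq// mulr0.
  rewrite big_nat_recr//= mulrDr mulSn addnC.
  rewrite [leRHS](big_cat_nat (n := (n * L)%N)) ?leq_addr//=.
  apply: lerD => //.
  rewrite -{1}[(n * L)%N]add0n big_addn addKn.
  rewrite mulr_natl -[L in X in X <= _]subn0 -sumr_const_nat.
  apply: ler_sum_nat => k /andP[_ kL].
  apply: d_mono; [|exact: Kd_grid|].
    by apply: ucut_upos; apply: upos_sa; case: Ka.
  apply: csub_cut_mono; last by apply: upos_sa; case: Ka.
  have : ((k + n * L).+1%:R : R) <= n.+1%:R * L%:R.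
    by rewrite -natrM ler_nat mulSn addnC -addnS addnC leq_add2r.
  move=> kn; apply: le_trans (_ : _ <= n.+1%:R * L%:R * h) _.
    by rewrite ler_pM2r.
  by rewrite -mulrA ler_pM2l ?ltr0n.
rewrite /Sn; set A := \sum_(0 <= k < n1) _ in E *; set B := \sum_(0 <= k < n1 * L) _ in E *.
have A0 : 0 <= A by apply: sumr_ge0 => k _; apply/d_ge0/Kd_grid.
have -> : (1 - h / h1) * (h1 * A) = (h1 - h) * A by field; exact: lt0r_neq0.
apply: le_trans (_ : _ <= h * (L%:R * A)) _; last by rewrite ler_pM2l.
rewrite mulrA ler_wpM2r//; move: L2; rewrite -natr1; lra.
Qed.

(** Meshes that subdivide a fixed [h] suffice to approach the integral; in the proof of additivity
    this [h] is the height of a slice. *)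
Lemma Sn_mesh h h1 a n1 e e' : 0 < h -> 0 < h1 -> 0 < e -> 0 < e' -> Kd a ->
  exists m n, h / m.+1%:R <= e' /\ Sn h1 a n1 - e <= Sn (h / m.+1%:R) a n.
Proof.
move=> h0 h10 e0 e0' Ka; have S0 := Sn_ge0 n1 h10 Ka.
have [m Hm] := @inv_small R h (Num.min e' (Num.min h1 (e * h1 / (Sn h1 a n1 + 1))))
  ltac:(by rewrite !lt_min h10 e0' divr_gt0 ?mulr_gt0//; lra).
move: Hm; rewrite !le_min => /andP[m0 /andP[m1 m2]].
have hm : 0 < h / m.+1%:R by rewrite divr_gt0.
have [n Hn] := Sn_refine n1 hm m1 Ka; exists m, n; split => //; apply: le_trans Hn.
rewrite ler_pdivlMr in m2; last lra.
have : h / m.+1%:R / h1 * (Sn h1 a n1 + 1) <= e.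
  by rewrite mulrAC ler_pdivrMr.
have : 0 <= h / m.+1%:R / h1 by rewrite (divr_ge0 (ltW hm) (ltW h10)).
rewrite mulrBl mul1r; set u := h / m.+1%:R / h1; nra.
Qed.

Lemma Td_le_mesh h a (c : \bar R) : 0 < h -> Kd a ->
  (forall m n, ((Sn (h / m.+1%:R) a n)%:E <= c)%E) -> (Td a <= c)%E.
Proof.
move=> h0 Ka H; apply: Td_le => h1 n1 h10.
apply/lee_addgt0Pr => e e0; have [m [n [_ Hmn]]] := Sn_mesh n1 h0 h10 e0 e0 Ka.
apply: le_trans (leeD2r e%:E (H m n)); rewrite -EFinD lee_fin; lra.
Qed.

Lemma Td_le_add z z0 w : upos z -> Kd z0 -> Pd w -> ule z (z0 + w) ->
  (Td z <= Td z0 + (N[z] * d w)%:E)%E.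
Proof.
move=> pz Kz0 Pw zz; have Kz : Kd z by apply: Kd_le zz (KdD Kz0 (Kd_Pd Pw)).
apply: Td_le => h n h0; apply: le_trans (leeD2r _ (Sn_le_Td z0 n h0)).
rewrite -EFinD lee_fin /Sn.
have H k : d (ucut (k.+1%:R * h) z) <= d (ucut (k.+1%:R * h) z0) +
    (if k.+1%:R * h < N[z] then d w else 0).
  have t0 : 0 < k.+1%:R * h by rewrite mulr_gt0.
  case: ltP => hk.
    apply: le_trans (d_sub (Kz0.2 _ t0) Pw); apply: d_mono.
    - by apply: ucut_upos; apply: upos_sa.
    - by apply: PdD => //; apply: Kz0.2.
    apply: ule_cut_csub; first exact: upos_sa.
      by apply: uposD; [apply: ucut_upos; apply: upos_sa; case: Kz0|exact: Pd_upos].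
    apply: ule_trans zz _; rewrite addrAC; apply: uleD; last exact: ule_refl.
    by apply: ule_cutA; case: Kz0.
  rewrite addr0 ucut_eq0 ?d0; [exact/d_ge0/Kz0.2|exact: upos_sa|].
  by apply: ule_normA => //; apply: upos_sa.
apply: le_trans (_ : _ <= h * \sum_(0 <= k < n) (d (ucut (k.+1%:R * h) z0) +
    (if k.+1%:R * h < N[z] then d w else 0))) _.
  by rewrite ler_pM2l//; apply: ler_sum.
rewrite big_split /= mulrDr lerD2l.
have dw0 := d_ge0 Pw.
(* At most [N[z] / h] grid points lie below [N[z]]; taking the minimum with [n h] makes the
   induction on [n] go through. *)
suff : h * \sum_(0 <= k < n) (if k.+1%:R * h < N[z] then d w else 0) <= Num.min (n%:R * h) N[z] * d w.
  by move/le_trans; apply; apply: ler_wpM2r => //; rewrite ge_min lexx orbT.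
elim: n => [|m IH]; first by rewrite big_geq// mulr0 mul0r (min_idPl (unorm_ge0 _)) mul0r.
rewrite big_nat_recr//= mulrDr; case: ltP => hm.
  have h1 : m%:R * h <= N[z] by move: hm; rewrite -natr1; lra.
  rewrite (min_idPl h1) in IH; rewrite -natr1; nra.
rewrite mulr0 addr0; apply: le_trans IH _; apply: ler_wpM2r => //.
by rewrite ge_min lexx orbT.
Qed.

Lemma Td0 : Td 0 = 0%E.
Proof.
apply/eqP; rewrite eq_le Td_ge0 andbT; apply: Td_le => h n h0; rewrite lee_fin /Sn.
rewrite big1 ?mulr0// => k _; rewrite ucut_eq0 ?d0//; first exact: sa0.
by apply/(ule_pos _).1/uposA; rewrite mulr_ge0// ltW.
Qed.

Lemma Td_Pd a : Pd a -> (Td a <= (N[a] * d a)%:E)%E.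
Proof.
move=> Pa; have := @Td_le_add a 0 a (Pd_upos Pa) (Kd_Pd Pd0) Pa.
rewrite Td0 add0e add0r; apply; exact: ule_refl.
Qed.

Lemma ucutZ t (c : R) a : 0 < c -> sa a -> ucut t (c *: a) = c *: ucut (t / c) a.
Proof.
move=> c0 sx; have -> : c *: a = fc (fun s => c * s) a by rewrite fcZ ?fc_id//; tpapp.
rewrite /ucut -fc_comp -?fcZ//; try tpapp; apply: fc_ext => //; try tpapp.
move=> s _; rewrite /cut maxr_pMr ?(ltW c0)// mulr0; congr Num.max.
by field; exact: lt0r_neq0.
Qed.

Lemma KdZ (c : R) a : 0 < c -> Kd a -> Kd (c *: a).
Proof.
move=> c0 [pa Ka]; split=> [|t t0]; first by apply: uposZ => //; apply: ltW.
rewrite ucutZ//; last exact: upos_sa.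
have Pt := Ka _ (divr_gt0 t0 c0); apply: Pd_csub (Pt) _ _.
  by apply: uposZ; [exact: ltW|exact: (Pd_upos Pt)].
exact/csubZ/ltW.
Qed.

Lemma dZ (c : R) a : 0 < c -> Pd a -> d (c *: a) = d a.
Proof.
move=> c0 Pa; have pa := Pd_upos Pa; have pc : upos (c *: a) by apply: uposZ => //; apply: ltW.
have Pc : Pd (c *: a) by apply: Pd_csub Pa pc _; apply/csubZ/ltW.
apply/eqP; rewrite eq_le; apply/andP; split; apply: d_mono => //; first exact/csubZ/ltW.
have := @csubZ _ _ c^-1 (c *: a); rewrite scalerA mulVf ?lt0r_neq0// scale1r.
by apply; rewrite invr_ge0 ltW.
Qed.

Lemma TdZ_le (c : R) a : 0 < c -> Kd a -> (Td (c *: a) <= c%:E * Td a)%E.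
Proof.
move=> c0 Ka; apply: Td_le => h n h0.
have hc : 0 < h / c by rewrite divr_gt0.
apply: le_trans (_ : _ <= c%:E * (Sn (h / c) a n)%:E)%E _; last first.
  by apply: lee_wpmul2l; [rewrite lee_fin ltW|apply: Sn_le_Td].
rewrite -EFinM lee_fin /Sn mulrA [c * (h / c)](_ : _ = h); last by field; exact: lt0r_neq0.
rewrite ler_pM2l//; apply: ler_sum => k _; rewrite ucutZ//; last exact: upos_sa Ka.1.
have t0 : 0 < k.+1%:R * h / c by rewrite divr_gt0 ?mulr_gt0.
rewrite -mulrA in t0 *; rewrite dZ//; exact: Ka.2.
Qed.

Lemma TdZ (c : R) a : 0 <= c -> Kd a -> Td (c *: a) = (c%:E * Td a)%E.
Proof.
rewrite le_eqVlt => /orP[/eqP <- _|c0 Ka]; first by rewrite scale0r Td0 mul0e.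
apply/eqP; rewrite eq_le TdZ_le//=.
have := @TdZ_le c^-1 (c *: a) _ (KdZ c0 Ka); rewrite invr_gt0 => /(_ c0).
rewrite scalerA mulVf ?lt0r_neq0// scale1r => /(@lee_wpmul2l _ c%:E _).
rewrite lee_fin => /(_ (ltW c0)); rewrite muleA -EFinM mulfV ?lt0r_neq0// mul1e; exact.
Qed.

(** Scaling the grid by some [r < 1] leaves a gap of at least [(1 - r) h] below each grid point,
    which absorbs a perturbation of [a] of that size. The factor [r] is close enough to 1 to keep
    the Riemann sum above [c]. *)
Lemma Td_lsc a (c : \bar R) : Kd a -> (c < Td a)%E -> exists2 e : R, 0 < e &
  forall a', Kd a' -> N[a - a'] <= e -> (c < Td a')%E.
Proof.
move=> Ka /Td_gt [h [n [h0 cS]]].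
have [r [r0 r1 cr]] : exists r : R, [/\ 0 < r, r < 1 & (c < (r * Sn h a n)%:E)%E].
  have S0 := Sn_ge0 n h0 Ka.
  case: c cS => [c|//|_]; last by exists 2^-1; rewrite ltNyr invr_gt0 invf_lt1 ?ltr1n.
  rewrite lte_fin => cS.
  have [c0|c0] := ltP c 0.
    exists 2^-1; rewrite invr_gt0 invf_lt1 ?ltr1n// lte_fin; split => //; nra.
  have S1 : 0 < Sn h a n by lra.
  exists ((c + Sn h a n) / 2 / Sn h a n); split.
  - by rewrite !divr_gt0//; lra.
  - by rewrite ltr_pdivrMr// mul1r; lra.
  - by rewrite divfK ?lt0r_neq0// lte_fin; lra.
have h0' : 0 < r * h by rewrite mulr_gt0.
exists ((1 - r) * h); first by rewrite mulr_gt0//; lra.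
move=> a' Ka' aa; apply: lt_le_trans cr (le_trans _ (Sn_le_Td a' n h0')).
rewrite lee_fin /Sn mulrA ler_pM2l//; apply: ler_sum => k _; apply: d_mono.
- by apply: ucut_upos; apply: upos_sa; case: Ka.
- exact: Kd_grid.
apply: csub_trans (@ule_ucut ((1 - r) * h) (k.+1%:R * (r * h)) a a' Ka.1 Ka'.1 _ _).
- apply: csub_cut_mono; last exact: upos_sa Ka.1.
  have k1 : 1 <= k.+1%:R :> R by rewrite ler1n.
  have : 0 <= (1 - r) * h * (k.+1%:R - 1) by rewrite !mulr_ge0//; lra.
  by lra.
- by rewrite mulr_ge0//; lra.
- have saa : sa (a - a') by apply: saB; [exact: upos_sa Ka.1|exact: upos_sa Ka'.1].
  have := ule_normA saa aa; rewrite /ule opprB addrA; congr upos.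
  by rewrite [_%:A + a']addrC.
Qed.

Lemma comm_ucut t x y : sa y -> x * y = y * x -> x * ucut t y = ucut t y * x.
Proof. by move=> sy; apply: fc_comm => //; tpapp. Qed.

(** In terms of supports: where [b + eta q > t], either [b > t] or [q > 0]. The modular law turns
    this union into the inequality. *)
Lemma d_upper1 t eta b q : 0 < t <= eta -> Kd b -> Pd q -> q * b = b * q ->
  d (ucut t (b + eta *: q)) + d (q * ucut t b) <= d (ucut t b) + d q.
Proof.
move=> /andP[t0 te] Kb Pq qb; have [pb _] := Kb; have pq := Pd_upos Pq.
have e0 : 0 <= eta by lra.
have PA := Kb.2 t t0; set A := ucut t b in PA *.
have qA : q * A = A * q by apply: comm_ucut => //; apply: upos_sa.
rewrite qA -(d_modular PA Pq)// lerD2r; apply: d_mono; last 1 first.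
- apply: csub_trans (_ : csub (A + eta *: q) _); last first.
    apply: (@csub_uleZ _ _ (1 + eta)); first lra.
      by apply: uposD; [exact: Pd_upos|exact: uposZ].
    rewrite scalerDr; apply: uleD.
      rewrite scalerDl scale1r; apply: ule_addr; apply: uposZ => //; exact: Pd_upos.
    by rewrite scalerDl scale1r addrC; apply: ule_addr.
  apply: ule_cut_csub.
  + by apply: saD; [exact: upos_sa|apply: saZ; exact: upos_sa].
  + by apply: uposD; [exact: Pd_upos|exact: uposZ].
  + by rewrite addrAC; apply: uleD; [exact: ule_cutA|exact: ule_refl].
- by apply: ucut_upos; apply: saD; [exact: upos_sa|apply: saZ; exact: upos_sa].
- exact: PdD.
Qed.

Lemma ucut_le_comm (s t : R) b : s <= t -> sa b -> ule (ucut t b) (ucut s b).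
Proof.
move=> st sb; apply: fc_ule => //; try tpapp; move=> r _; rewrite /cut.
by case: (leP (r - t) 0) => ?; case: (leP (r - s) 0) => ?; lra.
Qed.

Lemma ucut_ge t b : sa b -> ule (b - t%:A) (ucut t b).
Proof.
move=> sb; rewrite -{1}(fc_id sb) -(fc_cst t sb) -fcB//; try tpapp.
apply: fc_ule => //; try tpapp; move=> r _; rewrite /cut.
by case: (leP (r - t) 0) => ?; lra.
Qed.

Lemma commA x (t : R) : x * t%:A = t%:A * x.
Proof. by rewrite mulr_algl mulr_algr. Qed.

(** For [t > eta] the bound [q <= 1] confines the enlargement of the support to the region
    [b > t - eta], so [q] is replaced by its product with [(b - (t - eta))_+]. *)
Lemma d_upper2 t eta b q : 0 <= eta -> eta < t -> Kd b -> Pd q -> ule q 1 -> q * b = b * q ->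
  d (ucut t (b + eta *: q)) + d (q * ucut t b) <= d (ucut t b) + d (q * ucut (t - eta) b).
Proof.
move=> e0 te Kb Pq q1 qb; have [pb _] := Kb; have pq := Pd_upos Pq.
have sb := upos_sa pb; have sq := upos_sa pq.
have t0 : 0 < t by lra.
have PA := Kb.2 t t0; have PC := Kb.2 (t - eta) ltac:(lra).
have AsC := @ucut_le_comm (t - eta) t b ltac:(lra) sb.
have bA := ucut_ge t sb; have bC := ucut_ge (t - eta) sb.
have bAc : b * ucut t b = ucut t b * b by apply: comm_ucut.
have bCc : b * ucut (t - eta) b = ucut (t - eta) b * b by apply: comm_ucut.
set A := ucut t b in PA AsC bA bAc *; set C := ucut (t - eta) b in PC AsC bC bCc *.
have Aq : A * q = q * A by apply/esym/comm_ucut.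
have Cq : C * q = q * C by apply/esym/comm_ucut.
have CA : C * A = A * C by apply: fc_commV => //; tpapp.
(* Oriented commutation relations that sort a product; the [commL] versions act inside a longer
   left-associated product. *)
pose R3 := (Aq, commL Aq, Cq, commL Cq, CA, commL CA).
have [pA pC] := (Pd_upos PA, Pd_upos PC).
have pB : upos (q * C) by apply: upos_mulC.
have PB : Pd (q * C) by apply: Pd_csub Pq pB _; apply: csub_mulC.
have AB : A * (q * C) = q * C * A by rewrite !mulrA !R3.
have pqA : upos (q * A) by apply: upos_mulC.
have h1 : d (q * A) <= d (A * (q * C)).
  apply: d_mono => //.
    by apply: Pd_csub PA _ _; [apply: upos_mulC|apply: csub_mulC].
  apply: csub_trans (csub_square pqA) _.
  have -> : q * A * (q * A) = (q * A * A) * q by rewrite !mulrA !R3.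
  apply: csub_trans (_ : csub _ (q * A * A)) _.
    by apply: csub_mulC => //; rewrite !mulrA !R3.
  have -> : A * (q * C) = (q * A) * C by rewrite !mulrA !R3.
  apply: ule_csub; first by apply: upos_mulC => //; rewrite !mulrA !R3.
  by apply: ule_mulC => //; rewrite !mulrA !R3.
rewrite -(d_modular PA PB)//; apply: lerD => //; apply: d_mono; last 1 first.
- apply: ule_cut_csub.
  + by apply: saD => //; apply: saZ.
  + exact: uposD.
  (* A convex combination with the weights [1 - q] and [q], each of whose two terms lies below the
     corresponding cut. *)
  have -> : b + eta *: q = (1 - q) * (b - t%:A) + q * (b - (t - eta)%:A) + t%:A.
    rewrite scalerBl; transitivity (b - q * t%:A + q * t%:A + q * eta%:A).
      by rewrite subrK mulr_algr.
    by ncring.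
  apply: uleD; last exact: ule_refl.
  apply: uleD; last by apply: ule_mulC; rewrite // ?mulrBr ?mulrBl ?commA ?qb ?R3.
  apply: (@ule_trans _ _ ((1 - q) * A)).
    have H z : z * q = q * z -> (1 - q) * z = z * (1 - q).
      by move=> zq; rewrite mulrBl mulrBr mul1r mulr1 zq.
    by apply: ule_mulC => //; apply: H; rewrite // mulrBl mulrBr commA qb.
  rewrite mulrBl mul1r /ule opprB addrC subrK; exact: upos_mulC.
- by apply: ucut_upos; apply: saD => //; apply: saZ.
- exact: PdD.
Qed.

(* A common lower bound: [A^3 + y <= A (w - t) A + v (w - t) v <= (A^2 + v^2) w_+]. *)
Lemma csub_lower t b w v y : 0 < t -> upos b -> upos w -> ule b w -> upos v ->
  b * w = w * b -> v * w = w * v -> ule y (v * (w - t%:A) * v) -> upos y ->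
  csub (ucut t b * ucut t b * ucut t b + y) (ucut t w).
Proof.
move=> t0 pb pw bw pv bwc vw yv py.
have [sb [sw sv]] := (upos_sa pb, (upos_sa pw, upos_sa pv)).
have wW := ucut_ge t sw; set W := ucut t w in wW *.
have pW : upos W by apply: ucut_upos.
have vW : v * W = W * v by apply: comm_ucut.
have Aw : ucut t b * w = w * ucut t b by apply/esym/comm_ucut.
have AW : ucut t b * W = W * ucut t b by apply: comm_ucut.
have pA : upos (ucut t b) by apply: ucut_upos.
have sA := upos_sa pA.
have A3 : ule (ucut t b * ucut t b * ucut t b) (ucut t b * (w - t%:A) * ucut t b).
  have -> : ucut t b * ucut t b * ucut t b = (ucut t b)^*u * (b - t%:A) * ucut t b.
    have -> : b - t%:A = fc (fun s => s - t) b by rewrite fcB ?fc_id ?fc_cst//; tpapp.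
    rewrite [(ucut t b)^*u]sA /ucut -!fcM//; try tpapp.
    apply: fc_ext => //; try tpapp; move=> s _; rewrite /cut.
    by case: (leP (s - t) 0) => ?; ring.
  rewrite [(ucut t b)^*u]sA; apply: ule_sand => //.
  rewrite /ule opprB addrA subrK; exact: bw.
apply: csub_trans (_ : csub _ (ucut t b * W * ucut t b + v * W * v)) _.
  apply: ule_csub.
    by apply: uposD => //; apply: upos_sand => //; apply: upos_sa.
  apply: uleD.
    by apply: ule_trans A3 _; apply: ule_sand.
  by apply: ule_trans yv _; apply: ule_sand.
have -> : ucut t b * W * ucut t b + v * W * v = W * (ucut t b * ucut t b + v * v).
  by rewrite AW vW; ncring.
apply: csub_mulC; first by apply: uposD; apply: upos_sqr.
by rewrite mulrDl mulrDr !mulrA !(AW, commL AW, vW, commL vW).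
Qed.

Lemma d_lower t b w v y r : 0 < t -> upos b -> Kd w -> ule b w -> upos v ->
  b * w = w * b -> v * w = w * v -> ule y (v * (w - t%:A) * v) -> Pd y -> upos r ->
  csub r y -> csub (ucut t b * ucut t b * ucut t b * y) (r * ucut t b) ->
  r * ucut t b = ucut t b * r ->
  ucut t b * y = y * ucut t b ->
  d (ucut t b) + d r <= d (ucut t w) + d (r * ucut t b).
Proof.
move=> t0 pb Kw bw pv bwc vw yv Py pr ry Ayr rA Ay.
have py := Pd_upos Py; have sb := upos_sa pb.
have Kb : Kd b by apply: Kd_le bw Kw.
have PA := Kb.2 t t0; set A := ucut t b in PA Ayr rA Ay *; have pA := Pd_upos PA.
have pA3 : upos (A * A * A).
  by apply: upos_sand => //; apply: upos_sa.
have PA3 : Pd (A * A * A).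
  apply: Pd_csub (PA) pA3 _; rewrite -mulrA; apply: csub_mulC.
    by apply: upos_sqr; apply: upos_sa.
  by rewrite mulrA.
have A3y : A * A * A * y = y * (A * A * A) by rewrite !mulrA !(Ay, commL Ay).
have := d_modular PA3 Py A3y.
have PrA : Pd (r * A).
  by apply: Pd_csub (PA) (upos_mulC pr pA rA) _; rewrite rA; apply: csub_mulC.
have h1 : d (A * A * A * y) <= d (r * A).
  by apply: d_mono => //; apply: upos_mulC.
have h2 : d A <= d (A * A * A) by apply: d_mono => //; apply: csub_cube.
have h3 : d r <= d y by apply: d_mono.
have h4 : d (A * A * A + y) <= d (ucut t w).
  apply: d_mono; [exact: uposD|exact: Kw.2|].
  exact: (csub_lower t0 pb Kw.1 bw pv).
lra.
Qed.

(** [q r = r] says that [q = 1] on the support of [r], so that there [b + eta q >= eta > t]. Hence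
    both [b > t] and [r > 0] imply [b + eta q > t]. *)
Lemma d_lower1 t eta b q r : 0 < t < eta -> Kd b -> Kd (b + eta *: q) -> upos q -> Pd r ->
  q * r = r -> q * b = b * q -> r * b = b * r ->
  d (ucut t b) + d r <= d (ucut t (b + eta *: q)) + d (r * ucut t b).
Proof.
move=> /andP[t0 te] Kb Kw pq Pr qr qb rb; have [pb _] := Kb; have pr := Pd_upos Pr.
have [sb [sq sr]] := (upos_sa pb, (upos_sa pq, upos_sa pr)).
have rq : r * q = r by rewrite -{1}[r]sr -{1}[q]sq -ustarM qr.
have k0 : 0 < eta - t by lra.
have rA : r * ucut t b = ucut t b * r by apply: comm_ucut.
have pA : upos (ucut t b) by apply: ucut_upos.
have prr : upos (r * r) by apply: upos_sqr.
have Prr : Pd ((eta - t) *: (r * r)).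
  apply: Pd_csub (Pr) (uposZ (ltW k0) prr) _.
  by apply: csub_trans (csubZ _ (ltW k0)) _; apply: csub_mulC.
apply: (d_lower (v := r) (y := (eta - t) *: (r * r))) => //.
- apply: ule_addr; apply: uposZ => //; lra.
- by rewrite mulrDl mulrDr -scalerAl -scalerAr qb.
- by rewrite mulrDl mulrDr -scalerAl -scalerAr rb qr rq.
- have -> : r * (b + eta *: q - t%:A) * r = r * b * r + (eta - t) *: (r * r).
    rewrite !mulrBr mulrDr mulrBl mulrDl -scalerAr rq -!scalerAl mulr_algr -scalerAl.
    by rewrite scalerBl addrA.
  rewrite /ule addrK; exact: upos_sand.
- apply: csub_trans (csub_square pr) _.
  have := @csubZ _ _ (eta - t)^-1 ((eta - t) *: (r * r)).
  rewrite scalerA mulVf ?lt0r_neq0// scale1r; apply; rewrite invr_ge0; exact: ltW.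
- set A := ucut t b in rA pA *.
  have -> : A * A * A * ((eta - t) *: (r * r)) = (r * A) * ((eta - t) *: (r * (A * A))).
    by rewrite -!scalerAr; congr (_ *: _); rewrite !mulrA !(rA, commL rA).
  apply: csub_mulC.
    apply: uposZ; first exact: ltW.
    apply: upos_mulC => //; first by apply: upos_sqr; apply: upos_sa.
    by rewrite !mulrA !(rA, commL rA).
  by rewrite -!scalerAr -!scalerAl; congr (_ *: _); rewrite !mulrA !(rA, commL rA).
- by rewrite -scalerAl -scalerAr; congr (_ *: _); rewrite !mulrA !(rA, commL rA).
Qed.

(** On the support of [r], where [q = 1], the condition [b > t - eta] already gives [b + eta q > t];
    accordingly [v] in [d_lower] is [r (b - (t - eta))_+]. *)
Lemma d_lower2 t eta b q r : 0 <= eta < t -> Kd b -> Kd (b + eta *: q) -> upos q -> Pd r ->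
  q * r = r -> q * b = b * q -> r * b = b * r ->
  d (ucut t b) + d (r * ucut (t - eta) b) <= d (ucut t (b + eta *: q)) + d (r * ucut t b).
Proof.
move=> /andP[e0 te] Kb Kw pq Pr qr qb rb; have [pb _] := Kb; have pr := Pd_upos Pr.
have [sb [sq sr]] := (upos_sa pb, (upos_sa pq, upos_sa pr)).
have rq : r * q = r by rewrite -{1}[r]sr -{1}[q]sq -ustarM qr.
have rA : r * ucut t b = ucut t b * r by apply: comm_ucut.
have pA : upos (ucut t b) by apply: ucut_upos.
have rC : r * ucut (t - eta) b = ucut (t - eta) b * r by apply: comm_ucut.
have pC : upos (ucut (t - eta) b) by apply: ucut_upos.
have CA : ucut (t - eta) b * ucut t b = ucut t b * ucut (t - eta) b.
  by apply: fc_commV => //; tpapp.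
have bC : b * ucut (t - eta) b = ucut (t - eta) b * b by apply: comm_ucut.
have qC : q * ucut (t - eta) b = ucut (t - eta) b * q by apply: comm_ucut.
have C3 : ucut (t - eta) b * (b - (t - eta)%:A) * ucut (t - eta) b =
    ucut (t - eta) b * ucut (t - eta) b * ucut (t - eta) b.
  have -> : b - (t - eta)%:A = fc (fun s => s - (t - eta)) b.
    by rewrite fcB ?fc_id ?fc_cst//; tpapp.
  rewrite /ucut -!fcM//; try tpapp.
  apply: fc_ext => //; try tpapp; move=> s _; rewrite /cut.
  by case: (leP (s - (t - eta)) 0) => ?; ring.
set C := ucut (t - eta) b in rC pC CA bC qC C3 *; set A := ucut t b in rA pA CA *.
have prC : upos (r * C) by apply: upos_mulC.
pose R3 := (rA, commL rA, rC, commL rC, CA, commL CA).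
have PrC : Pd (r * C) by apply: Pd_csub (Pr) prC _; apply: csub_mulC.
have PrA : Pd (r * A) by apply: Pd_csub (Pr) (upos_mulC pr pA rA) _; apply: csub_mulC.
pose y := r * r * (C * C * C).
have pC3 : upos (C * C * C) by apply: upos_sand => //; apply: upos_sa.
have py : upos y by apply: upos_mulC => //; [exact: upos_sqr|rewrite !mulrA !R3].
have Py : Pd y.
  apply: Pd_csub (Pr) py _; rewrite /y -mulrA; apply: csub_mulC.
    by apply: upos_mulC => //; rewrite !mulrA !R3.
  by rewrite !mulrA !R3.
apply: le_trans (_ : _ <= d (ucut t (b + eta *: q)) + d (r * C * A)) _; last first.
  rewrite lerD2l; apply: d_mono => //.
    by apply: upos_mulC => //; rewrite !mulrA !R3.
  have -> : r * C * A = r * A * C by rewrite !R3.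
  by apply: csub_mulC => //; rewrite !mulrA !R3.
have wb : b * (b + eta *: q) = (b + eta *: q) * b.
  by rewrite mulrDl mulrDr -scalerAl -scalerAr qb.
apply: (d_lower (v := r * C) (y := y)) => //; first lra.
- by apply: ule_addr; apply: uposZ.
- rewrite mulrDl mulrDr -scalerAl -scalerAr; congr (_ + _ *: _).
    by rewrite -mulrA -bC !mulrA rb.
  by rewrite -mulrA -qC !mulrA rq qr.
- have -> : r * C * (b + eta *: q - t%:A) * (r * C) = y; last exact: ule_refl.
  have E : r * (b + eta *: q - t%:A) = r * (b - (t - eta)%:A).
    rewrite !mulrBr mulrDr -scalerAr rq !mulr_algr scalerBl opprB addrA.
    by rewrite addrAC.
  have rM : r * (b - (t - eta)%:A) = (b - (t - eta)%:A) * r.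
    by rewrite mulrBl mulrBr commA rb.
  have -> : r * C * (b + eta *: q - t%:A) * (r * C) = C * (r * (b + eta *: q - t%:A)) * (r * C).
    by rewrite rC !mulrA.
  rewrite E rM -!mulrA rC (mulrA r C) rC -(mulrA C) !mulrA C3 /y !mulrA !R3.
  by [].
- apply: csub_trans (csub_cube prC) _.
  have -> : r * C * (r * C) * (r * C) = y * r by rewrite /y !mulrA !R3.
  by apply: csub_mulC => //; rewrite /y !mulrA !R3.
- have -> : A * A * A * y = r * C * A * (A * A * (r * (C * C))).
    by rewrite /y !mulrA !R3.
  apply: csub_mulC; last by rewrite !mulrA !R3.
  apply: upos_mulC; [by apply: upos_sqr; apply: upos_sa| |by rewrite !mulrA !R3].
  by apply: upos_mulC => //; [apply: upos_sqr; apply: upos_sa|rewrite !mulrA !R3].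
- by rewrite !mulrA !R3.
- by rewrite /y !mulrA !R3.
Qed.

(* Adding to [b] a slice [eta *: q] of [a] changes the Riemann sums of [b] by
   [eta * d q] up to an error proportional to the mesh; summed over the slices of
   [a], this gives additivity on commuting elements. *)
Lemma Sn_upper eta b q m n : 0 < eta -> Kd b -> Pd q -> ule q 1 -> q * b = b * q ->
  Sn (eta / m.+1%:R) (b + eta *: q) (m.+1 + n) <= Sn (eta / m.+1%:R) b (m.+1 + n) + eta * d q.
Proof.
move=> e0 Kb Pq q1 qb; set h := eta / _; have h0 : 0 < h by rewrite divr_gt0.
have hE : m.+1%:R * h = eta by rewrite mulrC divfK// pnatr_eq0.
pose G k := d (q * ucut (k.+1%:R * h) b).
have G0 k : 0 <= G k.
  have t0 : 0 < k.+1%:R * h by rewrite mulr_gt0.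
  have PA := Kb.2 _ t0.
  have c : q * ucut (k.+1%:R * h) b = ucut (k.+1%:R * h) b * q.
    by apply: comm_ucut => //; exact: upos_sa Kb.1.
  apply: d_ge0; apply: Pd_csub (Pq) (upos_mulC (Pd_upos Pq) (Pd_upos PA) c) _.
  by apply: csub_mulC => //; apply: Pd_upos.
have H1 k : (k < m.+1)%N -> d (ucut (k.+1%:R * h) (b + eta *: q)) + G k <= d (ucut (k.+1%:R * h) b) + d q.
  move=> km; apply: d_upper1 => //; rewrite mulr_gt0//= -hE ler_pM2r// ler_nat//.
(* Since [eta] is [m.+1] mesh widths, lowering the threshold by [eta] shifts the index by [m.+1],
   and the correction terms [G] telescope. *)
have H2 k : d (ucut ((k + m.+1).+1%:R * h) (b + eta *: q)) + G (k + m.+1)%N <=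
    d (ucut ((k + m.+1).+1%:R * h) b) + G k.
  have E : (k + m.+1).+1%:R * h - eta = k.+1%:R * h by rewrite -hE -addSn natrD mulrDl addrK.
  rewrite /G -E; apply: d_upper2 => //; first exact: ltW.
  by rewrite -subr_gt0 E mulr_gt0.
have I1 : \sum_(0 <= k < m.+1) d (ucut (k.+1%:R * h) (b + eta *: q)) + \sum_(0 <= k < m.+1) G k <=
   \sum_(0 <= k < m.+1) d (ucut (k.+1%:R * h) b) + m.+1%:R * d q.
  rewrite -big_split /= mulr_natl -[X in _ <= _ + _ *+ X]subn0 -sumr_const_nat -big_split /=.
  by apply: ler_sum_nat => k /andP[_ km]; apply: H1.
have I2 : \sum_(0 <= k < n) d (ucut ((k + m.+1).+1%:R * h) (b + eta *: q)) +
     \sum_(0 <= k < n) G (k + m.+1)%N <=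
   \sum_(0 <= k < n) d (ucut ((k + m.+1).+1%:R * h) b) + \sum_(0 <= k < n) G k.
  by rewrite -!big_split /=; apply: ler_sum.
have I3 : \sum_(0 <= k < n) G k <= \sum_(0 <= k < m.+1) G k + \sum_(0 <= k < n) G (k + m.+1)%N.
  have -> : \sum_(0 <= k < m.+1) G k + \sum_(0 <= k < n) G (k + m.+1)%N =
      \sum_(0 <= k < m.+1 + n) G k.
    by rewrite sum_nat_split.
  rewrite [leRHS](big_cat_nat (n := n)) ?leq_addl//= lerDl; exact: sumr_ge0.
have S x : \sum_(0 <= k < m.+1 + n) d (ucut (k.+1%:R * h) x) =
    \sum_(0 <= k < m.+1) d (ucut (k.+1%:R * h) x) +
    \sum_(0 <= k < n) d (ucut ((k + m.+1).+1%:R * h) x).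
  exact: sum_nat_split.
have -> : eta * d q = h * (m.+1%:R * d q) by rewrite -{1}hE; ring.
rewrite /Sn !S -mulrDr ler_pM2l//; lra.
Qed.

Lemma Sn_lower eta b q r m n : 0 < eta -> Kd b -> Kd (b + eta *: q) -> upos q -> Pd r ->
  q * r = r -> q * b = b * q -> r * b = b * r ->
  N[b] <= n.+1%:R * (eta / m.+1%:R) ->
  Sn (eta / m.+1%:R) b (m.+1 + n) + (eta - eta / m.+1%:R) * d r <=
  Sn (eta / m.+1%:R) (b + eta *: q) (m.+1 + n).
Proof.
move=> e0 Kb Kw pq Pr qr qb rb; set h := eta / _; have h0 : 0 < h by rewrite divr_gt0.
move=> nb; have hE : m.+1%:R * h = eta by rewrite mulrC divfK// pnatr_eq0.
have sb := upos_sa Kb.1.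
pose G k := d (r * ucut (k.+1%:R * h) b).
(* Beyond the norm of [b] its cuts vanish, so the telescoping sum of the [G k] leaves no remainder
   at the upper end. *)
have Gn k : (n <= k)%N -> G k = 0.
  move=> nk; rewrite /G ucut_eq0 ?mulr0//; apply: ule_normA => //.
  by apply: le_trans nb _; rewrite ler_pM2r// ler_nat.
have H1 k : (k < m)%N -> d (ucut (k.+1%:R * h) b) + d r <= d (ucut (k.+1%:R * h) (b + eta *: q)) + G k.
  by move=> km; apply: d_lower1 => //; rewrite mulr_gt0//= -hE ltr_pM2r// ltr_nat.
have G0 k : 0 <= G k.
  have t0 : 0 < k.+1%:R * h by rewrite mulr_gt0.
  have PA := Kb.2 _ t0.
  have c : r * ucut (k.+1%:R * h) b = ucut (k.+1%:R * h) b * r by apply: comm_ucut.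
  apply: d_ge0; apply: Pd_csub (Pr) (upos_mulC (Pd_upos Pr) (Pd_upos PA) c) _.
  by apply: csub_mulC => //; apply: Pd_upos.
(* The grid point equal to [eta] violates the strict bound in [d_lower1]. Its summand [d r] is given
   up, whence the factor [eta - eta / m.+1] instead of [eta]. *)
have H3 : d (ucut (m.+1%:R * h) b) <= d (ucut (m.+1%:R * h) (b + eta *: q)) + G m.
  rewrite -[leLHS]addr0; apply: lerD => //; apply: d_mono; [exact: ucut_upos|exact: Kd_grid|].
  have bw : ule b (b + eta *: q) by apply: ule_addr; apply: uposZ => //; apply: ltW.
  have := @ule_ucut 0 (m.+1%:R * h) _ _ Kb.1 Kw.1 (lexx _); rewrite scale0r !addr0; exact.
have H2 k : d (ucut ((k + m.+1).+1%:R * h) b) + G k <=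
    d (ucut ((k + m.+1).+1%:R * h) (b + eta *: q)) + G (k + m.+1)%N.
  have E : (k + m.+1).+1%:R * h - eta = k.+1%:R * h by rewrite -hE -addSn natrD mulrDl addrK.
  rewrite /G -E; apply: d_lower2 => //; rewrite (ltW e0)/=.
  by rewrite -subr_gt0 E mulr_gt0.
have I1 : \sum_(0 <= k < m.+1) d (ucut (k.+1%:R * h) b) + m%:R * d r <=
    \sum_(0 <= k < m.+1) d (ucut (k.+1%:R * h) (b + eta *: q)) + \sum_(0 <= k < m.+1) G k.
  rewrite -big_split /= !big_nat_recr//= addrAC; apply: lerD => //.
  rewrite mulr_natl -[X in _ + _ *+ X <= _]subn0 -sumr_const_nat -big_split /=.
  by apply: ler_sum_nat => k /andP[_ km]; apply: H1.
have I2 : \sum_(0 <= k < n) d (ucut ((k + m.+1).+1%:R * h) b) + \sum_(0 <= k < n) G k <=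
   \sum_(0 <= k < n) d (ucut ((k + m.+1).+1%:R * h) (b + eta *: q)) +
   \sum_(0 <= k < n) G (k + m.+1)%N.
  by rewrite -!big_split /=; apply: ler_sum.
have I3 : \sum_(0 <= k < m.+1) G k + \sum_(0 <= k < n) G (k + m.+1)%N = \sum_(0 <= k < n) G k.
  have -> : \sum_(0 <= k < m.+1) G k + \sum_(0 <= k < n) G (k + m.+1)%N =
      \sum_(0 <= k < m.+1 + n) G k.
    by rewrite sum_nat_split.
  rewrite [LHS](big_cat_nat (n := n)) ?leq_addl//= [X in _ + X]big_nat_cond.
  by rewrite [X in _ + X]big1 ?addr0// => k /andP[/andP[nk _] _]; apply: Gn.
have S x : \sum_(0 <= k < m.+1 + n) d (ucut (k.+1%:R * h) x) =
    \sum_(0 <= k < m.+1) d (ucut (k.+1%:R * h) x) +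
    \sum_(0 <= k < n) d (ucut ((k + m.+1).+1%:R * h) x).
  exact: sum_nat_split.
have -> : (eta - h) * d r = h * (m%:R * d r) by rewrite -{1}hE -natr1; ring.
rewrite /Sn !S -mulrDr ler_pM2l//; lra.
Qed.

(** It rises linearly from 0 to 1 between [j eta] and [(j + 1) eta]: [eta] times the sum of the
    slices recovers [t >= 0], and each slice is 1 where the next one is nonzero. *)
Definition slice (eta : R) (j : nat) (t : R) := eta^-1 * Num.min eta (Num.max 0 (t - j%:R * eta)).

Lemma papp_slice eta j : papp (slice eta j).
Proof. by rewrite /slice; tpapp. Qed.
#[local] Hint Resolve papp_slice : papp.

Lemma slice_bounds eta j t : 0 < eta -> 0 <= slice eta j t <= 1.
Proof.
move=> e0; rewrite /slice; set u := Num.min _ _.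
have : 0 <= u <= eta by rewrite /u le_min le_max lexx ge_min lexx (ltW e0).
move=> /andP[u0 u1]; rewrite mulr_ge0 ?invr_ge0 ?(ltW e0)//=.
by rewrite mulrC ler_pdivrMr ?mul1r.
Qed.

Lemma slice_upos eta j a : 0 < eta -> upos a -> upos (fc (slice eta j) a).
Proof.
move=> e0 pa; apply: fc_upos => //; [tpapp|exact: upos_sa|].
by move=> t _; case/andP: (slice_bounds j t e0).
Qed.

Lemma slice_le1 eta j a : 0 < eta -> upos a -> ule (fc (slice eta j) a) 1.
Proof.
move=> e0 pa; have sx := upos_sa pa; rewrite -[X in ule _ X]scale1r -(fc_cst 1 sx).
apply: fc_ule => //; try tpapp.
by move=> t _; case/andP: (slice_bounds j t e0).
Qed.

Lemma slice_csub eta j a : 0 < eta -> upos a -> csub (fc (slice eta j) a) (ucut (j%:R * eta) a).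
Proof.
move=> e0 pa; apply: (csub_fc (C := eta^-1)) => //; try tpapp; first by rewrite invr_ge0 ltW.
move=> t _; case/andP: (slice_bounds j t e0) => -> _ /=.
rewrite /slice ler_pM2l ?invr_gt0// /cut maxC ge_min; apply/orP; right; exact: lexx.
Qed.

Lemma slice_next eta j a : 0 < eta -> upos a ->
  fc (slice eta j) a * ucut (j.+1%:R * eta) a = ucut (j.+1%:R * eta) a.
Proof.
move=> e0 pa; have sx := upos_sa pa; rewrite /ucut -fcM//; try tpapp.
apply: fc_ext => //; try tpapp; move=> t _; rewrite /cut /slice -natr1 mulrDl mul1r.
case: (leP (t - (j%:R * eta + eta)) 0) => ht; first by rewrite mulr0.
have h1 : 0 <= t - j%:R * eta by lra.
rewrite (max_idPr h1) (min_idPl _) ?mulVf ?mul1r ?lt0r_neq0//; lra.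
Qed.

Lemma slice_sum eta L a : 0 < eta -> upos a -> N[a] <= L%:R * eta ->
  eta *: \sum_(0 <= j < L) fc (slice eta j) a = a.
Proof.
move=> e0 pa aL; have sx := upos_sa pa.
have E n : eta *: \sum_(0 <= j < n) fc (slice eta j) a =
    fc (fun t => Num.min (Num.max 0 t) (n%:R * eta)) a.
  elim: n => [|n IH].
    rewrite big_geq// scaler0 -(scale0r 1) -(fc_cst 0 sx); apply: fc_ext => //; try tpapp.
    by move=> t _; rewrite mul0r; apply/esym/min_idPr; rewrite le_max lexx.
  rewrite big_nat_recr//= scalerDr IH -fcZ//; try tpapp.
  rewrite -fcD//; try tpapp; apply: fc_ext => //; try tpapp; move=> t _.
  rewrite /slice mulrA mulfV ?lt0r_neq0// mul1r -natr1 mulrDl mul1r.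
  have n0 : 0 <= n%:R * eta by rewrite mulr_ge0// ltW.
  set c := n%:R * eta in n0 *.
  case: (leP 0 t) => ht; case: (leP 0 (t - c)) => h1.
  - rewrite (min_idPr (_ : c <= t)); last lra.
    by case: (leP eta (t - c)) => h2; case: (leP t (c + eta)) => h3; lra.
  - rewrite (min_idPl (_ : t <= c)); last lra.
    rewrite (min_idPr (ltW e0)) (min_idPl (_ : t <= c + eta)); lra.
  - lra.
  - rewrite (min_idPl n0) (min_idPr (ltW e0)) (min_idPl (_ : 0 <= c + eta)); lra.
rewrite E -[RHS](fc_id sx); apply: fc_eq_pos => //; try tpapp.
move=> t /andP[t0 ta]; rewrite (max_idPr t0) (min_idPl _)//; lra.
Qed.

Lemma Td_fin a : Pd a -> Td a \is a fin_num.
Proof.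
move=> Pa; rewrite ge0_fin_numE ?Td_ge0//; apply: le_lt_trans (Td_Pd Pa) _.
exact: ltry.
Qed.

Lemma mesh_exists (eta x : R) : 0 < eta -> exists L, x <= L%:R * eta.
Proof.
move=> e0; exists (Num.truncn (`|x| / eta)).+1.
have := truncnS_gt (`|x| / eta); rewrite ltr_pdivrMr// => /ltW; apply: le_trans.
exact: ler_norm.
Qed.

(** Adding the slices [q_j] of [a] to [b] one at a time, [Sn_upper] bounds the Riemann sums of
    [a + b] by those of [b] plus [eta] times the sum of the [d q_j]. As [q_j] is below the cut of
    [a] at [j eta], this is a Riemann sum of [a] up to the term [j = 0], and [eta] is chosen so that
    [eta d(a) <= e]. *)
Lemma Td_add_le a b : Pd a -> Kd b -> a * b = b * a -> (Td (a + b)%R <= Td a + Td b)%E.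
Proof.
move=> Pa Kb ab; have pa := Pd_upos Pa; have sa_ := upos_sa pa.
apply/lee_addgt0Pr => e e0; have da := d_ge0 Pa.
pose eta := e / (d a + 1); have eta0 : 0 < eta by rewrite divr_gt0//; lra.
have ee : eta * d a <= e.
  by rewrite /eta mulrAC ler_pdivrMr; [nra|lra].
have [L0 HL0] := mesh_exists N[a] eta0; pose L := L0.+1.
have HL : N[a] <= L%:R * eta by rewrite /L -natr1; lra.
pose q j := fc (slice eta j) a; pose B i := b + eta *: \sum_(0 <= j < i) q j.
have Pq j : Pd (q j).
  apply: Pd_csub (Pa) (slice_upos j eta0 pa) _; apply: csub_trans (slice_csub j eta0 pa) _.
  by apply: csub_cut_le => //; rewrite mulr_ge0// ltW.
have BS i : B i.+1 = B i + eta *: q i by rewrite /B big_nat_recr//= scalerDr addrA.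
have B0 : B 0%N = b by rewrite /B big_geq// scaler0 addr0.
have KB i : Kd (B i).
  elim: i => [|i IH]; first by rewrite B0.
  by rewrite BS; apply: KdD => //; apply: KdZ => //; apply: Kd_Pd.
have qb j : q j * b = b * q j by apply/esym/fc_comm => //; tpapp.
have qB j i : q j * B i = B i * q j.
  elim: i => [|i IH]; first by rewrite B0.
  rewrite BS mulrDl mulrDr IH -scalerAl -scalerAr; congr (_ + _ *: _).
  by apply: fc_commV => //; tpapp.
have BL : B L = a + b by rewrite /B (slice_sum eta0 pa HL) addrC.
rewrite -BL; apply: (Td_le_mesh eta0) => // m n.
have hm : 0 < eta / m.+1%:R by rewrite divr_gt0.
have H i : Sn (eta / m.+1%:R) (B i) (m.+1 + n) <=
    Sn (eta / m.+1%:R) b (m.+1 + n) + eta * \sum_(0 <= j < i) d (q j).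
  elim: i => [|i IH]; first by rewrite B0 big_geq// mulr0 addr0.
  rewrite BS big_nat_recr//= mulrDr addrA.
  apply: le_trans (Sn_upper m n eta0 (KB i) (Pq i) (slice_le1 i eta0 pa) (qB i i)) _.
  by rewrite lerD2r.
apply: le_trans (_ : _ <= (Sn (eta / m.+1%:R) b (m.+1 + n) + (eta * d a + Sn eta a L0))%:E)%E _.
  rewrite lee_fin; apply: le_trans (Sn_mono_n hm (KB L) (leq_addl m.+1 n)) _.
  apply: le_trans (H L) _; rewrite lerD2l -mulrDr ler_pM2l// big_nat_recl//=; apply: lerD.
    apply: d_mono => //; first exact: slice_upos.
    apply: csub_trans (slice_csub 0 eta0 pa) _; rewrite mul0r ucut0//; exact: csub_refl.
  apply: ler_sum => j _; apply: d_mono; [exact: slice_upos|exact: Kd_grid (Kd_Pd Pa)|].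
  exact: slice_csub.
have h1 := Sn_le_Td b (m.+1 + n) hm; have h2 := Sn_le_Td a L0 eta0.
rewrite (_ : _ + (_ + _) = Sn eta a L0 + Sn (eta / m.+1%:R) b (m.+1 + n) + eta * d a); last by ring.
by rewrite !EFinD; apply: leeD; [exact: leeD|rewrite lee_fin].
Qed.

(** Finiteness of [Td a] allows the two suprema to be taken one after the other by subtraction. *)
Lemma Td_sup2 a b (X : \bar R) : Pd a -> (forall h1 n1 h2 n2, 0 < h1 -> 0 < h2 ->
  ((Sn h1 a n1 + Sn h2 b n2)%:E <= X)%E) -> (Td a + Td b <= X)%E.
Proof.
move=> Pa H; have H1 h1 n1 : 0 < h1 -> ((Sn h1 a n1)%:E + Td b <= X)%E.
  move=> h10; rewrite addeC -leeBrDr//; apply: Td_le => h2 n2 h20.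
  by rewrite leeBrDr// -EFinD addrC; apply: H.
case E : (Td b) => [y||].
- rewrite -leeBrDr//; apply: Td_le => h1 n1 h10; rewrite leeBrDr// -E; exact: H1.
- by have := H1 1 0%N ltr01; rewrite E addey// leye_eq => /eqP ->; rewrite leey.
- by have := Td_ge0 b; rewrite E.
Qed.

(** The element [r_j = (a - (j + 1) eta)_+] is supported where the slice [q_j] is 1, and [eta] times
    the sum of the [d r_j] is exactly a lower Riemann sum of [a]. The mesh [h] is fine enough for
    the losses [h d r_j] in [Sn_lower] to add up to at most [e]. *)
Lemma Td_add_ge a b : Pd a -> Kd b -> a * b = b * a -> (Td a + Td b <= Td (a + b)%R)%E.
Proof.
move=> Pa Kb ab; have pa := Pd_upos Pa; have sa_ := upos_sa pa.
apply: Td_sup2 => // eta n1 h2 n2 eta0 h20.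
apply/lee_addgt0Pr => e' e0'; pose e := e' / 2; have e0 : 0 < e := half_gt0 e0'.
pose q j := fc (slice eta j) a; pose r j := ucut (j.+1%:R * eta) a.
have Pr j : Pd (r j) by apply: Kd_grid => //; apply: Kd_Pd.
have S0 n : 0 <= \sum_(0 <= j < n) d (r j) by apply: sumr_ge0 => j _; apply: d_ge0.
have e1 : 0 < e / (\sum_(0 <= j < n1) d (r j) + 1) by rewrite divr_gt0//; have := S0 n1; lra.
have [m [n3 [hm1 Hm]]] := Sn_mesh n2 eta0 h20 e0 e1 Kb.
set h := eta / m.+1%:R in hm1 Hm.
have h0 : 0 < h by rewrite divr_gt0.
have [L1 HL1] := mesh_exists N[a] eta0; pose L := (L1 + n1)%N.
have HL : N[a] <= L%:R * eta.
  by rewrite /L natrD mulrDl; have : 0 <= n1%:R * eta by [rewrite mulr_ge0// ltW]; lra.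
have [n4 Hn4] := mesh_exists (N[a] + N[b]) h0; pose n := maxn n3 n4.
have Hn : N[a] + N[b] <= n.+1%:R * h.
  apply: le_trans Hn4 _; rewrite ler_pM2r// ler_nat; apply: leq_trans (leq_maxr n3 n4) (leqnSn _).
pose B i := b + eta *: \sum_(0 <= j < i) q j.
have pq j := slice_upos j eta0 pa.
have Pq j : Pd (q j).
  apply: Pd_csub (Pa) (pq j) _; apply: csub_trans (slice_csub j eta0 pa) _.
  by apply: csub_cut_le => //; rewrite mulr_ge0// ltW.
have BS i : B i.+1 = B i + eta *: q i by rewrite /B big_nat_recr//= scalerDr addrA.
have B0 : B 0%N = b by rewrite /B big_geq// scaler0 addr0.
have KB i : Kd (B i).
  elim: i => [|i IH]; first by rewrite B0.
  by rewrite BS; apply: KdD => //; apply: KdZ => //; apply: Kd_Pd.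
have BL : B L = a + b by rewrite /B (slice_sum eta0 pa HL) addrC.
have Bab i : (i <= L)%N -> N[B i] <= N[a] + N[b].
  move=> iL; apply: le_trans (unormD a b); rewrite -BL.
  apply: upos_norm_mono; first by case: (KB i).
  rewrite -(subnKC iL); elim: (L - i)%N => [|k IH]; first by rewrite addn0; apply: ule_refl.
  rewrite addnS BS; apply: ule_trans IH (ule_addr _ _); apply: uposZ; [exact: ltW|exact: pq].
have cB f i : papp f -> fc f a * B i = B i * fc f a.
  move=> Hf; elim: i => [|i IH]; first by rewrite B0; apply/esym/fc_comm.
  rewrite BS mulrDl mulrDr IH -scalerAl -scalerAr; congr (_ + _ *: _).
  by apply: fc_commV => //; tpapp.
have H i : (i <= L)%N -> Sn h b (m.+1 + n) + (eta - h) * \sum_(0 <= j < i) d (r j) <=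
    Sn h (B i) (m.+1 + n).
  elim: i => [|i IH] iL; first by rewrite B0 big_geq// mulr0 addr0.
  rewrite big_nat_recr//= mulrDr addrA BS.
  apply: le_trans (_ : _ <= Sn h (B i) (m.+1 + n) + (eta - h) * d (r i)) _.
    by rewrite lerD2r; apply: IH; apply: ltnW.
  apply: Sn_lower => //.
  - by rewrite -BS.
  - exact: pq.
  - exact: slice_next.
  - by apply: cB; tpapp.
  - by apply: cB; tpapp.
  - by apply: le_trans Hn; apply: Bab; apply: ltnW.
have hE : h <= eta by rewrite /h ler_pdivrMr ?ltr0n// ler_peMr ?(ltW eta0)// ler1n.
have := H L (leqnn L); rewrite BL => HLL.
have rL : \sum_(0 <= j < n1) d (r j) <= \sum_(0 <= j < L) d (r j).
  by rewrite /L addnC sum_nat_split lerDl; apply: sumr_ge0 => j _; apply: d_ge0.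
have he : h * \sum_(0 <= j < n1) d (r j) <= e.
  move: hm1; rewrite ler_pdivlMr; last by have := S0 n1; lra.
  by have := S0 n1; nra.
have bn : Sn h b n3 <= Sn h b (m.+1 + n).
  apply: Sn_mono_n => //; apply: leq_trans (leq_maxl n3 n4) (leq_addl _ _).
apply: le_trans (leeD2r e'%:E (Sn_le_Td (a + b)%R (m.+1 + n) h0)).
rewrite -EFinD lee_fin; have : Sn eta a n1 = eta * \sum_(0 <= j < n1) d (r j) by [].
move=> ->; have : (eta - h) * \sum_(0 <= j < n1) d (r j) <= (eta - h) * \sum_(0 <= j < L) d (r j).
  by rewrite ler_wpM2l//; lra.
have : e' = e + e by rewrite /e; field.
lra.
Qed.

(** The cuts of [a] and [b] belong to [Pd], where additivity is known. Monotonicity bounds their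
    values from above, and lower semicontinuity recovers those of [a], [b] and [a + b] in the
    limit. *)
Lemma Td_add a b : Kd a -> Kd b -> a * b = b * a -> Td (a + b)%R = (Td a + Td b)%E.
Proof.
move=> Ka Kb ab; have [sa_ sb] := (upos_sa Ka.1, upos_sa Kb.1).
have Kab := KdD Ka Kb.
have H e : 0 < e -> Td (ucut e a + ucut e b)%R = (Td (ucut e a) + Td (ucut e b))%E.
  move=> e0; have c : ucut e a * ucut e b = ucut e b * ucut e a.
    by apply: comm_ucut => //; apply/esym/comm_ucut.
  have [Pa Pb] := (Ka.2 _ e0, Kd_Pd (Kb.2 _ e0)).
  by apply/eqP; rewrite eq_le Td_add_le//= Td_add_ge.
have Kc x e : 0 < e -> Kd x -> Kd (ucut e x) by move=> e0 [_ /(_ _ e0) /Kd_Pd].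
have uc e x : 0 < e -> Kd x -> ule (ucut e x) x.
  move=> e0 [px _]; rewrite -{2}(ucut0 px); apply: ucut_le_comm; [exact: ltW|exact: upos_sa].
apply/eqP; rewrite eq_le; apply/andP; split.
  rewrite leNgt; apply/negP => /(Td_lsc Kab) [e e0 He].
  have e2 := half_gt0 e0.
  have := He (ucut (e / 2) a + ucut (e / 2) b) (KdD (Kc _ _ e2 Ka) (Kc _ _ e2 Kb)).
  have -> : a + b - (ucut (e / 2) a + ucut (e / 2) b) =
     (a - ucut (e / 2) a) + (b - ucut (e / 2) b) by rewrite opprD addrACA.
  rewrite H//; have := unormD (a - ucut (e / 2) a) (b - ucut (e / 2) b).
  have := ucut_dist (ltW e2) Ka.1; have := ucut_dist (ltW e2) Kb.1 => h1 h2 h3.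
  move=> /(_ ltac:(lra)); rewrite ltNge => /negP; apply; apply: leeD.
    by apply: Td_mono (uc _ _ e2 Ka) => //; apply: ucut_upos.
  by apply: Td_mono (uc _ _ e2 Kb) => //; apply: ucut_upos.
have M : forall x, Kd x -> ule x (a + b) -> (Td x <= Td (a + b)%R)%E.
  by move=> x [px _] xab; apply: Td_mono.
have Ma : (Td a <= Td (a + b)%R)%E by apply: M => //; apply: ule_addr; case: Kb.
have Mb : (Td b <= Td (a + b)%R)%E.
  by apply: M => //; rewrite addrC; apply: ule_addr; case: Ka.
rewrite leNgt; apply/negP => lt.
have [fa fb] : Td a \is a fin_num /\ Td b \is a fin_num.
  rewrite !ge0_fin_numE ?Td_ge0//; split; rewrite ltey; apply/eqP => E; move: lt.
    by rewrite (_ : Td (a + b)%R = +oo%E) ?ltNge ?leey//; apply/eqP; rewrite -leye_eq -E.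
  by rewrite (_ : Td (a + b)%R = +oo%E) ?ltNge ?leey//; apply/eqP; rewrite -leye_eq -E.
have [x Ea] : exists x : R, Td a = x%:E by exists (fine (Td a)); rewrite fineK.
have [y Eb] : exists y : R, Td b = y%:E by exists (fine (Td b)); rewrite fineK.
move: lt Ma Mb; rewrite Ea Eb; case Ez : (Td (a + b)%R) => [z||]//.
rewrite -EFinD lte_fin !lee_fin => zxy zx zy.
pose dl := (x + y - z) / 4; have dl0 : 0 < dl by rewrite /dl; lra.
have [|e1 e10 H1] := @Td_lsc a (x - dl)%:E Ka; first by rewrite Ea lte_fin; lra.
have [|e2 e20 H2] := @Td_lsc b (y - dl)%:E Kb; first by rewrite Eb lte_fin; lra.
pose e := Num.min e1 e2; have e0 : 0 < e by rewrite lt_min e10.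
have := H1 _ (Kc _ _ e0 Ka) (le_trans (ucut_dist (ltW e0) Ka.1) _); rewrite ge_min lexx => /(_ isT) g1.
have := H2 _ (Kc _ _ e0 Kb) (le_trans (ucut_dist (ltW e0) Kb.1) _); rewrite ge_min lexx orbT => /(_ isT) g2.
have g3 : (Td (ucut e a) + Td (ucut e b) <= z%:E)%E.
  rewrite -H// -Ez; apply: Td_mono => //; first by apply: uposD; apply: ucut_upos.
  by apply: uleD; apply: uc.
have := lt_le_trans (lteD g1 g2) g3; rewrite -EFinD lte_fin /dl; lra.
Qed.

End FromDimension.

Local Open Scope complex_scope.

(** * The unitization *)

Definition cabs (R : realType) (k : R[i]) : R := complex.Re `|k|.

Section CStarBasics.
Variables (R : realType) (A : cstarAlgType R).
Implicit Types (x y z a b : A) (k : R[i]).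

Definition cnorm (R : realType) (A : cstarAlgType R) (x : A) : R := complex.Re `|x|.

Lemma cabsE k : `|k| = (cabs k)%:C.
Proof. by rewrite /cabs RRe_real// normr_real. Qed.

Lemma cnormE x : `|x| = (cnorm x)%:C.
Proof. by rewrite /cnorm RRe_real// normr_real. Qed.

Lemma cabs_ge0 k : 0 <= cabs k.
Proof. by rewrite -lecR -cabsE normr_ge0. Qed.

Lemma cabsM k l : cabs (k * l) = cabs k * cabs l.
Proof. by apply: complexI; rewrite -cabsE normrM !cabsE rmorphM. Qed.

Lemma cabsD k l : cabs (k + l) <= cabs k + cabs l.
Proof. by rewrite -lecR rmorphD /= -!cabsE ler_normD. Qed.

Lemma cabsR (r : R) : cabs r%:C = `|r|.
Proof. by rewrite /cabs normc_def /= expr0n /= addr0 sqrtr_sqr. Qed.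

Lemma cabsi : cabs ('i : R[i]) = 1.
Proof. by rewrite /cabs normc_def /= expr0n /= expr1n add0r sqrtr1. Qed.

Lemma cabs_eq0 k : cabs k = 0 -> k = 0.
Proof. by move=> H; apply/eqP; rewrite -normr_eq0 cabsE H. Qed.

Lemma cabsJ k : cabs (Num.conj k) = cabs k.
Proof. by congr complex.Re; exact: normcJ. Qed.

Lemma cabs_Jmul k : cabs (Num.conj k * k) = cabs k ^+ 2.
Proof. by rewrite cabsM cabsJ expr2. Qed.

Lemma cnorm_ge0 x : 0 <= cnorm x.
Proof. by rewrite -lecR -cnormE normr_ge0. Qed.

Lemma cnormD x y : cnorm (x + y) <= cnorm x + cnorm y.
Proof. by rewrite -lecR rmorphD /= -!cnormE ler_normD. Qed.

Lemma cnormZ k x : cnorm (k *: x) = cabs k * cnorm x.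
Proof. by apply: complexI; rewrite -cnormE normrZ cabsE cnormE rmorphM. Qed.

Lemma cdistC x y : cnorm (x - y) = cnorm (y - x).
Proof. by rewrite /cnorm distrC. Qed.

Lemma cnorm0 : cnorm (0 : A) = 0.
Proof. by rewrite /cnorm normr0. Qed.

Lemma cnorm0_eq0 x : cnorm x = 0 -> x = 0.
Proof. by move=> H; apply/eqP; rewrite -normr_eq0 cnormE H. Qed.

Lemma cnormM x y : cnorm (x ** y) <= cnorm x * cnorm y.
Proof. by rewrite -lecR rmorphM /= -!cnormE cnormM_le. Qed.

Lemma cnorm_starM x : cnorm (star x ** x) = cnorm x ^+ 2.
Proof. by apply: complexI; rewrite -cnormE cnorm_star_mul cnormE rmorphXn. Qed.

Lemma cdistD z x y : cnorm (x - y) <= cnorm (x - z) + cnorm (z - y).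
Proof. by rewrite -{1}(subrK z x) -addrA; apply: cnormD. Qed.

Lemma cmul0l x : 0 ** x = 0.
Proof. by apply: (addrI (0 ** x)); rewrite -cmulDl !addr0. Qed.

Lemma cmul0r x : x ** 0 = 0.
Proof. by apply: (addrI (x ** 0)); rewrite -cmulDr !addr0. Qed.

Lemma cmulNl x y : (- x) ** y = - (x ** y).
Proof. by apply/eqP; rewrite -addr_eq0 -cmulDl addNr cmul0l. Qed.

Lemma cmulNr x y : x ** (- y) = - (x ** y).
Proof. by apply/eqP; rewrite -addr_eq0 -cmulDr addNr cmul0r. Qed.

Lemma cmulBl x y z : (x - y) ** z = x ** z - y ** z.
Proof. by rewrite cmulDl cmulNl. Qed.

Lemma cmulBr x y z : z ** (x - y) = z ** x - z ** y.
Proof. by rewrite cmulDr cmulNr. Qed.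

Lemma star0 : star (0 : A) = 0.
Proof. by apply: (addrI (star (0 : A))); rewrite -starD !addr0. Qed.

Lemma cmul_suml I (r : seq I) (P : pred I) (F : I -> A) y :
  (\sum_(i <- r | P i) F i) ** y = \sum_(i <- r | P i) F i ** y.
Proof. by apply: (big_morph (fun x => x ** y)) => [u v|]; rewrite ?cmulDl ?cmul0l. Qed.

Lemma cnorm_star x : cnorm (star x) = cnorm x.
Proof.
suff H y : cnorm y <= cnorm (star y).
  by apply/eqP; rewrite eq_le H -{2}[x]starK H.
have [->|y0] := eqVneq y 0; first by rewrite star0.
have y1 : 0 < cnorm y.
  by rewrite lt_def cnorm_ge0 andbT; apply: contra y0 => /eqP/cnorm0_eq0 ->.
by rewrite -(ler_pM2r y1) -expr2 -cnorm_starM; apply: cnormM.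
Qed.

Lemma ccvgP (u : nat -> A) l :
  (u @ \oo --> l) <-> forall e : R, 0 < e -> exists N, forall n, (N <= n)%N ->
       cnorm (u n - l) < e.
Proof.
split=> [/cvgrPdist_lt H e e0|H].
  have e0' : 0 < e%:C :> R[i] by rewrite ltcR.
  have [N _ HN] := H _ e0'; exists N => n Nn.
  by rewrite cdistC -ltcR -cnormE; apply: HN.
apply/cvgrPdist_lt => e e0.
have eR : e = (complex.Re e)%:C by rewrite RRe_real// realE (ltW e0).
have e0' : 0 < complex.Re e by rewrite -ltcR -eR.
have [N HN] := H _ e0'; exists N => // n /= Nn.
by rewrite eR cnormE ltcR cdistC; apply: HN.
Qed.

Lemma ccomplete (u : nat -> A) :
  (forall e : R, 0 < e -> exists N, forall m n, (N <= m)%N -> (N <= n)%N ->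
       cnorm (u m - u n) < e) ->
  exists l, forall e : R, 0 < e -> exists N, forall n, (N <= n)%N ->
       cnorm (u n - l) < e.
Proof.
move=> H.
suff : cvg (u @ \oo) by move/ccvgP => Hl; exists (lim (u @ \oo)).
apply: cauchy_cvg; apply: cauchy_exP => e e0.
have eR : e = (complex.Re e)%:C by rewrite RRe_real// realE (ltW e0).
have e0' : 0 < complex.Re e by rewrite -ltcR -eR.
have [N HN] := H _ e0'; exists (u N); exists N => // n /= Nn.
rewrite -ball_normE /=.
by rewrite eR cnormE ltcR; apply: HN.
Qed.

Lemma closedP (B : set A) : closed B <-> (forall (u : nat -> A) l, (forall n, B (u n)) ->
  (forall e : R, 0 < e -> exists N, forall n, (N <= n)%N -> cnorm (u n - l) < e) -> B l).
Proof.
split=> [cB u l Bu /ccvgP ul|H x xB].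
  by apply: (closed_cvg (F := \oo) B) => //; [exact: nearW|exact: ul].
have /choice[u Hu] (n : nat) : exists y, B y /\ cnorm (y - x) < n.+1%:R^-1.
  have e0 : 0 < (n.+1%:R^-1)%:C :> R[i] by rewrite ltcR invr_gt0.
  have [|y [By]] := xB (ball x (n.+1%:R^-1)%:C); first exact: nbhsx_ballx.
  rewrite -ball_normE /= cnormE ltcR cdistC => Hy.
  by exists y.
apply: (H u) => [n|e e0]; first by case: (Hu n).
have [N HN] := inv_small 1 e0.
exists N => n Nn; apply: lt_le_trans (proj2 (Hu n)) _.
apply: le_trans HN; rewrite div1r lef_pV2 ?posrE// ler_nat ltnS //.
Qed.

Lemma closureP (B : set A) x : closure B x <-> forall e : R, 0 < e ->
  exists2 y, B y & cnorm (y - x) < e.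
Proof.
split=> [xB e e0|H C /nbhs_ballP[e /= e0 HC]].
  have e0' : 0 < e%:C :> R[i] by rewrite ltcR.
  have [|y [By]] := xB (ball x e%:C); first exact: nbhsx_ballx.
  by rewrite -ball_normE /= cnormE ltcR cdistC => Hy; exists y.
have eR : e = (complex.Re e)%:C by rewrite RRe_real// realE (ltW e0).
have e0' : 0 < complex.Re e by rewrite -ltcR -eR.
have [y By Hy] := H _ e0'.
exists y; split=> //; apply: HC; rewrite -ball_normE /= eR cnormE ltcR cdistC //.
Qed.

End CStarBasics.

Lemma rcomplete (R : realType) (u : nat -> R) :
  (forall e : R, 0 < e -> exists N, forall m n, (N <= m)%N -> (N <= n)%N ->
       `|u m - u n| < e) ->
  exists l, forall e : R, 0 < e -> exists N, forall n, (N <= n)%N ->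
       `|u n - l| < e.
Proof.
move=> H.
suff : cvg (u @ \oo).
  move/cvgrPdist_lt => Hl; exists (lim (u @ \oo)) => e /Hl[N _ HN]; exists N => n Nn.
  by rewrite distrC; apply: HN.
apply: cauchy_cvg; apply: cauchy_exP => e e0.
have [N HN] := H _ e0; exists (u N); exists N => // n /= Nn.
by rewrite -ball_normE /=; apply: HN.
Qed.

(* Taking the maximum of [cabs p.1] and the operator norm of [p] on [A] gives a
   C*-norm also when [A] is unital. *)
Definition utz (R : realType) (A : cstarAlgType R) : Type := (R[i] * A)%type.

Section Utz.
Variables (R : realType) (A : cstarAlgType R).
Implicit Types (x y z a b : A) (k l : R[i]).
Local Notation U := (utz A).
Implicit Types p q r : U.

HB.instance Definition _ := GRing.Zmodule.copy U (R[i] * A)%type.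

Definition utz_mul p q : U := (p.1 * q.1, p.1 *: q.2 + q.1 *: p.2 + p.2 ** q.2).
Definition utz_one : U := (1, 0).
Definition utz_scale (r : R) p : U := (r%:C * p.1, r%:C *: p.2).
Definition uop p x : A := p.1 *: x + p.2 ** x.

Lemma utz_mulA : associative utz_mul.
Proof.
move=> [k a] [l b] [m c]; rewrite /utz_mul /=; congr pair; first by rewrite mulrA.
rewrite !scalerDr !cmulDl !cmulDr !scalerA -!cscalerAl -!cscalerAr cmulA.
rewrite ![m * _]mulrC -!addrA; congr (_ + _); congr (_ + _).
by rewrite [LHS]addrCA; congr (_ + _); rewrite [RHS]addrCA [X in _ + X]addrCA.
Qed.

Lemma utz_mul1l : left_id utz_one utz_mul.
Proof. by move=> [k a]; rewrite /utz_mul /= mul1r scale1r scaler0 addr0 cmul0l addr0. Qed.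

Lemma utz_mul1r : right_id utz_one utz_mul.
Proof. by move=> [k a]; rewrite /utz_mul /= mulr1 scale1r scaler0 add0r cmul0r addr0. Qed.

Lemma utz_mulDl : left_distributive utz_mul +%R.
Proof.
move=> [k a] [l b] [m c]; rewrite /utz_mul /=; congr pair; first by rewrite mulrDl.
by rewrite /= scalerDl scalerDr cmulDl [RHS]addrACA [X in _ = X + _]addrACA.
Qed.

Lemma utz_mulDr : right_distributive utz_mul +%R.
Proof.
move=> [k a] [l b] [m c]; rewrite /utz_mul /=; congr pair; first by rewrite mulrDr.
by rewrite /= scalerDl scalerDr cmulDr [RHS]addrACA [X in _ = X + _]addrACA.
Qed.

Lemma utz_1neq0 : utz_one != 0.
Proof. by apply/eqP => /(congr1 fst) /= /eqP; rewrite oner_eq0. Qed.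

HB.instance Definition _ := GRing.Zmodule_isNzRing.Build U utz_mulA utz_mul1l utz_mul1r
  utz_mulDl utz_mulDr utz_1neq0.

Lemma utz_scaleA (a b : R) p : utz_scale a (utz_scale b p) = utz_scale (a * b) p.
Proof. by rewrite /utz_scale /= rmorphM /= mulrA scalerA. Qed.

Lemma utz_scale1 : left_id 1 utz_scale.
Proof. by move=> [k a]; rewrite /utz_scale /= mul1r scale1r. Qed.

Lemma utz_scaleDr : right_distributive utz_scale +%R.
Proof. by move=> r [k a] [l b]; rewrite /utz_scale /= mulrDr scalerDr. Qed.

Lemma utz_scaleDl p : {morph utz_scale^~ p : a b / a + b}.
Proof. by move=> r s; rewrite /utz_scale rmorphD /= mulrDl scalerDl. Qed.

HB.instance Definition _ := GRing.Zmodule_isLmodule.Build R U utz_scaleA utz_scale1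
  utz_scaleDr utz_scaleDl.

Lemma utz_scaleAl (r : R) p q : r *: (p * q) = (r *: p) * q.
Proof.
case: p q => [k a] [l b]; congr pair => /=; first by rewrite mulrA.
by rewrite !scalerDr !scalerA cscalerAl [l * _]mulrC.
Qed.

HB.instance Definition _ := GRing.Lmodule_isLalgebra.Build R U utz_scaleAl.

Lemma utz_scaleAr (r : R) p q : r *: (p * q) = p * (r *: q).
Proof.
case: p q => [k a] [l b]; congr pair => /=; first by rewrite mulrCA.
by rewrite !scalerDr !scalerA cscalerAr [k * _]mulrC.
Qed.

HB.instance Definition _ := GRing.Lalgebra_isAlgebra.Build R U utz_scaleAr.

Definition utz_star p : U := (Num.conj p.1, star p.2).
Definition opn p : R := sup [set cnorm (uop p x) | x in [set x | cnorm x <= 1]].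
Definition utn p : R := Num.max (cabs p.1) (opn p).

Lemma uop_bound p x : cnorm (uop p x) <= (cabs p.1 + cnorm p.2) * cnorm x.
Proof.
apply: le_trans (cnormD _ _) _; rewrite cnormZ mulrDl lerD2l; exact: cnormM.
Qed.

Lemma uopZ k p x : uop p (k *: x) = k *: uop p x.
Proof. by rewrite /uop scalerDr !scalerA cscalerAr mulrC. Qed.

Lemma uopM p q x : uop (p * q) x = uop p (uop q x).
Proof.
case: p q => [k a] [l b]; rewrite /uop /= !cmulDl !cmulDr !scalerDr !scalerA -!cscalerAl -!cscalerAr.
by rewrite cmulA !addrA.
Qed.

Lemma uopD p q x : uop (p + q) x = uop p x + uop q x.
Proof. by case: p q => [k a] [l b]; rewrite /uop /= scalerDl cmulDl addrACA. Qed.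

Lemma uop_star p x y : star (uop p x) ** y = star x ** uop (utz_star p) y.
Proof.
by case: p => [k a]; rewrite /uop /= starD starZ starM cmulDl cmulDr -cscalerAl cscalerAr cmulA.
Qed.

Lemma opn_has_sup p : has_sup [set cnorm (uop p x) | x in [set x | cnorm x <= 1]].
Proof.
split; first by exists (cnorm (uop p 0)), 0 => //=; rewrite cnorm0 ler01.
exists (cabs p.1 + cnorm p.2) => _ [x /= x1 <-].
apply: le_trans (uop_bound _ _) _; rewrite ler_piMr// addr_ge0 ?cabs_ge0 ?cnorm_ge0 //.
Qed.

Lemma uop_le p x : cnorm (uop p x) <= utn p * cnorm x.
Proof.
suff H : cnorm (uop p x) <= opn p * cnorm x.
  by apply: le_trans H _; rewrite ler_wpM2r ?cnorm_ge0// /utn le_max lexx orbT.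
have [x0|x0] := eqVneq x 0; first by rewrite x0 /uop scaler0 cmul0r addr0 cnorm0 mulr0.
have x1 : 0 < cnorm x.
  by rewrite lt_def cnorm_ge0 andbT; apply: contra x0 => /eqP/cnorm0_eq0 ->.
rewrite -ler_pdivrMr//.
have -> : cnorm (uop p x) / cnorm x = cnorm (uop p ((cnorm x)^-1%:C *: x)).
  by rewrite uopZ cnormZ cabsR ger0_norm ?invr_ge0 ?cnorm_ge0// mulrC.
apply: sup_upper_bound; first exact: opn_has_sup.
exists ((cnorm x)^-1%:C *: x) => //=.
by rewrite cnormZ cabsR ger0_norm ?invr_ge0 ?cnorm_ge0// mulVf ?gt_eqF.
Qed.

Lemma utn_cabs p : cabs p.1 <= utn p.
Proof. by rewrite /utn le_max lexx. Qed.

Lemma utn_le p c : cabs p.1 <= c -> (forall x, cnorm (uop p x) <= c * cnorm x) -> utn p <= c.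
Proof.
move=> H1 H2; rewrite /utn ge_max H1 /=.
apply: ge_sup; first by case: (opn_has_sup p).
move=> _ [x /= x1 <-]; apply: le_trans (H2 _) _.
by rewrite ler_piMr// (le_trans _ H1)// cabs_ge0.
Qed.

Lemma utn_ge0 p : 0 <= utn p.
Proof. exact: le_trans (cabs_ge0 _) (utn_cabs p). Qed.

Lemma utn_le_add p : utn p <= cabs p.1 + cnorm p.2.
Proof. by apply: utn_le => [|x]; [rewrite lerDl cnorm_ge0|apply: uop_bound]. Qed.

Lemma utnD p q : utn (p + q) <= utn p + utn q.
Proof.
apply: utn_le => [|x]; first by apply: le_trans (cabsD _ _) _; rewrite lerD ?utn_cabs.
by rewrite uopD mulrDl; apply: le_trans (cnormD _ _) _; rewrite lerD ?uop_le.
Qed.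

Lemma utnZ (r : R) p : utn (r *: p) = `|r| * utn p.
Proof.
have H (s : R) q : utn (s *: q) <= `|s| * utn q.
  apply: utn_le => [|x]; first by rewrite /= cabsM cabsR ler_wpM2l ?utn_cabs.
  have -> : uop (s *: q) x = s%:C *: uop q x by rewrite /uop /= scalerDr scalerA cscalerAl.
  by rewrite cnormZ cabsR -mulrA ler_wpM2l ?uop_le.
apply/eqP; rewrite eq_le H /=.
have [->|r0] := eqVneq r 0; first by rewrite normr0 mul0r utn_ge0.
rewrite -ler_pdivlMl ?normr_gt0// -normfV; apply: le_trans (H _ _).
by rewrite scalerA mulVf// scale1r.
Qed.

Lemma utnN p : utn (- p) = utn p.
Proof.
have -> : - p = (-1 : R) *: p by rewrite scaleN1r.
by rewrite utnZ normrN1 mul1r.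
Qed.

Lemma utn_snd a : cnorm a = utn (0, a).
Proof.
apply/eqP; rewrite eq_le; apply/andP; split; last first.
  apply: le_trans (utn_le_add _) _ => /=; by rewrite /cabs normr0 add0r.
have [->|x0] := eqVneq a 0; first by rewrite cnorm0 utn_ge0.
have x1 : 0 < cnorm a.
  by rewrite lt_def cnorm_ge0 andbT; apply: contra x0 => /eqP/cnorm0_eq0 ->.
rewrite -(ler_pM2r x1) -expr2 -cnorm_star -cnorm_starM starK.
by have := uop_le (0, a) (star a); rewrite /uop /= scale0r add0r.
Qed.

Lemma utn_snd_le p : cnorm p.2 <= utn p *+ 2.
Proof.
case: p => [k a] /=; rewrite utn_snd.
have -> : ((0, a) : U) = (k, a) - (k, 0).
  by rewrite /GRing.add /= /add_pair /= subrr subr0.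
apply: le_trans (utnD _ _) _; rewrite mulr2n lerD2l utnN.
apply: le_trans (utn_le_add _) _; rewrite /= cnorm0 addr0; exact: (utn_cabs (k, a)).
Qed.

Lemma utn_eq0 p : utn p = 0 -> p = 0.
Proof.
move=> H; have := utn_snd_le p; have := utn_cabs p; rewrite H mul0rn.
case: p H => [k a] /= _ H1 H2; congr pair.
  by apply: cabs_eq0; apply/eqP; rewrite eq_le H1 cabs_ge0.
by apply: cnorm0_eq0; apply/eqP; rewrite eq_le H2 cnorm_ge0.
Qed.

Lemma utz_starK : involutive utz_star.
Proof. by move=> [k a]; rewrite /utz_star /= starK conjCK. Qed.

Lemma utz_starD : {morph utz_star : x y / x + y}.
Proof. by move=> [k a] [l b]; rewrite /utz_star /= rmorphD starD. Qed.

Lemma utz_starZ (r : R) p : utz_star (r *: p) = r *: utz_star p.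
Proof.
case: p => [k a]; congr pair => /=.
  by rewrite rmorphM /=; congr (_ * _); exact: conjc_real.
by rewrite starZ; congr (_ *: _); exact: conjc_real.
Qed.

Lemma utz_starM p q : utz_star (p * q) = utz_star q * utz_star p.
Proof.
case: p q => [k a] [l b]; congr pair => /=; first by rewrite rmorphM mulrC.
by rewrite !starD !starZ starM [_ *: star b + _]addrC.
Qed.

Definition utz_i : U := ('i, 0).

Lemma utz_star_i : utz_star utz_i = - utz_i.
Proof. by rewrite /utz_star /= star0; congr pair; rewrite ?oppr0//; apply/eqP; rewrite eq_complex /= oppr0 !eqxx. Qed.

Lemma utz_iM : utz_i * utz_i = -1.
Proof.
congr pair => /=; first by rewrite -expr2 sqr_i.
by rewrite !scaler0 cmul0r !addr0 oppr0.
Qed.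

Lemma utz_iC p : utz_i * p = p * utz_i.
Proof.
case: p => [k a]; congr pair => /=; first by rewrite mulrC.
by rewrite !scaler0 cmul0r cmul0l !addr0 add0r.
Qed.

Lemma utnM p q : utn (p * q) <= utn p * utn q.
Proof.
apply: utn_le => [|x]; first by rewrite /= cabsM ler_pM ?cabs_ge0 ?utn_cabs.
rewrite uopM; apply: le_trans (uop_le _ _) _; rewrite -mulrA ler_wpM2l ?utn_ge0 ?uop_le //.
Qed.

(** [|p x|^2 = |x^* p^* p x|] treats the operator norm, and the scalar part is the same identity in
    [R[i]]. *)
Lemma utn_sqr_le p : utn p ^+ 2 <= utn (utz_star p * p).
Proof.
set c := utn (_ * _).
have c0 : 0 <= c := utn_ge0 _.
suff H : utn p <= Num.sqrt c by rewrite -(sqr_sqrtr c0) lerXn2r ?nnegrE ?utn_ge0 ?sqrtr_ge0.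
apply: utn_le => [|x].
  rewrite -(ger0_norm (cabs_ge0 _)) -sqrtr_sqr ler_wsqrtr// -cabs_Jmul.
  exact: (utn_cabs (utz_star p * p)).
rewrite -(ger0_norm (cnorm_ge0 _)) -sqrtr_sqr -(ger0_norm (cnorm_ge0 x)) -sqrtr_sqr -sqrtrM//.
rewrite ler_wsqrtr// -cnorm_starM uop_star -uopM; apply: le_trans (cnormM _ _) _.
by rewrite cnorm_star mulrC expr2 mulrA ler_wpM2r ?cnorm_ge0 ?uop_le.
Qed.

Lemma utn_starM p : utn (utz_star p * p) = utn p ^+ 2.
Proof.
apply/eqP; rewrite eq_le utn_sqr_le andbT.
suff H q : utn q <= utn (utz_star q).
  apply: le_trans (utnM _ _) _; rewrite expr2 ler_wpM2r ?utn_ge0//.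
  by rewrite -{2}(utz_starK p).
have [->|q0] := eqVneq q 0; first by rewrite (_ : utz_star 0 = 0)// /utz_star /= star0 rmorph0.
have q1 : 0 < utn q.
  by rewrite lt_def utn_ge0 andbT; apply: contra q0 => /eqP/utn_eq0 ->.
rewrite -(ler_pM2r q1) -expr2; apply: le_trans (utn_sqr_le _) (utnM _ _).
Qed.

Lemma Re_le_cabs k : `|complex.Re k| <= cabs k.
Proof. by rewrite -lecR -cabsE normc_ge_Re. Qed.

Lemma Im_le_cabs k : `|complex.Im k| <= cabs k.
Proof.
have := Re_le_cabs (k * 'i); rewrite ReiNIm normrN cabsM cabsi mulr1; exact.
Qed.

Lemma cabs_ReIm k : cabs k <= `|complex.Re k| + `|complex.Im k|.
Proof.
rewrite {1}(complexE k); apply: le_trans (cabsD _ _) _.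
by rewrite cabsM cabsi mul1r !cabsR.
Qed.

Lemma utz_complete (u : nat -> U) :
  (forall e : R, 0 < e -> exists N, forall m n, (N <= m)%N -> (N <= n)%N ->
       utn (u m - u n) < e) ->
  exists p, forall e : R, 0 < e -> exists N, forall n, (N <= n)%N ->
       utn (u n - p) < e.
Proof.
move=> H.
have [r Hr] : exists t, forall e : R, 0 < e -> exists N, forall n, (N <= n)%N ->
    `|complex.Re (u n).1 - t| < e.
  apply: rcomplete => e /H[N HN]; exists N => m n Nm Nn.
  apply: le_lt_trans (HN m n Nm Nn).
  have := Re_le_cabs (u m - u n).1 => /= /le_trans; rewrite raddfB; apply; exact: (utn_cabs (u m - u n)).
have [s Hs] : exists t, forall e : R, 0 < e -> exists N, forall n, (N <= n)%N ->
    `|complex.Im (u n).1 - t| < e.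
  apply: rcomplete => e /H[N HN]; exists N => m n Nm Nn.
  apply: le_lt_trans (HN m n Nm Nn).
  have := Im_le_cabs (u m - u n).1 => /= /le_trans; rewrite raddfB; apply; exact: (utn_cabs (u m - u n)).
have [a Ha] : exists t, forall e : R, 0 < e -> exists N, forall n, (N <= n)%N ->
    cnorm ((u n).2 - t) < e.
  apply: ccomplete => e e0; have [N HN] := H _ (half_gt0 e0); exists N => m n Nm Nn.
  apply: le_lt_trans (utn_snd_le (u m - u n)) _.
  by rewrite -mulr_natr -ltr_pdivlMr//; exact: HN.
exists (r +i* s, a) => e e0.
have e3 : 0 < e / 3 by lra.
have [N1 H1] := Hr _ e3; have [N2 H2] := Hs _ e3; have [N3 H3] := Ha _ e3.
exists (maxn N1 (maxn N2 N3)) => n; rewrite !geq_max => /and3P[/H1 A1 /H2 A2 /H3 A3].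
apply: le_lt_trans (utn_le_add _) _.
have := cabs_ReIm (u n - (r +i* s, a)).1.
rewrite /= !raddfB /= => B; apply: le_lt_trans (lerD B (lexx _)) _; lra.
Qed.

HB.instance Definition _ := isUCStar.Build R U utnD utnZ utn_eq0 utz_starK utz_starD
  utz_starZ utz_starM utz_star_i utz_iM utz_iC utnM utn_starM utz_complete.

End Utz.

(** * The algebra as an ideal of its unitization *)

Section Link.
Variables (R : realType) (A : cstarAlgType R).
Implicit Types (x y z a b : A) (k l : R[i]).
Local Notation U := (utz A).
Implicit Types p q r : U.

Definition jz (R : realType) (A : cstarAlgType R) (a : A) : utz A := (0, a).
Definition ideal (R : realType) (A : cstarAlgType R) (p : utz A) := p.1 = 0.

Lemma jz_ideal a : ideal (jz a). Proof. by []. Qed.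

Lemma idealP p : ideal p -> p = jz p.2.
Proof. by case: p => k a; rewrite /ideal /= => ->. Qed.

Lemma jzD a b : jz (a + b) = jz a + jz b.
Proof. by congr pair; rewrite /= addr0. Qed.

Lemma jzN a : jz (- a) = - jz a.
Proof. by congr pair; rewrite /= oppr0. Qed.

Lemma jzB a b : jz (a - b) = jz a - jz b.
Proof. by rewrite jzD jzN. Qed.

Lemma jz0 : jz (0 : A) = 0. Proof. by []. Qed.

Lemma jz_sum I (r : seq I) (P : pred I) (F : I -> A) :
  jz (\sum_(i <- r | P i) F i) = \sum_(i <- r | P i) jz (F i).
Proof. by apply: (big_morph (@jz R A)) => [u v|]; rewrite ?jzD ?jz0. Qed.

Lemma jzM a b : jz (a ** b) = jz a * jz b.
Proof. by congr pair; rewrite /= ?mul0r// !scale0r !add0r. Qed.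

Lemma jz_star a : jz (star a) = (jz a)^*u.
Proof. by congr pair; rewrite /= rmorph0. Qed.

Lemma jzZ (r : R) a : jz (r%:C *: a) = r *: jz a.
Proof. by congr pair; rewrite /= mulr0. Qed.

Lemma jz_i a : jz ('i *: a) = ui * jz a.
Proof. by congr pair; rewrite /= ?mulr0// scale0r addr0 cmul0l addr0. Qed.

Lemma N_jz a : N[jz a] = cnorm a.
Proof. by rewrite utn_snd. Qed.

Lemma jz_inj : injective (@jz R A).
Proof. by move=> a b []. Qed.

Lemma ideal_mulr p q : ideal p -> ideal (p * q).
Proof. by rewrite /ideal /= => ->; rewrite mul0r. Qed.

Lemma ideal_mull p q : ideal p -> ideal (q * p).
Proof. by rewrite /ideal /= => ->; rewrite mulr0. Qed.

Lemma idealD p q : ideal p -> ideal q -> ideal (p + q).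
Proof. by rewrite /ideal /= => -> ->; rewrite addr0. Qed.

Lemma idealZ (r : R) p : ideal p -> ideal (r *: p).
Proof. by rewrite /ideal /= => ->; rewrite mulr0. Qed.

Lemma ideal_closed p : (forall e : R, 0 < e -> exists2 q, ideal q & N[p - q] < e) -> ideal p.
Proof.
move=> H; apply: cabs_eq0; apply/eqP; rewrite eq_le cabs_ge0 andbT.
apply: le_eps => e /H[q q0 Hq]; rewrite add0r; apply: le_trans (ltW Hq).
apply: le_trans (utn_cabs _); by rewrite /= q0 subr0.
Qed.

Lemma pev_fst (f : {poly R}) p : ideal p -> (pev f p).1 = (f.[0])%:C.
Proof.
move=> p0; elim/poly_ind: f => [|f c IH]; first by rewrite pev0 horner0.
by rewrite pevD pevM pevX pevC !hornerE /= p0 !mulr0 add0r ?addr0 mulr1.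
Qed.

Lemma ideal_fc f p : papp f -> f 0 = 0 -> sa p -> ideal p -> ideal (fc f p).
Proof.
move=> pf f0 sp p0; apply: ideal_closed => e e0.
have e3 : 0 < e / 3 by lra.
have [g [g1 g2]] := fc_approx pf sp e3.
exists (pev g p - (g.[0])%:A).
  by rewrite /ideal /= pev_fst// mulr1 subrr.
rewrite opprB addrCA; apply: le_lt_trans (unormD _ _) _.
have := g1 0; rewrite normr0 unorm_ge0 f0 sub0r normrN => /(_ isT) H.
by rewrite unormZ unorm1 mulr1; lra.
Qed.

Lemma ideal_ucut t p : 0 <= t -> sa p -> ideal p -> ideal (ucut t p).
Proof. by move=> t0; apply: ideal_fc; [exact: papp_cut|rewrite /cut sub0r max_r// oppr_le0]. Qed.

Lemma papp_sqrtp : papp (fun t : R => Num.sqrt t).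
Proof. tpapp. Qed.

Lemma upos_jzP x : positive x <-> upos (jz x).
Proof.
split=> [[y _ <-]|ux]; first by exists (jz y); rewrite jzM jz_star.
pose h := fc (fun t : R => Num.sqrt t) (jz x).
have sx := upos_sa ux.
have ih : ideal h by apply: ideal_fc => //; [exact: papp_sqrtp|rewrite sqrtr0].
have sh : sa h by apply: fc_sa => //; exact: papp_sqrtp.
have hh : h * h = jz x.
  rewrite -[RHS]upos_ppos// /h -fcM//; try exact: papp_sqrtp.
  apply: fc_eq_pos => //; [by apply: pappM; exact: papp_sqrtp|exact: papp_ppos|].
  by move=> t /andP[t0 _]; rewrite sqrtM_id// /ppos max_l.
exists h.2 => //; apply: jz_inj; rewrite jzM jz_star -!(idealP ih) -hh; congr (_ * _); exact: sh.
Qed.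

Lemma positiveW x : positive x -> upos (jz x).
Proof. by move/upos_jzP. Qed.

(** A local approximate unit: [f] is 1 from [e] on and vanishes at 0, so [fc f p] stays in every
    closed ideal that contains [p], while compressing by it hardly changes [p]. *)
Lemma approx_unit p (e : R) : 0 < e -> upos p ->
  exists f, [/\ papp f, f 0 = 0, forall t, 0 <= f t <= 1 & N[p - fc f p * p * fc f p] <= e].
Proof.
move=> e0 up; have sp := upos_sa up.
pose f := fun t : R => Num.min 1 (e^-1 * ppos t).
have pf : papp f by rewrite /f; tpapp.
have f01 t : 0 <= f t <= 1.
  rewrite /f le_min ge_min lexx ler01 /= andbT mulr_ge0 ?invr_ge0 ?(ltW e0)//.
  by rewrite /ppos le_max lexx orbT.
exists f; split=> //; first by rewrite /f /ppos maxxx mulr0 min_r.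
rewrite (_ : p - _ = fc id p - fc f p * fc id p * fc f p); last by rewrite fc_id.
rewrite -!fcM//; try tpapp.
rewrite -fcB//; try tpapp.
apply: fc_norm_pos => //; first by tpapp.
move=> t /andP[t0 _]; have /andP[F0 F1] := f01 t.
have -> : t - f t * t * f t = t * (1 - f t ^+ 2) by ring.
have F2 : 0 <= 1 - f t ^+ 2 <= 1.
  by rewrite subr_ge0 expr_le1//= F1 lerBlDr lerDl exprn_ge0.
rewrite ger0_norm ?mulr_ge0//; last by case/andP: F2.
have [te|te] := leP e t.
  suff -> : f t = 1 by rewrite expr1n subrr mulr0 ltW.
  by rewrite /f /ppos max_l// min_l// ler_pdivlMl// mulr1.
by apply: le_trans (ltW te); rewrite ler_piMr//; case/andP: F2.
Qed.

Lemma fc01_norm f p : papp f -> (forall t, 0 <= f t <= 1) -> sa p -> N[fc f p] <= 1.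
Proof. by move=> pf f01 sp; apply: fc_norm => // t _; case/andP: (f01 t) => a b; rewrite ger0_norm. Qed.

Lemma norm_sand_le1 (u v p : U) : N[u] <= 1 -> N[v] <= 1 -> N[u * p * v] <= N[p].
Proof.
move=> u1 v1; apply: le_trans (unormM _ _) _; apply: le_trans (ler_piMr _ v1) _; rewrite ?unorm_ge0//.
by apply: le_trans (unormM _ _) _; apply: ler_piMl; rewrite ?unorm_ge0.
Qed.

(** A witness [v] from the unitization is replaced by [v u] with [u] a local approximate unit of
    [x]; this product lies in the original algebra, which is an ideal. *)
Lemma cuntz_csub x y : positive x -> cuntz_sub x y <-> csub (jz x) (jz y).
Proof.
move=> px; split=> [[w /ccvgP Hw] e e0|H].
  have [N HN] := Hw e e0; exists (jz (w N)); rewrite -jz_star -!jzM -jzB N_jz; exact: HN.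
have /choice[w Hw] (n : nat) : exists w, N[(jz w)^*u * jz y * jz w - jz x] < n.+1%:R^-1.
  have e0 : 0 < n.+1%:R^-1 / 2 :> R by rewrite divr_gt0.
  have ux := positiveW px; have sx := upos_sa ux.
  have [f [pf f0 f01 Hu]] := approx_unit e0 ux; set u := fc f _ in Hu.
  have iu : ideal u by apply: ideal_fc.
  have u1 : N[u] <= 1 by apply: fc01_norm.
  have su : sa u by apply: fc_sa.
  have [v Hv] := H _ e0.
  exists (v * u).2; rewrite -(idealP (ideal_mull v iu)) ustarM su.
  rewrite (_ : _ - _ = u * (v^*u * jz y * v - jz x) * u - (jz x - u * jz x * u)); last by ncring.
  set c := n.+1%:R^-1 in e0 Hu Hv *.
  have D : N[u * (v^*u * jz y * v - jz x) * u] <= N[v^*u * jz y * v - jz x].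
    exact: norm_sand_le1.
  apply: le_lt_trans (unormB _ _) _; lra.
exists w; apply/ccvgP => e e0; have [N HN] := inv_small 1 e0.
exists N => n Nn; rewrite -N_jz jzB !jzM jz_star.
apply: lt_le_trans (Hw n) _; apply: le_trans HN.
by rewrite div1r lef_pV2 ?posrE// ler_nat ltnS.
Qed.

Lemma jz_poly_eval0 (f : {poly R}) x : f.[0] = 0 -> jz (poly_eval0 f x) = pev f (jz x).
Proof.
move=> f0; have H n : jz (iter n (cmul x) x) = jz x ^+ n.+1.
  by elim: n => [|n IH]; rewrite ?expr1// iterS jzM IH -exprS.
rewrite /poly_eval0 jz_sum; under eq_bigr do rewrite jzZ H.
rewrite -(big_mkord xpredT (fun i => f`_i.+1 *: jz x ^+ i.+1)).
have -> : pev f (jz x) = \sum_(0 <= i < (size f).+1) f`_i *: jz x ^+ i.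
  rewrite big_nat_recr//= nth_default// scale0r addr0 big_mkord -{1}(coefK f) poly_def.
  rewrite (big_morph (fun g => pev g (jz x)) (fun g h => pevD g h _) (pev0 _)).
  by apply: eq_bigr => i _; rewrite pevZ pevXn pevX.
by rewrite big_nat_recl// -horner_coef0 f0 scale0r add0r.
Qed.

(** [cfc] admits only polynomials without constant term. An approximant [g] of [f] is brought to
    that form by subtracting [g.[0]], which is small because [f 0 = 0]. *)
Lemma cfc_fc f x : papp f -> f 0 = 0 -> positive x -> jz (cfc f x) = fc f (jz x).
Proof.
move=> pf f0 px; have ux := positiveW px; have sx := upos_sa ux.
have U1 y : is_cfc f x y -> jz y = fc f (jz x).
  move=> Hy; apply/eqP; rewrite -subr_eq0 -unorm_le0; apply: le_eps => e e0.
  have [g [g0 g1 g2]] := Hy _ (half_gt0 e0); rewrite add0r.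
  apply: le_trans (udistD (pev g (jz x)) _ _) _.
  have -> : e = e / 2 + e / 2 by lra.
  apply: lerD; first by rewrite -jz_poly_eval0// -jzB N_jz -lecR -cnormE.
  rewrite udistC -fc_pev// -fcB//; last exact: papp_poly.
  apply: fc_norm_pos => //; first by apply: pappB => //; exact: papp_poly.
  by move=> t /andP[t0 t1]; rewrite distrC; apply: g1; rewrite // cnormE lecR -N_jz.
apply: U1; rewrite /cfc; case: xgetP => [y _ //|/(_ (fc f (jz x)).2) []].
move=> e e0.
have e3 : 0 < e / 3 by lra.
have [g [g1 g2]] := fc_approx pf sx e3.
have := g1 0; rewrite normr0 unorm_ge0 f0 sub0r normrN => /(_ isT) H.
exists (g - (g.[0])%:P); split.
- by rewrite !hornerE subrr.
- move=> t t0; rewrite cnormE lecR -N_jz => t1; rewrite !hornerE.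
  have /g1 : `|t| <= N[jz x] by rewrite ger0_norm.
  rewrite distrC => K; rewrite (_ : g.[t] - g.[0] - f t = g.[t] - f t - g.[0]); last by ring.
  apply: le_trans (ler_normB _ _) _; lra.
rewrite cnormE lecR -N_jz jzB jz_poly_eval0; last by rewrite !hornerE subrr.
rewrite -idealP; last exact: ideal_fc.
rewrite pevB pevC opprB addrCA addrC; apply: le_trans (unormD _ _) _.
by rewrite unormZ unorm1 mulr1; lra.
Qed.

Lemma f_cutE (e t : R) : 0 < e -> f_cut e t = Num.min 1 (Num.max 0 (2 / e * t - 1)).
Proof.
move=> e0; rewrite /f_cut; have E : 2 / e * t - 1 = 2 * t / e - 1 by rewrite mulrAC.
rewrite E; case: ifPn => [te|]; last rewrite -ltNge => te.
  rewrite max_l ?min_r// subr_le0 ler_pdivrMr// mul1r; lra.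
case: ifPn => [te1|]; last rewrite -ltNge => te1.
  by rewrite min_l// le_max lerBrDr ler_pdivlMr//; apply/orP; right; lra.
have H : 0 <= 2 * t / e - 1 by rewrite subr_ge0 ler_pdivlMr//; lra.
by rewrite max_r// min_r// lerBlDr ler_pdivrMr//; lra.
Qed.

Lemma papp_f_cut (e : R) : 0 < e -> papp (f_cut e).
Proof.
move=> e0; apply: (@papp_ext _ (fun t => Num.min 1 (Num.max 0 (2 / e * t - 1)))).
  by move=> t; rewrite f_cutE.
tpapp.
Qed.

Lemma f_cut0 (e : R) : 0 < e -> f_cut e 0 = 0.
Proof. by move=> e0; rewrite /f_cut ifT// divr_ge0// ltW. Qed.

End Link.

Lemma sqr_le (R : realType) (a b : R) : 0 <= a -> 0 <= b -> a ^+ 2 <= b ^+ 2 -> a <= b.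
Proof. by move=> a0 b0; rewrite ler_pXn2r. Qed.

(** * Matrices over a C*-algebra *)

Section Homs.
Variables (R : realType) (U V : ucstarType R) (phi : U -> V).
Hypothesis phiD : forall x y, phi (x + y) = phi x + phi y.
Hypothesis phiZ : forall (k : R) x, phi (k *: x) = k *: phi x.
Hypothesis phiM : forall x y, phi (x * y) = phi x * phi y.
Hypothesis phi1 : phi 1 = 1.
Hypothesis phi_star : forall x, phi x^*u = (phi x)^*u.

Lemma hom0 : phi 0 = 0.
Proof. by rewrite -(scale0r 0) phiZ scale0r. Qed.

Lemma hom_pev p x : phi (pev p x) = pev p (phi x).
Proof.
elim/poly_ind: p => [|p c IH]; first by rewrite !pev0 hom0.
by rewrite !pevD !pevM !pevX !pevC phiD phiM IH phiZ phi1.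
Qed.

(** For self-adjoint [z] with [N[z] < 1] there is [h] with [z^2 + h^2 = 1]. The relation is
    preserved by [phi] and bounds [phi z]. *)
Lemma hom_contr x : N[phi x] <= N[x].
Proof.
suff H y : sa y -> N[phi y] <= N[y].
  apply: sqr_le => //; rewrite -!unorm_ustar_mul -phi_star -phiM.
  by apply: H; exact: sa_ustarM.
move=> sy; apply: le_eps => e e0; set c := N[y] + e.
have c0 : 0 < c by apply: ltr_wpDl => //; exact: unorm_ge0.
pose z := c^-1 *: y; have sz : sa z by apply: saZ.
have z1 : N[z * z] < 1.
  have : N[z] < 1.
    rewrite /z unormZ ger0_norm ?invr_ge0 ?(ltW c0)//.
    by rewrite ltr_pdivrMl// mulr1 ltrDl.
  by rewrite sa_norm_sqr// expr2; have := unorm_ge0 z; nra.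
have [h hz hh] := sqrt_1B z1.
have sh : sa h by apply: inC_sa hz; apply: saM.
have zh : z * h = h * z by apply: inC_comm hz _; rewrite mulrA.
have : N[phi z] <= 1.
  apply: (@sq_sum1_norm_le1 _ _ (phi z) (phi h)).
  - by rewrite /sa -phi_star sz.
  - by rewrite /sa -phi_star sh.
  - by rewrite -!phiM zh.
  - by rewrite -!phiM -phiD hh addrC subrK phi1.
rewrite /z phiZ unormZ ger0_norm ?invr_ge0 ?(ltW c0)//.
by rewrite ler_pdivrMl// mulr1.
Qed.

Lemma hom_sa x : sa x -> sa (phi x).
Proof. by move=> sx; rewrite /sa -phi_star sx. Qed.

Lemma hom_fc f x : papp f -> sa x -> phi (fc f x) = fc f (phi x).
Proof.
move=> pf sx; symmetry; apply: fc_eq => //; first exact: hom_sa.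
move=> e e0; have [p [p1 p2]] := fc_approx pf sx e0; exists p; split.
  by move=> t /le_trans - /(_ _ (hom_contr x)); apply: p1.
rewrite -hom_pev; apply: le_trans p2.
rewrite -[X in phi _ - X]scale1r -scaleN1r -[X in N[X]]/(_ + _).
by rewrite scalerA mulr1 -phiZ -phiD scaleN1r hom_contr.
Qed.

(** For positive [y] the cut of [y] at [N[phi y]] is mapped to 0, so it vanishes by injectivity and
    [N[y] <= N[phi y]]. *)
Lemma hom_iso x : injective phi -> N[phi x] = N[x].
Proof.
move=> phi_inj; apply/eqP; rewrite eq_le hom_contr /=.
suff H y : upos y -> N[y] <= N[phi y].
  apply: sqr_le => //; rewrite -!unorm_ustar_mul -phi_star -phiM.
  by apply: H; exists x.
move=> uy; have sy := upos_sa uy.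
apply: ucut_eq0_norm => //; apply: phi_inj.
rewrite hom0 /ucut hom_fc//; last exact: papp_cut.
apply: ucut_eq0; first exact: hom_sa.
by apply: ule_norm; exact: hom_sa.
Qed.

End Homs.

Lemma chom_iso (R : realType) (A B : cstarAlgType R) (g : A -> B) (a : A) :
  (forall (k : R[i]) x y, g (k *: x + y) = k *: g x + g y) ->
  (forall x y, g (x ** y) = g x ** g y) -> (forall x, g (star x) = star (g x)) ->
  injective g -> cnorm (g a) = cnorm a.
Proof.
move=> gL gM gS gI.
have gD x y : g (x + y) = g x + g y by rewrite -[x]scale1r gL !scale1r.
have g0 : g 0 = 0 by apply: (addrI (g 0)); rewrite -gD !addr0.
have gZ k x : g (k *: x) = k *: g x by rewrite -[k *: x]addr0 gL g0 addr0.
pose phi (p : utz A) : utz B := (p.1, g p.2).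
rewrite -!N_jz -[jz (g a)]/(phi (jz a)); apply: (@hom_iso R (utz A) (utz B) phi) => [x y|k x|x y||x|].
- by congr pair; rewrite /= gD.
- by congr pair; rewrite /= gZ.
- by congr pair; rewrite /= !gD !gZ gM.
- by congr pair; rewrite /= g0.
- by congr pair; rewrite /= gS.
by move=> [k x] [l y] [-> /gI ->].
Qed.

Section Systems.
Variables (R : realType) (D : cstarAlgType R).

(* [E i j a] abstracts the matrix over [D] with the single entry [a] in position
   (i, j), for an embedding of the matrices over [D] in [U]. *)
Definition mxsys (U : ucstarType R) (E : nat -> nat -> D -> U) : Prop :=
  [/\ forall i j a b, E i j (a + b) = E i j a + E i j b,
      forall i j (k : R) a, E i j (k%:C *: a) = k *: E i j a,
      forall i j k l a b, E i j a * E k l b = if j == k then E i l (a ** b) else 0,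
      forall i j a, (E i j a)^*u = E j i (star a)
    & forall i j a, N[E i j a] = cnorm a].

Definition mmul n (x y : 'M[D]_n) : 'M[D]_n := \matrix_(i, j) \sum_k x i k ** y k j.
Definition mstar n (x : 'M[D]_n) : 'M[D]_n := \matrix_(i, j) star (x j i).
Definition mscale n (k : R) (x : 'M[D]_n) : 'M[D]_n := \matrix_(i, j) (k%:C *: x i j).

Section One.
Variables (U : ucstarType R) (E : nat -> nat -> D -> U).
Hypothesis sysE : mxsys E.

Definition mxe n (x : 'M[D]_n) : U := \sum_(i < n) \sum_(j < n) E i j (x i j).

Lemma sys_D i j a b : E i j (a + b) = E i j a + E i j b. Proof. by case: sysE. Qed.
Lemma sys_Z i j (k : R) a : E i j (k%:C *: a) = k *: E i j a. Proof. by case: sysE. Qed.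
Lemma sys_M i j k l a b : E i j a * E k l b = if j == k then E i l (a ** b) else 0.
Proof. by case: sysE. Qed.
Lemma sys_star i j a : (E i j a)^*u = E j i (star a). Proof. by case: sysE. Qed.
Lemma sys_norm i j a : N[E i j a] = cnorm a. Proof. by case: sysE. Qed.

Lemma sys_0 i j : E i j 0 = 0.
Proof. by apply: (addrI (E i j 0)); rewrite -sys_D !addr0. Qed.

Lemma sys_N i j a : E i j (- a) = - E i j a.
Proof. by apply/eqP; rewrite -addr_eq0 -sys_D addNr sys_0. Qed.

Lemma sys_B i j a b : E i j (a - b) = E i j a - E i j b.
Proof. by rewrite sys_D sys_N. Qed.

Lemma sys_sum i j I (r : seq I) (P : pred I) (F : I -> D) :
  E i j (\sum_(k <- r | P k) F k) = \sum_(k <- r | P k) E i j (F k).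
Proof. by apply: (big_morph (E i j)) => [u v|]; rewrite ?sys_D ?sys_0. Qed.

Lemma mxeD n (x y : 'M[D]_n) : mxe (x + y) = mxe x + mxe y.
Proof.
rewrite -big_split; apply: eq_bigr => i _; rewrite -big_split; apply: eq_bigr => j _.
by rewrite mxE sys_D.
Qed.

Lemma mxeN n (x : 'M[D]_n) : mxe (- x) = - mxe x.
Proof.
rewrite -sumrN; apply: eq_bigr => i _; rewrite -sumrN; apply: eq_bigr => j _.
by rewrite mxE sys_N.
Qed.

Lemma mxeB n (x y : 'M[D]_n) : mxe (x - y) = mxe x - mxe y.
Proof. by rewrite mxeD mxeN. Qed.

Lemma mxe0 n : mxe (0 : 'M[D]_n) = 0.
Proof. by rewrite /mxe big1// => i _; rewrite big1// => j _; rewrite mxE sys_0. Qed.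

Lemma mxeZ n (k : R) (x : 'M[D]_n) : mxe (mscale k x) = k *: mxe x.
Proof.
rewrite scaler_sumr; apply: eq_bigr => i _; rewrite scaler_sumr; apply: eq_bigr => j _.
by rewrite mxE sys_Z.
Qed.

Lemma mxe_star n (x : 'M[D]_n) : mxe (mstar x) = (mxe x)^*u.
Proof.
rewrite /mxe ustar_sum; under [RHS]eq_bigr do rewrite ustar_sum.
rewrite exchange_big; apply: eq_bigr => i _; apply: eq_bigr => j _.
by rewrite mxE sys_star.
Qed.

Lemma mul_E_mxe n k (i : 'I_n) a (x : 'M[D]_n) :
  E k i a * mxe x = \sum_(j < n) E k j (a ** x i j).
Proof.
rewrite mulr_sumr (bigD1 i)//= [X in _ + X]big1 ?addr0.
  by rewrite mulr_sumr; apply: eq_bigr => j _; rewrite sys_M eqxx.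
move=> j ji; rewrite mulr_sumr big1// => l _; rewrite sys_M ifN//.
by apply: contra ji => /eqP/val_inj ->.
Qed.

Lemma mxeM n (x y : 'M[D]_n) : mxe (mmul x y) = mxe x * mxe y.
Proof.
rewrite {2}/mxe mulr_suml; apply: eq_bigr => i _; rewrite mulr_suml.
under [RHS]eq_bigr do rewrite mul_E_mxe.
rewrite exchange_big; apply: eq_bigr => j _.
by rewrite mxE sys_sum.
Qed.

Lemma mxe_norm n (x : 'M[D]_n) : N[mxe x] <= \sum_(i < n) \sum_(j < n) cnorm (x i j).
Proof.
apply: le_trans (unorm_sum _ _ _) _; apply: ler_sum => i _.
apply: le_trans (unorm_sum _ _ _) _; apply: ler_sum => j _.
by rewrite sys_norm.
Qed.

(** [D] may lack a unit, so the entry [c] is not cut out by matrix units. Multiplication by [c^*] on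
    both sides isolates [c^* c c^*] instead, whose norm is at least [|c|^3]. *)
Lemma mxe_entry n (x : 'M[D]_n) i j : cnorm (x i j) <= N[mxe x].
Proof.
set c := x i j.
have H : E 0 i (star c) * mxe x * E j 0 (star c) = E 0 0 (star c ** c ** star c).
  rewrite mul_E_mxe mulr_suml (bigD1 j)//= [X in _ + X]big1 => [|k kj].
    by rewrite addr0 sys_M eqxx.
  by rewrite sys_M ifN//; apply: contra kj => /eqP/val_inj ->.
pose h : utz D := jz (star c) * jz c.
have sh : sa h by rewrite /h jz_star; exact: sa_ustarM.
have Nh : N[h] = cnorm c ^+ 2 by rewrite /h -jzM N_jz cnorm_starM.
have [c0|c0] := eqVneq (cnorm c) 0; first by rewrite c0; exact: unorm_ge0.
have cp : 0 < cnorm c by rewrite lt_def c0 cnorm_ge0.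
have H1 : cnorm c ^+ 4 <= cnorm (star c ** c ** star c) * cnorm c.
  rewrite -[cnorm (star c ** c ** star c)]N_jz !jzM -/h -[in X in _ * X]N_jz.
  apply: le_trans (unormM _ _); rewrite -mulrA -/h sa_norm_sqr// Nh -exprM //.
have H2 : cnorm (star c ** c ** star c) <= cnorm c ^+ 2 * N[mxe x].
  rewrite -(sys_norm 0 0) -H.
  apply: le_trans (unormM _ _) _; rewrite sys_norm cnorm_star.
  rewrite expr2 mulrAC ler_wpM2r// ?cnorm_ge0//.
  by apply: le_trans (unormM _ _) _; rewrite sys_norm cnorm_star.
have H3 : cnorm c ^+ 3 * cnorm c <= cnorm c ^+ 3 * N[mxe x].
  rewrite -exprSr; apply: le_trans H1 _.
  by rewrite exprSr [_ ^+ 2 * _ * _]mulrAC ler_wpM2r// (ltW cp).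
by move: H3; rewrite ler_pM2l// exprn_gt0.
Qed.

Lemma mxe_inj n : injective (@mxe n).
Proof.
move=> x y xy; apply/matrixP => i j; apply/eqP; rewrite -subr_eq0; apply/eqP/cnorm0_eq0.
apply/eqP; rewrite eq_le cnorm_ge0 andbT.
have := mxe_entry (x - y) i j; rewrite mxeB xy subrr unorm0 !mxE //.
Qed.

(** By [mxe_entry] a Cauchy sequence of matrices of fixed size is Cauchy in each entry, and the
    entrywise limits assemble to a matrix because the size is fixed. *)
Lemma mxe_closed n (u : U) :
  (forall e : R, 0 < e -> exists x : 'M[D]_n, N[u - mxe x] < e) -> exists x : 'M[D]_n, u = mxe x.
Proof.
move=> H.
have /choice[x Hx] (k : nat) : exists x : 'M[D]_n, N[u - mxe x] < k.+1%:R^-1.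
  by apply: H; rewrite invr_gt0.
have Cx (e : R) : 0 < e -> exists N, forall m, (N <= m)%N -> N[u - mxe (x m)] < e.
  move=> e0; have [N HN] := inv_small 1 e0; exists N => m Nm.
  apply: lt_le_trans (Hx m) _; apply: le_trans HN.
  by rewrite div1r lef_pV2 ?posrE// ler_nat ltnS.
have /choice[l Hl] (ij : 'I_n * 'I_n) : exists l, forall e : R, 0 < e ->
    exists N, forall m, (N <= m)%N -> cnorm (x m ij.1 ij.2 - l) < e.
  apply: ccomplete => e e0; have [N HN] := Cx _ (half_gt0 e0); exists N => p q Np Nq.
  have := mxe_entry (x p - x q) ij.1 ij.2; rewrite mxeB !mxE => K.
  apply: le_lt_trans K _; apply: le_lt_trans (udistD u _ _) _.
  by rewrite [X in X + _]udistC; have := HN _ Np; have := HN _ Nq; lra.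
pose y : 'M[D]_n := \matrix_(i, j) l (i, j).
exists y; apply/eqP; rewrite -subr_eq0 -unorm_le0.
apply: le_eps => e e0; rewrite add0r.
pose c := e / 2 / (n * n).+1%:R.
have c0 : 0 < c by rewrite divr_gt0// half_gt0.
have /choice[M HM] (ij : 'I_n * 'I_n) := Hl ij _ c0.
have [K HK] := Cx _ (half_gt0 e0).
pose m := maxn K (\max_ij M ij).
have Hm i j : cnorm (x m i j - l (i, j)) < c.
  by apply: (HM (i, j)); rewrite leq_max (leq_bigmax (i, j)) orbT.
apply: le_trans (udistD (mxe (x m)) _ _) _.
have -> : e = e / 2 + e / 2 by lra.
apply: lerD; first by apply/ltW/HK; rewrite leq_maxl.
rewrite -mxeB; apply: le_trans (mxe_norm _) _.
apply: (@le_trans _ _ (\sum_(i < n) \sum_(j < n) c)).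
  by apply: ler_sum => i _; apply: ler_sum => j _; rewrite !mxE ltW.
rewrite !sumr_const !card_ord -mulrnA -[c *+ _]mulr_natr.
rewrite /c mulrAC ler_pdivrMr ?ltr0n//.
by rewrite ler_wpM2l ?ler_nat// ltW// half_gt0.
Qed.

End One.
End Systems.

Lemma power_trick (R : realType) (a b C : R) : 0 <= a -> 0 <= b -> 0 <= C ->
  (forall k, a ^+ (2 ^ k) <= C * b ^+ (2 ^ k)) -> a <= b.
Proof.
move=> a0 b0 C0 H; rewrite leNgt; apply/negP => ba.
have ap : 0 < a by apply: le_lt_trans ba.
have q1 : 0 <= b / a < 1 by rewrite divr_ge0// ltr_pdivrMr// mul1r.
have C1 : 0 < (C + 1)^-1 by rewrite invr_gt0 ltr_wpDl.
have [n Hn] := exp_small q1 C1.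
have nk : (n <= 2 ^ n)%N by apply/ltnW/ltn_expl.
have := Hn _ nk; rewrite expr_div_n ltr_pdivrMr ?exprn_gt0// => K.
have := H n; rewrite leNgt => /negP; apply.
apply: (@le_lt_trans _ _ ((C + 1) * b ^+ (2 ^ n))).
  by rewrite ler_wpM2r ?exprn_ge0// lerDl.
by rewrite -ltr_pdivlMl ?ltr_wpDl//.
Qed.

Section TwoSystems.
Variables (R : realType) (D : cstarAlgType R) (U V : ucstarType R).
Variables (E : nat -> nat -> D -> U) (F : nat -> nat -> D -> V).
Hypotheses (sysE : mxsys E) (sysF : mxsys F).

(* The entrywise bound [N[mxe F y] <= n^2 N[mxe E y]] improves to the constant
   [1] by applying it to the powers of a self-adjoint [y]. *)
Lemma sys_contr n (x : 'M[D]_n) : N[mxe F x] <= N[mxe E x].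
Proof.
have H (y : 'M[D]_n) : N[mxe F y] <= (n * n)%:R * N[mxe E y].
  apply: le_trans (mxe_norm sysF _) _.
  apply: (@le_trans _ _ (\sum_(i < n) \sum_(j < n) N[mxe E y])).
    by apply: ler_sum => i _; apply: ler_sum => j _; apply: mxe_entry.
  by rewrite !sumr_const !card_ord -mulrnA mulr_natl.
apply: sqr_le; rewrite ?unorm_ge0//.
pose h k := iter k (fun y => mmul y y) (mmul (mstar x) x).
have hS k : h k.+1 = mmul (h k) (h k) by [].
suff K (W : ucstarType R) (G : nat -> nat -> D -> W) : mxsys G -> forall k,
    sa (mxe G (h k)) /\ N[mxe G (h k)] = (N[mxe G x] ^+ 2) ^+ (2 ^ k).
  apply: (@power_trick _ _ _ (n * n)%:R); rewrite ?exprn_ge0 ?unorm_ge0// => k.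
  have [_ <-] := K _ _ sysF k; have [_ <-] := K _ _ sysE k; exact: H.
move=> sysG; elim=> [|k [IH1 IH2]].
  by rewrite /h /= mxeM// mxe_star//; split; [exact: sa_ustarM|exact: unorm_ustar_mul].
rewrite hS mxeM//; split; first exact: saM.
by rewrite sa_norm_sqr// IH2 -exprM -expnSr.
Qed.

End TwoSystems.

(** * Corners of the stabilization *)

Section Emb.
Variables (R : realType) (A : cstarAlgType R) (AK : stabilization A).
Implicit Types (x y z : AK) (a b c : A).

Lemma embD i j a b : emb AK i j (a + b) = emb AK i j a + emb AK i j b.
Proof. by rewrite -[a]scale1r emb_linear !scale1r. Qed.

Lemma emb0 i j : emb AK i j 0 = 0.
Proof. by apply: (addrI (emb AK i j 0)); rewrite -embD !addr0. Qed.

Lemma embZ i j (k : R[i]) a : emb AK i j (k *: a) = k *: emb AK i j a.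
Proof. by rewrite -[k *: a]addr0 emb_linear emb0 addr0. Qed.

Lemma emb_norm i j a : cnorm (emb AK i j a) = cnorm a.
Proof.
have H k b : cnorm (emb AK k k b) = cnorm b.
  apply: chom_iso => [l c d|c d|c|]; last exact: emb_inj.
  - exact: emb_linear.
  - by rewrite emb_mul eqxx.
  - by rewrite emb_star.
apply: (@pexpIrn _ 2); rewrite ?nnegrE ?cnorm_ge0//.
by rewrite -!cnorm_starM emb_star emb_mul eqxx H.
Qed.

Definition Em (D : cstarAlgType R) (g : D -> A) (i j : nat) (d : D) : utz AK :=
  jz (emb AK i j (g d)).

Lemma Em_sys (D : cstarAlgType R) (g : D -> A) :
  (forall (k : R[i]) (x y : D), g (k *: x + y) = k *: g x + g y) ->
  (forall x y : D, g (x ** y) = g x ** g y) -> (forall x : D, g (star x) = star (g x)) ->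
  (forall x : D, cnorm (g x) = cnorm x) -> mxsys (Em g).
Proof.
move=> gL gM gS gI.
have gD (a b : D) : g (a + b) = g a + g b by rewrite -[a]scale1r gL !scale1r.
have g0 : g 0 = 0 by apply: (addrI (g 0)); rewrite -gD !addr0.
have gZ k (a : D) : g (k *: a) = k *: g a by rewrite -[k *: a]addr0 gL g0 addr0.
rewrite /Em; split=> [i j a b|i j k a|i j k l a b|i j a|i j a].
- by rewrite gD embD jzD.
- by rewrite gZ embZ jzZ.
- by rewrite -jzM emb_mul gM; case: ifP.
- by rewrite -jz_star emb_star gS.
- by rewrite N_jz emb_norm gI.
Qed.

Lemma Em_id : mxsys (Em (@id A)).
Proof. exact: Em_sys. Qed.

Lemma mx_in_mxe n (x : 'M[A]_n) : jz (mx_in AK x) = mxe (Em id) x.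
Proof. by rewrite jz_sum; apply: eq_bigr => i _; rewrite jz_sum. Qed.

Lemma emb_closed i j z :
  (forall e : R, 0 < e -> exists c, cnorm (z - emb AK i j c) < e) -> exists c, z = emb AK i j c.
Proof.
move=> H.
have embB a b : emb AK i j (a - b) = emb AK i j a - emb AK i j b.
  by rewrite embD -scaleN1r embZ scaleN1r.
have /choice[c Hc] (k : nat) : exists c, cnorm (z - emb AK i j c) < k.+1%:R^-1.
  by apply: H; rewrite invr_gt0.
have Cc (e : R) : 0 < e -> exists N, forall m, (N <= m)%N -> cnorm (z - emb AK i j (c m)) < e.
  move=> e0; have [N HN] := inv_small 1 e0; exists N => m Nm.
  apply: lt_le_trans (Hc m) _; apply: le_trans HN.
  by rewrite div1r lef_pV2 ?posrE// ler_nat ltnS.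
have [l Hl] : exists l, forall e : R, 0 < e ->
    exists N, forall m, (N <= m)%N -> cnorm (c m - l) < e.
  apply: ccomplete => e e0; have [N HN] := Cc _ (half_gt0 e0); exists N => p q Np Nq.
  rewrite -(emb_norm i j) embB; apply: le_lt_trans (cdistD z _ _) _.
  by rewrite [X in X + _]cdistC; have := HN _ Np; have := HN _ Nq; lra.
exists l; apply/eqP; rewrite -subr_eq0; apply/eqP/cnorm0_eq0.
apply/eqP; rewrite eq_le cnorm_ge0 andbT; apply: le_eps => e e0; rewrite add0r.
have [N HN] := Cc _ (half_gt0 e0); have [M HM] := Hl _ (half_gt0 e0).
apply: le_trans (cdistD (emb AK i j (c (maxn N M))) _ _) _.
rewrite -embB emb_norm.
by have := HN _ (leq_maxl N M); have := HM _ (leq_maxr N M); lra.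
Qed.

Lemma emb_approx z (e : R) : 0 < e -> exists s : seq (nat * nat * A),
  cnorm (z - \sum_(p <- s) emb AK p.1.1 p.1.2 p.2) < e.
Proof.
move=> e0; have : setT z by [].
rewrite -(emb_dense AK) => /closureP/(_ e e0)[_ [s ->]].
by rewrite cdistC; exists s.
Qed.

(** Clear for a finite sum of matrix units; density of these sums and closedness of the corner
    ([emb_closed]) give the general case. *)
Lemma corner i k l j a b z : exists c, emb AK i k a ** z ** emb AK l j b = emb AK i j c.
Proof.
apply: emb_closed => e e0.
pose K := cnorm a * cnorm b + 1.
have K0 : 0 < K by rewrite ltr_wpDl// mulr_ge0// cnorm_ge0.
have [s Hs] := emb_approx z (divr_gt0 e0 K0).
have [c Hc] : exists c, emb AK i k a ** (\sum_(p <- s) emb AK p.1.1 p.1.2 p.2) ** emb AK l j b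
    = emb AK i j c.
  elim: s {Hs} => [|[[u v] d] s [c IH]].
    by exists 0; rewrite big_nil cmul0r cmul0l emb0.
  rewrite big_cons cmulDr cmulDl IH emb_mul.
  have [ku|_] := eqVneq k u; last by exists c; rewrite cmul0l add0r.
  rewrite emb_mul; have [vl|_] := eqVneq v l; last by exists c; rewrite add0r.
  by exists (a ** d ** b + c); rewrite embD.
exists c; rewrite -Hc -cmulBl -cmulBr.
apply: le_lt_trans (cnormM _ _) _; rewrite emb_norm.
apply: le_lt_trans (ler_wpM2r (cnorm_ge0 _) (cnormM _ _)) _; rewrite emb_norm.
move: Hs; set w := cnorm (z - _) => Hs; rewrite ltr_pdivlMr// in Hs.
have : 0 <= w by apply: cnorm_ge0.
have := cnorm_ge0 a; have := cnorm_ge0 b; rewrite /K in Hs; nra.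
Qed.

Lemma corner_u i k l j a b (u : utz AK) : exists c, Em id i k a * u * Em id l j b = Em id i j c.
Proof.
case: u => m z; have [c Hc] := corner i k l j a b z.
exists (c + (if k == l then m *: (a ** b) else 0)).
rewrite /Em embD -Hc; congr pair; first by rewrite /= mul0r mul0r.
rewrite /= mul0r !scale0r !add0r cmulDl -cscalerAl emb_mul addrC; congr (_ + _).
by case: ifP => _; rewrite ?embZ// scaler0 emb0.
Qed.

End Emb.

Section FiniteMatrices.
Variables (R : realType) (D : cstarAlgType R) (U : ucstarType R) (E : nat -> nat -> D -> U).
Hypothesis sysE : mxsys E.

Definition finmx n (u : U) := exists x : 'M[D]_n, u = mxe E x.

Lemma finmxD n u v : finmx n u -> finmx n v -> finmx n (u + v).
Proof. by move=> [x ->] [y ->]; exists (x + y); rewrite mxeD. Qed.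

Lemma finmxM n u v : finmx n u -> finmx n v -> finmx n (u * v).
Proof. by move=> [x ->] [y ->]; exists (mmul x y); rewrite mxeM. Qed.

Lemma finmx_star n u : finmx n u -> finmx n u^*u.
Proof. by move=> [x ->]; exists (mstar x); rewrite mxe_star. Qed.

Lemma finmxZ n (k : R) u : finmx n u -> finmx n (k *: u).
Proof. by move=> [x ->]; exists (mscale k x); rewrite mxeZ. Qed.

Lemma finmx0 n : finmx n 0.
Proof. by exists 0; rewrite mxe0. Qed.

Lemma finmx_sum n I (r : seq I) (P : pred I) (F : I -> U) :
  (forall i, P i -> finmx n (F i)) -> finmx n (\sum_(i <- r | P i) F i).
Proof.
move=> H; elim/big_rec: _ => [|i x Pi hx]; first exact: finmx0.
by apply: finmxD => //; apply: H.
Qed.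

Lemma finmx_closed n u :
  (forall e : R, 0 < e -> exists2 v, finmx n v & N[u - v] < e) -> finmx n u.
Proof.
move=> H; apply: mxe_closed => // e /H[_ [x ->] Hx]; by exists x.
Qed.

Lemma finmx_E n i j a : (i < n)%N -> (j < n)%N -> finmx n (E i j a).
Proof.
move=> im jn; exists (\matrix_(k, l) if (k == Ordinal im) && (l == Ordinal jn) then a else 0).
rewrite /mxe (bigD1 (Ordinal im))//= [X in _ + X]big1 ?addr0 => [|k /negPf ki].
  rewrite (bigD1 (Ordinal jn))//= [X in _ + X]big1 ?addr0 => [|l /negPf lj].
    by rewrite mxE !eqxx.
  by rewrite mxE lj andbF sys_0.
by rewrite big1// => l _; rewrite mxE ki sys_0.
Qed.

Lemma finmx_widen n m u : (n <= m)%N -> finmx n u -> finmx m u.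
Proof.
move=> nm [x ->]; apply: finmx_sum => i _; apply: finmx_sum => j _.
by apply: finmx_E; apply: leq_trans nm.
Qed.

Lemma finmx_pev n p u : finmx n u -> finmx n (pev p u - (p.[0])%:A).
Proof.
move=> hu; elim/poly_ind: p => [|p c IH]; first by rewrite pev0 horner0 scale0r subrr; exact: finmx0.
rewrite pevD pevM pevX pevC !hornerE addrK.
have -> : pev p u * u = (pev p u - p.[0]%:A) * u + p.[0] *: u.
  by rewrite mulrBl -scalerAl mul1r subrK.
by apply: finmxD; [apply: finmxM|apply: finmxZ].
Qed.

Lemma finmx_fc n f u : papp f -> f 0 = 0 -> sa u -> finmx n u -> finmx n (fc f u).
Proof.
move=> pf f0 su hu; apply: finmx_closed => e e0.
have e3 : 0 < e / 3 by lra.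
have [g [g1 g2]] := fc_approx pf su e3.
exists (pev g u - (g.[0])%:A); first exact: finmx_pev.
rewrite opprB addrCA; apply: le_lt_trans (unormD _ _) _.
have := g1 0; rewrite normr0 unorm_ge0 f0 sub0r normrN => /(_ isT) H.
by rewrite unormZ unorm1 mulr1; lra.
Qed.

Lemma finmx_ucut n t u : 0 <= t -> sa u -> finmx n u -> finmx n (ucut t u).
Proof. by move=> t0; apply: finmx_fc; [exact: papp_cut|rewrite /cut sub0r max_r// oppr_le0]. Qed.

End FiniteMatrices.

Section FinStab.
Variables (R : realType) (A : cstarAlgType R) (AK : stabilization A).
Local Notation E := (@Em R A AK A id).

(** [M_n(A)] is hereditary in [A (x) K]: expanding [u] and [v] into entries leaves only terms of the
    form treated in [corner_u]. *)
Lemma finmx_her n (u v w : utz AK) : finmx E n u -> finmx E n v -> finmx E n (u * w * v).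
Proof.
move=> [x ->] [y ->]; rewrite /mxe 2!mulr_suml; apply: finmx_sum; first exact: Em_id.
move=> i _; rewrite 2!mulr_suml; apply: finmx_sum; first exact: Em_id.
move=> k _; rewrite mulr_sumr; apply: finmx_sum; first exact: Em_id.
move=> l _; rewrite mulr_sumr; apply: finmx_sum; first exact: Em_id.
move=> j _; have [c ->] := corner_u i k l j (x i k) (y l j) w.
by apply: finmx_E; first exact: Em_id.
Qed.

Lemma finmx_ideal n u : finmx E n u -> ideal u.
Proof. by move=> [x ->]; rewrite -mx_in_mxe. Qed.

Lemma finmx_dense (u : utz AK) (e : R) : ideal u -> 0 < e ->
  exists n v, finmx E n v /\ N[u - v] < e.
Proof.
move=> /idealP -> e0; have [s Hs] := emb_approx u.2 e0.
pose m := (\max_(p <- s) (maxn p.1.1 p.1.2).+1)%N.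
exists m, (jz (\sum_(p <- s) emb AK p.1.1 p.1.2 p.2)).
rewrite -jzB N_jz; split=> //; rewrite jz_sum big_seq.
apply: finmx_sum => [|p ps]; first exact: Em_id.
have H : ((maxn p.1.1 p.1.2).+1 <= m)%N.
  by apply: (leq_bigmax_seq (F := fun p : nat * nat * A => (maxn p.1.1 p.1.2).+1)).
apply: (finmx_E (Em_id AK)); apply: leq_trans H; rewrite ltnS ?leq_maxl ?leq_maxr //.
Qed.

End FinStab.

(** * The Cuntz semigroup *)

Section CuSeq.
Variables (R : realType) (U : ucstarType R).
Implicit Types (a b c : U) (s t : seq U).

Definition fam (s : seq U) (i : 'I_(size s)) : U := nth 0 s i.
Arguments fam : clear implicits.
Definition lsub s t := fsub (fam s) (fam t).

Lemma lsub_refl s : lsub s s.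
Proof. by apply: (fsub_inj (h := id)). Qed.

Lemma lsub_trans t s r : lsub s t -> lsub t r -> lsub s r.
Proof. exact: fsub_trans. Qed.

Lemma fcat_fam s t : fsub (fcat (fam s) (fam t)) (fam (s ++ t)).
Proof.
apply: (fsub_inj (h := fun u => cast_ord (esym (size_cat s t)) (unsplit u))).
  by move=> x y /cast_ord_inj /(can_inj (@unsplitK _ _)).
case=> i /=; rewrite /fam /= nth_cat; first by rewrite ltn_ord.
by rewrite ltnNge leq_addr /= addKn.
Qed.

Lemma fam_fcat s t : fsub (fam (s ++ t)) (fcat (fam s) (fam t)).
Proof.
apply: (fsub_inj (h := fun i => @fintype.split (size s) (size t) (cast_ord (size_cat s t) i))).
  by move=> x y /(can_inj (@splitK _ _)) /cast_ord_inj.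
move=> i; rewrite {1}/fam nth_cat.
by case: splitP => j /= ->; rewrite ?ltn_ord// ltnNge leq_addr /= addKn.
Qed.

Lemma lsub_cat s t s' t' : lsub s t -> lsub s' t' -> lsub (s ++ s') (t ++ t').
Proof.
move=> h h'; apply: fsub_trans (fam_fcat _ _) _; apply: fsub_trans (fcat_fam _ _).
exact: fsub_cat.
Qed.

Lemma lsub_catC s t : lsub (s ++ t) (t ++ s).
Proof.
apply: fsub_trans (fam_fcat _ _) _; apply: fsub_trans (fcat_fam _ _).
apply: (fsub_inj (h := fun u => match u with inl i => inr i | inr j => inl j end)).
  by move=> [x|x] [y|y] // [->].
by case.
Qed.

Lemma lsub_nil s : lsub [::] s.
Proof. by apply: (fsub_inj (h := fun i : 'I_0 => match notF (ltn_ord i) with end)) => [[]|[]]. Qed.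

Definition leqv s t := `[< lsub s t /\ lsub t s >].

Lemma leqv_refl : reflexive leqv.
Proof. by move=> s; apply/asboolP; split; exact: lsub_refl. Qed.

Lemma leqv_sym : symmetric leqv.
Proof. by move=> s t; apply/asboolP/asboolP => [[]|[]]. Qed.

Lemma leqv_trans : transitive leqv.
Proof.
move=> t s r /asboolP[a b] /asboolP[c d]; apply/asboolP.
by split; [apply: lsub_trans c|apply: lsub_trans b].
Qed.

Canonical leqv_equiv := EquivRel leqv leqv_refl leqv_sym leqv_trans.

(** A sequence stands for a diagonal matrix. Concatenation gives an addition that is defined for all
    elements, whereas adding inside [U] would first require orthogonal copies. *)
Definition Cu := {eq_quot leqv}%qT.
HB.instance Definition _ := Choice.on Cu.

Definition cul s : Cu := \pi_Cu%qT s.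
Definition cule (x y : Cu) := lsub (repr x) (repr y).

Lemma repr_cul s : leqv (repr (cul s)) s.
Proof. by apply/(@eqquotP _ leqv_equiv _ _ _); exact: (reprK (cul s)). Qed.

Lemma culP s t : cule (cul s) (cul t) <-> lsub s t.
Proof.
have /asboolP[a b] := repr_cul s; have /asboolP[c d] := repr_cul t.
split=> h; first by apply: lsub_trans b _; apply: lsub_trans h _.
by apply: lsub_trans a _; apply: lsub_trans h _.
Qed.

Lemma cul_eq s t : lsub s t -> lsub t s -> cul s = cul t.
Proof. by move=> h k; apply/(@eqquotP _ leqv_equiv _ _ _)/asboolP. Qed.

Definition cu_add (x y : Cu) : Cu := cul (repr x ++ repr y).

Lemma cu_addE s t : cu_add (cul s) (cul t) = cul (s ++ t).
Proof.
have /asboolP[a b] := repr_cul s; have /asboolP[c d] := repr_cul t.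
by apply: cul_eq; apply: lsub_cat.
Qed.

Lemma cul_ind (P : Cu -> Prop) : (forall s, P (cul s)) -> forall x, P x.
Proof. by move=> H x; rewrite -[x]reprK; apply: H. Qed.

Lemma cu_addA : associative cu_add.
Proof.
elim/cul_ind=> s; elim/cul_ind=> t; elim/cul_ind=> r.
by rewrite !cu_addE catA.
Qed.

Lemma cu_addC : commutative cu_add.
Proof.
elim/cul_ind=> s; elim/cul_ind=> t.
by rewrite !cu_addE; apply: cul_eq; exact: lsub_catC.
Qed.

Lemma cu_add0 : left_id (cul [::]) cu_add.
Proof. by elim/cul_ind=> s; rewrite cu_addE. Qed.

HB.instance Definition _ := GRing.isNmodule.Build Cu cu_addA cu_addC cu_add0.

Definition cu a : Cu := cul [:: a].

Lemma cul_cat s t : cul (s ++ t) = cul s + cul t.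
Proof. by rewrite -cu_addE. Qed.

Lemma cule_refl x : cule x x.
Proof. exact: lsub_refl. Qed.

Lemma cule_trans y x z : cule x y -> cule y z -> cule x z.
Proof. exact: lsub_trans. Qed.

Lemma cuD x y x' y' : cule x x' -> cule y y' -> cule (x + y) (x' + y').
Proof.
elim/cul_ind: x => x; elim/cul_ind: y => y; elim/cul_ind: x' => x'; elim/cul_ind: y' => y'.
move=> /culP h /culP k; rewrite -!cul_cat; apply/culP; exact: lsub_cat.
Qed.

Lemma cule0 x : cule 0 x.
Proof. by elim/cul_ind: x => s; apply/(culP [::]); exact: lsub_nil. Qed.

Lemma cuMn x y n : cule x y -> cule (x *+ n) (y *+ n).
Proof. by move=> h; elim: n => [|n IH]; rewrite ?mulr0n ?cule0// ?mulrS; [exact: cule_refl|apply: cuD]. Qed.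

Lemma cuMn_le x m n : (m <= n)%N -> cule (x *+ m) (x *+ n).
Proof.
move=> /subnKC <-; rewrite mulrnDr -[X in cule X _]addr0.
by apply: cuD; [exact: cule_refl|exact: cule0].
Qed.

Lemma cule_addl x y : cule x (x + y).
Proof. by rewrite -[X in cule X _]addr0; apply: cuD; [exact: cule_refl|exact: cule0]. Qed.

Lemma fam_codom (I : finType) (a : I -> U) : fsub a (fam (codom a)) /\ fsub (fam (codom a)) a.
Proof.
have E (i : I) : (enum_rank i < size (codom a))%N by rewrite size_codom; exact: ltn_ord.
split.
  apply: (fsub_inj (h := fun i => Ordinal (E i))).
    by move=> i j [] /val_inj /enum_rank_inj.
  move=> i; rewrite /fam /= nth_codom. by rewrite enum_rankK.
have C : size (codom a) = #|I| by rewrite size_codom.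
apply: (fsub_inj (h := fun i => enum_val (cast_ord C i))).
  by move=> i j /enum_val_inj/cast_ord_inj.
by move=> i; rewrite /fam -[nat_of_ord i]/(nat_of_ord (cast_ord C i)) nth_codom.
Qed.

Definition cuf (I : finType) (a : I -> U) := cul (codom a).

Lemma cufP (I J : finType) (a : I -> U) (b : J -> U) : cule (cuf a) (cuf b) <-> fsub a b.
Proof.
have [h1 h2] := fam_codom a; have [k1 k2] := fam_codom b.
split=> [/culP h|h]; first by apply: fsub_trans h1 _; apply: fsub_trans k2.
by apply/culP; apply: fsub_trans h2 _; apply: fsub_trans k1.
Qed.

Lemma cuf_sum (I : finType) (a : I -> U) : cuf a = \sum_i cu (a i).
Proof.
have -> : \sum_i cu (a i) = \sum_(i <- enum I) cu (a i) by rewrite big_enum.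
rewrite /cuf codomE; by elim: (enum _) => [|i s IH]; rewrite ?big_nil//= big_cons -IH -cul_cat.
Qed.

Lemma cuf_unit a : cuf (fun _ : unit => a) = cu a.
Proof. by rewrite cuf_sum (big_pred1 tt)// => -[]. Qed.

Lemma cuP a b : cule (cu a) (cu b) <-> csub a b.
Proof. by rewrite -!cuf_unit cufP -fsub1. Qed.

Lemma cu_sum (I : finType) (a : I -> U) : cule (cu (\sum_i a i)) (\sum_i cu (a i)).
Proof. by rewrite -cuf_sum -cuf_unit; apply/cufP; exact: fsub_sum. Qed.

Lemma cu_orth (I : finType) (a : I -> U) : (forall i, upos (a i)) ->
  (forall i j, i != j -> a i * a j = 0) -> cule (\sum_i cu (a i)) (cu (\sum_i a i)).
Proof. by move=> *; rewrite -cuf_sum -cuf_unit; apply/cufP; exact: fsub_orth. Qed.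

Lemma cuf_two (x y : U) : cuf (two x y) = cu x + cu y.
Proof.
have E (z : U) : cu z = \sum_(i : unit) cu z by rewrite (big_pred1 tt)// => -[].
by rewrite cuf_sum big_sumType /= -!E.
Qed.

Lemma cu_add2 a b : cule (cu (a + b)) (cu a + cu b).
Proof. by rewrite -cuf_two -cuf_unit; apply/cufP; exact: fsub_sum2. Qed.

Lemma cu_orth2 a b : upos a -> upos b -> a * b = 0 -> cule (cu a + cu b) (cu (a + b)).
Proof. by move=> *; rewrite -cuf_two -cuf_unit; apply/cufP; exact: fsub_orth2. Qed.

Lemma cuM_ord n a : cu a *+ n = \sum_(i < n) cu a.
Proof. by rewrite sumr_const card_ord. Qed.

Lemma cu0 : cule (cu 0) 0.
Proof.
apply/culP => e e0; exists (fun _ _ => 0) => i i'.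
rewrite big_ord0 /fam; case: i => [[|//] hi] /=; case: (_ == _); rewrite subrr unorm0//.
Qed.

End CuSeq.

Lemma cu_eqP (R : realType) (U : ucstarType R) (a b : U) : csub a b -> csub b a -> cu a = cu b.
Proof.
move=> h k; apply: cul_eq; [apply/(@culP _ _ [:: a] [:: b])|apply/(@culP _ _ [:: b] [:: a])]; exact/cuP.
Qed.

(** * Diagonal copies of a finite matrix *)

Section Shifts.
Variables (R : realType) (D : cstarAlgType R) (U : ucstarType R) (E : nat -> nat -> D -> U).
Hypothesis sysE : mxsys E.
Implicit Types rho sg tau : nat -> nat.

Definition mxr n rho sg (x : 'M[D]_n) : U := \sum_(i < n) \sum_(j < n) E (rho i) (sg j) (x i j).

Lemma shift_sys sg : injective sg -> mxsys (fun i j => E (sg i) (sg j)).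
Proof.
case: sysE => h1 h2 h3 h4 h5 si; split=> // i j k l a b.
by rewrite h3 (inj_eq si).
Qed.

Lemma mxr_star n rho sg (x : 'M[D]_n) : (mxr rho sg x)^*u = mxr sg rho (mstar x).
Proof.
rewrite /mxr ustar_sum; under eq_bigr do rewrite ustar_sum.
rewrite exchange_big; apply: eq_bigr => i _; apply: eq_bigr => j _.
by rewrite mxE sys_star.
Qed.

Lemma mxrM n rho sg tau (x y : 'M[D]_n) : injective sg ->
  mxr rho sg x * mxr sg tau y = mxr rho tau (mmul x y).
Proof.
move=> si; rewrite mulr_suml; apply: eq_bigr => i _; rewrite mulr_suml.
transitivity (\sum_(j < n) \sum_(k < n) E (rho i) (tau k) (x i j ** y j k)).
  apply: eq_bigr => j _; rewrite mulr_sumr (bigD1 j)//= [X in _ + X]big1 ?addr0.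
    by rewrite mulr_sumr; apply: eq_bigr => k _; rewrite sys_M// eqxx.
  move=> k kj; rewrite mulr_sumr big1// => l _; rewrite sys_M// ifN//.
  by apply: contra kj => /eqP/si/val_inj ->.
rewrite exchange_big; apply: eq_bigr => k _.
by rewrite mxE sys_sum.
Qed.

Lemma mxr_orth n rho sg sg' tau (x y : 'M[D]_n) :
  (forall i j : 'I_n, sg i != sg' j) -> mxr rho sg x * mxr sg' tau y = 0.
Proof.
move=> H; rewrite mulr_suml big1// => i _; rewrite mulr_suml big1// => j _.
rewrite mulr_sumr big1// => k _; rewrite mulr_sumr big1// => l _.
by rewrite sys_M// ifN.
Qed.

(** The partial isometry moving the indices by [sg] need not exist, as [D] may lack a unit. The
    square root of [x] with its rows relabelled by [sg] takes its place. *)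
Lemma shift_witness n sg (x : 'M[D]_n) : injective sg -> upos (mxe E x) ->
  exists Y : U, Y^*u * Y = mxe E x /\ Y * Y^*u = mxr sg sg x.
Proof.
move=> si ux; have sx := upos_sa ux.
pose h := fc (fun t : R => Num.sqrt t) (mxe E x).
have pq : papp (fun t : R => Num.sqrt t) by exact: papp_sqrtp.
have [y hy] : finmx E n h by apply: finmx_fc => //; [rewrite sqrtr0|exists x].
have sh : sa h by apply: fc_sa.
have hh : h * h = mxe E x.
  rewrite -[RHS]upos_ppos// /h -fcM//.
  apply: fc_eq_pos => //; [by apply: pappM|exact: papp_ppos|].
  by move=> t /andP[t0 _]; rewrite sqrtM_id// /ppos max_l.
have sy : mstar y = y by apply: (mxe_inj sysE); rewrite mxe_star// -hy.
have yy : mmul y y = x by apply: (mxe_inj sysE); rewrite mxeM// -hy.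
have idi : injective (id : nat -> nat) by [].
exists (mxr sg id y); split.
  by rewrite mxr_star sy mxrM// yy.
by rewrite mxr_star sy mxrM// yy.
Qed.

Lemma upos_shift n sg (x : 'M[D]_n) : injective sg -> upos (mxe E x) -> upos (mxr sg sg x).
Proof.
move=> si ux; have [Y [_ <-]] := shift_witness si ux; exists Y^*u; by rewrite ustarK.
Qed.

Lemma cu_shift n sg (x : 'M[D]_n) : injective sg -> upos (mxe E x) ->
  cu (mxr sg sg x) = cu (mxe E x).
Proof.
move=> si ux; have [Y [<- <-]] := shift_witness si ux.
by apply: cu_eqP; [have := csub_star Y^*u; rewrite ustarK|exact: csub_star].
Qed.

Definition blk n i (p : nat) := (i * n + p)%N.
Definition dg k n (x : 'M[D]_n) : U := \sum_(i < k) mxr (blk n i) (blk n i) x.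

Lemma blk_inj n i : injective (blk n i).
Proof. by move=> p q /addnI. Qed.

Lemma blk_disj n i j (p q : 'I_n) : i != j -> blk n i p != blk n j q.
Proof.
apply: contra => /eqP H; apply/eqP.
have n0 : (0 < n)%N by apply: leq_trans (ltn_ord p).
by have := congr1 (divn^~ n) H; rewrite /blk !divnMDl// !divn_small// !addn0.
Qed.

(** The dependent indices of [\mxdiag] are decoded through [tagnat]: entry [p] of block [i] sits at
    position [i * n + p], which is [blk n i p]. *)
Lemma dg_W_mul k n (x : 'M[D]_n) : mxe E (W_mul k x) = dg k x.
Proof.
rewrite /mxe.
have S (F : 'I_(\sum_(i < k) n) -> U) :
    \sum_s F s = \sum_(i < k) \sum_(p < n) F (@tagnat.Rank k (fun _ => n) i p).
  rewrite (reindex (@tagnat.rank k (fun _ => n))) /=; last exact: tagnat.rank_bij_on.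
  rewrite sig_big_dep /=; apply: eq_bigr => -[i p] _ //.
rewrite S; apply: eq_bigr => i _; apply: eq_bigr => p _.
rewrite S (bigD1 i)//= [X in _ + X]big1 ?addr0 => [|j ji].
  apply: eq_bigr => q _; rewrite /W_mul.
  have -> : (\mxdiag_(i0 < k) x) (@tagnat.Rank k (fun _ => n) i p) (@tagnat.Rank k (fun _ => n) i q) =
    submxblock (\mxdiag_(i0 < k) x) i i p q by rewrite [RHS]mxE.
  rewrite submxblock_diag.
  have V (r : 'I_n) : @tagnat.Rank k (fun _ => n) i r = blk n i r :> nat.
    rewrite tagnat.RankEsum /blk; congr (_ + _)%N.
    by rewrite sum_nat_const; congr (_ * _)%N; rewrite -[RHS]card_ord -[LHS]sum1_card
      (big_ord_narrow (ltnW (ltn_ord i))) sum1_card.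
  by rewrite -(V p) -(V q).
apply: big1 => q _; rewrite /W_mul.
have -> : (\mxdiag_(i0 < k) x) (@tagnat.Rank k (fun _ => n) i p) (@tagnat.Rank k (fun _ => n) j q) =
  submxblock (\mxdiag_(i0 < k) x) i j p q by rewrite [RHS]mxE.
by rewrite /mxdiag mxblockK eq_sym (negPf ji) mxE sys_0.
Qed.

Lemma cu_dg k n (x : 'M[D]_n) : upos (mxe E x) ->
  cule (cu (dg k x)) (cu (mxe E x) *+ k) /\ cule (cu (mxe E x) *+ k) (cu (dg k x)).
Proof.
move=> ux; have -> : cu (mxe E x) *+ k = \sum_(i < k) cu (mxr (blk n i) (blk n i) x).
  by rewrite cuM_ord; apply: eq_bigr => i _; rewrite cu_shift//; exact: blk_inj.
split; first exact: cu_sum.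
apply: cu_orth => [i|i j ij]; first by apply: upos_shift => //; exact: blk_inj.
by apply: mxr_orth => p q; exact: blk_disj.
Qed.

Lemma upos_dg k n (x : 'M[D]_n) : upos (mxe E x) -> upos (dg k x).
Proof. by move=> ux; apply: upos_sum => i _; apply: upos_shift => //; exact: blk_inj. Qed.

Lemma dgM k n (x y : 'M[D]_n) : dg k (mmul x y) = dg k x * dg k y.
Proof.
rewrite mulr_suml; apply: eq_bigr => i _; rewrite mulr_sumr (bigD1 i)//= big1 ?addr0.
  by rewrite mxrM//; exact: blk_inj.
by move=> j ji; apply: mxr_orth => p q; apply: blk_disj; rewrite eq_sym.
Qed.

Lemma dgB k n (x y : 'M[D]_n) : dg k (x - y) = dg k x - dg k y.
Proof.
rewrite -sumrB; apply: eq_bigr => i _; apply: (mxeB (shift_sys _)); exact: blk_inj.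
Qed.

Lemma dgZ k n (c : R) (x : 'M[D]_n) : dg k (mscale c x) = c *: dg k x.
Proof.
rewrite scaler_sumr; apply: eq_bigr => i _; apply: (mxeZ (shift_sys _)); exact: blk_inj.
Qed.

Lemma dg_star k n (x : 'M[D]_n) : dg k (mstar x) = (dg k x)^*u.
Proof.
rewrite ustar_sum; apply: eq_bigr => i _; apply: (mxe_star (shift_sys _)); exact: blk_inj.
Qed.

Lemma dg_norm k n (x : 'M[D]_n) : N[dg k x] <= k%:R * N[mxe E x].
Proof.
apply: le_trans (unorm_sum _ _ _) _.
apply: (@le_trans _ _ (\sum_(i < k) N[mxe E x])).
  apply: ler_sum => i _; apply: (sys_contr sysE (shift_sys _)); exact: blk_inj.
by rewrite sumr_const card_ord mulr_natl.
Qed.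

Lemma finmx_dg k n (x : 'M[D]_n) : finmx E (k * n) (dg k x).
Proof.
apply: finmx_sum => // i _; apply: finmx_sum => // p _; apply: finmx_sum => // q _.
have H (r : 'I_n) : (blk n i r < k * n)%N.
  apply: (@leq_trans (i.+1 * n)); last by rewrite leq_mul2r ltn_ord orbT.
  by rewrite /blk mulSn addnC ltn_add2r.
by apply: finmx_E.
Qed.

End Shifts.

(** * Transport between two embeddings of the same matrices *)

Section Transport.
Variables (R : realType) (D : cstarAlgType R) (U V : ucstarType R).
Variables (E : nat -> nat -> D -> U) (F : nat -> nat -> D -> V).
Hypotheses (sysE : mxsys E) (sysF : mxsys F).

(** In the application the two algebras are [A (x) K], reached through the inclusion of a
    subalgebra, and a stabilization of that subalgebra. By [sys_contr] in both directions the
    relation is isometric. *)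
Definition finrel n (u : U) (v : V) := exists x : 'M[D]_n, u = mxe E x /\ v = mxe F x.

Lemma finrelB n u v u' v' : finrel n u v -> finrel n u' v' -> finrel n (u - u') (v - v').
Proof. by move=> [x [-> ->]] [y [-> ->]]; exists (x - y); rewrite !mxeB. Qed.

Lemma finrelD n u v u' v' : finrel n u v -> finrel n u' v' -> finrel n (u + u') (v + v').
Proof. by move=> [x [-> ->]] [y [-> ->]]; exists (x + y); rewrite !mxeD. Qed.

Lemma finrelM n u v u' v' : finrel n u v -> finrel n u' v' -> finrel n (u * u') (v * v').
Proof. by move=> [x [-> ->]] [y [-> ->]]; exists (mmul x y); rewrite !mxeM. Qed.

Lemma finrelZ n (k : R) u v : finrel n u v -> finrel n (k *: u) (k *: v).
Proof. by move=> [x [-> ->]]; exists (mscale k x); rewrite !mxeZ. Qed.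

Lemma finrel_star n u v : finrel n u v -> finrel n u^*u v^*u.
Proof. by move=> [x [-> ->]]; exists (mstar x); rewrite !mxe_star. Qed.

Lemma finrel0 n : finrel n 0 0.
Proof. by exists 0; rewrite !mxe0. Qed.

Lemma finrel_sum n I (r : seq I) (f : I -> U) (g : I -> V) :
  (forall i, finrel n (f i) (g i)) -> finrel n (\sum_(i <- r) f i) (\sum_(i <- r) g i).
Proof.
move=> H; elim/big_rec2: _ => [|i y x _ h]; first exact: finrel0.
exact: finrelD.
Qed.

Lemma finrel_E n i j a : (i < n)%N -> (j < n)%N -> finrel n (E i j a) (F i j a).
Proof.
move=> im jn; pose x : 'M[D]_n :=
  \matrix_(k, l) if (k == Ordinal im) && (l == Ordinal jn) then a else 0.
suff H (W : ucstarType R) (G : nat -> nat -> D -> W) : mxsys G -> G i j a = mxe G x.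
  by exists x; split; apply: H.
move=> sysG; rewrite /mxe (bigD1 (Ordinal im))//= [X in _ + X]big1 ?addr0 => [|k /negPf ki].
  rewrite (bigD1 (Ordinal jn))//= [X in _ + X]big1 ?addr0 => [|l /negPf lj].
    by rewrite mxE !eqxx.
  by rewrite mxE lj andbF sys_0.
by rewrite big1// => l _; rewrite mxE ki sys_0.
Qed.

Lemma finrel_dg k n (x : 'M[D]_n) m : (k * n <= m)%N -> finrel m (dg E k x) (dg F k x).
Proof.
move=> km; apply: finrel_sum => i; apply: finrel_sum => p; apply: finrel_sum => q.
have H (r : 'I_n) : (blk n i r < m)%N.
  apply: leq_trans km; apply: (@leq_trans (i.+1 * n)); last by rewrite leq_mul2r ltn_ord orbT.
  by rewrite /blk mulSn addnC ltn_add2r.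
exact: finrel_E.
Qed.

Lemma finrel_norm n u v : finrel n u v -> N[u] = N[v].
Proof. by move=> [x [-> ->]]; apply/eqP; rewrite eq_le !sys_contr. Qed.

Lemma finrel_sa n u v : finrel n u v -> sa u -> sa v.
Proof.
move=> huv su; have := finrelB (finrel_star huv) huv => /finrel_norm; rewrite su subrr unorm0.
by move/esym/eqP; rewrite unorm_eq0 subr_eq0 => /eqP.
Qed.

End Transport.

(* Functional calculus commutes with bounded *-homomorphisms given only as
   relations, so that no C*-algebra of finite matrices need be constructed. *)
Lemma fc_transfer (R : realType) (U V : ucstarType R) (rel : U -> V -> Prop) (C : R) :
  (forall u v u' v', rel u v -> rel u' v' -> rel (u - u') (v - v')) ->
  (forall u v u' v', rel u v -> rel u' v' -> rel (u * u') (v * v')) ->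
  (forall k u v, rel u v -> rel (k *: u) (k *: v)) ->
  (forall u v, rel u v -> N[v] <= C * N[u]) ->
  0 <= C -> forall f u v v', papp f -> f 0 = 0 -> sa u -> sa v -> rel u v -> rel (fc f u) v' ->
  fc f v = v'.
Proof.
move=> rB rM rZ rN C0 f u v v' pf f0 su sv huv hf.
have rp p : rel (pev p u - (p.[0])%:A) (pev p v - (p.[0])%:A).
  elim/poly_ind: p => [|p c IH].
    by have := rB _ _ _ _ huv huv; rewrite !pev0 horner0 !scale0r !subrr.
  rewrite !pevD !pevM !pevX !pevC !hornerE !addrK.
  have H (W : ucstarType R) (w : W) : pev p w * w = (pev p w - p.[0]%:A) * w - (- p.[0]) *: w.
    by rewrite mulrBl -scalerAl mul1r scaleNr opprK subrK.
  by rewrite !H; apply: rB; [apply: rM|apply: rZ].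
apply: fc_eq => // e e0.
have K0 : 0 < 2 * C + 1 by rewrite ltr_wpDl// mulr_ge0.
(* The error consists of [C (d + d)] from the transported difference and of [d] from the constant
   term of the polynomial. *)
pose d := e / (2 * C + 1); have d0 : 0 < d by exact: divr_gt0.
have de : (2 * C + 1) * d = e by rewrite /d mulrCA divff ?mulr1// gt_eqF.
have [p Hp] := pf (N[u] + N[v]) _ d0.
have ge0 (W : ucstarType R) (w : W) := unorm_ge0 w.
have du : d <= e by rewrite -de; nra.
have H0 : `|p.[0]| <= d.
  by have := Hp 0; rewrite normr0 addr_ge0// f0 sub0r normrN => /(_ isT).
exists p; split=> [t tv|].
  by apply: le_trans (Hp t _) du; apply: le_trans tv _; rewrite lerDr.
have h1 : N[fc f u - pev p u] <= d.
  by apply: (fcP pf su) => t tu; apply: Hp; apply: le_trans tu _; rewrite lerDl.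
have HA (W : ucstarType R) : N[(p.[0])%:A : W] <= d by rewrite unormZ unorm1 mulr1.
have h2 : N[v' - (pev p v - (p.[0])%:A)] <= C * (d + d).
  apply: le_trans (rN _ _ (rB _ _ _ _ hf (rp p))) _; rewrite ler_wpM2l//.
  by rewrite opprB addrCA addrC; apply: le_trans (unormD _ _) _; rewrite lerD.
rewrite (_ : v' - pev p v = (v' - (pev p v - (p.[0])%:A)) - p.[0]%:A); last first.
  by rewrite opprB addrA addrAC addrK.
apply: le_trans (unormB _ _) _; have := HA V; rewrite -de; lra.
Qed.

Section TransportFc.
Variables (R : realType) (D : cstarAlgType R) (U V : ucstarType R).
Variables (E : nat -> nat -> D -> U) (F : nat -> nat -> D -> V).
Hypotheses (sysE : mxsys E) (sysF : mxsys F).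

Lemma finrel_fc n f u v : papp f -> f 0 = 0 -> sa u ->
  finrel E F n u v -> finrel E F n (fc f u) (fc f v).
Proof.
move=> pf f0 su huv; have sv := finrel_sa sysE sysF huv su.
have [x hx] : finmx E n (fc f u) by apply: finmx_fc => //; case: huv => x [-> _]; exists x.
exists x; split=> //.
apply: (@fc_transfer _ _ _ (finrel E F n) 1 _ _ _ _ _ f u v) => //; last by exists x.
- by move=> *; apply: finrelB.
- by move=> *; apply: finrelM.
- by move=> *; apply: finrelZ.
- by move=> u' v' /(finrel_norm sysE sysF) ->; rewrite mul1r.
Qed.

Lemma dg_fc k n f (x y : 'M[D]_n) : papp f -> f 0 = 0 -> sa (mxe E x) ->
  fc f (mxe E x) = mxe E y -> fc f (dg E k x) = dg E k y.
Proof.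
move=> pf f0 sx hxy.
have sd : sa (dg E k x).
  rewrite /sa -dg_star//; congr (dg _ _ _); apply: (mxe_inj sysE).
  by rewrite mxe_star.
apply: (@fc_transfer _ _ _ (fun u v => exists x : 'M[D]_n, u = mxe E x /\ v = dg E k x) k%:R
  _ _ _ _ _ f (mxe E x)) => //.
- by move=> u v u' v' [a [-> ->]] [b [-> ->]]; exists (a - b); rewrite mxeB// dgB.
- by move=> u v u' v' [a [-> ->]] [b [-> ->]]; exists (mmul a b); rewrite mxeM// dgM.
- by move=> c u v [a [-> ->]]; exists (mscale c a); rewrite mxeZ// dgZ.
- by move=> u v [a [-> ->]]; exact: dg_norm.
- by exists x.
- by exists y.
Qed.

End TransportFc.

(** * Comparison of finite matrices inside the stabilization *)

Section WLe.
Variables (R : realType) (A : cstarAlgType R) (AK : stabilization A).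
Local Notation E := (@Em R A AK A id).

Lemma mx_positiveP n (a : 'M[A]_n) : mx_positive AK a <-> upos (mxe E a).
Proof.
split=> [[y hy]|ua].
  by rewrite -mx_in_mxe hy jzM jz_star; exists (jz (mx_in AK y)).
have idi : injective (id : nat -> nat) by [].
have sx := upos_sa ua.
pose h := fc (fun t : R => Num.sqrt t) (mxe E a).
have pq : papp (fun t : R => Num.sqrt t) by exact: papp_sqrtp.
have [y hy] : finmx E n h by apply: (finmx_fc (Em_id AK)) => //; [rewrite sqrtr0|exists a].
have sh : sa h by apply: fc_sa.
have hh : h * h = mxe E a.
  rewrite -[RHS]upos_ppos// /h -fcM//.
  apply: fc_eq_pos => //; [by apply: pappM|exact: papp_ppos|].
  by move=> t /andP[t0 _]; rewrite sqrtM_id// /ppos max_l.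
exists y; apply: jz_inj; rewrite jzM jz_star !mx_in_mxe -hy sh hh //.
Qed.

(** The witness [v] is compressed to [w v u] with local approximate units [w] of [b] and [u] of [a].
    These are finite matrices, and [M_n(A)] is hereditary, so [w v u] is one as well. *)
Lemma csub_finmx n (a b : utz AK) (e : R) : upos a -> upos b -> finmx E n a -> finmx E n b ->
  csub a b -> 0 < e -> exists x : 'M[A]_n, N[(mxe E x)^*u * b * mxe E x - a] < e.
Proof.
move=> ua ub fa fb H e0; have sa' := upos_sa ua; have sb' := upos_sa ub.
have e3 : 0 < e / 3 by lra.
have [f [pf f0 f01 Hf]] := approx_unit e3 ua; set u := fc f a in Hf.
have u1 : N[u] <= 1 by apply: fc01_norm.
have su : sa u by apply: fc_sa.
have [v Hv] := H _ e3.
pose K := N[v] ^+ 2 + 1.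
have K0 : 0 < K by rewrite ltr_wpDl// exprn_ge0// unorm_ge0.
have [g [pg g0 g01 Hg]] := approx_unit (divr_gt0 e3 K0) ub; set w := fc g b in Hg.
have sw : sa w by apply: fc_sa.
have fu : finmx E n u by apply: (finmx_fc (Em_id AK)).
have fw : finmx E n w by apply: (finmx_fc (Em_id AK)).
have [x hx] := finmx_her v fw fu.
exists x; rewrite -hx 2!ustarM su sw.
rewrite (_ : _ - _ = u * (v^*u * b * v - a) * u - (a - u * a * u)
  - u * (v^*u * (b - w * b * w) * v) * u); last by ncring.
have D1 := norm_sand_le1 (v^*u * b * v - a) u1 u1.
have D2 := norm_sand_le1 (v^*u * (b - w * b * w) * v) u1 u1.
have D3 := norm_conj_le (b - w * b * w) v.
have D4 : N[v] ^+ 2 * N[b - w * b * w] <= e / 3.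
  apply: le_trans (_ : K * N[b - w * b * w] <= _).
    by rewrite ler_wpM2r ?unorm_ge0// lerDl.
  by rewrite mulrC -ler_pdivlMr.
apply: le_lt_trans (unormB _ _) _; apply: le_lt_trans (lerD (unormB _ _) (lexx _)) _.
lra.
Qed.

Lemma W_leP n m (a : 'M[A]_n) (b : 'M[A]_m) : upos (mxe E a) -> upos (mxe E b) ->
  W_le AK a b <-> csub (mxe E a) (mxe E b).
Proof.
move=> ua ub; rewrite -!mx_in_mxe; split.
  move=> [N _ [x /ccvgP Hx]] e e0; have [M HM] := Hx e e0.
  exists (jz (mx_in AK (x M))); rewrite -jz_star -!jzM -jzB N_jz; exact: HM.
move=> H; rewrite !mx_in_mxe in H; exists (maxn n m) => //.
have fa : finmx E (maxn n m) (mxe E a).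
  by apply: finmx_widen; [exact: Em_id|exact: leq_maxl|exists a].
have fb : finmx E (maxn n m) (mxe E b).
  by apply: finmx_widen; [exact: Em_id|exact: leq_maxr|exists b].
have /choice[x Hx] (k : nat) : exists x : 'M[A]_(maxn n m),
    N[(mxe E x)^*u * mxe E b * mxe E x - mxe E a] < k.+1%:R^-1.
  by apply: csub_finmx; rewrite ?invr_gt0.
exists x; apply/ccvgP => e e0; have [N HN] := inv_small 1 e0.
exists N => k Nk; rewrite -N_jz jzB !jzM jz_star !mx_in_mxe.
apply: lt_le_trans (Hx k) _; apply: le_trans HN.
by rewrite div1r lef_pV2 ?posrE// ler_nat ltnS.
Qed.

End WLe.

(** * Simplicity *)

Section AlgebraicIdeal.
Variables (R : realType) (U : ucstarType R).
Implicit Types (x y z u v w : U).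

Definition aid y z := exists s : seq (U * U), z = \sum_(p <- s) p.1 * y * p.2.

Lemma aidD y z w : aid y z -> aid y w -> aid y (z + w).
Proof. by move=> [s ->] [t ->]; exists (s ++ t); rewrite big_cat. Qed.

Lemma aid0 y : aid y 0.
Proof. by exists [::]; rewrite big_nil. Qed.

Lemma aid_mul y z u v : aid y z -> aid y (u * z * v).
Proof.
move=> [s ->]; exists [seq (u * p.1, p.2 * v) | p <- s].
by rewrite big_map mulr_sumr mulr_suml; apply: eq_bigr => p _; rewrite /= !mulrA.
Qed.

Lemma aid_conj y u v : aid y (u * y * v).
Proof. by exists [:: (u, v)]; rewrite big_seq1. Qed.

Lemma aid_mull y z u : aid y z -> aid y (u * z).
Proof. by move=> /(aid_mul u 1); rewrite mulr1. Qed.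

Lemma aid_mulr y z u : aid y z -> aid y (z * u).
Proof. by move=> /(aid_mul 1 u); rewrite mul1r. Qed.

Definition clo y z := forall e : R, 0 < e -> exists2 w, aid y w & N[z - w] < e.

Lemma clo_aid y z : aid y z -> clo y z.
Proof. by move=> h e e0; exists z => //; rewrite subrr unorm0. Qed.

Lemma cloD y z w : clo y z -> clo y w -> clo y (z + w).
Proof.
move=> hz hw e e0; have [z' h1 h2] := hz _ (half_gt0 e0); have [w' k1 k2] := hw _ (half_gt0 e0).
exists (z' + w'); first exact: aidD.
rewrite opprD addrACA; apply: le_lt_trans (unormD _ _) _; lra.
Qed.

Lemma clo_mul y z u v : clo y z -> clo y (u * z * v).
Proof.
move=> hz e e0; pose K := N[u] * N[v] + 1.
have K0 : 0 < K by rewrite ltr_wpDl// mulr_ge0// unorm_ge0.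
have [w h1 h2] := hz _ (divr_gt0 e0 K0); exists (u * w * v); first exact: aid_mul.
rewrite -mulrBl -mulrBr; apply: le_lt_trans (unormM _ _) _.
apply: le_lt_trans (ler_wpM2r (unorm_ge0 _) (unormM _ _)) _.
rewrite ltr_pdivlMr// in h2; have := unorm_ge0 (z - w); have := unorm_ge0 u.
have := unorm_ge0 v; rewrite /K in h2; nra.
Qed.

Lemma clo_lim y z : (forall e : R, 0 < e -> exists2 w, clo y w & N[z - w] < e) -> clo y z.
Proof.
move=> H e e0; have [w hw h] := H _ (half_gt0 e0); have [v hv k] := hw _ (half_gt0 e0).
exists v => //; apply: le_lt_trans (udistD w _ _) _; lra.
Qed.

Lemma clo0 y : clo y 0.
Proof. exact/clo_aid/aid0. Qed.

Lemma csub_norm_sqr u y : upos y -> csub (y * (u^*u * u) * y) y.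
Proof.
move=> uy; have sy := upos_sa uy; apply: csub_trans (csub_sqr uy).
apply: (@csub_uleZ _ _ (N[u] ^+ 2)); rewrite ?exprn_ge0 ?unorm_ge0//.
  by rewrite -{1}sy; apply: upos_conj; exists u.
have H : ule (u^*u * u) (N[u] ^+ 2)%:A.
  by rewrite -unorm_ustar_mul; apply: ule_norm; exact: sa_ustarM.
have := ule_sand sy H; by rewrite -scalerAr mulr1 -scalerAl.
Qed.

(* [(a + b)^* (a + b) <= 2 (a^* a + b^* b)] *)
Lemma cu_sqrD (a b : U) : cule (cu ((a + b)^*u * (a + b))) (cu (a^*u * a) + cu (b^*u * b)).
Proof.
apply: cule_trans (cu_add2 _ _); apply/cuP.
apply: (@csub_uleZ _ _ 2) => //; first by exists (a + b).
exists (a - b); rewrite ustarD ustarB scaler_nat mulr2n; ncring.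
Qed.

Lemma cu_aid y w : upos y -> aid y w -> exists m, cule (cu (w^*u * w)) (cu y *+ m).
Proof.
move=> uy [s ->]; elim: s => [|[u v] s [m IH]].
  exists 0%N; rewrite big_nil mulr0; exact: cu0.
exists m.+1; rewrite big_cons; apply: cule_trans (cu_sqrD _ _) _; rewrite mulrS; apply: cuD => //.
apply/cuP; rewrite (_ : _ * _ = v^*u * (y * (u^*u * u) * y) * v); last first.
  by rewrite /= !ustarM (upos_sa uy); ncring.
exact: csub_trans (csub_conj _ _) (csub_norm_sqr _ uy).
Qed.

(** An element [w] of the algebraic ideal close to [h] satisfies [w^* w <~ m y] for some [m], and
    [h^2] cut at [t] is below [w^* w]. *)
Lemma cu_clo y z t : upos y -> upos z -> (exists h, [/\ clo y h, sa h & z = h * h]) -> 0 < t ->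
  exists m, cule (cu (ucut t z)) (cu y *+ m).
Proof.
move=> uy uz [h [ch sh zh]] t0.
pose K := N[h] + N[h] + 1.
have K0 : 0 < K by rewrite ltr_wpDl// addr_ge0 ?unorm_ge0.
have e0 : 0 < Num.min 1 (t / K) by rewrite lt_min ltr01 divr_gt0.
have [w aw] := ch _ e0; rewrite lt_min ltr_pdivlMr// => /andP[w1 wt].
have [m Hm] := cu_aid uy aw; exists m; apply: cule_trans Hm.
apply/cuP; apply: dist_cut_csub; [exact: upos_sa|by exists w|].
rewrite zh -{1}sh; apply: le_trans (norm_mulB_le _ _ _ _) _.
have Nw : N[w^*u] <= N[h] + 1.
  rewrite norm_ustar -[w](subKr h); apply: le_trans (unormB _ _) _; lra.
have H : N[h^*u - w^*u] = N[h - w] by rewrite -ustarB norm_ustar.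
rewrite H; apply: le_trans (ltW wt).
rewrite -[X in _ + _ * X]mulr1 mulr1 [N[h - w] * N[h]]mulrC -mulrDl mulrC.
rewrite ler_wpM2l ?unorm_ge0// /K; lra.
Qed.

End AlgebraicIdeal.

Section Simple.
Variables (R : realType) (A : cstarAlgType R) (AK : stabilization A).
Hypotheses (hsig : sigma_unital A) (hsimple : simple_cstar A).
Local Notation U := (utz AK).
Local Notation E := (@Em R A AK A id).
Implicit Types (y z w : U) (a b c s : A).
Let sysE := Em_id AK.

Lemma sigma_approx a (e : R) : 0 < e -> exists u, cnorm u <= 1 /\ cnorm (u ** a ** u - a) < e.
Proof.
move=> e0; have [u Hu Hl] := hsig; have [/ccvgP h1 /ccvgP h2] := Hl a.
have [N1 H1] := h1 _ (half_gt0 e0); have [N2 H2] := h2 _ (half_gt0 e0).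
pose n := maxn N1 N2; exists (u n); have [_ un] := Hu n.
have un1 : cnorm (u n) <= 1 by rewrite -lecR -cnormE.
split=> //; apply: le_lt_trans (cdistD (u n ** a) _ _) _.
have : cnorm (u n ** a ** u n - u n ** a) <= cnorm (a ** u n - a).
  rewrite -cmulA -cmulBr; apply: le_trans (cnormM _ _) _.
  by rewrite ler_piMl ?cnorm_ge0.
have := H1 n (leq_maxl _ _); have := H2 n (leq_maxr _ _); lra.
Qed.

Lemma cstar_sq_eq0 (B : cstarAlgType R) (x : B) : star x ** x = 0 -> x = 0.
Proof.
move=> H; apply: cnorm0_eq0; apply/eqP; rewrite -sqrf_eq0 -cnorm_starM H cnorm0 //.
Qed.

(** The elements [z] with [z A b = 0] form a closed ideal. Were it to contain the given [a], it
    would be nonzero, hence all of [A]; then it contains [b^*], which gives [(b^* b)^2 = 0] and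
    [b = 0]. *)
Lemma prime_A a b : a != 0 -> b != 0 -> exists c, a ** c ** b != 0.
Proof.
move=> a0 b0; apply: contrapT => /forallNP H.
have {}H c : a ** c ** b = 0 by apply/eqP/negP => /negP; exact: H.
pose I : set A := [set z | forall c, z ** c ** b = 0].
have tI : two_sided_ideal I.
  split=> [c|k x y hx hy c|d x hx]; first by rewrite !cmul0l.
    by rewrite !cmulDl -!cscalerAl hx hy scaler0 addr0.
  split=> c; first by rewrite -[d ** x ** c]cmulA -[d ** _ ** b]cmulA hx cmul0r.
  by rewrite -[x ** d ** c]cmulA hx.
have cI : closed I.
  apply/closedP => u l hu ul c; apply: cnorm0_eq0; apply/eqP.
  rewrite eq_le cnorm_ge0 andbT; apply: le_eps => e e0; rewrite add0r.
  pose K := cnorm c * cnorm b + 1.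
  have K0 : 0 < K by rewrite ltr_wpDl// mulr_ge0// cnorm_ge0.
  have [N /(_ N (leqnn _))] := ul _ (divr_gt0 e0 K0).
  rewrite cdistC ltr_pdivlMr// => h.
  have -> : l ** c ** b = (l - u N) ** c ** b by rewrite !cmulBl hu subr0.
  apply: le_trans (cnormM _ _) _.
  apply: le_trans (ler_wpM2r (cnorm_ge0 _) (cnormM _ _)) _.
  have := cnorm_ge0 (l - u N); have := cnorm_ge0 c.
  have := cnorm_ge0 b; rewrite /K in h; nra.
have [_ /(_ I tI cI)[I0|IT]] := hsimple.
  by have : I a by []; rewrite I0 => /= /eqP; rewrite (negPf a0).
have : I (star b) by rewrite IT.
move=> /(_ (b ** star b)); rewrite cmulA -cmulA => h.
have : star b ** b = 0.
  by apply: cstar_sq_eq0; rewrite starM starK.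
by move/cstar_sq_eq0/eqP; rewrite (negPf b0).
Qed.

(** If all matrix units of row 0 kill [z], so do all others, since [x^* x = 0] forces [x = 0].
    Approximating [z^*] by sums of matrix units then gives [z^* z = 0]. *)
Lemma left_corner (z : AK) : z != 0 -> exists i a, emb AK 0%N i a ** z != 0.
Proof.
move=> z0; apply: contrapT => /forallNP H.
have {}H i a : emb AK 0%N i a ** z = 0.
  by apply/eqP/negP => /negP h; apply: (H i); exists a.
have K k i a : emb AK k i a ** z = 0.
  apply: cstar_sq_eq0; rewrite starM emb_star cmulA -[_ ** emb AK k i a]cmulA emb_mul eqxx.
  have -> : emb AK i i (star a ** a) = emb AK i 0%N (star a) ** emb AK 0%N i a.
    by rewrite emb_mul eqxx.
  by rewrite -!cmulA H !cmul0r.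
suff : star z ** z = 0 by move/cstar_sq_eq0/eqP; rewrite (negPf z0).
apply: cnorm0_eq0; apply/eqP; rewrite eq_le cnorm_ge0 andbT.
apply: le_eps => e e0; rewrite add0r.
have K0 : 0 < cnorm z + 1 by rewrite ltr_wpDl// cnorm_ge0.
have [s] := emb_approx (star z) (divr_gt0 e0 K0).
rewrite ltr_pdivlMr// => h.
have -> : star z ** z = (star z - \sum_(p <- s) emb AK p.1.1 p.1.2 p.2) ** z.
  by rewrite cmulBl cmul_suml [X in _ - X]big1 ?subr0.
apply: le_trans (cnormM _ _) _; have := cnorm_ge0 z; move: h.
set q := cnorm (_ - _); have : 0 <= q by exact: cnorm_ge0.
nra.
Qed.

Lemma nonzero_corner (z : AK) : z != 0 ->
  exists i j a b c, emb AK 0%N i a ** z ** emb AK j 0%N b = emb AK 0%N 0%N c /\ c != 0.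
Proof.
move=> /left_corner[i [a w0]]; set w := _ ** z in w0.
have sw0 : star w != 0 by apply: contra w0 => /eqP h; rewrite -[w]starK h star0.
have [j [b v0]] := left_corner sw0.
have [c hc] := corner 0%N i j 0%N a (star b) z.
exists i, j, a, (star b), c; split; first exact: hc.
apply: contra v0 => /eqP c0.
by rewrite -[X in X == _]starK starM starK emb_star hc c0 emb0 star0.
Qed.

Lemma prime_AK (x y : AK) : x != 0 -> y != 0 -> exists w : AK, x ** w ** y != 0.
Proof.
move=> /nonzero_corner[i [j [a [b [c [hc c0]]]]]] /nonzero_corner[k [l [d [f [g [hg g0]]]]]].
have [w hw] := prime_A c0 g0.
exists (emb AK j 0%N b ** emb AK 0%N 0%N w ** emb AK 0%N k d).
apply: contra hw => /eqP h; apply/eqP; apply: (@emb_inj _ _ _ AK 0%N 0%N).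
have -> : emb AK 0%N 0%N (c ** w ** g) =
    emb AK 0%N 0%N c ** emb AK 0%N 0%N w ** emb AK 0%N 0%N g by rewrite !emb_mul.
rewrite -hc -hg emb0.
have -> : emb AK 0%N i a ** x ** emb AK j 0%N b ** emb AK 0%N 0%N w **
      (emb AK 0%N k d ** y ** emb AK l 0%N f) =
  emb AK 0%N i a ** (x ** (emb AK j 0%N b ** emb AK 0%N 0%N w ** emb AK 0%N k d) ** y) **
    emb AK l 0%N f by rewrite !cmulA.
by rewrite h cmul0r cmul0l.
Qed.

Lemma prime_U y z : ideal y -> ideal z -> y != 0 -> z != 0 -> exists w, ideal w /\ y * w * z != 0.
Proof.
move=> /idealP -> /idealP ->; set y' := y.2; set z' := z.2 => y0 z0.
have [||w hw] := @prime_AK y' z'.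
- by apply: contra y0 => /eqP ->.
- by apply: contra z0 => /eqP ->.
exists (jz w); split=> //; rewrite -!jzM; apply: contra hw => /eqP h.
by apply/eqP; apply: jz_inj.
Qed.

(** Simplicity passes from [A] to [A (x) K]: the [a] whose corner copy lies in the closed ideal of
    [y] form a nonzero closed ideal of [A]. The approximate unit then spreads the corner to all
    positions through [E i 0 u * E 0 0 a * E 0 j u]. *)
Lemma clo_all y z : ideal y -> y != 0 -> ideal z -> clo y z.
Proof.
move=> iy y0 iz.
pose I : set A := [set a | clo y (E 0 0 a)].
have EZ (k : R[i]) a : E 0 0 (k *: a) = ((k, 0) : U) * E 0 0 a.
  by rewrite /Em embZ; congr pair; rewrite /= ?mulr0// scaler0 addr0 cmul0l addr0.
have tI : two_sided_ideal I.
  split=> [|k a b ha hb|a b hb]; rewrite /I /=.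
  - by rewrite sys_0//; exact: clo0.
  - rewrite sys_D// EZ; apply: cloD => //.
    by have := clo_mul ((k, 0) : U) 1 ha; rewrite mulr1.
  - have h (c d : A) : E 0 0 (c ** d) = E 0 0 c * E 0 0 d by rewrite sys_M.
    rewrite !h; split; first by have := clo_mul (E 0 0 a) 1 hb; rewrite mulr1.
    by have := clo_mul 1 (E 0 0 a) hb; rewrite mul1r.
have cI : closed I.
  apply/closedP => u l hu ul; apply: clo_lim => e /ul[N /(_ N (leqnn _))] h.
  by exists (E 0 0 (u N)); [exact: hu|rewrite -sys_B// sys_norm// cdistC].
have IT : I = setT.
  have [_ /(_ I tI cI)[I0|//]] := hsimple; exfalso.
  have y1 : y.2 != 0 by apply: contra y0 => /eqP h; rewrite (idealP iy) h.
  have [i [j [a [b [c [hc /eqP c0]]]]]] := nonzero_corner y1; apply: c0.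
  suff : I c by rewrite I0.
  by rewrite /I /= /Em /= -hc !jzM -(idealP iy); apply/clo_aid/aid_conj.
have HE i j a : clo y (E i j a).
  apply: clo_lim => e e0; have [u [_ hu]] := sigma_approx a e0.
  exists (E i 0 u * E 0 0 a * E 0 j u).
    by apply: clo_mul; have : I a by rewrite IT.
  by rewrite !sys_M// -sys_B// sys_norm// cdistC.
apply: clo_lim => e e0; have [n [v [[x ->] hx]]] := finmx_dense iz e0.
exists (mxe E x) => //; rewrite /mxe.
elim/big_rec: _ => [|i u _ hu]; first exact: clo0.
apply: cloD => //; elim/big_rec: _ => [|j v' _ hv]; first exact: clo0.
exact: cloD.
Qed.

Lemma upos_ideal_sqrt z : upos z -> ideal z -> exists h, [/\ ideal h, sa h & z = h * h].
Proof.
move=> uz iz; have sz := upos_sa uz; have pq := @papp_sqrtp R.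
exists (fc (fun t : R => Num.sqrt t) z); split.
- by apply: ideal_fc => //; rewrite sqrtr0.
- by apply: fc_sa.
rewrite -[LHS]upos_ppos// -fcM//.
apply: fc_eq_pos => //; [exact: papp_ppos|by apply: pappM|].
by move=> t /andP[t0 _]; rewrite sqrtM_id// /ppos max_l.
Qed.

Lemma cut_le_multiple y z t : upos y -> ideal y -> y != 0 -> upos z -> ideal z -> 0 < t ->
  exists m, cule (cu (ucut t z)) (cu y *+ m).
Proof.
move=> uy iy y0 uz iz t0; apply: cu_clo => //.
have [h [ih sh zh]] := upos_ideal_sqrt uz iz; exists h; split=> //; exact: clo_all.
Qed.

(** The [a] whose corner copy lies in the algebraic ideal of [y] form an ideal of [A], dense by
    [clo_all], so it contains the Pedersen ideal. Thus the bound holds for [b] itself, where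
    [cut_le_multiple] bounds only cuts. *)
Lemma pedersen_multiple y b : upos y -> ideal y -> y != 0 -> positive b -> pedersen_ideal b ->
  exists m, cule (cu (E 0 0 b)) (cu y *+ m).
Proof.
move=> uy iy y0 pb pedb.
pose I : set A := [set a | aid y (E 0 0 a)].
have EZ (k : R[i]) a : E 0 0 (k *: a) = ((k, 0) : U) * E 0 0 a.
  by rewrite /Em embZ; congr pair; rewrite /= ?mulr0// scaler0 addr0 cmul0l addr0.
have h (c d : A) : E 0 0 (c ** d) = E 0 0 c * E 0 0 d by rewrite sys_M.
have tI : two_sided_ideal I.
  split=> [|k a c ha hc|a c hc]; rewrite /I /=.
  - by rewrite sys_0//; exact: aid0.
  - by rewrite sys_D// EZ; apply: aidD => //; exact: aid_mull.
  - by rewrite !h; split; [exact: aid_mull|exact: aid_mulr].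
have dI : closure I = setT.
  apply/seteqP; split=> // a _; apply/closureP => e e0.
  have e2 := half_gt0 e0.
  have [u [u1 hu]] := sigma_approx a e2.
  have [w aw hw] := clo_all iy y0 (jz_ideal (emb AK 0%N 0%N a)) e2.
  have [c hc] := corner_u 0 0 0 0 u u w.
  exists c; first by rewrite /I /= -hc; exact: aid_mul.
  rewrite cdistC -(sys_norm sysE 0 0) sys_B// -hc.
  rewrite (_ : _ - _ = - (E 0 0 (u ** a ** u - a)) + E 0 0 u * (E 0 0 a - w) * E 0 0 u); last first.
    by rewrite sys_B// !h; ncring.
  apply: le_lt_trans (unormD _ _) _; rewrite unormN sys_norm//.
  have := @norm_sand_le1 _ _ (E 0 0 u) (E 0 0 u) (E 0 0 a - w); rewrite !sys_norm// => /(_ u1 u1).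
  rewrite -/(E 0 0 a) in hw; lra.
have ab : aid y (E 0 0 b) by exact: (pedb I tI dI).
have [m Hm] := cu_aid uy ab; exists m; apply: cule_trans Hm; apply/cuP.
have ub : upos (E 0 0 b) by case: pb => x _ <-; exists (E 0 0 x); rewrite sys_star// sys_M.
by rewrite (upos_sa ub); exact: csub_square.
Qed.

Lemma upos_E00 c : upos (E 0 0 c) -> positive c.
Proof.
move=> uc; pose x : 'M[A]_1 := \matrix_(i, j) c.
have hx : mxe E x = E 0 0 c by rewrite /mxe !big_ord1 mxE.
have [y hy] : mx_positive AK x by apply/mx_positiveP; rewrite hx.
exists (y ord0 ord0) => //; apply: (@emb_inj _ _ _ AK 0%N 0%N); apply: jz_inj.
rewrite -[RHS]hx -mx_in_mxe hy jzM jz_star mx_in_mxe /mxe !big_ord1 sys_star// sys_M //.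
Qed.

(** Primeness provides a nonzero [g = s w t], and [g g^*] is below both [s] and [t]. Being flanked
    by [s], it stays in the corner, so it comes from [A], where the tracial approximation requires
    its small element to lie. *)
Lemma common_lower (l : seq U) : (forall t, t \in l -> [/\ upos t, ideal t & t != 0]) ->
  exists s, [/\ positive s, s != 0 & forall t, t \in l -> csub (E 0 0 s) t].
Proof.
elim: l => [|t l IH] H.
  have [[x x0] _] := hsimple; exists (star x ** x); split=> //; first by exists x.
  by apply: contra x0 => /eqP/cstar_sq_eq0 ->.
have [s [ps s0 Hs]] : exists s, [/\ positive s, s != 0 & forall t, t \in l -> csub (E 0 0 s) t].
  by apply: IH => x xl; apply: H; rewrite inE xl orbT.
have [ut it t0] := H t (mem_head _ _).
have us : upos (E 0 0 s) by case: ps => x _ <-; exists (E 0 0 x); rewrite sys_star// sys_M.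
have Es0 : E 0 0 s != 0.
  apply: contra s0 => /eqP h; apply/eqP; apply: (@emb_inj _ _ _ AK 0%N 0%N); apply: jz_inj.
  by rewrite emb0.
have [w [iw g0]] := prime_U (jz_ideal _) it Es0 t0.
set g := _ * t in g0.
have [c hc] := corner_u 0 0 0 0 s s (w * t * t * w^*u).
have gg : g * g^*u = E 0 0 c.
  by rewrite -hc /g !ustarM (upos_sa us) (upos_sa ut) -/(E 0 0 s); ncring.
have uc : upos (E 0 0 c) by rewrite -gg; exists g^*u; rewrite ustarK.
have cs : csub (E 0 0 c) (E 0 0 s).
  rewrite -gg /g; have := csub_norm_sqr (w * t)^*u us; rewrite ustarK.
  by rewrite !ustarM (upos_sa us) (upos_sa ut) !mulrA.
exists c; split; first exact: upos_E00.
  apply: contra g0 => /eqP c0; rewrite -unorm_eq0 -sqrf_eq0 -unorm_mul_ustar gg c0.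
  by rewrite sys_0// unorm0.
move=> x; rewrite inE => /orP[/eqP ->|xl]; last by apply: csub_trans cs _; apply: Hs.
rewrite -gg; apply: csub_trans (_ : csub _ (g^*u * g)) _.
  by have := csub_star g^*u; rewrite ustarK.
have := csub_norm_sqr (E 0 0 s * w) ut.
by rewrite /g !ustarM (upos_sa us) (upos_sa ut) !mulrA.
Qed.

End Simple.

(** * Room in hereditary subalgebras *)

Section Hereditary.
Variables (R : realType) (U : ucstarType R).
Implicit Types (x y z u v w b c g : U).

(* The hereditary C*-subalgebra generated by [b]. *)
Definition inher b z := forall e : R, 0 < e -> exists x, N[z - b * x * b] < e.

(** The middle factor [x] may be replaced by its real part [y], and [G^* y G <= N[y] G^* G], so
    every cut of [z] is below a multiple of [G^* G]. *)
Lemma lim_conj_csub G z : upos z ->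
  (forall e : R, 0 < e -> exists x, N[z - G^*u * x * G] < e) -> csub z (G^*u * G).
Proof.
move=> uz H; apply: csub_cutP => // e e0; have sz := upos_sa uz.
have [x hx] := H e e0; pose y := 2^-1 *: (x + x^*u).
have sy : sa y by apply: saZ; rewrite /sa ustarD ustarK addrC.
have hy : N[z - G^*u * y * G] <= e.
  have -> : z - G^*u * y * G = 2^-1 *: ((z - G^*u * x * G) + (z - G^*u * x * G)^*u).
    rewrite /y -scalerAr -scalerAl.
    have -> : (z - G^*u * x * G) + (z - G^*u * x * G)^*u = 2 *: z - G^*u * (x + x^*u) * G.
      by rewrite scaler_nat mulr2n ustarB !ustarM ustarK sz; ncring.
    by rewrite scalerBr scalerA mulVf// scale1r.
  rewrite unormZ ger0_norm ?invr_ge0//.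
  have := unormD (z - G^*u * x * G) (z - G^*u * x * G)^*u; rewrite norm_ustar; lra.
have sGy : sa (G^*u * y * G) by exact: sa_conj.
have le1 : ule z (G^*u * y * G + e%:A).
  have := ule_normA (saB sz sGy) hy; rewrite /ule opprB addrA [e%:A + _]addrC //.
have le2 : ule (G^*u * y * G) (N[y] *: (G^*u * G)).
  by have := ule_conj G (ule_norm sy); rewrite -[_ * _%:A]scalerAr mulr1 -scalerAl.
apply: csub_trans (csubZ (G^*u * G) (unorm_ge0 y)).
apply: ule_cut_csub => //; first by apply: uposZ; [exact: unorm_ge0|exists G].
by apply: ule_trans le1 _; apply: uleD => //; exact: ule_refl.
Qed.

Lemma inher_csub b z : upos b -> upos z -> inher b z -> csub z b.
Proof.
move=> ub uz H; apply: csub_trans (csub_sqr ub).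
by rewrite -{1}(upos_sa ub); apply: lim_conj_csub => //; rewrite (upos_sa ub).
Qed.

Lemma inher_closed b z : (forall e : R, 0 < e -> exists2 w, inher b w & N[z - w] < e) -> inher b z.
Proof.
move=> H e e0; have [w hw h] := H _ (half_gt0 e0); have [x hx] := hw _ (half_gt0 e0).
exists x; apply: le_lt_trans (udistD w _ _) _; lra.
Qed.

Lemma inher0 b : inher b 0.
Proof. by move=> e e0; exists 0; rewrite mulr0 mul0r subrr unorm0. Qed.

Lemma inherD b z w : inher b z -> inher b w -> inher b (z + w).
Proof.
move=> hz hw e e0; have [x hx] := hz _ (half_gt0 e0); have [y hy] := hw _ (half_gt0 e0).
exists (x + y); rewrite mulrDr mulrDl opprD addrACA.
apply: le_lt_trans (unormD _ _) _; lra.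
Qed.

Lemma inherZ b z (k : R) : inher b z -> inher b (k *: z).
Proof.
move=> hz e e0; have K0 : 0 < `|k| + 1 by rewrite ltr_wpDl.
have [x hx] := hz _ (divr_gt0 e0 K0); exists (k *: x).
rewrite -scalerAr -scalerAl -scalerBr unormZ; rewrite ltr_pdivlMr// in hx.
have := unorm_ge0 (z - b * x * b); nra.
Qed.

Lemma inherN b z : inher b z -> inher b (- z).
Proof. by move=> h; rewrite -scaleN1r; apply: inherZ. Qed.

Lemma inherB b z w : inher b z -> inher b w -> inher b (z - w).
Proof. by move=> hz hw; apply: inherD => //; exact: inherN. Qed.

Lemma inher_sand b z u w : inher b z -> inher b w -> inher b (z * u * w).
Proof.
move=> hz hw; apply: inher_closed => e e0.
pose K1 := N[u * w] + 1.
have K10 : 0 < K1 by rewrite ltr_wpDl// unorm_ge0.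
have [x hx] := hz _ (divr_gt0 (half_gt0 e0) K10).
pose K2 := N[b * x * b * u] + 1.
have K20 : 0 < K2 by rewrite ltr_wpDl// unorm_ge0.
have [y hy] := hw _ (divr_gt0 (half_gt0 e0) K20).
exists (b * (x * b * u * b * y) * b).
  by move=> d d0; exists (x * b * u * b * y); rewrite subrr unorm0.
rewrite (_ : _ - _ = (z - b * x * b) * (u * w) + b * x * b * u * (w - b * y * b)); last by ncring.
apply: le_lt_trans (unormD _ _) _.
have h1 := unormM (z - b * x * b) (u * w).
have h2 := unormM (b * x * b * u) (w - b * y * b).
rewrite ltr_pdivlMr// in hx; rewrite ltr_pdivlMr// in hy.
have := unorm_ge0 (z - b * x * b); have := unorm_ge0 (w - b * y * b); rewrite /K1 in hx; rewrite /K2 in hy.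
nra.
Qed.

Lemma inherM b z w : inher b z -> inher b w -> inher b (z * w).
Proof. by move=> hz hw; have := inher_sand 1 hz hw; rewrite mulr1. Qed.

Lemma inher_trans y b z : inher b y -> inher y z -> inher b z.
Proof.
move=> hy hz; apply: inher_closed => e /hz[x hx].
by exists (y * x * y) => //; exact: inher_sand.
Qed.

Lemma inher_refl b : upos b -> inher b b.
Proof.
move=> ub e e0; have sb := upos_sa ub; have e2 := half_gt0 e0.
pose f := fun t : R => (Num.max t (e / 2))^-1.
have pf : papp f.
  by apply: (@papp_inv _ (e / 2)) => //; [tpapp|move=> t; rewrite le_max lexx orbT].
exists (fc f b); rewrite (_ : b - _ = fc id b - fc id b * fc f b * fc id b); last by rewrite fc_id.
rewrite -!fcM//; try tpapp.
rewrite -fcB//; try tpapp.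
apply: le_lt_trans (_ : e / 2 < e); last by lra.
apply: fc_norm_pos => //; first by tpapp.
move=> t /andP[t0 _]; rewrite /f; have [te|te] := leP (e / 2) t.
  have tp : 0 < t by apply: lt_le_trans te.
  by rewrite divff ?gt_eqF// mul1r subrr normr0 ltW.
have H : 0 <= t / (e / 2) <= 1 by rewrite divr_ge0 ?(ltW e2)// ler_pdivrMr// mul1r ltW.
rewrite ger0_norm; first by nra.
by nra.
Qed.

Lemma inher_fc f b z : papp f -> f 0 = 0 -> sa z -> inher b z -> inher b (fc f z).
Proof.
move=> pf f0 sz hz; apply: inher_closed => e e0.
have e3 : 0 < e / 3 by lra.
have [p [p1 p2]] := fc_approx pf sz e3.
exists (pev p z - (p.[0])%:A).
  elim/poly_ind: p {p1 p2} => [|p c IH]; first by rewrite pev0 horner0 scale0r subrr; exact: inher0.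
  rewrite pevD pevM pevX pevC !hornerE addrK.
  have -> : pev p z * z = (pev p z - p.[0]%:A) * z + p.[0] *: z.
    by rewrite mulrBl -scalerAl mul1r subrK.
  by apply: inherD; [apply: inherM|apply: inherZ].
rewrite opprB addrCA; apply: le_lt_trans (unormD _ _) _.
have := p1 0; rewrite normr0 unorm_ge0 f0 sub0r normrN => /(_ isT) H.
by rewrite unormZ unorm1 mulr1; lra.
Qed.

Lemma inher_orth b z y : inher b z -> y * b = 0 -> y * z = 0.
Proof.
move=> hz yb; apply/eqP; rewrite -unorm_le0; apply: le_eps => e e0; rewrite add0r.
have K0 : 0 < N[y] + 1 by rewrite ltr_wpDl// unorm_ge0.
have [x] := hz _ (divr_gt0 e0 K0); rewrite ltr_pdivlMr// => hx.
have -> : y * z = y * (z - b * x * b) by rewrite mulrBr !mulrA yb !mul0r subr0.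
apply: le_trans (unormM _ _) _; have := unorm_ge0 (z - b * x * b); nra.
Qed.

Lemma upos_sqrt_her b : upos b -> exists h, [/\ sa h, inher b h & b = h * h].
Proof.
move=> ub; have sb := upos_sa ub; have pq := @papp_sqrtp R.
exists (fc (fun t : R => Num.sqrt t) b); split; first exact: fc_sa.
  by apply: inher_fc => //; [rewrite sqrtr0|exact: inher_refl].
rewrite -[LHS]upos_ppos// -fcM//.
apply: fc_eq_pos => //; [exact: papp_ppos|by apply: pappM|].
by move=> t /andP[t0 _]; rewrite sqrtM_id// /ppos max_l.
Qed.

Lemma upos_sqrtU b : upos b -> exists h, sa h /\ b = h * h.
Proof. by move=> /upos_commP[h [_ sh ->]]; exists h. Qed.

(* [b = ((1 - g) + g) b ((1 - g) + g)] *)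
Lemma cu_compress b g : upos b -> upos g ->
  cule (cu b) (cu ((1 - g) * b * (1 - g)) + cu g).
Proof.
move=> ub ug; have sg := upos_sa ug; have [h [sh bh]] := upos_sqrtU ub.
have := cu_sqrD (h * (1 - g)) (h * g).
rewrite -mulrDr subrK mulr1 sh !ustarM ustarB ustar1 sg sh -bh => H.
apply: cule_trans H _; apply: cuD; first by rewrite bh !mulrA; exact: cule_refl.
by apply/cuP; have := csub_norm_sqr h ug; rewrite sh -!mulrA.
Qed.

Lemma cu_compress_orth b g c : upos b -> upos g -> upos c -> inher b g -> inher b c -> g * c = c ->
  cule (cu ((1 - g) * b * (1 - g)) + cu c) (cu b).
Proof.
move=> ub ug uc hg hc gc; have sg := upos_sa ug; have hb := inher_refl ub.
have s1g : sa (1 - g) by apply: saB; [exact: sa1|].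
have u1 : upos ((1 - g) * b * (1 - g)) by apply: upos_sand.
have h1 : inher b ((1 - g) * b * (1 - g)).
  rewrite (_ : _ * _ = b - g * b - b * g + g * b * g); last by ncring.
  by apply: inherD; [apply: inherB; [apply: inherB|]|]; rewrite ?inherM//; apply: inherM => //; apply: inherM.
apply: cule_trans (cu_orth2 u1 uc _) _.
  by rewrite -[_ * (1 - g) * c]mulrA [(1 - g) * c]mulrBl mul1r gc subrr mulr0.
by apply/cuP; apply: inher_csub => //; [exact: uposD|exact: inherD].
Qed.

(** Two orthogonal nonzero positive elements fit into the hereditary subalgebra of [z]. Its failure
    for a single nonzero positive [z] produces a minimal projection. *)
Definition splits z := exists x y, [/\ upos x, upos y, x != 0, y != 0 & [/\ x * y = 0, inher z x & inher z y]].

End Hereditary.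

Section Room.
Variables (R : realType) (A : cstarAlgType R) (AK : stabilization A).
Hypotheses (hsig : sigma_unital A) (hsimple : simple_cstar A).
Local Notation U := (utz AK).
Local Notation E := (@Em R A AK A id).
Implicit Types (x y z w b c g p t : U).

Lemma inher_ideal b z : ideal b -> inher b z -> ideal z.
Proof.
move=> ib hz; apply: ideal_closed => e /hz[x hx]; exists (b * x * b) => //.
exact: ideal_mull.
Qed.

Lemma inher_finmx n b z : finmx E n b -> inher b z -> finmx E n z.
Proof.
move=> fb hz; apply: (finmx_closed (Em_id AK)) => e /hz[x hx]; exists (b * x * b) => //.
exact: finmx_her.
Qed.

Section NonElementary.
Hypothesis nonel : forall z, upos z -> ideal z -> z != 0 -> splits z.

Lemma many_orth K z : upos z -> ideal z -> z != 0 -> exists t : 'I_K -> U,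
  (forall i, [/\ upos (t i), ideal (t i), t i != 0 & inher z (t i)]) /\
  forall i j, i != j -> t i * t j = 0.
Proof.
elim: K z => [|K IH] z uz iz z0; first by exists (fun=> 0); split=> [[]|[]].
have [x [y [ux uy x0 y0 [xy hx hy]]]] := nonel uz iz z0.
have [t [ht1 ht2]] := IH y uy (inher_ideal iz hy) y0.
exists (fun i => if unlift ord0 i is Some j then t j else x); split=> [i|i j].
  case: unliftP => [j _|_]; last by split=> //; exact: inher_ideal hx.
  by have [a1 a2 a3 a4] := ht1 j; split=> //; apply: inher_trans a4.
have xt k : x * t k = 0 by have [_ _ _ h] := ht1 k; apply: inher_orth h xy.
case: (unliftP ord0 i) => [i' ->|->]; case: (unliftP ord0 j) => [j' ->|->].
- by move=> ij; apply: ht2; apply: contra ij => /eqP ->.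
- move=> _; have [a1 _ _ _] := ht1 i'.
  by rewrite -[LHS]ustarK ustarM (upos_sa a1) (upos_sa ux) xt ustar0.
- by rewrite xt.
- by rewrite eqxx.
Qed.

(** A common lower bound in [A] of [n] orthogonal pieces of [c]; it leaves room below [c] for all
    the copies of the error element that the tracial step adds. *)
Lemma small_copies n c : upos c -> ideal c -> c != 0 ->
  exists s, [/\ positive s, s != 0 & cule (cu (E 0 0 s) *+ n) (cu c)].
Proof.
move=> uc ic c0; have [t [ht1 ht2]] := many_orth n uc ic c0.
have [|s [ps s0 hs]] := common_lower hsimple (l := codom t).
  by move=> x /codomP[i ->]; have [] := ht1 i.
exists s; split=> //; rewrite cuM_ord.
apply: cule_trans (_ : cule _ (\sum_i cu (t i))) _.
  elim/big_ind2: _ => [|x1 x2 y1 y2|i _]; [exact: cule_refl|exact: cuD|].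
  by apply/cuP/hs/codom_f.
apply: cule_trans (cu_orth _ ht2) _; first by move=> i; have [] := ht1 i.
apply/cuP; apply: inher_csub => //; first by apply: upos_sum => i _; have [] := ht1 i.
elim/big_ind: _ => [|x y|i _]; [exact: inher0|exact: inherD|].
by have [] := ht1 i.
Qed.

(* Splitting [b] and using the absence of minimal projections, one finds [g] with
   many orthogonal copies below [b]; [b1] is [b] compressed by [1 - g], and [c] is
   orthogonal to [b1]. *)
Lemma room k b : upos b -> ideal b -> b != 0 -> exists b1 c,
  [/\ upos b1, upos c, c != 0, inher b b1 & [/\ inher b c, cule (cu b1 + cu c) (cu b) &
      cule (cu b *+ k) (cu b1 *+ k.+1)]].
Proof.
move=> ub ib b0; have sb := upos_sa ub.
have [t [ht1 ht2]] := many_orth k.+1 ub ib b0.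
have [|s0 [ps s00 hs]] := common_lower hsimple (l := codom t).
  by move=> x /codomP[i ->]; have [] := ht1 i.
have us : upos (E 0 0 s0).
  by case: ps => x _ <-; exists (E 0 0 x); rewrite (sys_star (Em_id AK)) (sys_M (Em_id AK)).
have [h [ih sh Eh]] := upos_ideal_sqrt us (jz_ideal _).
have h0 : h != 0.
  apply: contra s00 => /eqP h0; apply/eqP; apply: (@emb_inj _ _ _ AK 0%N 0%N); apply: jz_inj.
  by rewrite emb0 -[LHS]/(E 0 0 s0) Eh h0 mul0r.
have [ut0 it0 t00 ht0] := ht1 ord0.
(* [q] begins with [t ord0] and ends with the square root [h] of [s0], so [s = q q^*] lies in the
   hereditary subalgebra of [t ord0] and is below [s0], hence below every [t i]. *)
have [w [_ q0]] := prime_U hsimple it0 ih t00 h0; set q := _ * h in q0.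
pose s := q * q^*u.
have us1 : upos s by exists q^*u; rewrite ustarK.
have s_E : s = (w^*u * t ord0)^*u * E 0 0 s0 * (w^*u * t ord0).
  by rewrite /s /q Eh !ustarM ustarK sh (upos_sa ut0); ncring.
have s_t i : csub s (t i).
  by apply: csub_trans (hs _ (codom_f t i)); rewrite s_E; exact: csub_conj.
have s_nz : s != 0.
  by apply: contra q0 => /eqP h1; rewrite -unorm_eq0 -sqrf_eq0 -unorm_mul_ustar -/s h1 unorm0.
have s_her : inher (t ord0) s.
  move=> e e0; exists (w * h * h * w^*u); have -> : t ord0 * (w * h * h * w^*u) * t ord0 = s.
    by rewrite /s /q !ustarM sh (upos_sa ut0); ncring.
  by rewrite subrr unorm0.
have ss := upos_sa us1.
(* Any positive [eta] below the norm of [s] keeps the cut [c] nonzero, while the slice [g] is 1 on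
   the support of [c]. *)
pose eta := N[s] / 2; have eta0 : 0 < eta by rewrite half_gt0// unorm_gt0.
pose g := fc (slice eta 0) s; pose c := ucut eta s.
have pg := @papp_slice _ eta 0.
have ug : upos g by exact: slice_upos.
have uc : upos c by exact: ucut_upos.
have gc : g * c = c by have := slice_next 0 eta0 us1; rewrite mul1r.
have sl0 : slice eta 0 0 = 0 :> R by rewrite /slice mul0r subr0 maxxx min_r ?mulr0// ltW.
have hbs : inher b s by apply: inher_trans ht0 s_her.
have hbg : inher b g by apply: inher_fc.
have hbc : inher b c.
  by apply: inher_fc => //; [exact: papp_cut|rewrite /cut sub0r max_r// oppr_le0 ltW].
have c0 : c != 0.
  apply/eqP => /(ucut_eq0_norm (ltW eta0) us1); rewrite /eta.
  have : 0 < N[s] by rewrite unorm_gt0.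
  lra.
have sg := upos_sa ug; have s1g : sa (1 - g) by apply: saB; [exact: sa1|].
pose b1 := (1 - g) * b * (1 - g).
have ub1 : upos b1 by exact: upos_sand.
have g_s : csub g s by have := slice_csub 0 eta0 us1; rewrite mul0r ucut0.
have hb := inher_refl ub.
exists b1, c; split=> //.
  rewrite /b1 (_ : _ * _ = b - g * b - b * g + g * b * g); last by ncring.
  apply: inherD; last by apply: inherM => //; apply: inherM.
  by apply: inherB; [apply: inherB => //|]; apply: inherM.
split=> //; first exact: cu_compress_orth.
(* The remaining [k] pieces are orthogonal to [g], so compression by [1 - g] fixes them. They
   provide [k] copies of [g] below [b1], and [k<b> <= k<b1> + k<g>] costs only one more [<b1>]. *)
pose T := \sum_(i < k) t (lift ord0 i).
have hT : csub T b1.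
  have uT : upos T by apply: upos_sum => i _; have [] := ht1 (lift ord0 i).
  have gT : g * T = 0.
    rewrite mulr_sumr big1// => i _.
    have st : t (lift ord0 i) * s = 0 by apply: inher_orth s_her _; apply: ht2.
    apply: (fc_mul0l pg sl0 ss); have [ut _ _ _] := ht1 (lift ord0 i).
    by rewrite -[LHS]ustarK ustarM (upos_sa ut) ss st ustar0.
  have Tg : T * g = 0 by rewrite -[LHS]ustarK ustarM (upos_sa uT) sg gT ustar0.
  have T_E : T = (1 - g) * T * (1 - g).
    by rewrite mulrBl mul1r gT subr0 mulrBr mulr1 Tg subr0.
  have hbT : inher b T.
    rewrite /T; elim/big_ind: _ => [|x y|i _]; [exact: inher0|exact: inherD|].
    by have [] := ht1 (lift ord0 i).
  have [B [sB bB]] := upos_sqrtU ub.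
  have -> : b1 = (B * (1 - g))^*u * (B * (1 - g)).
    by rewrite ustarM ustarB ustar1 sg sB /b1 bB !mulrA.
  apply: lim_conj_csub => // e e0.
  have K0 : 0 < N[1 - g] ^+ 2 + 1 by rewrite ltr_wpDl// exprn_ge0// unorm_ge0.
  have [x] := hbT _ (divr_gt0 e0 K0); rewrite ltr_pdivlMr// => hx.
  exists (B * x * B).
  rewrite (_ : _ - _ = (1 - g)^*u * (T - b * x * b) * (1 - g)); last first.
    rewrite {1}T_E ustarM ustarB ustar1 sg sB bB; ncring.
  apply: le_lt_trans (norm_conj_le _ _) _; have := unorm_ge0 (T - b * x * b); nra.
apply: cule_trans (cuMn _ (cu_compress ub ug)) _.
rewrite mulrnDl mulrSr; apply: cuD; first exact: cule_refl.
apply: cule_trans (_ : cule _ (\sum_(i < k) cu (t (lift ord0 i)))) _.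
  rewrite cuM_ord; elim/big_ind2: _ => [|x1 x2 y1 y2|i _]; [exact: cule_refl|exact: cuD|].
  by apply/cuP; apply: csub_trans g_s _.
apply: cule_trans (cu_orth _ _) _.
- by move=> i; have [] := ht1 (lift ord0 i).
- by move=> i j ij; apply: ht2; rewrite (inj_eq lift_inj).
exact/cuP.
Qed.

End NonElementary.

Section Elementary.
Variable z0 : U.
Hypotheses (uz : upos z0) (iz : ideal z0) (z00 : z0 != 0) (nsp : ~ splits z0).

(** For [t < N[x]] the cut of [x] at [t] is nonzero and orthogonal to [x (t - x)_+], so the latter
    vanishes and [x] has no spectrum strictly between 0 and [t]. As [t] tends to [N[x]], [x] turns
    out to be a multiple of a projection. *)
Lemma unsplit_square x : upos x -> inher z0 x -> x * x = N[x] *: x.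
Proof.
move=> ux hx; have sx := upos_sa ux.
suff H : N[N[x] *: x - x * x] <= 0 by move: H; rewrite unorm_le0 subr_eq0 => /eqP.
apply: le_eps => e e0; rewrite add0r.
have [x0|x0] := eqVneq x 0; first by rewrite x0 scaler0 mul0r subrr unorm0 ltW.
pose l := N[x]; have l0 : 0 < l by rewrite unorm_gt0.
(* Chosen so that [l s - s^2 <= l (l - t) <= e] for [s] between [t] and [l]. *)
pose t := Num.max 0 (l - e / l).
have t0 : 0 <= t by rewrite le_max lexx.
have tl : t < l by rewrite gt_max l0 ltrBlDr ltrDl divr_gt0.
pose f := fun s : R => s * Num.max (t - s) 0.
have pf : papp f by rewrite /f; tpapp.
have f0 : f 0 = 0 by rewrite /f mul0r.
have y1 : ucut t x != 0 by apply/eqP => /(ucut_eq0_norm t0 ux); rewrite -/l leNgt tl.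
have y2 : fc f x = 0.
  apply/eqP/negP => /negP y2; apply: nsp; exists (ucut t x), (fc f x); split=> //.
  - exact: ucut_upos.
  - by apply: fc_upos_pos => // s /andP[s0 _]; rewrite /f mulr_ge0// le_max lexx orbT.
  split; last by apply: inher_fc.
    rewrite -fcM//; last exact: papp_cut.
    rewrite (fc_ext (g := fun=> 0))//; first by rewrite fc_cst// scale0r.
    - by apply: pappM => //; exact: papp_cut.
    - exact: papp_cst.
    move=> s _; rewrite /cut /f; have [st|st] := leP s t.
      by rewrite max_r ?mul0r// subr_le0.
    by rewrite [Num.max (t - s) 0]max_r ?mulr0// subr_le0 ltW.
  apply: inher_fc => //; [exact: papp_cut|by rewrite /cut sub0r max_r// oppr_le0].
have -> : N[x] *: x - x * x = fc (fun s => l * s) x - fc (fun s => s * s) x - fc f x.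
  rewrite y2 subr0 fcZ//; last exact: papp_id.
  by rewrite fcM ?fc_id//; exact: papp_id.
rewrite -!fcB//; try tpapp.
apply: fc_norm_pos => //; first by rewrite /f; tpapp.
move=> s /andP[s0 sl]; rewrite /f -/l in sl *.
have tl2 : l * (l - t) <= e.
  have : l - e / l <= t by rewrite le_max lexx orbT.
  rewrite lerBlDr -lerBlDl ler_pdivlMr//; lra.
have [st|st] := leP s t.
  by rewrite max_l ?subr_ge0// ger0_norm; nra.
by rewrite max_r ?subr_le0 ?ltW// mulr0 subr0 ger0_norm; nra.
Qed.

(** By [unsplit_square], [z0] and every nonzero [p x p] are multiples of projections. If the
    projection [q] of [p x p] differed from [p], then [q] and [p - q] would split [z0]. *)
Lemma minimal_projection : exists p, [/\ upos p, ideal p, p * p = p, p != 0 &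
  forall x, upos x -> p * x * p = N[p * x * p] *: p].
Proof.
have l0 : 0 < N[z0] by rewrite unorm_gt0.
pose p := N[z0]^-1 *: z0.
have hz := inher_refl uz.
have up : upos p by apply: uposZ => //; rewrite invr_ge0 ltW.
have hp : inher z0 p by apply: inherZ.
have pp : p * p = p.
  rewrite /p -scalerAr -scalerAl unsplit_square//; congr (_ *: _).
  by rewrite scalerA mulVf ?gt_eqF// scale1r.
have p0 : p != 0 by rewrite scaler_eq0 invr_eq0 negb_or z00 gt_eqF.
have sp := upos_sa up.
exists p; split=> // [|x ux]; first by apply: idealZ.
set y := p * x * p; have uy : upos y by apply: upos_sand.
have hy : inher z0 y by apply: inher_sand.
have [y0|y0] := eqVneq y 0; first by rewrite y0 unorm0 scale0r.
have m0 : 0 < N[y] by rewrite unorm_gt0.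
pose q := N[y]^-1 *: y.
have qq : q * q = q.
  rewrite /q -scalerAr -scalerAl unsplit_square//; congr (_ *: _).
  by rewrite scalerA mulVf ?gt_eqF// scale1r.
have qp : q * p = q by rewrite /q /y -scalerAl -[p * x * p * p]mulrA pp.
have pq : p * q = q by rewrite /q /y -scalerAr !mulrA pp.
have uq : upos q by apply: uposZ => //; rewrite invr_ge0 ltW.
have sq := upos_sa uq.
suff : p - q == 0.
  by rewrite subr_eq0 => /eqP ->; rewrite /q scalerA mulfV ?gt_eqF// scale1r.
apply/negPn/negP => d0; apply: nsp; exists q, (p - q); split=> //.
- have -> : p - q = (p - q) * (p - q).
    by rewrite mulrBl !mulrBr pp qq pq qp subrr subr0.
  by apply: upos_sqr; exact: saB.
- by rewrite scaler_eq0 invr_eq0 negb_or y0 gt_eqF.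
split; first by rewrite mulrBr qp qq subrr.
  by apply: inherZ.
by apply: inherB => //; apply: inherZ.
Qed.

Variable p : U.
Hypotheses (up : upos p) (ip : ideal p) (pp : p * p = p) (p0 : p != 0).
Hypothesis pmin : forall x, upos x -> p * x * p = N[p * x * p] *: p.

(** Primeness makes some [p w c w^* p] nonzero, and minimality makes it a positive multiple of [p];
    rescaling gives an exact conjugation. *)
Lemma min_le c : upos c -> ideal c -> c != 0 -> exists v, v^*u * c * v = p.
Proof.
move=> uc ic c0; have [h [ih sh ch]] := upos_ideal_sqrt uc ic; have sp := upos_sa up.
have h0 : h != 0 by apply: contra c0 => /eqP h0; rewrite ch h0 mul0r.
have [w [_ q0]] := prime_U hsimple ip ih p0 h0; set q := _ * h in q0.
have qq : q * q^*u = p * (w * c * w^*u) * p.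
  by rewrite /q ch !ustarM sh sp; ncring.
have uw : upos (w * c * w^*u) by have := upos_conj w^*u uc; rewrite ustarK.
have l0 : 0 < N[p * (w * c * w^*u) * p].
  by rewrite -qq unorm_mul_ustar exprn_gt0// unorm_gt0.
set l := N[_] in l0.
exists ((Num.sqrt l)^-1 *: (w^*u * p)).
rewrite ustarZ -!scalerAl -!scalerAr scalerA -invfM sqrtM_id ?ltW//.
rewrite ustarM ustarK sp (_ : _ * _ = p * (w * c * w^*u) * p); last by ncring.
by rewrite pmin// -/l scalerA mulVf ?gt_eqF// scale1r.
Qed.

(** By [min_le] the hereditary subalgebra of a nonzero [c] contains a projection [q] equivalent to
    [p]. Compression by [1 - q] splits it off exactly, and the induction continues with what
    remains. *)
Lemma min_dichotomy k c : upos c -> ideal c ->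
  cule (cu p *+ k.+1) (cu c) \/ cule (cu c) (cu p *+ k).
Proof.
elim: k c => [|k IH] c uc ic.
  have [->|c0] := eqVneq c 0; first by right; exact: cu0.
  by left; have [v <-] := min_le uc ic c0; apply/cuP; exact: csub_conj.
have [->|c0] := eqVneq c 0.
  by right; apply: cule_trans (cu0 _) _; exact: cule0.
have [v hv] := min_le uc ic c0; have [h [sh hh ch]] := upos_sqrt_her uc.
have sp := upos_sa up.
pose y : U := h * v; have yy : y^*u * y = p by rewrite -hv /y ustarM sh ch !mulrA.
pose q := y * y^*u.
have yp : y * p = y.
  apply/eqP; rewrite -subr_eq0 -unorm_eq0 -sqrf_eq0 -unorm_ustar_mul ustarB ustarM sp.
  have -> : (p * y^*u - y^*u) * (y * p - y) =
      p * (y^*u * y) * p - p * (y^*u * y) - y^*u * y * p + y^*u * y by clearbody y; ncring.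
  by rewrite yy !pp subrr sub0r addNr unorm0.
have qq : q * q = q.
  by rewrite /q -mulrA [y^*u * _]mulrA yy mulrA yp.
have uq : upos q by exists y^*u; rewrite ustarK.
have hq : inher c q.
  by have := inher_sand (v * v^*u) hh hh; rewrite /q /y ustarM sh !mulrA.
have cq : cu q = cu p.
  by rewrite /q -yy; apply: cu_eqP; [have := csub_star y^*u; rewrite ustarK|exact: csub_star].
have uc1 : upos ((1 - q) * c * (1 - q)).
  by apply: upos_sand => //; apply: saB; [exact: sa1|exact: upos_sa].
have ic1 : ideal ((1 - q) * c * (1 - q)) by apply: ideal_mulr; apply: ideal_mull.
have [H|H] := IH _ uc1 ic1; [left|right].
  rewrite mulrS addrC; apply: cule_trans (cu_compress_orth uc uq uq hq hq qq).
  by apply: cuD => //; rewrite cq; exact: cule_refl.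
rewrite mulrSr; apply: cule_trans (cu_compress uc uq) _.
by apply: cuD => //; rewrite cq; exact: cule_refl.
Qed.

(* For each row, [r_j = \sum_i x_ji x_ji^*] satisfies [r_j^2 <= r_j] up to a small
   error, so [\sum_i |x_ji|^2 = |r_j|] is almost at most [1]. *)
Lemma min_rank M L : cule (cu p *+ M) (cu p *+ L) -> (M <= L)%N.
Proof.
move=> H; rewrite leqNgt; apply/negP => LM; have sp := upos_sa up.
(* Small enough that [e (M + L M^2) < 1], so that [(1 - e) M <= (1 + e M^2) L] is incompatible with
   [L + 1 <= M]. *)
pose e := (2 * (M%:R + L%:R * M%:R ^+ 2 + 1))^-1 : R.
have K0 : 0 < 2 * (M%:R + L%:R * M%:R ^+ 2 + 1) :> R.
  by rewrite mulr_gt0// ltr_wpDl// addr_ge0// mulr_ge0// exprn_ge0.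
have e0 : 0 < e by rewrite invr_gt0.
have [X0 hX0] : exists X : 'I_L -> 'I_M -> U, forall i i',
    N[\sum_j (X j i)^*u * p * X j i' - (if i == i' then p else 0)] < e.
  have : fsub (fun _ : 'I_M => p) (fun _ : 'I_L => p).
    by apply/cufP; rewrite !cuf_sum -!cuM_ord.
  by move=> /(_ e e0).
have p1 : N[p] = 1.
  have Np : 0 < N[p] by rewrite unorm_gt0.
  have := sa_norm_sqr sp; rewrite pp expr2 -{1}[N[p]]mulr1.
  by move/mulfI => /(_ (lt0r_neq0 Np)) <-.
pose x j i := p * X0 j i * p.
have px j i : p * x j i = x j i by rewrite /x !mulrA pp.
have xp j i : x j i * p = x j i by rewrite /x -[LHS]mulrA pp.
have pxs j i : p * (x j i)^*u = (x j i)^*u by rewrite -{1}sp -ustarM xp.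
have sxp j i : (x j i)^*u * p = (x j i)^*u by rewrite -{1}sp -ustarM px.
have hX i i' : N[\sum_j (x j i)^*u * x j i' - (if i == i' then p else 0)] <= e.
  have -> : \sum_j (x j i)^*u * x j i' - (if i == i' then p else 0) =
      p * (\sum_j (X0 j i)^*u * p * X0 j i' - (if i == i' then p else 0)) * p.
    rewrite mulrBr mulrBl mulr_sumr mulr_suml; congr (_ - _).
      apply: eq_bigr => j _; rewrite /x !ustarM sp.
      by rewrite !mulrA -[p * _ * p * p]mulrA pp.
    by case: ifP => _; rewrite ?pp// mulr0 mul0r.
  by apply: le_trans (norm_sand_le1 _ _ _) (ltW (hX0 i i')); rewrite p1.
clearbody x.
have scal y : upos y -> p * y * p = y -> y = N[y] *: p.
  by move=> uy h; rewrite -{1}h pmin// h.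
pose r j := \sum_i x j i * (x j i)^*u.
have ux j i : upos (x j i * (x j i)^*u) by exists (x j i)^*u; rewrite ustarK.
have ur j : upos (r j) by exact: upos_sum.
have xxE j i : x j i * (x j i)^*u = N[x j i] ^+ 2 *: p.
  rewrite -unorm_mul_ustar; apply: scal => //.
  by rewrite mulrA px -[LHS]mulrA sxp.
have rE j : r j = (\sum_i N[x j i] ^+ 2) *: p.
  by rewrite scaler_suml; apply: eq_bigr => i _.
have rN j : N[r j] = \sum_i N[x j i] ^+ 2.
  by rewrite rE unormZ p1 mulr1 ger0_norm// sumr_ge0// => i _; rewrite exprn_ge0// unorm_ge0.
have xr j i : N[x j i] ^+ 2 <= N[r j].
  by rewrite rN (bigD1 i)//= lerDl sumr_ge0// => i' _; rewrite exprn_ge0// unorm_ge0.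
have row j : N[r j] <= 1 + e * M%:R ^+ 2.
  (* [W] dominates its summand [(r j)^2] in the form [W1], and is close to [r j] because the columns
     of [x] are nearly orthonormal. *)
  pose W := \sum_i \sum_i' x j i * (\sum_k (x k i)^*u * x k i') * (x j i')^*u.
  have W1 : W = \sum_k (\sum_i x j i * (x k i)^*u) * (\sum_i x k i * (x j i)^*u).
    rewrite /W; under eq_bigr do under eq_bigr do rewrite mulr_sumr mulr_suml.
    under eq_bigr do rewrite exchange_big.
    rewrite exchange_big; apply: eq_bigr => k _.
    rewrite mulr_suml; apply: eq_bigr => i _; rewrite mulr_sumr; apply: eq_bigr => i' _.
    by rewrite !mulrA.
  have W2 : N[W - r j] <= e * M%:R ^+ 2 * N[r j].
    have -> : W - r j = \sum_i \sum_i' x j i *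
        (\sum_k (x k i)^*u * x k i' - (if i == i' then p else 0)) * (x j i')^*u.
      rewrite /W /r -sumrB; apply: eq_bigr => i _.
      have -> : x j i * (x j i)^*u = \sum_i' x j i * (if i == i' then p else 0) * (x j i')^*u.
        rewrite (bigD1 i)//= eqxx xp big1 ?addr0// => i' /negPf h.
        by rewrite eq_sym h mulr0 mul0r.
      by rewrite -sumrB; apply: eq_bigr => i' _; rewrite mulrBr mulrBl.
    apply: le_trans (unorm_sum _ _ _) _.
    apply: (@le_trans _ _ (\sum_(i < M) \sum_(i' < M) e * N[r j])).
      apply: ler_sum => i _; apply: le_trans (unorm_sum _ _ _) _; apply: ler_sum => i' _.
      apply: le_trans (unormM _ _) _; rewrite norm_ustar.
      apply: le_trans (ler_wpM2r (unorm_ge0 _) (unormM _ _)) _.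
      have a1 := xr j i; have a2 := xr j i'; have a3 := hX i i'.
      set m := N[\sum_k _ - _] in a3 *; have m0 : 0 <= m by exact: unorm_ge0.
      have b1 := unorm_ge0 (x j i); have b2 := unorm_ge0 (x j i').
      have : N[x j i] * N[x j i'] <= N[r j] by nra.
      move=> b3; rewrite mulrAC; apply: le_trans (_ : N[r j] * m <= _).
        by rewrite ler_wpM2r.
      by rewrite mulrC ler_wpM2r ?unorm_ge0.
    rewrite !sumr_const !card_ord -[X in X <= _]mulr_natr -[X in X * _ <= _]mulr_natr.
    by rewrite le_eqVlt; apply/orP; left; apply/eqP; ring.
  have W3 : N[r j] ^+ 2 <= N[W].
    rewrite -sa_norm_sqr; last exact: upos_sa.
    apply: upos_norm_mono; first by apply: upos_sqr; exact: upos_sa.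
    rewrite W1 (bigD1 j)//= -/(r j) /ule addrC addrK; apply: upos_sum => k _.
    exists (\sum_i x k i * (x j i)^*u); rewrite ustar_sum; congr (_ * _).
    by apply: eq_bigr => i _; rewrite ustarM ustarK.
  have W4 : N[W] <= N[r j] + e * M%:R ^+ 2 * N[r j].
    rewrite -[W](subrK (r j)) addrC; apply: le_trans (unormD _ _) _; rewrite lerD2l //.
  have := unorm_ge0 (r j); rewrite le_eqVlt => /orP[/eqP <-|rp].
    by rewrite addr_ge0// mulr_ge0 ?(ltW e0)// exprn_ge0.
  by rewrite -(ler_pM2r rp) -expr2 mulrDl mul1r; apply: le_trans W3 W4.
have col i : 1 - e <= \sum_j N[x j i] ^+ 2.
  have := hX i i; rewrite eqxx.
  have -> : \sum_j (x j i)^*u * x j i = (\sum_j N[x j i] ^+ 2) *: p.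
    rewrite scaler_suml; apply: eq_bigr => j _; rewrite -unorm_ustar_mul; apply: scal.
      by exists (x j i).
    by rewrite !mulrA pxs -mulrA xp.
  rewrite -[X in _ - X]scale1r -scalerBl unormZ p1 mulr1 ler_norml => /andP[h _]; lra.
have : \sum_(i < M) (1 - e) <= \sum_(j < L) (1 + e * M%:R ^+ 2).
  apply: le_trans (_ : \sum_(i < M) \sum_j N[x j i] ^+ 2 <= _); first exact: ler_sum.
  by rewrite exchange_big; apply: ler_sum => j _; rewrite -rN.
rewrite !sumr_const !card_ord -[X in X <= _]mulr_natr -[X in _ <= X]mulr_natr.
have : (L%:R + 1 <= M%:R :> R) by rewrite natr1 ler_nat.
have : e * (2 * (M%:R + L%:R * M%:R ^+ 2 + 1)) = 1 by rewrite mulVf// gt_eqF.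
suff G (q m l : R) : 0 < q -> q * (2 * (m + l * m ^+ 2 + 1)) = 1 -> l + 1 <= m ->
    (1 - q) * m <= (1 + q * m ^+ 2) * l -> False by exact: G e0.
by move=> *; nra.
Qed.

(** Let [L] be the least multiple of [p] that dominates [(a - t)_+]. If [b] does not dominate [L]
    copies of [p], it is below [L - 1] copies, and the hypothesis compares [L (k + 1)] copies of [p]
    with [(L - 1) k] copies, which [min_rank] excludes. *)
Lemma elementary_unperf k a b (t : R) : upos a -> ideal a -> upos b -> ideal b -> 0 < t ->
  cule (cu a *+ k.+1) (cu b *+ k) -> csub (ucut t a) b.
Proof.
move=> ua ia ub ib t0 H; have sa_ := upos_sa ua.
have [m Hm] := cut_le_multiple hsig hsimple up ip p0 ua ia t0.
pose a' := ucut t a; have ua' : upos a' by exact: ucut_upos.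
have ia' : ideal a' by apply: ideal_ucut => //; exact: ltW.
have aa' : csub a' a by apply: csub_cut_le => //; exact: ltW.
have [L HL Lmin] : exists2 L, cule (cu a') (cu p *+ L) &
    forall l, (l < L)%N -> ~ cule (cu a') (cu p *+ l).
  elim: m Hm => [|m IH] Hm; first by exists 0%N.
  have [h|h] := pselect (cule (cu a') (cu p *+ m)); first exact: IH.
  exists m.+1 => // l; rewrite ltnS => lm hl; apply: h; apply: cule_trans hl _; exact: cuMn_le.
case: L HL Lmin => [|L] HL Lmin.
  by apply/cuP; apply: cule_trans HL _; exact: cule0.
have [h|h] := min_dichotomy L ub ib; first by apply/cuP; apply: cule_trans HL h.
have [h2|/(Lmin _ (ltnSn _)) //] := min_dichotomy L ua' ia'.
have : cule (cu p *+ (L.+1 * k.+1)) (cu p *+ (L * k)).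
  rewrite !mulrnA; apply: cule_trans (cuMn _ h2) _.
  apply: cule_trans (cuMn _ _) _; last by apply: cule_trans H _; exact: cuMn h.
  exact/cuP.
move/min_rank; nia.
Qed.

End Elementary.
End Room.

(** * The tracial step *)

Section Unperforated.
Variables (R : realType) (A : cstarAlgType R) (AK : stabilization A).
Variables (D : cstarAlgType R) (iota : D -> A).
Hypothesis iotaL : forall (k : R[i]) (x y : D), iota (k *: x + y) = k *: iota x + iota y.
Hypothesis iotaM : forall x y : D, iota (x ** y) = iota x ** iota y.
Hypothesis iotaS : forall x : D, iota (star x) = star (iota x).
Hypothesis iotaN : forall x : D, cnorm (iota x) = cnorm x.
Hypothesis hW : W_almost_unperforated D.
Local Notation F := (@Em R A AK D iota).

(** The approximate comparison of diagonal matrices over [D] involves finite matrices only, so it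
    holds with the same norms in a stabilization of [D]. There [hW] applies, and the witness it
    yields is a finite matrix again and moves back. The forms of [a] and [b] make them positive in
    every embedding. *)
Lemma unperf_transport n k (w v : 'M[D]_n) (X : 'M[D]_(k.+1 * n)) (th eta : R) :
  let a := mmul (mmul (mstar w) w) (mmul (mstar w) w) in let b := mmul (mstar v) v in
  0 < th -> 0 < eta ->
  N[(mxe F X)^*u * dg F k b * mxe F X - dg F k.+1 a] <= th ->
  N[mxe F X] ^+ 2 * (k%:R * eta) <= th ->
  csub (ucut (th + th) (mxe F a)) (ucut eta (mxe F b)).
Proof.
move=> a b th0 eta0 H1 H2.
have sysF : mxsys F by exact: Em_sys.
have [DK hDK] := hW; pose G := @Em R D DK D id; have sysG : mxsys G by exact: Em_id.
have ub (W : ucstarType R) (L : nat -> nat -> D -> W) : mxsys L -> upos (mxe L b).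
  by move=> sysL; exists (mxe L v); rewrite /b mxeM// mxe_star.
have ua (W : ucstarType R) (L : nat -> nat -> D -> W) : mxsys L -> upos (mxe L a).
  move=> sysL; exists (mxe L (mmul (mstar w) w)); rewrite /a !mxeM// ustarM mxe_star//.
  by rewrite ustarK.
(* One matrix [y] represents the cut of [x] in all embeddings at once, and its diagonal copies
   represent the cuts of those of [x]. *)
have cut (t : R) (x : 'M[D]_n) : 0 < t ->
    (forall (W : ucstarType R) (L : nat -> nat -> D -> W), mxsys L -> upos (mxe L x)) ->
    exists y : 'M[D]_n, forall (W : ucstarType R) (L : nat -> nat -> D -> W), mxsys L ->
      [/\ ucut t (mxe L x) = mxe L y, upos (mxe L y) & forall l, ucut t (dg L l x) = dg L l y].
  move=> t0 ux.
  have c0 : cut t 0 = 0 by rewrite /cut sub0r max_r// oppr_le0 ltW.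
  have pc : papp (cut t) by exact: papp_cut.
  have [y hy] : finmx F n (ucut t (mxe F x)).
    by apply: finmx_ucut => //; [exact: ltW|exact/upos_sa/ux|exists x].
  exists y => W L sysL.
  have hxL : finrel F L n (mxe F x) (mxe L x) by exists x.
  have [y' [h1 h2]] := finrel_fc sysF sysL pc c0 (upos_sa (ux _ _ sysF)) hxL.
  have yy : y' = y by apply: (mxe_inj sysF); rewrite -h1 -hy.
  rewrite yy in h2; split=> // [|l].
    by rewrite -h2; apply: ucut_upos; exact/upos_sa/ux.
  by apply: dg_fc => //; exact/upos_sa/ux.
have th2 : 0 < th + th by lra.
have [a' ha'] := cut _ a th2 ua; have [b' hb'] := cut _ b eta0 ub.
have [hFa _ _] := ha' _ _ sysF; have [hFb uFb _] := hb' _ _ sysF.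
have [_ uGa hGa] := ha' _ _ sysG; have [_ uGb _] := hb' _ _ sysG.
rewrite hFa hFb.
have N1 : N[(mxe F X)^*u * dg F k b' * mxe F X - dg F k.+1 a] <= th + th.
  apply: le_trans (udistD ((mxe F X)^*u * dg F k b * mxe F X) _ _) _.
  apply: lerD H1.
  rewrite -mulrBl -mulrBr; apply: le_trans (norm_conj_le _ _) _; apply: le_trans H2.
  rewrite ler_wpM2l ?exprn_ge0 ?unorm_ge0// -dgB//; apply: le_trans (dg_norm sysF _ _) _.
  rewrite ler_wpM2l// mxeB// -hFb udistC; apply: ucut_dist; [exact: ltW|exact: ub].
have N2 : N[(mxe G X)^*u * dg G k b' * mxe G X - dg G k.+1 a] <= th + th.
  suff h : finrel F G (k.+1 * n) ((mxe F X)^*u * dg F k b' * mxe F X - dg F k.+1 a)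
      ((mxe G X)^*u * dg G k b' * mxe G X - dg G k.+1 a).
    by rewrite -(finrel_norm sysF sysG h).
  have hX : finrel F G (k.+1 * n) (mxe F X) (mxe G X) by exists X.
  apply: finrelB => //; last exact: finrel_dg.
  apply: finrelM => //; apply: finrelM => //; first exact: finrel_star.
  by apply: finrel_dg => //; rewrite leq_mul2r leqnSn orbT.
have C1 : csub (dg G k.+1 a') (dg G k b').
  apply: csub_trans (csub_conj (dg G k b') (mxe G X)).
  rewrite -hGa; apply: dist_cut_csub; [|apply: upos_conj; exact: upos_dg|by rewrite udistC].
  exact/upos_sa/upos_dg/ua.
have C2 : csub (mxe G a') (mxe G b').
  apply/W_leP => //; apply: (hDK _ _ _ _ k); [exact/mx_positiveP|exact/mx_positiveP|].
  by apply/W_leP; rewrite ?dg_W_mul//; exact: upos_dg.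
move=> e e0.
have fGa : finmx G n (mxe G a') by exists a'.
have fGb : finmx G n (mxe G b') by exists b'.
have [Y hY] := csub_finmx uGa uGb fGa fGb C2 e0.
exists (mxe F Y).
suff h : finrel F G n ((mxe F Y)^*u * mxe F b' * mxe F Y - mxe F a')
    ((mxe G Y)^*u * mxe G b' * mxe G Y - mxe G a').
  by rewrite (finrel_norm sysF sysG h).
have hY' : finrel F G n (mxe F Y) (mxe G Y) by exists Y.
apply: finrelB => //; last by exists a'.
apply: finrelM => //; apply: finrelM => //; first exact: finrel_star.
by exists b'.
Qed.

End Unperforated.

Section Pinch.
Variables (R : realType) (U : ucstarType R).
Implicit Types (a p e x y z : U).

Lemma ule_pinch a p : upos a -> sa p -> ule a (2 *: (p * a * p + (1 - p) * a * (1 - p))).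
Proof.
move=> /upos_sqrtU[h [sh ->]] sp; have sr : sa (1 - p) by apply: saB; [exact: sa1|].
exists (h * (p - (1 - p))); rewrite ustarM ustarB sp sr sh scaler_nat mulr2n; ncring.
Qed.

Lemma ule_double x y y' z (t : R) : ule x (2 *: (y + z)) -> ule y (y' + t%:A) ->
  ule x (2 *: (y' + z) + (2 * t)%:A).
Proof.
move=> h1 h2; apply: ule_trans h1 _.
have -> : 2 *: (y' + z) + (2 * t)%:A = 2 *: ((y' + t%:A) + z).
  by rewrite -scalerA -scalerDr addrAC.
by apply: uleZ => //; apply: uleD => //; exact: ule_refl.
Qed.

(** [1 - (1 - e)^2 = e (2 - e)], so the compression of [a] is a conjugate of [e a e], which is below
    [e]. *)
Lemma csub_pinch a e : upos a -> upos e ->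
  csub ((1 - (1 - e) * (1 - e)) * a * (1 - (1 - e) * (1 - e))) e.
Proof.
move=> /upos_sqrtU[h [sh ->]] ue; have se := upos_sa ue.
have -> : (1 - (1 - e) * (1 - e)) * (h * h) * (1 - (1 - e) * (1 - e)) =
    (1 + 1 - e)^*u * (e * (h^*u * h) * e) * (1 + 1 - e).
  by rewrite ustarB ustarD ustar1 se sh; ncring.
exact: csub_trans (csub_conj _ _) (csub_norm_sqr _ ue).
Qed.

End Pinch.

(** * Calculus with almost commuting sequences *)

Section Approx.
Variables (R : realType) (U : ucstarType R).
Implicit Types (x y z : nat -> U).

Definition bdseq x := exists K : R, forall j, N[x j] <= K.
(** Equality of bounded sequences modulo null sequences. Errors coming from almost commuting
    elements are thus handled by algebra in a quotient rather than by explicit estimates. *)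
Definition ap x y := [/\ bdseq x, bdseq y &
  forall e : R, 0 < e -> exists n, forall j, (n <= j)%N -> N[x j - y j] <= e].

Lemma ap_refl x : bdseq x -> ap x x.
Proof. by move=> bx; split=> // e e0; exists 0%N => j _; rewrite subrr unorm0 ltW. Qed.

Lemma ap_sym x y : ap x y -> ap y x.
Proof. by move=> [bx by_ h]; split=> // e /h[n hn]; exists n => j /hn; rewrite udistC. Qed.

Lemma ap_trans y x z : ap x y -> ap y z -> ap x z.
Proof.
move=> [bx _ h] [_ bz k]; split=> // e e0.
have [n hn] := h _ (half_gt0 e0); have [m hm] := k _ (half_gt0 e0).
exists (maxn n m) => j; rewrite geq_max => /andP[/hn a /hm b].
apply: le_trans (udistD (y j) _ _) _; lra.
Qed.

Lemma bdseqM x y : bdseq x -> bdseq y -> bdseq (fun j => x j * y j).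
Proof.
move=> [K hK] [L hL]; exists (K * L) => j; apply: le_trans (unormM _ _) _.
by rewrite ler_pM ?unorm_ge0.
Qed.

Lemma bdseqB x y : bdseq x -> bdseq y -> bdseq (fun j => x j - y j).
Proof. by move=> [K hK] [L hL]; exists (K + L) => j; apply: le_trans (unormB _ _) _; rewrite lerD. Qed.

Lemma bdseq_star x : bdseq x -> bdseq (fun j => (x j)^*u).
Proof. by move=> [K hK]; exists K => j; rewrite norm_ustar. Qed.

Lemma bdseq_cst (c : U) : bdseq (fun _ => c).
Proof. by exists N[c]. Qed.

Lemma ap_star x y : ap x y -> ap (fun j => (x j)^*u) (fun j => (y j)^*u).
Proof.
move=> [bx by_ h]; split; [exact: bdseq_star|exact: bdseq_star|].
by move=> e /h[n hn]; exists n => j /hn; rewrite -ustarB norm_ustar.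
Qed.

Lemma apM x y x' y' : ap x y -> ap x' y' -> ap (fun j => x j * x' j) (fun j => y j * y' j).
Proof.
move=> [bx by_ h] [bx' by' h']; split; [exact: bdseqM|exact: bdseqM|].
move=> e e0; have [K hK] := bx'; have [L hL] := by_.
have K0 : 0 <= K := le_trans (unorm_ge0 _) (hK 0%N).
have L0 : 0 <= L := le_trans (unorm_ge0 _) (hL 0%N).
have d0 : 0 < e / (K + L + 1) by rewrite divr_gt0// ltr_wpDl// addr_ge0.
have [n hn] := h _ d0; have [m hm] := h' _ d0.
exists (maxn n m) => j; rewrite geq_max => /andP[/hn a /hm b].
apply: le_trans (norm_mulB_le _ _ _ _) _.
have E : (K + L + 1) * (e / (K + L + 1)) = e.
  by rewrite mulrCA divff ?mulr1// gt_eqF// ltr_wpDl// addr_ge0.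
have := hK j; have := hL j; have := unorm_ge0 (x j - y j); have := unorm_ge0 (x' j - y' j).
have := unorm_ge0 (x' j); have := unorm_ge0 (y j).
move: E d0 a b; set d := e / _ => E d0 a b *; nra.
Qed.

Lemma apB x y x' y' : ap x y -> ap x' y' -> ap (fun j => x j - x' j) (fun j => y j - y' j).
Proof.
move=> [bx by_ h] [bx' by' h']; split; [exact: bdseqB|exact: bdseqB|].
move=> e e0; have [n hn] := h _ (half_gt0 e0); have [m hm] := h' _ (half_gt0 e0).
exists (maxn n m) => j; rewrite geq_max => /andP[/hn a /hm b].
rewrite opprD addrACA -opprD; apply: le_trans (unormB _ _) _; lra.
Qed.

Lemma ap_rate x y (C : R) : bdseq y -> 0 <= C -> (forall j, N[x j - y j] <= C / j.+1%:R) -> ap x y.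
Proof.
move=> by_ C0 H; split=> //.
  have [K hK] := by_; exists (C + K) => j; rewrite -[x j](subrK (y j)).
  apply: le_trans (unormD _ _) _; apply: lerD => //; apply: le_trans (H j) _.
  by rewrite ler_piMr// invf_le1// ler1n.
move=> e e0; have [n hn] := inv_small C e0; exists n => j nj; apply: le_trans (H j) _.
by apply: le_trans hn; rewrite ler_wpM2l// lef_pV2 ?posrE// ler_nat ltnS.
Qed.

End Approx.

Section LeftMul.
Variables (R : realType) (A : cstarAlgType R) (AK : stabilization A).
Local Notation E := (@Em R A AK A id).
Local Notation U := (utz AK).
Let sysE := Em_id AK.

Definition diagE m (e : A) : U := \sum_(p < m) E p p e.

Lemma diagE_mxr m n (rho sg : nat -> nat) e (x : 'M[A]_n) : (forall i : 'I_n, (rho i < m)%N) ->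
  diagE m e * mxr E rho sg x = mxr E rho sg (\matrix_(i, j) (e ** x i j)).
Proof.
move=> H; rewrite mulr_sumr; apply: eq_bigr => i _; rewrite mulr_sumr; apply: eq_bigr => j _.
rewrite mulr_suml (bigD1 (Ordinal (H i)))//= [X in _ + X]big1 ?addr0.
  by rewrite sys_M// eqxx mxE.
move=> p pi; rewrite sys_M// ifN//; apply: contra pi => /eqP h; exact/eqP/val_inj.
Qed.

Lemma mxr_diagE m n (rho sg : nat -> nat) e (x : 'M[A]_n) : (forall i : 'I_n, (sg i < m)%N) ->
  mxr E rho sg x * diagE m e = mxr E rho sg (\matrix_(i, j) (x i j ** e)).
Proof.
move=> H; rewrite mulr_suml; apply: eq_bigr => i _; rewrite mulr_suml; apply: eq_bigr => j _.
rewrite mulr_sumr (bigD1 (Ordinal (H j)))//= [X in _ + X]big1 ?addr0.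
  by rewrite sys_M// eqxx mxE.
move=> p pi; rewrite sys_M// ifN//; apply: contra pi => /eqP h; exact/eqP/val_inj.
Qed.

Lemma mxr_norm n rho sg (x : 'M[A]_n) (d : R) : (forall i j, cnorm (x i j) <= d) ->
  N[mxr E rho sg x] <= (n * n)%:R * d.
Proof.
move=> H; apply: (@le_trans _ _ (\sum_(i < n) \sum_(j < n) d)).
  apply: le_trans (unorm_sum _ _ _) _; apply: ler_sum => i _.
  apply: le_trans (unorm_sum _ _ _) _; apply: ler_sum => j _.
  by rewrite sys_norm.
by rewrite !sumr_const !card_ord -mulrnA mulr_natl.
Qed.

Lemma mxr_B n rho sg (x y : 'M[A]_n) : mxr E rho sg (x - y) = mxr E rho sg x - mxr E rho sg y.
Proof.
rewrite /mxr -sumrB; apply: eq_bigr => i _; rewrite -sumrB; apply: eq_bigr => j _.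
by rewrite !mxE sys_B.
Qed.

Variables (D : cstarAlgType R) (iota : D -> A).
Local Notation F := (@Em R A AK D iota).

Lemma mxr_approx n m (rho sg : nat -> nat) e (x : 'M[A]_n) (x' : 'M[D]_n) (d : R) :
  (forall i : 'I_n, (rho i < m)%N) -> (forall i : 'I_n, (sg i < m)%N) ->
  (forall i j, cnorm (e ** x i j - x i j ** e) <= d) ->
  (forall i j, cnorm (x i j - e ** x i j - iota (x' i j)) <= d) ->
  N[mxr F rho sg x' - (1 - diagE m e) * mxr E rho sg x] <= (n * n)%:R * d /\
  N[(1 - diagE m e) * mxr E rho sg x - mxr E rho sg x * (1 - diagE m e)] <= (n * n)%:R * d.
Proof.
move=> h1 h2 h3 h4; rewrite mulrBl mulrBr mul1r mulr1 diagE_mxr// mxr_diagE//; split.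
  pose z := \matrix_(i, j) iota (x' i j).
  have -> : mxr F rho sg x' = mxr E rho sg z.
    by apply: eq_bigr => i _; apply: eq_bigr => j _; rewrite mxE.
  rewrite udistC -!mxr_B; apply: mxr_norm => i j; rewrite !mxE; exact: h4.
rewrite opprB addrC addrA subrK udistC -mxr_B; apply: mxr_norm => i j; rewrite !mxE; exact: h3.
Qed.

Lemma dg_approx n m k e (x : 'M[A]_n) (x' : 'M[D]_n) (d : R) : (k * n <= m)%N ->
  (forall i j, cnorm (e ** x i j - x i j ** e) <= d) ->
  (forall i j, cnorm (x i j - e ** x i j - iota (x' i j)) <= d) ->
  N[dg F k x' - (1 - diagE m e) * dg E k x] <= k%:R * ((n * n)%:R * d) /\
  N[(1 - diagE m e) * dg E k x - dg E k x * (1 - diagE m e)] <= k%:R * ((n * n)%:R * d).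
Proof.
move=> km h3 h4.
have H (i : 'I_k) (r : 'I_n) : (blk n i r < m)%N.
  apply: leq_trans km; apply: (@leq_trans (i.+1 * n)); last by rewrite leq_mul2r ltn_ord orbT.
  by rewrite /blk mulSn addnC ltn_add2r.
have S (c : R) : k%:R * c = \sum_(i < k) c by rewrite sumr_const card_ord mulr_natl.
rewrite /dg mulr_sumr mulr_suml -!sumrB !S; split; apply: le_trans (unorm_sum _ _ _) _;
  apply: ler_sum => i _.
  by have [] := mxr_approx (H i) (H i) h3 h4.
by have [] := mxr_approx (H i) (H i) h3 h4.
Qed.

End LeftMul.

Section ApCalc.
Variables (R : realType) (U : ucstarType R) (Q : nat -> U).
Hypotheses (bQ : bdseq Q) (sQ : forall j, sa (Q j)).
Implicit Types (w y : U).

Definition apcomm w := ap (fun j => Q j * w) (fun j => w * Q j).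

Lemma ap_ext (x y x' y' : nat -> U) : x =1 x' -> y =1 y' -> ap x y -> ap x' y'.
Proof. by move=> /funext -> /funext ->. Qed.

Lemma apcommM w y : apcomm w -> apcomm y -> apcomm (w * y).
Proof.
move=> hw hy; apply: (ap_trans (y := fun j => w * Q j * y)).
  apply: (ap_ext _ _ (apM hw (ap_refl (bdseq_cst y)))) => j //; by rewrite !mulrA.
apply: (ap_ext _ _ (apM (ap_refl (bdseq_cst w)) hy)) => j; by rewrite !mulrA.
Qed.

Lemma apcomm_star w : apcomm w -> apcomm w^*u.
Proof.
move=> /ap_star /ap_sym; apply: ap_ext => j; by rewrite ustarM (sQ j).
Qed.

Lemma apcommQ w : apcomm w -> ap (fun j => Q j * w * Q j) (fun j => Q j * Q j * w).
Proof.
move=> /ap_sym hw; apply: (ap_ext _ _ (apM (ap_refl bQ) hw)) => j; by rewrite !mulrA.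
Qed.

Lemma apcommQr w : apcomm w -> ap (fun j => Q j * w * Q j) (fun j => w * Q j * Q j).
Proof. by move=> hw; apply: (apM hw (ap_refl bQ)). Qed.

Lemma ap_square w (w' : nat -> U) : sa w -> apcomm w -> ap w' (fun j => Q j * w) ->
  ap (fun j => (w' j)^*u * w' j) (fun j => Q j * (w * w) * Q j).
Proof.
move=> sw hw h; have h' := ap_trans h hw.
apply: (ap_ext _ _ (apM (ap_star h') h')) => j //; by rewrite ustarM sw (sQ j) !mulrA.
Qed.

(** With a fourth root [w], the compression of [w^4] carries [Q^2] on either side, exactly as the
    compressed comparison does in [ap_sandwich]. The difference of the two is then asymptotically
    [Q^2 (X^* b X - a) Q^2], which is small. *)
Lemma ap_fourth w (w' : nat -> U) : sa w -> apcomm w -> ap w' (fun j => Q j * w) ->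
  ap (fun j => (w' j)^*u * w' j * ((w' j)^*u * w' j))
     (fun j => Q j * Q j * (w * w * (w * w)) * (Q j * Q j)).
Proof.
move=> sw hw h; have h2 := ap_square sw hw h; have hww := apcommM hw hw.
have a1 := ap_trans h2 (apcommQ hww); have a2 := ap_trans h2 (apcommQr hww).
by apply: (ap_ext _ _ (apM a1 a2)) => j //; rewrite !mulrA.
Qed.

Lemma ap_sandwich v X (v' X' : nat -> U) : sa v -> apcomm v -> ap v' (fun j => Q j * v) ->
  apcomm X -> ap X' (fun j => Q j * X) ->
  ap (fun j => (X' j)^*u * ((v' j)^*u * v' j) * X' j)
     (fun j => Q j * Q j * (X^*u * (v * v) * X) * (Q j * Q j)).
Proof.
move=> sv hv h hX k; have h2 := ap_square sv hv h; have k' := ap_trans k hX.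
have k2 : ap (fun j => (X' j)^*u) (fun j => Q j * X^*u).
  by apply: (ap_ext _ _ (ap_star k')) => j //; rewrite ustarM (sQ j).
have a1 : ap (fun j => (X' j)^*u * Q j) (fun j => Q j * Q j * X^*u).
  exact: ap_trans (apM k2 (ap_refl bQ)) (apcommQ (apcomm_star hX)).
have a2 : ap (fun j => Q j * X' j) (fun j => X * Q j * Q j).
  apply: ap_trans (apM (ap_refl bQ) k') _.
  by apply: (ap_ext _ _ (apcommQr hX)) => j //; rewrite !mulrA.
apply: ap_trans (apM (apM (ap_refl (bdseq_star _)) h2) (ap_refl _)) _; try by case: k.
have a3 := apM (apM a1 (ap_refl (bdseq_cst (v * v)))) a2.
by apply: (ap_ext _ _ a3) => j; rewrite !mulrA.
Qed.

End ApCalc.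

Section TracialStep.
Variables (R : realType) (A : cstarAlgType R) (AK : stabilization A).
Hypothesis htracial : essentially_tracially_in (@W_almost_unperforated R) A.
Local Notation E := (@Em R A AK A id).
Local Notation U := (utz AK).
Let sysE := Em_id AK.

Lemma sqrt_mx n (x : 'M[A]_n) : upos (mxe E x) ->
  exists y, [/\ mstar y = y, mmul y y = x & upos (mxe E y)].
Proof.
move=> ux; have sx := upos_sa ux.
pose h := fc (fun t : R => Num.sqrt t) (mxe E x).
have pq := @papp_sqrtp R.
have [y hy] : finmx E n h by apply: finmx_fc => //; [rewrite sqrtr0|exists x].
have sh : sa h by apply: fc_sa.
have hh : h * h = mxe E x.
  rewrite -[RHS]upos_ppos// /h -fcM//.
  apply: fc_eq_pos => //; [by apply: pappM|exact: papp_ppos|].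
  by move=> t /andP[t0 _]; rewrite sqrtM_id// /ppos max_l.
exists y; split.
- by apply: (mxe_inj sysE); rewrite mxe_star// -hy.
- by apply: (mxe_inj sysE); rewrite mxeM// -hy.
- by rewrite -hy; apply: fc_upos => // t _; exact: sqrtr_ge0.
Qed.

(* [w'], [v'] and [X'] are the compressions by [1 - e] of a fourth root of [a], a
   square root of [b], and an element implementing the comparison; they are matrices
   over the subalgebra provided by [htracial]. *)
Lemma tracial_package n k (xw xv : 'M[A]_n) (xX : 'M[A]_(k.+1 * n)) (s : A) (d : R) :
  0 < d -> positive s -> s != 0 ->
  exists (e : A) (w' v' dw' dv' X' : U), let Q := 1 - diagE AK (k.+1 * n) e in
  [/\ positive_unit_ball e, cuntz_sub e s,
      forall th eta : R, 0 < th -> 0 < eta ->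
        N[X'^*u * (dv'^*u * dv') * X' - dw'^*u * dw' * (dw'^*u * dw')] <= th ->
        N[X'] ^+ 2 * (k%:R * eta) <= th ->
        csub (ucut (th + th) (w'^*u * w' * (w'^*u * w'))) (ucut eta (v'^*u * v')),
      [/\ N[w' - Q * mxe E xw] <= (n * n)%:R * d, N[v' - Q * mxe E xv] <= (n * n)%:R * d,
          N[dw' - Q * dg E k.+1 xw] <= k.+1%:R * ((n * n)%:R * d),
          N[dv' - Q * dg E k xv] <= k%:R * ((n * n)%:R * d) &
          N[X' - Q * mxe E xX] <= (k.+1 * n * (k.+1 * n))%:R * d] &
      [/\ N[Q * mxe E xw - mxe E xw * Q] <= (n * n)%:R * d,
          N[Q * mxe E xv - mxe E xv * Q] <= (n * n)%:R * d,
          N[Q * dg E k.+1 xw - dg E k.+1 xw * Q] <= k.+1%:R * ((n * n)%:R * d),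
          N[Q * dg E k xv - dg E k xv * Q] <= k%:R * ((n * n)%:R * d) &
          N[Q * mxe E xX - mxe E xX * Q] <= (k.+1 * n * (k.+1 * n))%:R * d]].
Proof.
move=> d0 ps s0; pose m := (k.+1 * n)%N.
pose ent p (x : 'M[A]_p) := [set x i.1 i.2 | i in [set: 'I_p * 'I_p]].
have fent p (x : 'M[A]_p) : finite_set (ent p x) by apply: finite_image; exact: finite_finset.
pose S := ent n xw `|` ent n xv `|` ent m xX.
have fS : finite_set S by rewrite !finite_setU.
have [e [B [pe _ [D [iota [[iL iM iS iN iB] hD]]] hS es]]] := htracial fS d0 ps s0.
have iN' x : cnorm (iota x) = cnorm x by rewrite /cnorm iN.
have h3 x : S x -> cnorm (e ** x - x ** e) <= d.
  by move=> /hS[h _ _]; rewrite -lecR -cnormE ltW.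
have h4 x : S x -> exists y, cnorm (x - e ** x - iota y) <= d.
  move=> /hS[_ [b]]; rewrite -iB => -[y _ <-] h _; exists y; rewrite -lecR -cnormE ltW //.
have pick p (x : 'M[A]_p) : ent p x `<=` S -> exists x' : 'M[D]_p,
    (forall i j, cnorm (e ** x i j - x i j ** e) <= d) /\
    (forall i j, cnorm (x i j - e ** x i j - iota (x' i j)) <= d).
  move=> sub; have hx i j : S (x i j) by apply: sub; exists (i, j).
  have /choice[y hy] (ij : 'I_p * 'I_p) : exists y, cnorm (x ij.1 ij.2 - e ** x ij.1 ij.2 - iota y) <= d.
    exact: h4.
  exists (\matrix_(i, j) y (i, j)); split=> i j; first exact: h3.
  by rewrite mxE; exact: (hy (i, j)).
have [yw [w1 w2]] : exists x' : 'M[D]_n,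
    (forall i j, cnorm (e ** xw i j - xw i j ** e) <= d) /\
    (forall i j, cnorm (xw i j - e ** xw i j - iota (x' i j)) <= d).
  by apply: pick => x hx; left; left.
have [yv [v1 v2]] : exists x' : 'M[D]_n,
    (forall i j, cnorm (e ** xv i j - xv i j ** e) <= d) /\
    (forall i j, cnorm (xv i j - e ** xv i j - iota (x' i j)) <= d).
  by apply: pick => x hx; left; right.
have [yX [X1 X2]] : exists x' : 'M[D]_m,
    (forall i j, cnorm (e ** xX i j - xX i j ** e) <= d) /\
    (forall i j, cnorm (xX i j - e ** xX i j - iota (x' i j)) <= d).
  by apply: pick => x hx; right.
pose F := @Em R A AK D iota; have sysF : mxsys F by exact: Em_sys.
have nm (i : 'I_n) : (id i < m)%N by apply: leq_trans (ltn_ord i) _; rewrite leq_pmull.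
have mm (i : 'I_m) : (id i < m)%N by [].
have km : (k * n <= m)%N by rewrite leq_mul2r leqnSn orbT.
have [aw bw] := mxr_approx AK (rho := id) (sg := id) nm nm w1 w2; have [av bv] := mxr_approx AK (rho := id) (sg := id) nm nm v1 v2.
have [aX bX] := mxr_approx AK (rho := id) (sg := id) mm mm X1 X2.
have [adw bdw] := dg_approx AK (leqnn (k.+1 * n)) w1 w2; have [adv bdv] := dg_approx AK km v1 v2.
exists e, (mxe F yw), (mxe F yv), (dg F k.+1 yw), (dg F k yv), (mxe F yX); split=> //.
move=> th eta th0 eta0.
rewrite -!dg_star// -!dgM// -!mxe_star// -!mxeM// [mxe F (mstar yX)]mxe_star//.
exact: unperf_transport.
Qed.

Lemma diagE_norm m e : N[diagE AK m e] <= m%:R * cnorm e.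
Proof.
apply: le_trans (unorm_sum _ _ _) _; under eq_bigr do rewrite sys_norm//.
by rewrite sumr_const card_ord mulr_natl.
Qed.

Lemma cu_diagE m e s : positive e -> cuntz_sub e s ->
  cule (cu (diagE AK m e)) (cu (E 0 0 s) *+ m).
Proof.
move=> [y _ <-] es; apply: cule_trans (cu_sum _) _; rewrite cuM_ord.
elim/big_ind2: _ => [|x1 x2 y1 y2|p _]; [exact: cule_refl|exact: cuD|].
apply/cuP.
have h1 : csub (E p p (star y ** y)) (E 0 0 (y ** star y)).
  by have := csub_star (E 0 p y); rewrite sys_star// !sys_M// !eqxx.
have h2 : csub (E 0 0 (y ** star y)) (E 0 0 (star y ** y)).
  have := csub_star (E 0 0 (star y)); by rewrite sys_star// !sys_M// starK.
apply: csub_trans h1 _; apply: csub_trans h2 _.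
move=> d d0; have [x /ccvgP/(_ d d0)[n /(_ n (leqnn _)) h]] := es.
exists (E 0 0 (x n)); rewrite sys_star// !sys_M// -sys_B// sys_norm //.
Qed.

Lemma upos_diagE m e : positive e -> upos (diagE AK m e).
Proof.
move=> [y _ <-]; apply: upos_sum => p _; exists (E p p y); by rewrite sys_star// sys_M// eqxx.
Qed.

(** Put [q = 1 - diag(e, ..., e)], [p = q^2] and [r = 1 - p]; pinching gives
    [a <= 2 (p a p + r a r)]. The first term is close to an element built from the subalgebra, a cut
    of which is below [b] by unperforation there. The second is below [diag(e, ..., e)], that is,
    below [m] copies of [s]. *)
Lemma tracial_step n k (xa xb : 'M[A]_n) (s : A) (eps : R) :
  upos (mxe E xa) -> upos (mxe E xb) -> positive s -> s != 0 -> 0 < eps ->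
  cule (cu (mxe E xa) *+ k.+1) (cu (mxe E xb) *+ k) ->
  cule (cu (ucut eps (mxe E xa))) (cu (mxe E xb) + cu (E 0 0 s) *+ (k.+1 * n)).
Proof.
move=> ua ub ps s0 eps0 H; pose m := (k.+1 * n)%N.
have [xh [sxh hh uh]] := sqrt_mx ua; have [xw [sxw ww uw]] := sqrt_mx uh.
have [xv [sxv vv uv]] := sqrt_mx ub.
pose w := mxe E xw; pose v := mxe E xv; pose a := mxe E xa; pose b := mxe E xb.
have sw : sa w := upos_sa uw; have sv : sa v := upos_sa uv.
have wE : w * w * (w * w) = a by rewrite /w -!mxeM// ww hh.
have vE : v * v = b by rewrite /v -!mxeM// vv.
pose dw := dg E k.+1 xw; pose dv := dg E k xv.
have sdw : sa dw by rewrite /sa /dw -dg_star// sxw.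
have sdv : sa dv by rewrite /sa /dv -dg_star// sxv.
have dwE : dw * dw * (dw * dw) = dg E k.+1 xa by rewrite /dw -!dgM// ww hh.
have dvE : dv * dv = dg E k xb by rewrite /dv -!dgM// vv.
have C1 : csub (dg E k.+1 xa) (dg E k xb).
  have [_ h1] := cu_dg sysE k ub; have [h2 _] := cu_dg sysE k.+1 ua.
  by apply/cuP; apply: cule_trans h2 _; apply: cule_trans H h1.
pose C : R := m%:R + 1; have C0 : 0 < C by rewrite ltr_wpDl.
(* The cut by [th + th] and the approximation error [th] are both doubled by the pinching. *)
pose th := eps / 6; have th0 : 0 < th by rewrite divr_gt0.
(* Multiplication by [Q^2] on both sides enlarges the error of the witness [X] by a factor of at
   most [C^4]. *)
have kap0 : 0 < th / 2 / C ^+ 4 by rewrite !divr_gt0// exprn_gt0.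
have fa : finmx E m (dg E k.+1 xa) by apply: finmx_dg.
have fb : finmx E m (dg E k xb).
  by apply: finmx_widen (finmx_dg sysE k xb) => //; rewrite leq_mul2r leqnSn orbT.
have [xX hX] := csub_finmx (upos_dg sysE _ ua) (upos_dg sysE _ ub) fa fb C1 kap0.
pose X := mxe E xX.
have inv0 (j : nat) : 0 < j.+1%:R^-1 :> R by rewrite invr_gt0.
(* The tolerances [1 / (j + 1)] produce sequences, for which [ap] records what holds in the limit; a
   single large [j] is fixed at the end. *)
have /choice[e /choice[w' /choice[v' /choice[dw' /choice[dv' /choice[X' P]]]]]] (j : nat) :=
  tracial_package xw xv xX (inv0 j) ps s0.
pose Q j := 1 - diagE AK m (e j).
have se j : sa (diagE AK m (e j)) by have [[pe _] _ _ _ _] := P j; exact/upos_sa/upos_diagE.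
have sQ j : sa (Q j) by apply: saB; [exact: sa1|].
have NQ j : N[Q j] <= C.
  have [[_ e1] _ _ _ _] := P j; rewrite cnormE lecR in e1.
  apply: le_trans (unormB _ _) _; rewrite unorm1 addrC /C lerD2r.
  by apply: le_trans (diagE_norm _ _) _; rewrite ler_piMr.
have bQ : bdseq Q by exists C.
have bQc (c : U) : bdseq (fun j => Q j * c) by apply: bdseqM => //; exact: bdseq_cst.
have bcQ (c : U) : bdseq (fun j => c * Q j) by apply: bdseqM => //; exact: bdseq_cst.
have hw : ap w' (fun j => Q j * w).
  by apply: (@ap_rate _ _ _ _ (n * n)%:R) => // j; have [_ _ _ [] ] := P j.
have hv : ap v' (fun j => Q j * v).
  by apply: (@ap_rate _ _ _ _ (n * n)%:R) => // j; have [_ _ _ [] ] := P j.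
have hdw : ap dw' (fun j => Q j * dw).
  apply: (@ap_rate _ _ _ _ (k.+1%:R * (n * n)%:R)) => // j.
  by rewrite -mulrA; have [_ _ _ [] ] := P j.
have hdv : ap dv' (fun j => Q j * dv).
  apply: (@ap_rate _ _ _ _ (k%:R * (n * n)%:R)) => // j.
  by rewrite -mulrA; have [_ _ _ [] ] := P j.
have hX' : ap X' (fun j => Q j * X).
  by apply: (@ap_rate _ _ _ _ (k.+1 * n * (k.+1 * n))%:R) => // j; have [_ _ _ [] ] := P j.
have cw : apcomm Q w.
  by apply: (@ap_rate _ _ _ _ (n * n)%:R) => // j; have [_ _ _ _ [] ] := P j.
have cv : apcomm Q v.
  by apply: (@ap_rate _ _ _ _ (n * n)%:R) => // j; have [_ _ _ _ [] ] := P j.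
have cdw : apcomm Q dw.
  apply: (@ap_rate _ _ _ _ (k.+1%:R * (n * n)%:R)) => // j.
  by rewrite -mulrA; have [_ _ _ _ [] ] := P j.
have cdv : apcomm Q dv.
  apply: (@ap_rate _ _ _ _ (k%:R * (n * n)%:R)) => // j.
  by rewrite -mulrA; have [_ _ _ _ [] ] := P j.
have cX : apcomm Q X.
  by apply: (@ap_rate _ _ _ _ (k.+1 * n * (k.+1 * n))%:R) => // j; have [_ _ _ _ [] ] := P j.
have [_ _ A1] := ap_fourth bQ sQ sw cw hw.
have [_ _ A2] := ap_square sQ sv cv hv.
have [_ _ A3] := apB (ap_sandwich bQ sQ sdv cdv hdv cX hX') (ap_fourth bQ sQ sdw cdw hdw).
have [[K hK] _ _] := hX'.
have L0 : 0 < K ^+ 2 * k%:R + 1 by rewrite ltr_wpDl// mulr_ge0// sqr_ge0.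
pose eta := th / (K ^+ 2 * k%:R + 1); have eta0 : 0 < eta by exact: divr_gt0.
have [n1 B1] := A1 _ th0; have [n2 B2] := A2 _ eta0; have [n3 B3] := A3 _ (half_gt0 th0).
pose j := maxn n1 (maxn n2 n3).
have {B1} := B1 j (leq_maxl _ _); have {B2} := B2 j ltac:(rewrite /j !leq_max leqnn ?orbT //).
have {B3} := B3 j ltac:(rewrite /j !leq_max leqnn ?orbT //).
have [[pe _] es good _ _] := P j.
rewrite dvE dwE vE wE.
set q := Q j; set al := _ * ((w' j)^*u * _); set be := (v' j)^*u * _ => B3 B2 B1.
have Nq : N[q * q] <= C ^+ 2.
  by apply: le_trans (unormM _ _) _; rewrite expr2 ler_pM ?unorm_ge0//; exact: NQ.
have sq : sa q := sQ j.
have G1 : csub (ucut (th + th) al) (ucut eta be).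
  apply: good => //.
    rewrite -[X in N[X]](subrK (q * q * (X^*u * dg E k xb * X) * (q * q) -
      q * q * dg E k.+1 xa * (q * q))).
    apply: le_trans (unormD _ _) _; apply: le_trans (lerD B3 (lexx _)) _.
    set g := _ - q * q * dg E k.+1 xa * (q * q).
    suff : N[g] <= th / 2 by lra.
    rewrite /g -mulrBl -mulrBr.
    apply: le_trans (unormM _ _) _; apply: le_trans (ler_wpM2r (unorm_ge0 _) (unormM _ _)) _.
    have h := ltW hX; rewrite ler_pdivlMr ?exprn_gt0// -/X in h.
    apply: le_trans h; set y := N[_ - _]; set z := N[_ * q].
    have -> : z * y * z = y * (z * z) by ring.
    have -> : C ^+ 4 = C ^+ 2 * C ^+ 2 by rewrite -exprD.
    by apply: ler_wpM2l; [exact: unorm_ge0|rewrite ler_pM ?unorm_ge0].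
  apply: le_trans (_ : K ^+ 2 * (k%:R * eta) <= _).
    apply: ler_wpM2r; first by apply: mulr_ge0 => //; exact: ltW.
    by rewrite lerXn2r ?nnegrE ?unorm_ge0// (le_trans (unorm_ge0 _) (hK j)).
  have hE : (K ^+ 2 * k%:R + 1) * eta = th by rewrite /eta mulrCA divff ?mulr1// gt_eqF.
  apply: (@le_trans _ _ ((K ^+ 2 * k%:R + 1) * eta)); last by rewrite hE.
  by rewrite mulrDl mul1r mulrA lerDl ltW.
have ube : upos be by exists (v' j).
have G2 : csub (ucut eta be) b.
  apply: csub_trans (_ : csub (q * b * q) b); last by have := csub_conj b q; rewrite sq.
  by apply: dist_cut_csub; [exact: upos_sa|apply: upos_sand|].
have ual : upos al.
  exists ((w' j)^*u * w' j); by rewrite /al ustarM ustarK.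
pose p := q * q; pose r := 1 - p.
have sp : sa p by apply: saM. 
have sr : sa r by apply: saB; [exact: sa1|].
have L1 : ule a (2 *: (p * a * p + r * a * r)).
  exact: ule_pinch.
have L2 : ule (p * a * p) (ucut (th + th) al + (th + th + th)%:A).
  have sd : sa (p * a * p - al) by apply: saB; [exact/upos_sa/upos_sand|exact: upos_sa].
  have h1 : ule (p * a * p - al) th%:A by apply: ule_normA => //; rewrite udistC; exact: B1.
  have h2 := uleD h1 (ule_cutA (th + th) ual); rewrite subrK in h2.
  by rewrite (scalerDl 1 (th + th) th) addrA [X in ule _ X]addrC.
have L3 : csub (ucut eps a) (2 *: (ucut (th + th) al + r * a * r)).
  have sal := upos_sa ual.
  apply: ule_cut_csub; [exact: upos_sa| |].
    by apply: uposZ => //; apply: uposD; [exact: ucut_upos|exact: upos_sand].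
  have -> : eps = 2 * (th + th + th) by rewrite /th; lra.
  exact: ule_double L1 L2.
have L4 : csub (r * a * r) (diagE AK m (e j)) by apply: csub_pinch => //; exact: upos_diagE.
apply: (cule_trans (y := cu (ucut (th + th) al + r * a * r))).
  by apply/cuP; apply: csub_trans L3 _; exact: csubZ.
apply: cule_trans (cu_add2 _ _) _; apply: cuD; first by apply/cuP; exact: csub_trans G1 G2.
apply: cule_trans (cu_diagE m pe es); exact/cuP.
Qed.

End TracialStep.

Section FiniteUnperforation.
Variables (R : realType) (A : cstarAlgType R) (AK : stabilization A).
Hypotheses (hsig : sigma_unital A) (hsimple : simple_cstar A).
Hypothesis htracial : essentially_tracially_in (@W_almost_unperforated R) A.
Local Notation E := (@Em R A AK A id).
Local Notation U := (utz AK).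
Let sysE := Em_id AK.

Lemma fin_unperf n k (a b : U) (eps : R) : finmx E n a -> finmx E n b -> upos a -> upos b ->
  0 < eps -> cule (cu a *+ k.+1) (cu b *+ k) -> csub (ucut eps a) b.
Proof.
move=> fa fb ua ub eps0 H; have ia := finmx_ideal fa; have ib := finmx_ideal fb.
have [b0|b0] := eqVneq b 0.
  apply: csub_trans (csub_cut_le (ltW eps0) ua) _; apply/cuP.
  apply: (cule_trans (y := cu a *+ k.+1)); first by rewrite mulrS; exact: cule_addl.
  apply: cule_trans H _; rewrite b0; apply: cule_trans (cuMn _ (cu0 U)) _.
  rewrite mul0rn; exact: cule0.
have [nonel|/existsNP[z0]] := pselect (forall z : U, upos z -> ideal z -> z != 0 -> splits z).
  (* With [2 k] in place of [k]: [(2k + 2)<a> <= 2k<b> <= (2k + 1)<b1>], so [tracial_step] applies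
     to [a] and [b1] with the number [2k + 1]. *)
  have [b1 [c [ub1 uc c0 hb1 [hc hbc hk]]]] := room hsimple nonel (2 * k) ub ib b0.
  have ic := inher_ideal ib hc.
  (* The number of copies is the one that [tracial_step] adds to [b1]. *)
  have [s [ps s0 hs]] := small_copies hsimple nonel ((2 * k).+2 * n) uc ic c0.
  have [xa hxa] := fa; have [xb hxb] := inher_finmx fb hb1.
  apply/cuP; apply: cule_trans hbc; apply: cule_trans (cuD (cule_refl _) hs).
  rewrite hxa hxb; apply: (@tracial_step _ _ _ htracial n (2 * k).+1) => //.
  - by rewrite -hxa.
  - by rewrite -hxb.
  rewrite -hxa -hxb; apply: cule_trans hk.
  have -> : (2 * k).+2 = (k.+1 * 2)%N by lia.
  by rewrite mulrnA mulnC mulrnA; exact: cuMn.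
move=> /not_implyP[uz /not_implyP[iz /not_implyP[z00 nsp]]].
have [p [up ip pp p0 pmin]] := minimal_projection uz iz z00 nsp.
exact: (elementary_unperf hsig hsimple z00 up ip pp p0 pmin ua ia ub ib eps0 H).
Qed.

End FiniteUnperforation.

(** * Unperforation in the stabilization *)

Section Copies.
Variables (R : realType) (A : cstarAlgType R) (AK : stabilization A).
Local Notation E := (@Em R A AK A id).
Local Notation U := (utz AK).
Let sysE := Em_id AK.

Definition widen_mx n m (x : 'M[A]_n) : 'M[A]_m :=
  \matrix_(i, j) if insub (i : nat) is Some i' then
    if insub (j : nat) is Some j' then x i' j' else 0 else 0.

Lemma mxr_widen n m (rho sg : nat -> nat) (x : 'M[A]_n) : (n <= m)%N ->
  mxr E rho sg (widen_mx m x) = mxr E rho sg x.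
Proof.
move=> nm; pose f (i j : nat) : A := if insub i is Some i' then
    if insub j is Some j' then x i' j' else 0 else 0.
have fn (i : nat) j : (n <= i)%N -> f i j = 0 by move=> ni; rewrite /f insubF// ltnNge ni.
have fm i (j : nat) : (n <= j)%N -> f i j = 0.
  by move=> nj; rewrite /f; case: (insub i) => // i'; rewrite insubF// ltnNge nj.
have fx (i j : 'I_n) : f i j = x i j by rewrite /f !valK.
transitivity (\sum_(i < n) \sum_(j < n) E (rho i) (sg j) (f i j)); last first.
  by apply: eq_bigr => i _; apply: eq_bigr => j _; rewrite fx.
rewrite (big_ord_widen m (fun i => \sum_(j < n) E (rho i) (sg j) (f i j)) nm) [RHS]big_mkcond.
apply: eq_bigr => i _; case: ifPn => [_|]; last first.
  by rewrite -leqNgt => ni; rewrite big1// => j _; rewrite mxE -/(f i j) fn// sys_0.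
rewrite (big_ord_widen m (fun j => E (rho i) (sg j) (f i j)) nm) [RHS]big_mkcond.
apply: eq_bigr => j _; rewrite mxE -/(f i j); case: ifPn => // nj.
by rewrite fm ?sys_0// leqNgt.
Qed.

Lemma mxr_norm_eq n (sg : nat -> nat) (x : 'M[A]_n) : injective sg ->
  N[mxr E sg id x] = N[mxe E x].
Proof.
move=> si; apply/eqP; rewrite -(@eqrXn2 _ 2)// ?unorm_ge0// -!unorm_ustar_mul.
by rewrite mxr_star// mxrM// -mxe_star// -mxeM.
Qed.

Lemma ulim_ex (W : ucstarType R) (u : nat -> W) : (forall e : R, 0 < e ->
    exists N, forall m n, (N <= m)%N -> (N <= n)%N -> N[u m - u n] < e) -> exists l, ulim u l.
Proof. exact: ucomplete. Qed.

Lemma ulim_star_mul (W : ucstarType R) (u v : nat -> W) l l' :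
  ulim u l -> ulim v l' -> ulim (fun j => (u j)^*u * v j) (l^*u * l').
Proof.
move=> hu hv e e0.
pose K := N[l] + N[l'] + 1; have K0 : 0 < K by rewrite ltr_wpDl// addr_ge0 ?unorm_ge0.
have d0 : 0 < Num.min 1 (e / (2 * K)) by rewrite lt_min ltr01 divr_gt0// mulr_gt0.
have [n hn] := hu _ d0; have [m hm] := hv _ d0; exists (maxn n m) => j.
rewrite geq_max => /andP[/hn + /hm]; rewrite !lt_min => /andP[a1 a2] /andP[b1 b2].
apply: le_lt_trans (norm_mulB_le _ _ _ _) _; rewrite -ustarB !norm_ustar.
have h : N[v j] <= N[l'] + 1.
  by rewrite -[v j](subrK l') addrC; apply: le_trans (unormD _ _) _; rewrite lerD2l ltW.
rewrite ltr_pdivlMr ?mulr_gt0// in a2; rewrite ltr_pdivlMr ?mulr_gt0// in b2.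
have := unorm_ge0 (u j - l); have := unorm_ge0 (v j - l'); have := unorm_ge0 l; have := unorm_ge0 l'.
have := unorm_ge0 (v j).
rewrite /K in a2 b2; nra.
Qed.

(* The finite matrices approximating [h], with their rows moved to pairwise disjoint
   positions. *)
Lemma copies k (h : U) : ideal h -> exists Y : 'I_k -> U,
  forall i j, (Y i)^*u * Y j = if i == j then h^*u * h else 0.
Proof.
move=> ih.
have /choice[x hx] (q : nat) : exists x : {n & 'M[A]_n}, N[h - mxe E (projT2 x)] < q.+1%:R^-1.
  have q0 : 0 < q.+1%:R^-1 :> R by rewrite invr_gt0.
  by have [n [_ [[x ->] hx]]] := finmx_dense ih q0; exists (existT (fun n => 'M[A]_n) n x).
pose sg (j : 'I_k) (p : nat) := (p * k + j)%N.
have sI j : injective (sg j).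
  by move=> p q /addIn /eqP; rewrite eqn_pmul2r => [/eqP|]//; apply: leq_trans (ltn_ord j).
have sD i j p q : i != j -> sg i p != sg j q.
  apply: contra => /eqP e; apply/eqP/val_inj; have := congr1 (modn^~ k) e.
  by rewrite /sg !modnMDl !modn_small.
have lim_h : ulim (fun q => mxe E (projT2 (x q))) h.
  move=> e e0; have [N HN] := inv_small 1 e0; exists N => q Nq; rewrite udistC.
  apply: lt_le_trans (hx q) _; apply: le_trans HN.
  by rewrite div1r lef_pV2 ?posrE// ler_nat ltnS.
have /choice[Y hY] (j : 'I_k) : exists y, ulim (fun q => mxr E (sg j) id (projT2 (x q))) y.
  apply: ulim_ex => e e0; have [N HN] := lim_h _ (half_gt0 e0); exists N => p q Np Nq.
  pose n q := projT1 (x q).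
  rewrite -(mxr_widen _ _ _ (leq_maxl (n p) (n q))) -(mxr_widen _ _ (projT2 (x q)) (leq_maxr (n p) (n q))).
  rewrite -mxr_B mxr_norm_eq//.
  rewrite -[mxe E _]/(mxr E id id _) mxr_B !mxr_widen ?leq_maxl ?leq_maxr//.
  apply: le_lt_trans (udistD h _ _) _; rewrite [X in _ + X]udistC.
  have := HN _ Np; have := HN _ Nq; rewrite /mxe /mxr; lra.
exists Y => i j; have h1 := ulim_star_mul (hY i) (hY j).
case: (eqVneq i j) h1 => [<-|ij] h1.
  apply: ulim_unique (ulim_star_mul lim_h lim_h) => e e0.
  have [N HN] := h1 e e0; exists N => q /HN.
  by rewrite mxr_star// mxrM// -mxe_star// -mxeM.
apply: ulim_unique h1 _ => e e0; exists 0%N => q _.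
rewrite mxr_star// mxr_orth// ?subrr ?unorm0//.
by move=> p r; exact: sD.
Qed.

Lemma fc_orth_sum (W : ucstarType R) (I : finType) f (a : I -> W) : papp f -> f 0 = 0 ->
  (forall i, sa (a i)) -> (forall i j, i != j -> a i * a j = 0) ->
  fc f (\sum_i a i) = \sum_i fc f (a i).
Proof.
move=> pf f0 sa_a orth.
pose P (s : seq I) := uniq s -> fc f (\sum_(i <- s) a i) = \sum_(i <- s) fc f (a i).
suff H s : P s by have := H _ (index_enum_uniq I).
rewrite /P; elim: s => [|i s IH] /=.
  by rewrite !big_nil fc_at0// f0 scale0r.
move=> /andP[is_ us]; rewrite !big_cons -IH//; set b := \sum_(i <- s) a i.
have sb : sa b by apply: sa_sum => j _.
have ab : a i * b = 0.
  rewrite mulr_sumr big_seq big1// => j js; apply: orth.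
  by apply: contra is_ => /eqP ->.
have ba : b * a i = 0 by rewrite -[LHS]ustarK ustarM sb sa_a ab ustar0.
apply: fc_eq => //; first exact: saD.
move=> e e0; have e3 : 0 < e / 3 by lra.
have [p Hp] := pf (N[a i + b] + N[a i] + N[b]) _ e3.
have H0 : `|p.[0]| <= e / 3.
  by have := Hp 0; rewrite normr0 !addr_ge0 ?unorm_ge0// f0 sub0r normrN => /(_ isT).
exists p; split=> [t ht|].
  apply: le_trans (Hp t _) _; last by lra.
  by apply: le_trans ht _; rewrite -addrA lerDl addr_ge0// unorm_ge0.
have hl (u v : W) : u * v = 0 -> forall q : {poly R}, pev q u * v = q.[0] *: v.
  move=> uv; elim/poly_ind=> [|q c _]; first by rewrite pev0 horner0 mul0r scale0r.
  by rewrite pevD pevM pevX pevC !hornerE mulrDl -mulrA uv mulr0 add0r -scalerAl mul1r.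
have hp (q : {poly R}) : pev q (a i + b) = pev q (a i) + pev q b - (q.[0])%:A.
  elim/poly_ind: q => [|q c IHq]; first by rewrite !pev0 horner0 scale0r !addr0 subr0.
  rewrite !pevD !pevM !pevX !pevC IHq !hornerE mulrDr !mulrBl !mulrDl (hl _ _ ab) (hl _ _ ba).
  rewrite -!scalerAl !mul1r; set u := q.[0] *: a i; set v := q.[0] *: b; ncring.
have h1 : N[fc f (a i) - pev p (a i)] <= e / 3.
  apply: (fcP pf (sa_a i)) => t ht; apply: Hp; apply: le_trans ht _.
  by rewrite -addrA addrCA lerDl addr_ge0// unorm_ge0.
have h2 : N[fc f b - pev p b] <= e / 3.
  apply: (fcP pf sb) => t ht; apply: Hp; apply: le_trans ht _.
  by rewrite lerDr addr_ge0// unorm_ge0.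
have h3 : N[(p.[0])%:A : W] <= e / 3 by rewrite unormZ unorm1 mulr1.
rewrite hp (_ : _ - _ = (fc f (a i) - pev p (a i)) + (fc f b - pev p b) + (p.[0])%:A).
  apply: le_trans (unormD _ _) _; apply: le_trans (lerD (unormD _ _) (lexx _)) _; lra.
by ncring.
Qed.

Lemma cu_copies k (Y : 'I_k -> U) (h : U) :
  (forall i j, (Y i)^*u * Y j = if i == j then h^*u * h else 0) ->
  let y := \sum_i Y i * (Y i)^*u in
  [/\ upos y, cule (cu y) (cu (h^*u * h) *+ k), cule (cu (h^*u * h) *+ k) (cu y) &
   forall t : R, 0 < t -> cule (cu (ucut t y)) (cu (ucut t (h^*u * h)) *+ k) /\
                    cule (cu (ucut t (h^*u * h)) *+ k) (cu (ucut t y))].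
Proof.
move=> HY y.
have uY i : upos (Y i * (Y i)^*u) by exists (Y i)^*u; rewrite ustarK.
have oY i j : i != j -> Y i * (Y i)^*u * (Y j * (Y j)^*u) = 0.
  by move=> /negPf ij; rewrite !mulrA -[Y i * _ * Y j]mulrA HY ij mulr0 mul0r.
have E1 i : h^*u * h = (Y i)^*u * Y i by rewrite HY eqxx.
have cE i : cu (Y i * (Y i)^*u) = cu (h^*u * h).
  rewrite (E1 i); apply: cu_eqP; last exact: csub_star.
  by have := csub_star (Y i)^*u; rewrite ustarK.
have tE (t : R) i : 0 < t -> cu (ucut t (Y i * (Y i)^*u)) = cu (ucut t (h^*u * h)).
  move=> t0; rewrite (E1 i); apply: cu_eqP; last exact: csub_cut_star.
  by have := csub_cut_star (Y i)^*u t0; rewrite ustarK.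
split; first exact: upos_sum.
- by rewrite cuM_ord -(eq_bigr _ (fun i _ => cE i)); exact: cu_sum.
- by rewrite cuM_ord -(eq_bigr _ (fun i _ => cE i)); exact: cu_orth.
move=> t t0; rewrite cuM_ord -(eq_bigr _ (fun i _ => tE t i t0)).
have c0 : cut t 0 = 0 by rewrite /cut sub0r max_r// oppr_le0 ltW.
have pc := @papp_cut R t.
have -> : ucut t y = \sum_i ucut t (Y i * (Y i)^*u).
  by apply: fc_orth_sum => // i; exact: upos_sa.
split; first exact: cu_sum.
apply: cu_orth => [i|i j ij]; first exact/ucut_upos/upos_sa.
apply: fc_mul0r => //; first exact: upos_sa.
by apply: fc_mul0l => //; [exact: upos_sa|exact: oY].
Qed.

(** Multiples in the semigroup are realized by the single elements of [cu_copies], to which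
    [csub_cut_cut] applies; cutting such an element cuts each of its copies. *)
Lemma cule_cut p q (x y : U) (e : R) : upos x -> ideal x -> upos y -> ideal y -> 0 < e ->
  cule (cu x *+ p) (cu y *+ q) ->
  exists2 d : R, 0 < d & cule (cu (ucut e x) *+ p) (cu (ucut d y) *+ q).
Proof.
move=> ux ix uy iy e0 H.
have [h [ih sh hx]] := upos_ideal_sqrt ux ix; have [g [ig sg gy]] := upos_ideal_sqrt uy iy.
have [X HX] := copies p ih; have [Y HY] := copies q ig.
have [u1 a1 b1 c1] := cu_copies HX; have [u2 a2 b2 c2] := cu_copies HY.
have hh : h^*u * h = x by rewrite sh.
have gg : g^*u * g = y by rewrite sg.
rewrite hh in a1 b1 c1; rewrite gg in a2 b2 c2.
have : csub (\sum_i X i * (X i)^*u) (\sum_i Y i * (Y i)^*u).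
  by apply/cuP; apply: cule_trans a1 _; apply: cule_trans H b2.
move=> /(csub_cut_cut e0 u1 u2)[d d0 hd]; exists d => //.
by apply: cule_trans (c1 _ e0).2 _; apply: cule_trans (c2 _ d0).1; exact/cuP.
Qed.

Lemma finmx_dense_pos (x : U) (e : R) : upos x -> ideal x -> 0 < e ->
  exists n a, [/\ finmx E n a, upos a & N[x - a] <= e].
Proof.
move=> ux ix e0; have [h [ih sh hx]] := upos_ideal_sqrt ux ix.
pose K := N[h] + N[h] + 1; have K0 : 0 < K by rewrite ltr_wpDl// addr_ge0 ?unorm_ge0.
have d0 : 0 < Num.min 1 (e / K) by rewrite lt_min ltr01 divr_gt0.
have [n [g [fg]]] := finmx_dense ih d0; rewrite lt_min ltr_pdivlMr// => /andP[g1 g2].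
exists n, (g^*u * g); split; [|by exists g|].
  by apply: finmxM => //; exact: finmx_star.
rewrite hx -{1}sh; apply: le_trans (norm_mulB_le _ _ _ _) _; rewrite -ustarB !norm_ustar.
have ng : N[g] <= N[h] + 1.
  rewrite -[g](subKr h); apply: le_trans (unormB _ _) _; rewrite lerD2l ltW//.
have := unorm_ge0 (h - g); rewrite /K in g2; have := unorm_ge0 h; nra.
Qed.

Hypotheses (hsig : sigma_unital A) (hsimple : simple_cstar A).
Hypothesis htracial : essentially_tracially_in (@W_almost_unperforated R) A.

Lemma ak_unperf k (x y : U) (eps : R) : upos x -> ideal x -> upos y -> ideal y -> 0 < eps ->
  cule (cu x *+ k.+1) (cu y *+ k) -> csub (ucut eps x) y.
Proof.
move=> ux ix uy iy eps0 H.
(* One quarter of [eps] is spent on the cut in [cule_cut], one on each of the two passages between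
   [x] and its approximant [x0], and one on [fin_unperf]. *)
have e3 : 0 < eps / 4 by lra.
have [d d0 Hd] := cule_cut ux ix uy iy e3 H.
have [n [x0 [fx ux0 hx]]] := finmx_dense_pos ux ix e3.
have [m [y0 [fy uy0 hy]]] := finmx_dense_pos uy iy (half_gt0 d0).
have s0 : 0 <= eps / 4 by exact: ltW.
have le1 (u v : U) (t : R) : upos u -> upos v -> N[u - v] <= t -> ule u (v + t%:A).
  move=> uu uv huv; have := ule_normA (saB (upos_sa uu) (upos_sa uv)) huv.
  by rewrite /ule opprB addrA [_%:A + _]addrC.
pose a := ucut (eps / 4 + eps / 4) x0; pose b := ucut (d / 2) y0.
have ua : upos a by exact/ucut_upos/upos_sa.
have ub : upos b by exact/ucut_upos/upos_sa.
have ax : csub a (ucut (eps / 4) x).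
  by apply: ule_ucut => //; apply: le1 => //; rewrite udistC.
have xa : csub (ucut eps x) (ucut (eps / 4) a).
  rewrite /a ucut_ucut//; last exact: upos_sa.
  have -> : ucut eps x = ucut ((eps / 4 + eps / 4 + eps / 4) + eps / 4) x by congr ucut; lra.
  by apply: ule_ucut => //; exact: le1.
have yb : csub (ucut d y) b.
  have -> : ucut d y = ucut (d / 2 + d / 2) y by congr ucut; lra.
  by apply: ule_ucut => //; [exact/ltW/half_gt0|exact: le1].
have yb' : csub b y by apply: dist_cut_csub => //; [exact: upos_sa|rewrite udistC].
have Hab : cule (cu a *+ k.+1) (cu b *+ k).
  apply: cule_trans (cuMn _ (_ : cule _ (cu (ucut (eps / 4) x)))) _; first exact/cuP.
  by apply: cule_trans Hd _; apply: cuMn; exact/cuP.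
have fa : finmx E (maxn n m) a.
  apply: (finmx_widen sysE (leq_maxl n m)); apply: finmx_ucut => //; first lra.
  exact: upos_sa.
have fb : finmx E (maxn n m) b.
  apply: (finmx_widen sysE (leq_maxr n m)); apply: finmx_ucut => //; first lra.
  exact: upos_sa.
apply: csub_trans yb'; apply: csub_trans xa _.
exact: (fin_unperf hsig hsimple htracial fa fb ua ub e3 Hab).
Qed.

End Copies.

(** * The C*-algebra of 2 x 2 matrices *)

Section CScale.
Variables (R : realType) (U : ucstarType R).

Definition uscale (k : R[i]) (z : U) : U := complex.Re k *: z + complex.Im k *: (ui * z).

Lemma uscaleD k z w : uscale k (z + w) = uscale k z + uscale k w.
Proof. by rewrite /uscale mulrDr !scalerDr addrACA. Qed.

Lemma uscale_norm k z : N[uscale k z] = cabs k * N[z].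
Proof.
have E : complex.Re k ^+ 2 + complex.Im k ^+ 2 = cabs k ^+ 2.
  by apply: complexI; rewrite add_Re2_Im2 rmorphXn /= -cabsE.
have uu : (uscale k z)^*u * uscale k z = cabs k ^+ 2 *: (z^*u * z).
  rewrite /uscale ustarD !ustarZ ustarM ustar_ui -E.
  set a := complex.Re k; set b := complex.Im k.
  rewrite mulrDl !mulrDr -!scalerAl -!scalerAr !scalerA.
  have h1 : z^*u * - ui * z = - (z^*u * (ui * z)) by rewrite mulrN mulNr mulrA.
  have h2 : z^*u * - ui * (ui * z) = z^*u * z.
    by rewrite mulrN mulNr -mulrA [ui * (ui * z)]mulrA uiM mulN1r mulrN opprK.
  rewrite h1 h2 scalerN [b * a]mulrC -addrA [_ + (- _ + _)]addrA subrr add0r.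
  by rewrite -scalerDl !expr2.
apply/eqP; rewrite -(@eqrXn2 _ 2)// ?mulr_ge0 ?cabs_ge0 ?unorm_ge0//; apply/eqP.
by rewrite exprMn -!unorm_ustar_mul uu unormZ ger0_norm// exprn_ge0// cabs_ge0.
Qed.

End CScale.

Section M2.
Variables (R : realType) (D : cstarAlgType R) (U : ucstarType R) (E : nat -> nat -> D -> U).

(** [mxsys] sees only real scalars, since [U] is an algebra over [R]; compatibility with [ui]
    restores complex linearity. *)
Definition csys := mxsys E /\ forall i j a, E i j ('i *: a) = ui * E i j a.

Lemma csysZ (h : csys) i j (k : R[i]) a : E i j (k *: a) = uscale k (E i j a).
Proof.
case: h => sysE h; rewrite {1}(complexE k) scalerDl sys_D// sys_Z// mulrC -scalerA sys_Z// h //.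
Qed.

(* Normed through the embedding given by [E], hence the parameter [h]. *)
Definition m2 (h : csys) : Type := 'M[D]_2.

Variable h : csys.
Let sysE : mxsys E := proj1 h.
Implicit Types x y z : m2 h.
Local Notation M := (m2 h).

HB.instance Definition _ := GRing.Zmodule.copy M 'M[D]_2.

Definition m2v (x : M) : U := mxe E (x : 'M[D]_2).
Definition m2_scale (k : R[i]) (x : M) : M := \matrix_(i, j) (k *: (x : 'M[D]_2) i j).

Lemma m2_scaleA (a b : R[i]) x : m2_scale a (m2_scale b x) = m2_scale (a * b) x.
Proof. by apply/matrixP => i j; rewrite !mxE scalerA. Qed.

Lemma m2_scale1 : left_id 1 m2_scale.
Proof. by move=> x; apply/matrixP => i j; rewrite mxE scale1r. Qed.

Lemma m2_scaleDr : right_distributive m2_scale +%R.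
Proof. by move=> k x y; apply/matrixP => i j; rewrite !mxE scalerDr. Qed.

Lemma m2_scaleDl x : {morph m2_scale^~ x : a b / a + b}.
Proof. by move=> a b; apply/matrixP => i j; rewrite !mxE scalerDl. Qed.

HB.instance Definition _ := GRing.Zmodule_isLmodule.Build R[i] M m2_scaleA m2_scale1
  m2_scaleDr m2_scaleDl.

Lemma m2vD x y : m2v (x + y) = m2v x + m2v y.
Proof. exact: mxeD. Qed.

Lemma uscale0 (k : R[i]) : uscale k (0 : U) = 0.
Proof. by rewrite /uscale mulr0 !scaler0 addr0. Qed.

Lemma m2vZ (k : R[i]) x : m2v (k *: x) = uscale k (m2v x).
Proof.
rewrite /m2v /mxe.
rewrite (big_morph _ (uscaleD k) (uscale0 k)); apply: eq_bigr => i _.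
rewrite (big_morph _ (uscaleD k) (uscale0 k)); apply: eq_bigr => j _.
by rewrite mxE csysZ.
Qed.

Definition m2_norm x : R[i] := (N[m2v x])%:C.

Lemma m2_normD x y : m2_norm (x + y) <= m2_norm x + m2_norm y.
Proof. by rewrite /m2_norm -rmorphD /= lecR m2vD unormD. Qed.

Lemma m2_normZ (k : R[i]) x : m2_norm (k *: x) = `|k| * m2_norm x.
Proof. by rewrite /m2_norm m2vZ uscale_norm cabsE -rmorphM. Qed.

Lemma m2_norm_eq0 x : m2_norm x = 0 -> x = 0.
Proof.
move=> [/unorm0_eq0 H]; apply: (mxe_inj sysE).
by rewrite mxe0.
Qed.

HB.instance Definition _ := Lmodule_isNormed.Build R[i] M m2_normD m2_normZ m2_norm_eq0.

Lemma m2_normE x : `|x| = (N[m2v x])%:C.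
Proof. by []. Qed.

Lemma m2_entry x i j : `|(x : 'M[D]_2) i j| <= `|x|.
Proof. by rewrite m2_normE cnormE lecR mxe_entry. Qed.

Lemma m2_norm_le x : `|x| <= \sum_(i < 2) \sum_(j < 2) `|(x : 'M[D]_2) i j|.
Proof.
rewrite m2_normE; apply: le_trans (_ : (\sum_(i < 2) \sum_(j < 2) cnorm ((x : 'M[D]_2) i j))%:C <= _).
  by rewrite lecR; apply: mxe_norm.
rewrite rmorph_sum /=; apply: ler_sum => i _; rewrite rmorph_sum /=; apply: ler_sum => j _.
by rewrite -cnormE.
Qed.

Lemma m2_cauchy_cvg (F : set_system M) : ProperFilter F -> cauchy F -> cvg F.
Proof.
move=> FF /cauchyP FC.
have H (ij : 'I_2 * 'I_2) : exists l : D, (fun x : M => (x : 'M[D]_2) ij.1 ij.2) @ F --> l.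
  suff : cvg ((fun x : M => (x : 'M[D]_2) ij.1 ij.2) @ F).
    by move=> hc; exists (lim ((fun x : M => (x : 'M[D]_2) ij.1 ij.2) @ F)).
  apply: cauchy_cvg; apply: cauchy_exP => e e0.
  have [x hx] := FC e e0; exists ((x : 'M[D]_2) ij.1 ij.2).
  rewrite /nbhs /=; near=> y.
  have : ball x e y by near: y.
  rewrite -!ball_normE /= => hy; apply: le_lt_trans hy.
  have -> : (x : 'M[D]_2) ij.1 ij.2 - (y : 'M[D]_2) ij.1 ij.2 = ((x - y : M) : 'M[D]_2) ij.1 ij.2.
    by rewrite !mxE.
  exact: m2_entry.
have /choice[l hl] := H.
apply/cvg_ex; exists ((\matrix_(i, j) l (i, j)) : M).
apply/cvgrPdist_lt => e e0.
have e4 : 0 < e / 4%:R by rewrite divr_gt0.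
have hij i j : \forall x \near F, `|l (i, j) - (x : 'M[D]_2) i j| < e / 4%:R.
  by have /cvgrPdist_lt := hl (i, j); exact.
near=> x.
have h1 : `|l (ord0, ord0) - (x : 'M[D]_2) ord0 ord0| < e / 4%:R by near: x; exact: hij.
have h2 : `|l (ord0, lift ord0 ord0) - (x : 'M[D]_2) ord0 (lift ord0 ord0)| < e / 4%:R.
  by near: x; exact: hij.
have h3 : `|l (lift ord0 ord0, ord0) - (x : 'M[D]_2) (lift ord0 ord0) ord0| < e / 4%:R.
  by near: x; exact: hij.
have h4 : `|l (lift ord0 ord0, lift ord0 ord0) -
    (x : 'M[D]_2) (lift ord0 ord0) (lift ord0 ord0)| < e / 4%:R.
  by near: x; exact: hij.
apply: le_lt_trans (m2_norm_le _) _.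
rewrite !big_ord_recl !big_ord0 !mxE !addr0.
have -> : e = (e / 4%:R + e / 4%:R) + (e / 4%:R + e / 4%:R) by field.
by rewrite !ltrD.
Unshelve. all: by end_near.
Qed.

HB.instance Definition _ := Uniform_isComplete.Build M m2_cauchy_cvg.

Definition m2_mul x y : M := mmul x y.
Definition m2_star x : M := mstar x.

Lemma m2v_mul x y : m2v (m2_mul x y) = m2v x * m2v y.
Proof. exact: mxeM. Qed.

Lemma m2v_star x : m2v (m2_star x) = (m2v x)^*u.
Proof. exact: mxe_star. Qed.

Lemma m2v_inj : injective m2v.
Proof. exact: mxe_inj. Qed.

Lemma m2_mulA : associative m2_mul.
Proof. by move=> x y z; apply: m2v_inj; rewrite !m2v_mul mulrA. Qed.

Lemma m2_mulDl : left_distributive m2_mul +%R.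
Proof. by move=> x y z; apply: m2v_inj; rewrite m2vD !m2v_mul m2vD mulrDl. Qed.

Lemma m2_mulDr : right_distributive m2_mul +%R.
Proof. by move=> x y z; apply: m2v_inj; rewrite m2vD !m2v_mul m2vD mulrDr. Qed.

Lemma uscaleAl (k : R[i]) (a b : U) : uscale k (a * b) = uscale k a * b.
Proof. by rewrite /uscale mulrDl -!scalerAl mulrA. Qed.

Lemma uscaleAr (k : R[i]) (a b : U) : uscale k (a * b) = a * uscale k b.
Proof. by rewrite /uscale mulrDr -!scalerAr mulrA uiC -mulrA. Qed.

Lemma m2_scaleAl (k : R[i]) x y : k *: m2_mul x y = m2_mul (k *: x) y.
Proof. by apply: m2v_inj; rewrite m2vZ !m2v_mul m2vZ uscaleAl. Qed.

Lemma m2_scaleAr (k : R[i]) x y : k *: m2_mul x y = m2_mul x (k *: y).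
Proof. by apply: m2v_inj; rewrite m2vZ !m2v_mul m2vZ uscaleAr. Qed.

Lemma m2_starK : involutive m2_star.
Proof. by move=> x; apply/matrixP => i j; rewrite !mxE starK. Qed.

Lemma m2_starD : {morph m2_star : x y / x + y}.
Proof. by move=> x y; apply/matrixP => i j; rewrite !mxE starD. Qed.

Lemma m2_starZ (k : R[i]) x : m2_star (k *: x) = Num.conj k *: m2_star x.
Proof. by apply/matrixP => i j; rewrite !mxE starZ. Qed.

Lemma m2_starM x y : m2_star (m2_mul x y) = m2_mul (m2_star y) (m2_star x).
Proof. by apply: m2v_inj; rewrite m2v_star !m2v_mul !m2v_star ustarM. Qed.

Lemma m2_normM x y : `|m2_mul x y| <= `|x| * `|y|.
Proof. by rewrite !m2_normE -rmorphM /= lecR m2v_mul unormM. Qed.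

Lemma m2_norm_star_mul x : `|m2_mul (m2_star x) x| = `|x| ^+ 2.
Proof. by rewrite !m2_normE m2v_mul m2v_star unorm_ustar_mul rmorphXn. Qed.

HB.instance Definition _ := CompleteNormedModule_isCStarAlgebra.Build R M m2_mulA m2_mulDl
  m2_mulDr m2_scaleAl m2_scaleAr m2_starK m2_starD m2_starZ m2_starM m2_normM m2_norm_star_mul.

Definition m2_emb (i j : 'I_2) (d : D) : M := \matrix_(k, l) if (k == i) && (l == j) then d else 0.

Lemma m2v_emb i j d : m2v (m2_emb i j d) = E i j d.
Proof.
rewrite /m2v /mxe (bigD1 i)//= [X in _ + X]big1 ?addr0 => [|k /negPf ki].
  rewrite (bigD1 j)//= [X in _ + X]big1 ?addr0 => [|l /negPf lj]; first by rewrite mxE !eqxx.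
  by rewrite mxE lj andbF sys_0.
by rewrite big1// => l _; rewrite mxE ki sys_0.
Qed.

Lemma m2_emb_linear i j (k : R[i]) (a b : D) :
  m2_emb i j (k *: a + b) = k *: m2_emb i j a + m2_emb i j b.
Proof. by apply/matrixP => p q; rewrite !mxE; case: ifP => // _; rewrite scaler0 addr0. Qed.

Lemma m2_emb_mul i j k l (a b : D) :
  m2_emb i j a ** m2_emb k l b = if j == k then m2_emb i l (a ** b) else 0.
Proof.
apply: m2v_inj; rewrite m2v_mul !m2v_emb sys_M//.
have -> : (j == k :> nat) = (j == k) by [].
by case: ifP => _; rewrite ?m2v_emb// /m2v mxe0.
Qed.

Lemma m2_emb_star i j (a : D) : star (m2_emb i j a) = m2_emb j i (star a).
Proof. by apply: m2v_inj; rewrite m2v_star !m2v_emb sys_star. Qed.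

Lemma m2_emb_inj i j : injective (m2_emb i j).
Proof.
move=> a b /(congr1 m2v); rewrite !m2v_emb => H; apply/eqP; rewrite -subr_eq0.
by apply/eqP/cnorm0_eq0; rewrite -(sys_norm sysE i j) sys_B// H subrr unorm0.
Qed.

Lemma m2_emb_dense : closure
  [set x : M | exists s : seq ('I_2 * 'I_2 * D), x = \sum_(p <- s) m2_emb p.1.1 p.1.2 p.2] = setT.
Proof.
apply/seteqP; split=> // x _; apply: subset_closure => /=.
exists [seq (ij, (x : 'M[D]_2) ij.1 ij.2) | ij : 'I_2 * 'I_2].
rewrite big_map; apply: m2v_inj.
rewrite (big_morph m2v (id1 := 0) (op1 := +%R)); [|exact: m2vD|by rewrite /m2v mxe0].
rewrite big_enum /= /m2v /mxe pair_bigA /=; apply: eq_bigr => -[i j] _ /=.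
by rewrite -[RHS]/(m2v _) m2v_emb.
Qed.

(** The amplification on which [quasitrace2] requires an extension of the trace. Its elements sit in
    [U] through [m2v], so a functional on [U] restricts to it. *)
Definition m2_amp : amplification 'I_2 D :=
  {| amp := M : cstarAlgType R; emb := m2_emb; emb_linear := m2_emb_linear;
     emb_mul := m2_emb_mul; emb_star := m2_emb_star; emb_inj := m2_emb_inj;
     emb_dense := m2_emb_dense |}.

End M2.

(** * 2-quasitraces on hereditary subalgebras *)

Section Quasi.
Variables (R : realType) (U : ucstarType R) (T : U -> \bar R) (c0 : U).
Implicit Types (x y z a b p q u : U).
Local Notation pp := (@ppos R).
Local Notation pn := (@pneg R).
Hypothesis sa_c0 : sa c0.
Hypothesis T_fin : forall z, upos z -> inher c0 z -> T z \is a fin_num.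
Hypothesis T_add : forall z w, upos z -> inher c0 z -> upos w -> inher c0 w ->
  z * w = w * z -> T (z + w) = (T z + T w)%E.
Hypothesis T_ge0 : forall z, (0 <= T z)%E.
Hypothesis T_scale : forall (r : R) z, 0 <= r -> upos z -> inher c0 z -> T (r *: z) = (r%:E * T z)%E.
Hypothesis T_tr : forall u, inher c0 u -> T (u^*u * u) = T (u * u^*u).

Lemma inher_star z : inher c0 z -> inher c0 z^*u.
Proof.
move=> hz e e0; have [x hx] := hz e e0; exists x^*u.
have -> : z^*u - c0 * x^*u * c0 = (z - c0 * x * c0)^*u by rewrite ustarB !ustarM sa_c0 mulrA.
by rewrite norm_ustar.
Qed.

Lemma inher_ui z : inher c0 z -> inher c0 (ui * z).
Proof.
move=> hz e e0; have [x hx] := hz e e0; exists (ui * x).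
have -> : ui * z - c0 * (ui * x) * c0 = ui * (z - c0 * x * c0).
  by rewrite mulrBr !mulrA -(uiC c0).
have uu : N[ui : U] = 1.
  apply/eqP; rewrite -(@eqrXn2 _ 2)//; last exact: unorm_ge0.
  by rewrite -unorm_ustar_mul ustar_ui mulNr uiM opprK unorm1 expr1n.
by apply: le_lt_trans (unormM _ _) _; rewrite uu mul1r.
Qed.

Definition tsa a : R := fine (T (fc pp a)) - fine (T (fc pn a)).

Lemma ppos_pneg a : sa a -> a = fc pp a - fc pn a.
Proof.
move=> sa_a; rewrite -fcB//; try tpapp.
rewrite -[LHS](fc_id sa_a); apply: fc_ext => //; try tpapp.
move=> t _; rewrite /ppos /pneg; case: (leP 0 t) => h.
  by rewrite max_r ?subr0// oppr_le0.
by rewrite max_l ?sub0r ?opprK// oppr_ge0 ltW.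
Qed.

Lemma ppos_upos a : sa a -> upos (fc pp a).
Proof. by move=> sa_a; apply: fc_upos => //; [tpapp|move=> t _; rewrite /ppos le_max lexx orbT]. Qed.

Lemma pneg_upos a : sa a -> upos (fc pn a).
Proof. by move=> sa_a; apply: fc_upos => //; [tpapp|move=> t _; rewrite /pneg le_max lexx orbT]. Qed.

Lemma ppos_her a : sa a -> inher c0 a -> inher c0 (fc pp a).
Proof. by move=> sa_a ha; apply: inher_fc => //; [tpapp|rewrite /ppos maxxx]. Qed.

Lemma pneg_her a : sa a -> inher c0 a -> inher c0 (fc pn a).
Proof. by move=> sa_a ha; apply: inher_fc => //; [tpapp|rewrite /pneg oppr0 maxxx]. Qed.

(** With [a = p - q] one has [a_+ + q = p + a_-], where the two terms on each side commute.
    Additivity on commuting positive elements then makes the value independent of the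
    decomposition. *)
Lemma tsa_diff p q : upos p -> upos q -> inher c0 p -> inher c0 q -> p * q = q * p ->
  tsa (p - q) = fine (T p) - fine (T q).
Proof.
move=> up uq hp hq pq.
have sp := upos_sa up; have sq := upos_sa uq.
have sa_a : sa (p - q) by rewrite /sa ustarB sp sq.
have ha : inher c0 (p - q) by exact: inherB.
have u1 := ppos_upos sa_a; have u2 := pneg_upos sa_a.
have h1 := ppos_her sa_a ha; have h2 := pneg_her sa_a ha.
have E : fc pp (p - q) + q = p + fc pn (p - q).
  have -> : p + fc pn (p - q) = (p - q) + (q + fc pn (p - q)) by rewrite addrA subrK.
  by rewrite [X in _ = X + _](ppos_pneg sa_a) [q + _]addrC addrA subrK.
have c1 : fc pp (p - q) * q = q * fc pp (p - q).
  by symmetry; apply: fc_comm => //; [tpapp|rewrite mulrBl mulrBr pq].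
have c2 : p * fc pn (p - q) = fc pn (p - q) * p.
  by apply: fc_comm => //; [tpapp|rewrite mulrBl mulrBr pq].
have := congr1 T E; rewrite !T_add// => E2.
have := congr1 fine E2; rewrite !fineD ?T_fin// /tsa => E3.
by apply/eqP; rewrite subr_eq addrAC eq_sym subr_eq E3 eqxx.
Qed.

Lemma tsa_upos p : upos p -> inher c0 p -> tsa p = fine (T p).
Proof.
move=> up hp; have T0 : T 0 = 0%E.
  by rewrite -(scale0r (0 : U)) T_scale ?mul0e//; [exact: upos0|exact: inher0].
rewrite -{1}[p]subr0 tsa_diff ?T0 ?subr0//; [exact: upos0|exact: inher0|by rewrite mulr0 mul0r].
Qed.

Lemma tsa_add a b : sa a -> sa b -> inher c0 a -> inher c0 b -> a * b = b * a ->
  tsa (a + b) = tsa a + tsa b.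
Proof.
move=> sa_a sb ha hb ab.
have u1 := ppos_upos sa_a; have u2 := pneg_upos sa_a.
have h1 := ppos_her sa_a ha; have h2 := pneg_her sa_a ha.
have v1 := ppos_upos sb; have v2 := pneg_upos sb.
have k1 := ppos_her sb hb; have k2 := pneg_her sb hb.
have E : a + b = (fc pp a + fc pp b) - (fc pn a + fc pn b).
  by rewrite {1}(ppos_pneg sa_a) {1}(ppos_pneg sb) opprD addrACA.
have C f g : papp f -> papp g -> fc f a * fc g b = fc g b * fc f a.
  move=> pf pg; apply: fc_comm => //; symmetry; apply: fc_comm => //.
have Ca f g : papp f -> papp g -> fc f a * fc g a = fc g a * fc f a.
  move=> pf pg; apply: fc_comm => //; symmetry; apply: fc_comm => //.
have Cb f g : papp f -> papp g -> fc f b * fc g b = fc g b * fc f b.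
  move=> pf pg; apply: fc_comm => //; symmetry; apply: fc_comm => //.
rewrite E tsa_diff; first last.
- rewrite mulrDl !mulrDr (Ca pp pn) ?(C pp pn) -?(C pn pp) ?(Cb pp pn); try tpapp.
  ncring.
- exact: inherD.
- exact: inherD.
- exact: uposD.
- exact: uposD.
rewrite !T_add//; try (by apply: C; tpapp).
by rewrite !fineD ?T_fin// /tsa; ring.
Qed.

Lemma tsa_scale (r : R) a : sa a -> inher c0 a -> tsa (r *: a) = r * tsa a.
Proof.
move=> sa_a ha.
have u1 := ppos_upos sa_a; have u2 := pneg_upos sa_a.
have h1 := ppos_her sa_a ha; have h2 := pneg_her sa_a ha.
have c : fc pp a * fc pn a = fc pn a * fc pp a.
  by apply: fc_comm; try tpapp => //; symmetry; apply: fc_comm; try tpapp => //.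
have S (s : R) z : 0 <= s -> upos z -> inher c0 z -> fine (T (s *: z)) = s * fine (T z).
  by move=> s0 uz hz; rewrite T_scale// -[T z]fineK ?T_fin// -EFinM.
have cc (s s' : R) : s *: fc pp a * (s' *: fc pn a) = s' *: fc pn a * (s *: fc pp a).
  by rewrite -!scalerAl -!scalerAr c !scalerA mulrC.
case: (leP 0 r) => r0.
  rewrite {1}(ppos_pneg sa_a) scalerBr tsa_diff ?S//; try exact: uposZ; try exact: inherZ.
  by rewrite /tsa mulrBr.
have r0' : 0 <= - r by rewrite oppr_ge0 ltW.
have -> : r *: a = (- r) *: fc pn a - (- r) *: fc pp a.
  by rewrite {1}(ppos_pneg sa_a) scalerBr !scaleNr opprK addrC.
rewrite tsa_diff ?S//; try exact: uposZ; try exact: inherZ.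
by rewrite /tsa; ring.
Qed.

Definition ure z : U := 2^-1 *: (z + z^*u).
Definition uim z : U := 2^-1 *: (ui * (z^*u - z)).

Lemma ure_sa z : sa (ure z).
Proof. by rewrite /sa /ure ustarZ ustarD ustarK addrC. Qed.

Lemma uim_sa z : sa (uim z).
Proof.
by rewrite /sa /uim ustarZ ustarM ustarB ustarK ustar_ui mulrN -uiC -mulrN opprB.
Qed.

Lemma ure_her z : inher c0 z -> inher c0 (ure z).
Proof. by move=> h; apply: inherZ; apply: inherD => //; apply: inher_star. Qed.

Lemma uim_her z : inher c0 z -> inher c0 (uim z).
Proof. by move=> h; apply: inherZ; apply: inher_ui; apply: inherB => //; apply: inher_star. Qed.

Lemma half2 a : (2 : R)^-1 *: (a + a) = a.
Proof. by rewrite scalerDr -scalerDl (_ : 2^-1 + 2^-1 = 1 :> R) ?scale1r//; field. Qed.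

Lemma ure_sum a b : sa a -> sa b -> ure (a + ui * b) = a.
Proof.
move=> ha hb; rewrite /ure ustarD ustarM ustar_ui ha hb mulrN -uiC.
by rewrite addrACA subrr addr0 half2.
Qed.

Lemma uim_sum a b : sa a -> sa b -> uim (a + ui * b) = b.
Proof.
move=> ha hb; rewrite /uim ustarD ustarM ustar_ui ha hb mulrN -uiC.
have -> : a - ui * b - (a + ui * b) = - (ui * b + ui * b) by rewrite opprD addrACA subrr add0r opprD.
by rewrite mulrN mulrDr !mulrA uiM !mulN1r opprD !opprK half2.
Qed.

Definition tau_u z : R[i] := (tsa (ure z))%:C + 'i * (tsa (uim z))%:C.

Lemma tsa0 : tsa 0 = 0.
Proof.
rewrite -(scale0r (0 : U)) tsa_scale ?mul0r//; last exact: inher0.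
by rewrite /sa ustar0.
Qed.

Lemma ure_of_sa a : sa a -> ure a = a.
Proof. by move=> sa_a; rewrite /ure sa_a half2. Qed.

Lemma uim_of_sa a : sa a -> uim a = 0.
Proof. by move=> sa_a; rewrite /uim sa_a subrr mulr0 scaler0. Qed.

Lemma tau_sa a : sa a -> tau_u a = (tsa a)%:C.
Proof. by move=> h; rewrite /tau_u ure_of_sa// uim_of_sa// tsa0 mulr0 addr0. Qed.

Lemma tau_upos a : upos a -> inher c0 a -> tau_u a = (fine (T a))%:C.
Proof. by move=> ua ha; rewrite tau_sa ?tsa_upos//; apply: upos_sa. Qed.

(** The commutation hypotheses make the real and imaginary parts of [x] commute with each other and
    with those of [y], so that [tsa] is linear on the two self-adjoint combinations that arise. *)
Lemma tau_linear (k : R[i]) x y : inher c0 x -> inher c0 y ->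
  x * y = y * x -> x * x^*u = x^*u * x -> y * y^*u = y^*u * y -> x * y^*u = y^*u * x ->
  tau_u (uscale k x + y) = k * tau_u x + tau_u y.
Proof.
move=> hx hy xy xx yy xys.
have xsy : x^*u * y = y * x^*u.
  by have := congr1 (@ustar _ _) xys; rewrite !ustarM ustarK => ->.
have xsys : x^*u * y^*u = y^*u * x^*u by rewrite -!ustarM xy.
have comC a b : a * b = b * a -> a^*u * b = b * a^*u ->
   ure a * b = b * ure a /\ uim a * b = b * uim a.
  move=> h1 h2; split.
    by rewrite -scalerAl -scalerAr mulrDl mulrDr h1 h2.
  by rewrite -scalerAl -scalerAr -mulrA mulrBl h1 h2 -mulrBr !mulrA (uiC b).
have [rx1 ix1] : ure x * x = x * ure x /\ uim x * x = x * uim x by exact: comC.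
have [rx2 ix2] : ure x * x^*u = x^*u * ure x /\ uim x * x^*u = x^*u * uim x by exact: comC.
have [rx3 ix3] : ure x * y = y * ure x /\ uim x * y = y * uim x by exact: comC.
have [rx4 ix4] : ure x * y^*u = y^*u * ure x /\ uim x * y^*u = y^*u * uim x by exact: comC.
have [_ c1] := comC x (ure x) (esym rx1) (esym rx2).
have [c2 c3] := comC y (ure x) (esym rx3) (esym rx4).
have [c4 c5] := comC y (uim x) (esym ix3) (esym ix4).
set p := complex.Re k; set q := complex.Im k.
have E1 : ure (uscale k x + y) = (p *: ure x + (- q) *: uim x) + ure y.
  rewrite /ure /uscale -/p -/q !ustarD !ustarZ ustarM ustar_ui /uim.
  rewrite !scalerA ![_ * 2^-1]mulrC -!scalerA -!scalerDr; congr (_ *: _).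
  rewrite mulrN -uiC mulrBr !scalerDr !scaleNr !scalerN opprK.
  by rewrite [LHS]addrACA; congr (_ + _); rewrite addrACA [- _ + _]addrC.
have E2 : uim (uscale k x + y) = (q *: ure x + p *: uim x) + uim y.
  rewrite /ure /uscale -/p -/q /uim !ustarD !ustarZ ustarM ustar_ui.
  rewrite !scalerA ![_ * 2^-1]mulrC -!scalerA -!scalerDr; congr (_ *: _).
  rewrite opprD addrACA mulrDr; congr (_ + _).
  rewrite ?mulrN -uiC opprD addrACA -scalerBr scalerN -opprD -scalerDr mulrDr.
  rewrite mulrN -!scalerAr (mulrDr ui (ui * _)) !mulrA uiM !mulN1r -opprD scalerN opprK.
  by rewrite [RHS]addrC [x^*u + x]addrC.
have lin (r s : R) w : sa w -> inher c0 w -> ure x * w = w * ure x -> uim x * w = w * uim x ->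
    tsa ((r *: ure x + s *: uim x) + w) = r * tsa (ure x) + s * tsa (uim x) + tsa w.
  move=> sw hw h1 h2.
  have saZ (v : R) z : sa z -> sa (v *: z) by move=> h; rewrite /sa ustarZ h.
  rewrite tsa_add//; first last.
  - by rewrite mulrDl mulrDr -(scalerAl r) -(scalerAl s) h1 h2 -(scalerAr r) -(scalerAr s).
  - by apply: inherD; apply: inherZ; [exact: ure_her|exact: uim_her].
  - by rewrite /sa ustarD (saZ _ _ (ure_sa _)) (saZ _ _ (uim_sa _)).
  have hrx := ure_her hx; have hix := uim_her hx; have srx := ure_sa x; have six := uim_sa x.
  rewrite (tsa_add (saZ r _ srx) (saZ s _ six) (inherZ r hrx) (inherZ s hix)).
    by rewrite (tsa_scale r srx hrx) (tsa_scale s six hix).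
  by rewrite -(scalerAl r) -(scalerAl s) -(scalerAr r) -(scalerAr s) -c1 !scalerA mulrC.
rewrite /tau_u E1 E2 !lin//; try exact: ure_sa; try exact: uim_sa; try exact: ure_her; try exact: uim_her.
rewrite [k in RHS]complexE -/p -/q.
move: (tsa (ure x)) (tsa (uim x)) (tsa (ure y)) (tsa (uim y)) p q {E1 E2} => A B C D P Q.
rewrite complexiE !rmorphD !rmorphM /= rmorphN /=.
have ii : 'i * 'i = -1 :> R[i] by rewrite -expr2 sqrCi.
transitivity (P%:C * A%:C + 'i * 'i * Q%:C * B%:C + 'i * Q%:C * A%:C + 'i * P%:C * B%:C + C%:C
    + 'i * D%:C).
  by rewrite ii; ring.
by ring.
Qed.

Variables (E : cstarAlgType R) (phi : E -> U).
Hypothesis phi_lin : forall (k : R[i]) (x y : E), phi (k *: x + y) = uscale k (phi x) + phi y.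
Hypothesis phiM : forall x y : E, phi (x ** y) = phi x * phi y.
Hypothesis phi_star : forall x : E, phi (star x) = (phi x)^*u.
Hypothesis phi_her : forall x : E, inher c0 (phi x).

Lemma quasitrace_tau : quasitrace (fun e : E => tau_u (phi e)).
Proof.
split.
- move=> x; rewrite !phiM phi_star.
  have u1 : upos ((phi x)^*u * phi x) by exists (phi x).
  have u2 : upos (phi x * (phi x)^*u) by exists (phi x)^*u; rewrite ustarK.
  have h1 : inher c0 ((phi x)^*u * phi x) by apply: inherM => //; apply: inher_star.
  have h2 : inher c0 (phi x * (phi x)^*u) by apply: inherM => //; apply: inher_star.
  rewrite !tau_upos// T_tr//; split=> //.
  by rewrite lecR fine_ge0.
- move=> B [_ _ _ Bs _] BC k x y Bx By; rewrite phi_lin tau_linear//.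
  + by rewrite -!phiM BC.
  + by rewrite -phi_star -!phiM BC//; apply: Bs.
  + by rewrite -phi_star -!phiM BC//; apply: Bs.
  + by rewrite -phi_star -!phiM BC//; apply: Bs.
- move=> a b sa_a sa_b.
  have sa1 : sa (phi a) by rewrite /sa -phi_star sa_a.
  have sb1 : sa (phi b) by rewrite /sa -phi_star sa_b.
  rewrite addrC phi_lin addrC.
  have -> : uscale 'i (phi b) = ui * phi b by rewrite /uscale /= scale0r scale1r add0r.
  by rewrite {1}/tau_u ure_sum// uim_sum// !tau_sa.
Qed.
End Quasi.

(** [f_cut e] is 1 from [e] on, hence on the support of [cut eps]; there its cut at [h < 1] equals
    the constant [1 - h]. *)
Lemma cut_f_cut (R : realType) (e eps h N t : R) : 0 < e < eps -> 0 < h < 1 -> 0 <= t <= N ->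
  0 <= cut eps t <= N / (1 - h) * cut h (f_cut e t).
Proof.
case/andP => e0 ee /andP[h0 h1] /andP[t0 tN]; rewrite /cut le_max lexx orbT /=.
have h10 : 0 < 1 - h by lra.
have N0 : 0 <= N by lra.
case: (leP eps t) => et.
  have -> : f_cut e t = 1.
    rewrite /f_cut; case: ifPn => [h2|_]; first lra.
    by case: ifPn => //; rewrite -ltNge => h2; lra.
  rewrite (_ : Num.max (1 - h) 0 = 1 - h) ?mulfVK ?gt_eqF//; last by apply: max_l; lra.
  by rewrite ge_max N0 andbT; lra.
have -> : Num.max (t - eps) 0 = 0 by apply: max_r; lra.
apply: mulr_ge0; last by rewrite le_max lexx orbT.
by rewrite divr_ge0// ltW.
Qed.

(** * Strict comparison *)

Section DimState.
Variables (R : realType) (A : cstarAlgType R) (AK : stabilization A).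
Hypotheses (hsig : sigma_unital A) (hsimple : simple_cstar A).
Local Notation U := (utz AK).
Local Notation E := (@Em R A AK A id).
Let sysE := Em_id AK.
Variables (y : U) (f : Cu U -> R).
Hypotheses (uy : upos y) (iy : ideal y) (y0 : y != 0).
Definition bdy (x : Cu U) := exists m, cule x (cu y *+ m).
Hypothesis f_add : forall x z, bdy x -> bdy z -> f (x + z) = f x + f z.
Hypothesis f_mono : forall x z, bdy z -> cule x z -> f x <= f z.

(** The domain on which the state [f] is controlled. By [pedersen_multiple] it contains the corner
    copies of the positive elements of the Pedersen ideal. *)
Definition Pd (z : U) := [/\ upos z, ideal z & bdy (cu z)].
Definition df (z : U) := f (cu z).

Lemma bdy_le x z : cule x z -> bdy z -> bdy x.
Proof. by move=> h [m hm]; exists m; apply: cule_trans hm. Qed.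

Lemma bdyD x z : bdy x -> bdy z -> bdy (x + z).
Proof. by move=> [m hm] [n hn]; exists (m + n)%N; rewrite mulrnDr; apply: cuD. Qed.

Lemma bdy0 : bdy 0.
Proof. by exists 0%N; apply: cule0. Qed.

Lemma f0 : f 0 = 0.
Proof. by have := f_add bdy0 bdy0; rewrite addr0 => h; lra. Qed.

Lemma Pd_upos z : Pd z -> upos z. Proof. by case. Qed.

Lemma ideal_csub (a b : U) : ideal b -> csub a b -> ideal a.
Proof.
move=> ib ab; apply: ideal_closed => e e0; have [x hx] := ab e e0.
exists (x^*u * b * x); last by rewrite udistC.
by apply: ideal_mulr; apply: ideal_mull.
Qed.

Lemma Pd_csub a b : Pd b -> upos a -> csub a b -> Pd a.
Proof.
move=> [ub ib bb] ua ab; split=> //; first exact: ideal_csub ab.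
by apply: bdy_le bb; apply/cuP.
Qed.

Lemma PdD a b : Pd a -> Pd b -> Pd (a + b).
Proof.
move=> [ua ia ba] [ub ib bb]; split; [exact: uposD|exact: idealD|].
by apply: bdy_le (bdyD ba bb); apply: cu_add2.
Qed.

Lemma Pd0 : Pd 0.
Proof. by split; [exact: upos0|by []|apply: bdy_le bdy0; apply: cu0]. Qed.

Lemma df0 : df 0 = 0.
Proof.
have [_ _ b0] := Pd0; have := f_mono b0 (cule0 _); have := f_mono bdy0 (cu0 U).
by rewrite f0 /df => *; lra.
Qed.

Lemma df_two x z v w : upos x -> upos z -> Pd v -> Pd w ->
  fsub (two x z) (two v w) -> df x + df z <= df v + df w.
Proof.
move=> ux uz [_ _ bv] [_ _ bw] /cufP; rewrite !cuf_two => h.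
have bvw := bdyD bv bw; have bxz := bdy_le h bvw.
have bx : bdy (cu x) by apply: bdy_le bxz; apply: cule_addl.
have bz : bdy (cu z) by apply: bdy_le bxz; rewrite addrC; apply: cule_addl.
by rewrite /df -!f_add//; apply: f_mono.
Qed.

Local Notation K := (Kd Pd).
Local Notation T := (Td df).

Lemma Kd_all z : upos z -> ideal z -> K z.
Proof.
move=> uz iz; split=> // t t0; split; [exact: ucut_upos (upos_sa uz)| |].
  by apply: ideal_ucut (ltW t0) (upos_sa uz) iz.
exact: (cut_le_multiple hsig hsimple uy iy y0 uz iz t0).
Qed.

Lemma upos_Ed i c : positive c -> upos (E i i c).
Proof.
move=> [w _ <-]; exists (E i i w); rewrite (sys_star sysE) (sys_M sysE) eqxx //.
Qed.

Lemma Pd_Ed i c : positive c -> pedersen_ideal c -> Pd (E i i c).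
Proof.
move=> pc dc; have P0 : Pd (E 0 0 c).
  split; [exact: upos_Ed|exact: jz_ideal|].
  exact: (pedersen_multiple hsig hsimple uy iy y0 pc dc).
apply: (Pd_csub P0); first exact: upos_Ed.
move: pc => [w _ <-].
have e1 : E i i (star w ** w) = (E 0 i w)^*u * E 0 i w.
  by rewrite (sys_star sysE) (sys_M sysE) eqxx.
have -> : E 0 0 (star w ** w) = (E 0 0 w)^*u * E 0 0 w.
  by rewrite (sys_star sysE) (sys_M sysE) eqxx.
have e2 : E 0 i w * (E 0 i w)^*u = E 0 0 w * (E 0 0 w)^*u.
  by rewrite !(sys_star sysE) !(sys_M sysE) !eqxx.
rewrite e1; apply: csub_trans (csub_star _) _; rewrite e2.
by have := csub_star (E 0 0 w)^*u; rewrite ustarK.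
Qed.

Lemma Td_trace u : ideal u -> T (u^*u * u) = T (u * u^*u).
Proof.
move=> iu; have i1 : ideal (u^*u * u) by apply: ideal_mull.
have i2 : ideal (u * u^*u) by apply: ideal_mulr.
have u1 : upos (u^*u * u) by exists u.
have u2 : upos (u * u^*u) by exists u^*u; rewrite ustarK.
have k1 := Kd_all u1 i1; have k2 := Kd_all u2 i2.
apply/eqP; rewrite eq_le !(Td_sub Pd0 df0 df_two)//.
- by move=> t t0; have := csub_cut_star u^*u t0; rewrite ustarK.
- by move=> t t0; apply: csub_cut_star.
Qed.

Lemma TZ (r : R) z : 0 <= r -> upos z -> ideal z -> T (r *: z) = (r%:E * T z)%E.
Proof. by move=> r0 uz iz; apply: (TdZ Pd_upos Pd_csub Pd0 df0 df_two) => //; apply: Kd_all. Qed.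

Lemma TD z w : upos z -> ideal z -> upos w -> ideal w -> z * w = w * z -> T (z + w) = (T z + T w)%E.
Proof.
move=> uz iz uw iw; apply: (Td_add Pd_upos Pd_csub PdD Pd0 df0 df_two); exact: Kd_all.
Qed.

Lemma df_muln z n : bdy z -> f (z *+ n) = n%:R * f z.
Proof.
move=> bz; elim: n => [|n IH]; first by rewrite mulr0n f0 mul0r.
have bn : bdy (z *+ n).
  elim: n {IH} => [|n IH]; first exact: bdy0.
  by rewrite mulrS; apply: bdyD.
by rewrite mulrS f_add// IH mulrS mulrDl mul1r.
Qed.

Section Normalized.
Variables (X : U) (eps : R).
Hypotheses (uX : upos X) (iX : ideal X) (eps0 : 0 < eps).
Hypothesis f_ge1 : 1 <= df (ucut eps X).
Hypothesis f_le1 : df y <= 1.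

(** By simplicity the cut of [X], at which [df] is at least 1, is bounded by a multiple of a cut of
    [z], so [df] is positive at the latter and a one-term Riemann sum is positive. *)
Lemma T_gt0 z : upos z -> ideal z -> z != 0 -> (0 < T z)%E.
Proof.
move=> uz iz z0.
have Nz : 0 < N[z] by rewrite lt_neqAle eq_sym unorm_ge0 andbT; apply: contra z0 => /eqP/unorm0_eq0 ->.
set t := N[z] / 2; have t0 : 0 < t by rewrite divr_gt0.
have uc : upos (ucut t z) by apply: ucut_upos (upos_sa uz).
have ic : ideal (ucut t z) by apply: ideal_ucut (ltW t0) (upos_sa uz) iz.
have nc : ucut t z != 0.
  apply/eqP => h; have := ucut_eq0_norm (ltW t0) uz h.
  by rewrite leNgt {1}/t gtr_pMr// invf_lt1// ltr1n.
have [m hm] := cut_le_multiple hsig hsimple uc ic nc uX iX eps0.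
have bc : bdy (cu (ucut t z)).
  exact: (cut_le_multiple hsig hsimple uy iy y0 uz iz t0).
have bcm : bdy (cu (ucut t z) *+ m).
  elim: m {hm} => [|n IH]; first exact: bdy0.
  by rewrite mulrS; apply: bdyD.
have := f_mono bcm hm; rewrite df_muln// => h1.
have h2 : 0 < df (ucut t z).
  rewrite ltNge; apply/negP => h3; have := le_trans f_ge1 h1.
  by rewrite leNgt; apply/negP; rewrite negbK; apply: le_lt_trans ltr01; apply: mulr_ge0_le0.
apply: lt_le_trans (Sn_le_Td df z 1 t0).
by rewrite /Sn big_nat1 mul1r lte_fin mulr_gt0.
Qed.

Variable c : R.
Hypothesis c0 : 0 < c.
Definition Tc z : \bar R := (c%:E * T z)%E.

Lemma Tc_ge0 z : (0 <= Tc z)%E.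
Proof. by apply: mule_ge0; [rewrite lee_fin ltW|exact: Td_ge0]. Qed.

Lemma TcZ (r : R) z : 0 <= r -> upos z -> ideal z -> Tc (r *: z) = (r%:E * Tc z)%E.
Proof. by move=> r0 uz iz; rewrite /Tc TZ// muleCA. Qed.

Lemma TcD z w : upos z -> ideal z -> upos w -> ideal w -> z * w = w * z ->
  Tc (z + w) = (Tc z + Tc w)%E.
Proof. by move=> *; rewrite /Tc TD// ge0_muleDr//; exact: Td_ge0. Qed.

Lemma Tc_trace u : ideal u -> Tc (u^*u * u) = Tc (u * u^*u).
Proof. by move=> iu; rewrite /Tc Td_trace. Qed.

Lemma Tc_fin z : Pd z -> Tc z \is a fin_num.
Proof. by move=> pz; rewrite /Tc fin_numM// (Td_fin Pd_upos Pd_csub PdD Pd0 df0 df_two). Qed.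

Lemma Tc_lsc_quasitrace : lsc_quasitrace (fun x : AK => Tc (jz x)).
Proof.
split.
- by move=> x _; apply: Tc_ge0.
- by move=> x; rewrite !jzM jz_star Tc_trace.
- by move=> k x k0 /positiveW px; rewrite jzZ TcZ.
- move=> x z /positiveW px /positiveW pz xz; rewrite jzD TcD// -!jzM xz //.
(* In the subspace topology a point that is not positive has its singleton as a neighborhood, so the
   estimate concerns positive [x] only. *)
- move=> x a ax; rewrite /nbhs /=; case: (@nbhs_subspaceP_subproof AK (@positive R AK) x) => px.
    have ux := positiveW px.
    have h : ((a / c)%:E < T (jz x))%E.
      by move: ax; rewrite /Tc -lte_pdivrMl// muleC -EFinM.
    have [e e0 he] := Td_lsc Pd0 df0 df_two (Kd_all ux (jz_ideal x)) h.
    exists [set z | positive z /\ cnorm (x - z) <= e].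
      apply/nbhs_ballP; exists e%:C => /=; first by rewrite ltcR.
      move=> z; rewrite -ball_normE /= cnormE ltcR => hz pz; split=> //; exact: ltW hz.
    move=> z [pz hz]; have /he : K (jz z) by apply: Kd_all (positiveW pz) (jz_ideal z).
    rewrite -jzB N_jz => /(_ hz); rewrite /Tc => h2.
    by rewrite -lte_pdivrMl// muleC -EFinM.
  by exists [set x] => // z ->.
Qed.

Lemma cfc_jz e x : 0 < e -> positive x -> jz (cfc (f_cut e) x : AK) = fc (f_cut e) (jz x).
Proof. by move=> e0 px; apply: cfc_fc => //; [exact: papp_f_cut|exact: f_cut0]. Qed.

Lemma f_cut01 (e t : R) : 0 < e -> 0 <= f_cut e t <= 1.
Proof. by move=> e0; rewrite f_cutE// le_min ler01 !le_max lexx /= ge_min lexx. Qed.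

Lemma cut_seq_nondecreasing (x : AK) : positive x ->
  nondecreasing_seq (fun n : nat => Tc (jz (cfc (f_cut (n.+1%:R)^-1) x))).
Proof.
move=> px m n mn.
have ux := positiveW px.
have em : 0 < m.+1%:R^-1 :> R by rewrite invr_gt0.
have en : 0 < n.+1%:R^-1 :> R by rewrite invr_gt0.
rewrite (cfc_jz em px) (cfc_jz en px) /Tc lee_pmul2l//.
apply: (Td_mono Pd_csub Pd0 df0 df_two).
- apply: fc_upos_pos => //; first exact: papp_f_cut.
  by move=> t _; case/andP: (f_cut01 t em).
- apply: Kd_all.
    apply: fc_upos_pos => //; first exact: papp_f_cut.
    by move=> t _; case/andP: (f_cut01 t en).
  by apply: ideal_fc => //; [exact: papp_f_cut|exact: f_cut0|exact: upos_sa].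
apply: fc_ule_pos => //; try exact: papp_f_cut.
move=> t /andP[t0 _]; rewrite !f_cutE ?invr_gt0// !invrK le_min2//= ?le_max2//.
by rewrite lerD2r ler_wpM2r// ler_pM2l// ler_nat.
Qed.

(** [Td_Pd] bounds [T] at [g = f_cut(y)] by [N[g] df(g)], where [N[g] <= 1] and
    [df(g) <= df(y) <= 1]. *)
Lemma dim_fun_le x : jz x = y -> (dim_fun (fun x : AK => Tc (jz x)) x <= c%:E)%E.
Proof.
move=> xy; have px : positive x by apply/upos_jzP; rewrite xy.
apply: lime_le; first by apply: ereal_nondecreasing_is_cvgn; apply: cut_seq_nondecreasing.
apply: nearW => n; rewrite cfc_jz// xy.
have e0 : 0 < n.+1%:R^-1 :> R by rewrite invr_gt0.
set e := n.+1%:R^-1 in e0 *.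
have sy := upos_sa uy.
have pg : papp (f_cut e) by apply: papp_f_cut.
have ug : upos (fc (f_cut e) y).
  by apply: fc_upos_pos => // t _; case/andP: (f_cut01 t e0).
have gy : csub (fc (f_cut e) y) y.
  rewrite -[X in csub _ X](fc_id sy); apply: (csub_fc (C := 2 / e)) => //; first exact: papp_id.
    by rewrite divr_ge0// ltW.
  move=> t /andP[t0 _]; case/andP: (f_cut01 t e0) => -> _ /=.
  have h0 : 0 <= 2 / e * t by rewrite mulr_ge0// divr_ge0// ltW.
  by rewrite f_cutE// ge_min ge_max h0 /= lerBlDr lerDl ler01 orbT.
have Py : Pd y by split=> //; exists 1%N; rewrite mulr1n; apply: cule_refl.
have Pg := Pd_csub Py ug gy.
rewrite /Tc -[X in (_ <= X)%E]mule1 lee_pmul2l//.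
apply: le_trans (Td_Pd Pd_upos Pd_csub PdD Pd0 df0 df_two Pg) _; rewrite lee_fin.
have n1 : N[fc (f_cut e) y] <= 1 by apply: fc01_norm => // t; apply: f_cut01.
have d1 : df (fc (f_cut e) y) <= 1.
  by apply: le_trans f_le1; apply: (d_mono Pd0 df0 df_two).
rewrite -[X in _ <= X]mulr1; apply: ler_pM => //; first exact: unorm_ge0.
exact: (d_ge0 Pd0 df0 df_two).
Qed.

(** For small [e] put [g = f_cut e (X)]. For every [h < 1] the one-term Riemann sum of mesh [h]
    gives [T(g) >= h df((g - h)_+) >= h df((X - eps)_+) >= h]. *)
Lemma dim_fun_ge x : jz x = X -> (c%:E <= dim_fun (fun x : AK => Tc (jz x)) x)%E.
Proof.
move=> xy; have px : positive x by apply/upos_jzP; rewrite xy.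
apply: lime_ge; first by apply: ereal_nondecreasing_is_cvgn; apply: cut_seq_nondecreasing.
have hn : \forall n \near \oo, n.+1%:R^-1 < eps.
  exact: (near_infty_natSinv_lt (PosNum eps0)).
near=> n; rewrite cfc_jz// xy.
have e0 : 0 < n.+1%:R^-1 :> R by rewrite invr_gt0.
have ee : n.+1%:R^-1 < eps by near: n.
move: e0 ee; move: (n.+1%:R^-1) => e e0 ee.
have sX := upos_sa uX.
have pg : papp (f_cut e) by apply: papp_f_cut.
have ug : upos (fc (f_cut e) X).
  by apply: fc_upos_pos => // t _; case/andP: (f_cut01 t e0).
have ig : ideal (fc (f_cut e) X) by apply: ideal_fc => //; apply: f_cut0.
rewrite /Tc -[X in (X <= _)%E]mule1 lee_pmul2l//.
have hh (h : R) : 0 < h < 1 -> (h%:E <= T (fc (f_cut e) X))%E.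
  case/andP => h0 h1; apply: le_trans (Sn_le_Td df _ 1 h0).
  rewrite /Sn big_nat1 mul1r lee_fin ler_peMr//; first exact: ltW.
  apply: le_trans f_ge1 _.
  have [_ hK] := Kd_all ug ig.
  apply: (d_mono Pd0 df0 df_two); [exact: ucut_upos|exact: hK|].
  rewrite /ucut -fc_comp//; last exact: papp_cut.
  have h10 : 0 < 1 - h by rewrite subr_gt0.
  apply: (csub_fc (C := N[X] / (1 - h))) => //; first exact: papp_cut.
  - by apply: papp_comp => //; apply: papp_cut.
  - by rewrite divr_ge0// ?unorm_ge0// ltW.
  by move=> t ht; apply: cut_f_cut; rewrite ?e0 ?h0.
rewrite leNgt; apply/negP => h1.
have g0 := Td_ge0 df (fc (f_cut e) X).
move: h1 g0 hh; case: (T _) => [r| |] //; rewrite lte_fin lee_fin => r1 r0 hh.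
have := hh ((1 + r) / 2); rewrite lee_fin => /(_ _); lra.
Unshelve. all: by end_near.
Qed.

Lemma quasitrace_Tc (B : cstarAlgType R) (phi : B -> U) p : Pd p ->
  (forall (k : R[i]) (x z : B), phi (k *: x + z) = uscale k (phi x) + phi z) ->
  (forall x z : B, phi (x ** z) = phi x * phi z) ->
  (forall x : B, phi (star x) = (phi x)^*u) -> (forall x : B, inher p (phi x)) ->
  quasitrace (fun e : B => tau_u Tc (phi e)).
Proof.
move=> Pp hl hm hs hh; have [up ip _] := Pp.
have HP z : upos z -> inher p z -> Pd z.
  by move=> uz hz; apply: (Pd_csub Pp uz); apply: inher_csub.
apply: (@quasitrace_tau R U Tc p) => //.
- exact: upos_sa.
- by move=> z uz hz; apply: Tc_fin; apply: HP.
- by move=> z w uz hz uw hw; apply: TcD => //; apply: inher_ideal ip _.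
- exact: Tc_ge0.
- by move=> r z r0 uz hz; apply: TcZ => //; apply: inher_ideal ip hz.
- by move=> u hu; apply: Tc_trace; apply: inher_ideal ip hu.
Qed.

End Normalized.

Section Corner.
Variables (b : A) (D : cstarAlgType R) (iota : D -> A).
Hypotheses (pb : positive b) (dbp : pedersen_ideal b) (b1 : `|b| = 1).
Hypothesis iotaP : star_iso_onto (hereditary_of b) iota.
Local Notation F := (@Em R A AK D iota).

Lemma iota_csys : csys F.
Proof.
case: iotaP => hl hm hs hn _.
have iota0 : iota 0 = 0 by apply/eqP; rewrite -normr_eq0 hn normr0.
split; first by apply: Em_sys => // x; rewrite /cnorm hn.
move=> i j a; rewrite /Em -[X in iota X]addr0 hl iota0 addr0 embZ jz_i //.
Qed.

Lemma corner_her p i j d : (forall x, p * E i j x * p = E i j (b ** x ** b)) -> inher p (F i j d).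
Proof.
move=> hp e e0; have : hereditary_of b (iota d) by case: iotaP => _ _ _ _ <-; exists d.
move=> /closureP/(_ e e0)[_ [x _ <-] hx]; exists (E i j x).
by rewrite hp /F -(sys_B sysE) (sys_norm sysE) cdistC.
Qed.

Lemma E00_her d : inher (E 0 0 b) (F 0 0 d).
Proof. by apply: corner_her => x; rewrite !(sys_M sysE) !eqxx. Qed.

Lemma E2_her i j d : (i < 2)%N -> (j < 2)%N -> inher (E 0 0 b + E 1 1 b) (F i j d).
Proof.
move=> i2 j2; apply: corner_her => x.
have -> : (E 0 0 b + E 1 1 b) * E i j x = E i j (b ** x).
  rewrite mulrDl !(sys_M sysE); case: i i2 => [|[|//]] _ /=; by rewrite ?addr0 ?add0r.
rewrite mulrDr !(sys_M sysE); case: j j2 => [|[|//]] _ /=; by rewrite ?addr0 ?add0r.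
Qed.

Variables (X : U) (eps : R).
Hypotheses (uX : upos X) (iX : ideal X) (eps0 : 0 < eps).
Hypothesis f_ge1 : 1 <= df (ucut eps X).
Hypothesis f_le1 : df y <= 1.

Definition corner_values := [set T (F 0 0 a) | a in @positive_unit_ball R D].

Lemma positive_iota a : positive a -> positive (iota a).
Proof. by case: iotaP => _ hm hs _ _ [w _ <-]; exists (iota w) => //; rewrite hm hs. Qed.

Lemma corner_values_pos : exists2 v, corner_values v & (0 < v)%E.
Proof.
case: (iotaP) => hl hm hs hn hr.
(* [b b b] visibly belongs to [B_0]. Its preimage [w] is nonzero of norm at most 1, so [w^* w] is an
   admissible test element at which [T] is positive. *)
have : hereditary_of b (b ** b ** b) by apply: subset_closure; exists b.
rewrite -hr => -[w _ hw].
have bn : cnorm b = 1 by rewrite /cnorm b1.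
have bs : star b = b by have := upos_sa (positiveW pb); rewrite /sa -jz_star => /jz_inj.
exists (T (F 0 0 (star w ** w))).
  exists (star w ** w) => //; split; first by exists w.
  rewrite cnormE lecR cnorm_starM exprn_ile1 ?cnorm_ge0//.
  have -> : cnorm w = cnorm (b ** b ** b) by rewrite /cnorm -hw hn.
  by apply: le_trans (cnormM _ _) _; rewrite bn mulr1 (le_trans (cnormM _ _))// bn mulr1.
apply: (T_gt0 uX iX eps0 f_ge1); [|exact: jz_ideal|].
  by apply: upos_Ed; apply: positive_iota; exists w.
have nw : cnorm (star w ** w) != 0.
  rewrite cnorm_starM sqrf_eq0; have -> : cnorm w = cnorm (b ** b ** b) by rewrite /cnorm -hw hn.
  have sb : sa (jz b) by exact: upos_sa (positiveW pb).
  have nb2 : N[jz b * jz b] = 1 by rewrite sa_norm_sqr// N_jz bn expr1n.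
  apply/eqP => h; have h3 : jz b * jz b * jz b = 0 by rewrite -!jzM; apply: unorm0_eq0; rewrite N_jz.
  have : N[(jz b * jz b) * (jz b * jz b)] = 1.
    by rewrite sa_norm_sqr ?nb2 ?expr1n// /sa ustarM sb.
  by rewrite mulrA h3 mul0r unorm0 => /esym/eqP; rewrite oner_eq0.
apply: contra nw => /eqP/(congr1 (@unorm R U)); rewrite unorm0 N_jz emb_norm => h.
by rewrite -h /cnorm hn.
Qed.

Lemma Pd_corner a : positive a -> Pd (F 0 0 a).
Proof.
move=> pa; have ua : upos (F 0 0 a) by apply: upos_Ed; apply: positive_iota.
apply: (Pd_csub (Pd_Ed 0 pb dbp) ua); apply: inher_csub ua (E00_her a); exact: upos_Ed.
Qed.

Lemma corner_values_bd v : corner_values v -> (v <= (df (E 0 0 b))%:E)%E.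
Proof.
move=> [a [pa na] <-]; have [ua ia _] := Pd_corner pa.
apply: le_trans (Td_Pd Pd_upos Pd_csub PdD Pd0 df0 df_two (Pd_corner pa)) _.
have h1 : df (F 0 0 a) <= df (E 0 0 b).
  apply: (d_mono Pd0 df0 df_two ua (Pd_Ed 0 pb dbp)).
  by apply: inher_csub ua (E00_her a); exact: upos_Ed.
have h0 := d_ge0 Pd0 df0 df_two (Pd_corner pa).
rewrite lee_fin; apply: le_trans h1; apply: ler_piMl => //.
rewrite N_jz emb_norm; case: (iotaP) => _ _ _ hn _.
by rewrite /cnorm hn -lecR; move: na; rewrite cnormE.
Qed.

Lemma corner_normalizer : exists2 c : R, 0 < c & (c%:E * ereal_sup corner_values)%E = 1%E.
Proof.
have [v hv v0] := corner_values_pos.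
have h1 : (0 < ereal_sup corner_values)%E by apply: lt_le_trans v0 _; apply: ereal_sup_ubound.
have h2 : (ereal_sup corner_values <= (df (E 0 0 b))%:E)%E.
  by apply: ge_ereal_sup => w hw; apply: corner_values_bd.
move: h1 h2; case: (ereal_sup _) => [s| |] //; rewrite lte_fin => s0 _.
by exists s^-1; rewrite ?invr_gt0// -EFinM mulVf ?gt_eqF.
Qed.

Variable c : R.
Hypothesis c0 : 0 < c.
Hypothesis c1 : (c%:E * ereal_sup corner_values)%E = 1%E.
Definition tau_c (d : D) : R[i] := tau_u (Tc c) (F 0 0 d).

Lemma tau_c_pos d : positive d -> (complex.Re (tau_c d))%:E = Tc c (F 0 0 d).
Proof.
move=> pd; have P := Pd_corner pd; have [u i _] := P.
have Pb := Pd_Ed 0 pb dbp; have [ub ib _] := Pb.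
rewrite /tau_c (@tau_upos R U (Tc c) (E 0 0 b)) //=; last exact: E00_her.
- by rewrite fineK// Tc_fin.
- by move=> z uz hz; apply: Tc_fin; apply: (Pd_csub Pb uz); apply: inher_csub.
- by move=> z w uz hz uw hw; apply: TcD => //; apply: inher_ideal ib _.
- by move=> r z r0 uz hz; apply: TcZ => //; apply: inher_ideal ib hz.
Qed.

Lemma tau_c_QT : QT tau_c.
Proof.
have Pb := Pd_Ed 0 pb dbp; have Pb2 := PdD Pb (Pd_Ed 1 pb dbp).
have cs := iota_csys; have sF := proj1 cs.
split; last first.
  rewrite -c1 -ereal_supZl; first last.
  - exact: ltW.
  - by have [v hv _] := corner_values_pos; apply/set0P; exists v.
  congr (ereal_sup _); apply/seteqP; split => v /=.
    by move=> [a [pa na] <-]; exists (T (F 0 0 a)); [exists a|rewrite tau_c_pos].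
  by move=> [_ [a [pa na] <-] <-]; exists a => //; rewrite tau_c_pos.
split.
  apply: (quasitrace_Tc c0 Pb).
  - by move=> k x z; rewrite (sys_D sF) (csysZ cs).
  - by move=> x z; rewrite (sys_M sF).
  - by move=> x; rewrite (sys_star sF).
  - exact: E00_her.
(* [M_2(B_0)] lies in the hereditary subalgebra of [E 0 0 b + E 1 1 b], which is still in [Pd], so
   the same formula defines the extension. *)
exists (m2_amp cs), (fun x => tau_u (Tc c) (m2v (h := cs) x)); split; last first.
  by move=> a; rewrite /= m2v_emb.
apply: (quasitrace_Tc c0 Pb2).
- by move=> k x z; rewrite m2vD m2vZ.
- by move=> x z; apply: m2v_mul.
- by move=> x; apply: m2v_star.
- move=> x; rewrite /m2v /mxe; apply: (big_ind (fun z => inher _ z)).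
  + exact: inher0.
  + by move=> *; apply: inherD.
  + move=> i _; apply: (big_ind (fun z => inher _ z)).
    * exact: inher0.
    * by move=> *; apply: inherD.
    * by move=> j _; apply: E2_her.
Qed.

End Corner.
End DimState.

Theorem corollary4p10 (R : realType) (A : cstarAlgType R)
    (hsigma : sigma_unital A) (hsimple : simple_cstar A)
    (htracial : essentially_tracially_in
       (@W_almost_unperforated R) A) :
  strict_comparison A.
Proof.
move=> AK b D iota pb db b1 iotaP x y px py y0 hT.
have ux := positiveW px; have uy := positiveW py.
have ix := jz_ideal x; have iy := jz_ideal y.
have yn0 : jz y != 0 by apply: contra y0 => /eqP h; apply/eqP/jz_inj.
apply/(cuntz_csub _ px); apply: csub_cutP => // e e0.
(* One half of [e] defines the element at which the state is large; the other half is the cut lost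
   in [ak_unperf]. *)
have e20 : 0 < e / 2 by rewrite divr_gt0.
apply: contrapT => hn.
have ua : upos (ucut (e / 2) (jz x)) by apply: ucut_upos (upos_sa ux).
have ia : ideal (ucut (e / 2) (jz x)) by apply: ideal_ucut (ltW e20) (upos_sa ux) ix.
have no k : ~ cule (cu (ucut (e / 2) (jz x)) *+ k.+1) (cu (jz y) *+ k).
  move=> h; apply: hn.
  have := ak_unperf hsigma hsimple htracial ua ia uy iy e20 h.
  by rewrite ucut_ucut -?splitr//; [exact: ltW|exact: upos_sa].
have bda := cut_le_multiple hsigma hsimple uy iy yn0 ux ix e20.
have [f [f_add f_mono f_y f_a]] := state_ex R (@cule_refl _ _) (@cule_trans _ _)
  (fun p p' q q' => @cuD _ _ p q p' q') (@cule0 _ _) bda no.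
have [c c0 c1] := corner_normalizer hsigma hsimple uy iy yn0 f_add f_mono pb db b1 iotaP ux ix e20 f_a.
have qt := tau_c_QT hsigma hsimple uy iy yn0 f_add f_mono pb db b1 iotaP ux ix e20 f_a c0 c1.
have lq := Tc_lsc_quasitrace hsigma hsimple uy iy yn0 f_add f_mono c0.
have := hT _ _ qt lq.
have h1 : forall d : D, positive d ->
    Tc f c (jz (emb AK 0%N 0%N (iota d))) = (complex.Re (tau_c f iota c d))%:E.
  by move=> d pd; rewrite (tau_c_pos hsigma hsimple uy iy yn0 f_add f_mono pb db iotaP).
move=> /(_ h1); apply/negP; rewrite -leNgt.
apply: le_trans (dim_fun_le hsigma hsimple uy iy yn0 f_add f_mono f_y c0 erefl) _.
exact: (dim_fun_ge hsigma hsimple uy iy yn0 f_add f_mono ux ix e20 f_a c0 erefl).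
Qed.
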